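(* Let $\mathbb{G}$ be a Carnot group of homogeneous dimension $Q$, fix $\lambda\in[1,Q)$, and let $\mathcal{L}$ be a $\lambda$-homogeneous, left-invariant linear differential operator on $\mathbb{G}$ such that both $\mathcal{L}$ and its transpose $\mathcal{L}^t$ are hypoelliptic. Let $\delta\in(0,1)$ and let $T\subset\mathbb{G}$ be the fundamental tile. Then a compact set $K\subset T$ is removable for $\mathrm{Lip}_\delta$ $\mathcal{L}$-solutions if and only if $\kappa^\delta(K)=0$, where $$\kappa^\delta(K)=\sup\{|\langle\mathcal{L}f,1\rangle| : f\in \mathrm{Lip}_\delta(\mathbb{G}),\ \|f\|_\delta\le1,\ \operatorname{supp}(\mathcal{L}f)\subset K\}.$$
   Context: Carnot groups. A Carnot group $\mathbb{G}$ is a connected, simply connected, nilpotent Lie group whose Lie algebra has a stratification $\mathfrak{g}=\mathfrak{v}_1\oplus\cdots\oplus\mathfrak{v}_s$ into non-zero subspaces with $[\mathfrak{v}_1,\mathfrak{v}_i]=\mathfrak{v}_{i+1}$ for $1\le i\le s-1$ and $[\mathfrak{v}_1,\mathfrak{v}_s]=\{0\}$. Via the exponential map $\mathbb{G}$ is identified with $\mathbb{R}^N$, $N=\sum_i\dim\mathfrak{v}_i$, with identity $0$; $m_1=\dim\mathfrak{v}_1$; the homogeneous dimension is $Q=\sum_i i\dim\mathfrak{v}_i$. Elements of $\mathfrak{g}$ act as left-invariant vector fields, and the Jacobian basis $X_1,\dots,X_{m_1}$ of $\mathfrak{v}_1$ is the one with $X_j|_0=\partial_j|_0$. The Carnot-Carathéodory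 distance $d(x,y)$ is the infimum of all $T'$ for which there is a piecewise smooth $\gamma:[0,T']\to\mathbb{G}$ with $\gamma(0)=x$, $\gamma(T')=y$ and $\langle\dot\gamma(t),\xi\rangle^2\le\sum_{j=1}^{m_1}\langle X_jI(\gamma(t)),\xi\rangle^2$ for all $\xi\in\mathbb{R}^N$ and a.e. $t$, where $X_jI(x)$ is the coefficient vector of $X_j$ at $x$. For $t>0$ the dilation $\delta_t$ is $\delta_t(X)=t^iX$ for $X\in\mathfrak{v}_i$, extended linearly and transferred to $\mathbb{G}$ by $\exp$. $|\cdot|$ is Haar (Lebesgue) measure. Operators. $\mathcal{L}$ is left-invariant if $\mathcal{L}(U\circ\tau_\alpha)=(\mathcal{L}U)\circ\tau_\alpha$ for all $\alpha\in\mathbb{G}$ and distributions $U$, where $\tau_\alpha(x)=\alpha\cdot x$; homogeneous of degree $\lambda$ if $\mathcal{L}(U\circ\delta_t)=t^\lambda(\mathcal{L}U)\circ\delta_t$ for all $t>0$ and all distributions $U$; hypoelliptic if for every open $\Omega$ and distributions $U,F$ on $\Omega$ with $\mathcal{L}U=F$, $F\in C^\infty(\Omega)$ implies $U\in C^\infty(\Omega)$. Fundamental tile. There are $M=2^Q$ $\tfrac12$-homotheties $f_1,\dots,f_M$ of $\mathbb{G}$ (maps $p\mapsto q_j\cdot\delta_{1/2}(p)$) and a compact set $T$ with $T=\bigcup_{j=1}^M f_j(T)$, $0<|T|<\infty$, and $|f_i(T)\cap f_j(T)|=0$ for $i\ne j$; $T$ is the closure of an open set. Such a $T$ is fixed and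 called the fundamental tile. Hölder space. For $\Omega\subset\mathbb{G}$ open, $\mathrm{Lip}_\delta(\Omega)$ is the set of $f:\Omega\to\mathbb{R}$ for which there is $C>0$ with $|f(x)-f(y)|\le C\,d(x,y)^\delta$ for all $x,y\in\Omega$; $\|f\|_\delta$ is the least such $C$. $\mathcal{L}f$ and its support are distributional; $\langle\mathcal{L}f,1\rangle$ means $\langle\mathcal{L}f,\psi\rangle$ for any $\psi\in C_0^\infty$ equal to $1$ near $K$. Removability. $K$ is removable for $\mathrm{Lip}_\delta$ $\mathcal{L}$-solutions if for every domain $\Omega\subset\mathbb{G}$ (not required to contain $K$), every $f\in\mathrm{Lip}_\delta(\Omega)$ with $\mathcal{L}f=0$ in $\Omega\setminus K$ (distributionally) satisfies $\mathcal{L}f=0$ in $\Omega$. *)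

(* Defs.v *)
From HB Require Import structures.
From mathcomp Require Import all_boot all_order all_algebra.
From mathcomp Require Import all_classical all_reals all_analysis.
Set Implicit Arguments.
Unset Strict Implicit.
Unset Printing Implicit Defensive.
Import Order.TTheory GRing.Theory Num.Theory.
Import numFieldNormedType.Exports.
Local Open Scope classical_set_scope.
Local Open Scope ring_scope.

Section lebesgue_tuple.
Context {R : realType}.
Notation T := (measurableTypeR R).

Section step.
Variables (n : nat) (mu : {sigma_finite_measure set (n.-tuple T) -> \bar R}).

Definition cons_pair (z : T * n.-tuple T) : n.+1.-tuple T := [tuple of z.1 :: z.2].

Lemma measurable_cons_pair : measurable_fun [set: T * n.-tuple T] cons_pair.
Proof. exact: measurable_cons. Qed.

#[local] Hint Resolve measurable_cons_pair : core.

Definition lebesgue_cons : set (n.+1.-tuple T) -> \bar R :=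
  pushforward ((@lebesgue_measure R) \x mu)%E cons_pair.

Let mu0 : lebesgue_cons set0 = 0%E.
Proof. by rewrite /lebesgue_cons /pushforward preimage_set0 measure0. Qed.

Let mu_ge0 A : (0 <= lebesgue_cons A)%E.
Proof. exact: measure_ge0. Qed.

Let mu_sigma_additive : semi_sigma_additive lebesgue_cons.
Proof. exact: measure_semi_sigma_additive. Qed.

HB.instance Definition _ := isMeasure.Build _ _ _ lebesgue_cons mu0 mu_ge0 mu_sigma_additive.

Let mu_sigma_finite : sigma_finite setT lebesgue_cons.
Proof.
have /sigma_finiteP[F [TF ndF Foo]] := sigma_finiteT (@lebesgue_measure R).
have /sigma_finiteP[G [TG ndG Goo]] := sigma_finiteT mu.
pose g (t : n.+1.-tuple T) : T * n.-tuple T := (thead t, [tuple of behead t]).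
have mg : measurable_fun setT g.
  by apply/measurable_fun_pair; [exact: measurable_tnth|exact: measurable_behead].
have gK : g \o cons_pair = id.
  by apply/funext => -[a t]; rewrite /g/=; congr pair; exact/val_inj.
exists (fun k => g @^-1` (F k `*` G k)).
  rewrite -preimage_bigcup (_ : \bigcup_k _ = setT) ?preimage_setT//.
  rewrite -setXTT TF TG predeqE => -[x y]; split.
    by move=> [k _ [/= ? ?]]; split; exists k.
  move=> [/= [k _ Fkx] [l _ Gly]]; exists (maxn k l) => //; split.
  - by move: x Fkx; exact/subsetPset/ndF/leq_maxl.
  - by move: y Gly; exact/subsetPset/ndG/leq_maxr.
move=> k; have [mF ?] := Foo k; have [mG ?] := Goo k; split.
  by rewrite -[X in measurable X]setTI; apply: mg => //; exact: measurableX.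
rewrite /lebesgue_cons /pushforward -comp_preimage gK preimage_id.
by rewrite product_measure1E// lte_mul_pinfty// ge0_fin_numE.
Qed.

HB.instance Definition _ := Measure_isSigmaFinite.Build _ _ _ lebesgue_cons mu_sigma_finite.
End step.

(* Lebesgue measure on R^n, on the product sigma-algebra of n-tuples *)
Fixpoint lebesgue_tuple n : {sigma_finite_measure set (n.-tuple T) -> \bar R} :=
  if n is m.+1 then lebesgue_cons (lebesgue_tuple m) else \d_([tuple] : 0.-tuple T).
End lebesgue_tuple.

Section smooth_functions.
Context {R : realType} {N : nat}.
Local Notation E := 'rV[R]_N.

Definition volume (A : set E) : \bar R :=
  lebesgue_tuple N [set t | A (\row_i tnth t i)].

Definition integral_rV (f : E -> R) : R :=
  \int[lebesgue_tuple N]_t f (\row_i tnth t i).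

Definition basis_vec (i : 'I_N) : E := delta_mx 0 i.

Definition dotr (u v : E) : R := \sum_(i < N) u 0 i * v 0 i.

Definition partial (i : 'I_N) (f : E -> R) : E -> R :=
  fun x => 'D_(basis_vec i) f x.

Definition partials (w : seq 'I_N) (f : E -> R) : E -> R := foldr partial f w.

(* The values of f outside the open set Omega play no role. *)
Definition smooth_on (Omega : set E) (f : E -> R) : Prop :=
  forall (w : seq 'I_N) (x : E), Omega x ->
    {for x, continuous (partials w f)} /\
    forall i, derivable (partials w f) x (basis_vec i).

(* C^oo_0(Omega), as functions on all of R^N. *)
Definition test (Omega : set E) (phi : E -> R) : Prop :=
  smooth_on setT phi /\
  exists C : set E, [/\ compact C, C `<=` Omega & forall x, ~ C x -> phi x = 0].

(* Only the values at test functions matter; in particular two functionals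
   represent the same distribution on Omega when they agree on [test Omega]. *)
Definition functional := (E -> R) -> R.

Definition distribution_on (Omega : set E) (U : functional) : Prop :=
  (forall (a : R) phi psi, test Omega phi -> test Omega psi ->
     U (fun x => a * phi x + psi x) = a * U phi + U psi) /\
  (forall C : set E, compact C -> C `<=` Omega ->
     exists (M : R) (m : nat), forall (phi : E -> R) (B : R),
       smooth_on setT phi -> (forall x, ~ C x -> phi x = 0) ->
       (forall (w : seq 'I_N) x, (size w <= m)%N -> `|partials w phi x| <= B) ->
       `|U phi| <= M * B).

Definition of_fun (f : E -> R) : functional :=
  fun phi => integral_rV (fun x => f x * phi x).

Definition smooth_distribution_on (Omega : set E) (U : functional) : Prop :=
  exists2 g : E -> R, smooth_on Omega g &
    forall phi, test Omega phi -> U phi = of_fun g phi.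

Definition vanishes_on (Omega : set E) (U : functional) : Prop :=
  forall phi, test Omega phi -> U phi = 0.

Definition dsupport (U : functional) : set E :=
  ~` \bigcup_(V in [set V : set E | open V /\ vanishes_on V U]) V.

(* sum_k c_k(x) D^(w_k), with smooth coefficients *)
Record diffop := Diffop {
  nterms : nat ;
  coef : 'I_nterms -> E -> R ;
  word : 'I_nterms -> seq 'I_N ;
  coef_smooth : forall k, smooth_on setT (coef k) }.

Definition diffop_app (L : diffop) (phi : E -> R) : E -> R :=
  fun x => \sum_(k < nterms L) coef k x * partials (word k) phi x.

Definition diffop_tr_app (L : diffop) (phi : E -> R) : E -> R :=
  fun x => \sum_(k < nterms L) (-1) ^+ size (word k) *
    partials (rev (word k)) (fun y => coef k y * phi y) x.

(* The actions of L and of its transpose L^t on distributions: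
   <L U, phi> = <U, L^t phi> and <L^t U, phi> = <U, L phi>. *)
Definition diffop_dist (L : diffop) (U : functional) : functional :=
  fun phi => U (diffop_tr_app L phi).

Definition diffop_tr_dist (L : diffop) (U : functional) : functional :=
  fun phi => U (diffop_app L phi).

Definition hypoelliptic (A : functional -> functional) : Prop :=
  forall (Omega : set E) (U F : functional), open Omega ->
    distribution_on Omega U -> distribution_on Omega F ->
    (forall phi, test Omega phi -> A U phi = F phi) ->
    smooth_distribution_on Omega F -> smooth_distribution_on Omega U.

Definition lin_span (A : set E) : set E :=
  [set v | exists n (c : 'I_n -> R) (a : 'I_n -> E),
     (forall k, A (a k)) /\ v = \sum_(k < n) c k *: a k].

End smooth_functions.
Arguments diffop : clear implicits.
Arguments functional : clear implicits.

Section left_invariant_fields.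
Context {R : realType} {N : nat}.
Local Notation E := 'rV[R]_N.
Variable mul : E -> E -> E.

(* The left-invariant vector field with value v at the identity 0, as its
   coefficient vector. *)
Definition left_field (v : E) : E -> E := fun x => 'D_v (mul x) 0.

Definition field_bracket (X Y : E -> E) : E -> E :=
  fun x => 'D_(X x) Y x - 'D_(Y x) X x.

(* The Lie algebra is identified with the tangent space R^N at 0. *)
Definition lie (v w : E) : E :=
  field_bracket (left_field v) (left_field w) 0.

Definition lie_span (A B : set E) : set E :=
  lin_span [set u | exists v w, [/\ A v, B w & u = lie v w]].

End left_invariant_fields.

Definition layer {R : realType} {N : nat} (deg : 'I_N -> nat) (i : nat) :
    set 'rV[R]_N :=
  [set v | forall j, deg j != i -> v 0 j = 0].

(* A Carnot group in exponential coordinates with respect to a basis adapted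
   to the stratification: [deg j] is the index of the layer containing the
   j-th basis vector.  [mul_exp] says that t |-> t v is the one-parameter
   subgroup generated by v, i.e. that exp is the identity of R^N.
   Nilpotency follows from the stratification. *)
Record carnot_group (R : realType) (N : nat) := CarnotGroup {
  mul : 'rV[R]_N -> 'rV[R]_N -> 'rV[R]_N ;
  inv : 'rV[R]_N -> 'rV[R]_N ;
  nlayers : nat ;
  deg : 'I_N -> nat ;
  mul_assoc : associative mul ;
  mul_id_l : left_id 0 mul ;
  mul_inv_l : left_inverse 0 inv mul ;
  mul_smooth : forall i, smooth_on setT
    (fun z : 'rV[R]_(N + N) => mul (lsubmx z) (rsubmx z) 0 i) ;
  inv_smooth : forall i, smooth_on setT (fun x => inv x 0 i) ;
  mul_exp : forall (s t : R) (v : 'rV[R]_N),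
    mul (s *: v) (t *: v) = (s + t) *: v ;
  nlayers_gt0 : (0 < nlayers)%N ;
  deg_bounds : forall j, (1 <= deg j <= nlayers)%N ;
  deg_onto : forall i, (1 <= i <= nlayers)%N -> exists j, deg j = i ;
  deg_mono : forall j k : 'I_N, (j <= k)%N -> (deg j <= deg k)%N ;
  bracket_layer : forall i, (1 <= i < nlayers)%N ->
    lie_span mul (layer deg 1) (layer deg i) = layer deg i.+1 ;
  bracket_last : lie_span mul (layer deg 1) (layer deg nlayers) = [set 0] }.

Section carnot.
Context {R : realType} {N : nat}.
Variable G : carnot_group R N.
Local Notation E := 'rV[R]_N.

Definition hom_dim : nat :=
  (\sum_(1 <= i < (nlayers G).+1) i * #|[pred j | deg G j == i]|)%N.

Definition dilation (t : R) (x : E) : E := \row_j (t ^+ deg G j * x 0 j).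

Definition jacobian_field (j : 'I_N) : E -> E :=
  left_field (mul G) (basis_vec j).

Definition smooth_curve (g : R -> E) : Prop :=
  forall (i : 'I_N) n t, derivable (derive1n n (fun s => g s 0 i)) t 1.

Definition piecewise_smooth (T : R) (gamma : R -> E) : Prop :=
  exists (n : nat) (p : nat -> R),
    [/\ p 0%N = 0, p n = T, forall k, (k < n)%N -> p k < p k.+1 &
      forall k, (k < n)%N -> exists2 g : R -> E, smooth_curve g &
        forall t, p k <= t <= p k.+1 -> gamma t = g t].

Definition subunit (T : R) (gamma : R -> E) : Prop :=
  {ae @lebesgue_measure R, forall t : R, 0 <= t <= T -> forall xi : E,
     dotr (derive1 gamma t) xi ^+ 2 <=
     \sum_(j < N | deg G j == 1%N) dotr (jacobian_field j (gamma t)) xi ^+ 2}.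

Definition cc_dist (x y : E) : R :=
  inf [set T : R | 0 <= T /\ exists gamma : R -> E,
    [/\ piecewise_smooth T gamma, gamma 0 = x, gamma T = y & subunit T gamma]].

(* U o tau_alpha and U o delta_t; the Jacobian determinants of tau_alpha and
   delta_t are 1 and t^Q. *)
Definition translate (alpha : E) (U : functional R N) : functional R N :=
  fun phi => U (fun x => phi (mul G (inv G alpha) x)).

Definition dilate (t : R) (U : functional R N) : functional R N :=
  fun phi => (t ^+ hom_dim)^-1 * U (fun x => phi (dilation t^-1 x)).

Definition left_invariant (A : functional R N -> functional R N) : Prop :=
  forall (alpha : E) (U : functional R N), distribution_on setT U ->
    forall phi, test setT phi ->
      A (translate alpha U) phi = translate alpha (A U) phi.

Definition homogeneous (lambda : R) (A : functional R N -> functional R N) :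
    Prop :=
  forall (t : R) (U : functional R N), 0 < t -> distribution_on setT U ->
    forall phi, test setT phi ->
      A (dilate t U) phi = t `^ lambda * dilate t (A U) phi.

Definition homothety (q : E) (p : E) : E := mul G q (dilation 2^-1 p).

Definition fundamental_tile (T : set E) : Prop :=
  [/\ compact T,
      exists q : 'I_(2 ^ hom_dim) -> E,
        T = \bigcup_j homothety (q j) @` T /\
        forall i j, i != j ->
          volume (homothety (q i) @` T `&` homothety (q j) @` T) = 0%E,
      (0 < volume T < +oo)%E &
      exists2 O : set E, open O & T = closure O].

Definition lip_bound (delta : R) (Omega : set E) (f : E -> R) : set R :=
  [set C | 0 < C /\ forall x y, Omega x -> Omega y ->
     `|f x - f y| <= C * cc_dist x y `^ delta].

Definition lip (delta : R) (Omega : set E) (f : E -> R) : Prop :=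
  lip_bound delta Omega f !=set0.

Definition lip_norm (delta : R) (Omega : set E) (f : E -> R) : R :=
  inf (lip_bound delta Omega f).

Definition removable (L : diffop R N) (delta : R) (K : set E) : Prop :=
  forall Omega : set E, open Omega -> connected Omega -> Omega !=set0 ->
  forall f : E -> R, lip delta Omega f ->
    vanishes_on (Omega `\` K) (diffop_dist L (of_fun f)) ->
    vanishes_on Omega (diffop_dist L (of_fun f)).

Definition cutoff (K : set E) (psi : E -> R) : Prop :=
  test setT psi /\
  exists V : set E, [/\ open V, K `<=` V & forall x, V x -> psi x = 1].

(* <L f, 1> is the value at any cutoff psi of K. *)
Definition kappa (L : diffop R N) (delta : R) (K : set E) : \bar R :=
  ereal_sup [set z | exists f psi : E -> R,
    [/\ lip delta setT f, lip_norm delta setT f <= 1,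
        dsupport (diffop_dist L (of_fun f)) `<=` K, cutoff K psi &
        z = `|diffop_dist L (of_fun f) psi|%:E]].

End carnot.

(* Main.v *)
(* If K is removable, a competitor f for kappa satisfies L f = 0 off K by a partition of
   unity, hence everywhere, so kappa = 0.

   Conversely, let f be delta-Hoelder on Omega with L f = 0 off K and <L f, phi> <> 0. It
   suffices to localize: to find a global delta-Hoelder g with
   <g, L^t psi> = <f, L^t (phi psi)> for every test function psi. Since L^t is hypoelliptic,
   a gliding hump argument bounds a function u supported in a small ball by finitely many
   derivatives of L^t u; by Hahn-Banach there is a distribution P with
   P (L^t u) = u 0 - int omega u. As L is homogeneous and hypoelliptic,
   P - 2^-lambda P o delta_(1/2) is a smooth compactly supported function kap, and
   int kap (L^t u) = int omega (u o delta_(1/2)) - int omega u. Let g be the sum over all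
   dyadic scales s of the potentials of phi (L f) with the dilates of kap. The sum telescopes
   to the required identity. The term of scale s <= 1 is O(s^delta), because f is
   delta-Hoelder and L^t theta has integral 0 for every test function theta; the term of scale
   s >= 1 is O(s^(lambda - Q)); both are Lipschitz with a constant larger by a factor 1/s.
   Hence g is delta-Hoelder.

   The group enters through the Haar measure, the dilations being automorphisms (proved from
   the linear differential equation for the differential of exp), and the bounds
   min(|x|, 1) <= A d(0, x) and d(0, x) <= C for x bounded (Chow). *)

Require Import Defs.
From HB Require Import structures.
From mathcomp Require Import all_boot all_order all_algebra.
From mathcomp Require Import all_classical all_reals all_analysis.
From mathcomp Require Import ring lra.
Set Implicit Arguments.
Unset Strict Implicit.
Unset Printing Implicit Defensive.
Import Order.TTheory GRing.Theory Num.Theory.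
Import numFieldNormedType.Exports.
Local Open Scope classical_set_scope.
Local Open Scope ring_scope.

(** * Differential calculus on row vectors *)

Section calculus_basics.
Context {R : realType}.
Implicit Types (N : nat).
Local Notation isd t g l := (is_derive (t : R) (1 : R) (g : R -> R) (l : R)).

(** A homogeneous fundamental solution $\Gamma$ of $\mathcal L$ with size bounds would give $g$ as
    one potential, but only a parametrix is at hand. The kernel [kap] plays the part of $\Gamma$
    applied to the difference of two mollifiers, of scales $1/2$ and $1$; its dilates thus form a
    dyadic decomposition of $\Gamma$ into smooth compactly supported pieces, and every bound on a
    piece follows from compactness. Hypoellipticity of $\mathcal L^t$ yields the local inverse; that
    of $\mathcal L$ makes this inverse smooth off 0 and turns [kap] into a function. The integral of
    $\mathcal L^t\theta$ vanishes because $\mathcal L1=0$, which comes from $2^\lambda\neq1$ and the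
    fixed points of homotheties. The bound $\lambda<Q$ makes the large scales a geometric series of
    ratio $2^{\lambda-Q}$. The bounds $0<\delta<1$ make the sizes decay and the Lipschitz constants
    grow as $s\to0$, so that the scale $s\sim d(x,y)$ dominates. Everything is phrased by pairing
    with $\mathcal L^t\psi$, which avoids convolutions of distributions. *)

Lemma coord_le_norm N (x : 'rV[R]_N) i : `|x 0 i| <= `|x|.
Proof.
rewrite [leRHS]/Num.Def.normr/= mx_normrE.
exact: (le_bigmax _ (fun i : 'I_1 * 'I_N => `|x i.1 i.2|) (0, i)).
Qed.

Lemma norm_le_coords N (x : 'rV[R]_N) r :
  0 <= r -> (forall i, `|x 0 i| <= r) -> `|x| <= r.
Proof.
move=> r0 H; rewrite [leLHS]/Num.Def.normr/= mx_normrE bigmax_le// => -[i j] _ /=.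
by rewrite (ord1 i); exact: H.
Qed.

Lemma norm_lt_coords N (x : 'rV[R]_N) r :
  0 < r -> (forall i, `|x 0 i| < r) -> `|x| < r.
Proof.
move=> r0 H; rewrite [ltLHS]/Num.Def.normr/= mx_normrE bigmax_lt// => -[i j] _ /=.
by rewrite (ord1 i); exact: H.
Qed.

Lemma contP (V W : normedModType R) (f : V -> W) x :
  {for x, continuous f} <->
  (forall e, 0 < e -> exists2 d, 0 < d & forall y, `|y - x| < d -> `|f y - f x| < e).
Proof.
split=> [/cvgrPdist_lt H e e0|H].
  have /nbhs_ballP[d /= d0 Hd] := H e e0.
  by exists d => // y yd; rewrite distrC; apply: Hd; rewrite -ball_normE/= distrC.
apply/cvgrPdist_lt => e e0; have [d d0 Hd] := H e e0.
apply/nbhs_ballP; exists d => //= y; rewrite -ball_normE/= => yd.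
by rewrite distrC; apply: Hd; rewrite distrC.
Qed.

Lemma nbhs_normP (V : normedModType R) (x : V) (A : set V) :
  nbhs x A <-> exists2 d, 0 < d & forall y, `|y - x| < d -> A y.
Proof.
split=> [/nbhs_ballP[d /= d0 Hd]|[d d0 Hd]].
  by exists d => // y yd; apply: Hd; rewrite -ball_normE/= distrC.
apply/nbhs_ballP; exists d => //= y; rewrite -ball_normE/= => yd.
by apply: Hd; rewrite distrC.
Qed.

Lemma fin_delta (V : normedModType R) N (P : 'I_N -> V -> Prop) :
  (forall i, exists2 d : R, 0 < d & forall h, `|h| < d -> P i h) ->
  exists2 d : R, 0 < d & forall h, `|h| < d -> forall i, P i h.
Proof.
move=> H.
have : nbhs (0 : V) (fun h => forall i, P i h).
  apply: filter_forall => i; apply/nbhs_normP.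
  by have [d d0 Hd] := H i; exists d => // y; rewrite subr0; exact: Hd.
by move=> /nbhs_normP[d d0 Hd]; exists d => // h hd; apply: Hd; rewrite subr0.
Qed.

(** This form includes the increment 0 and contains no quotient, so that derivatives of affine,
    rescaled or piecewise functions can be checked directly. *)
Lemma derive1P (f : R -> R) (x l : R) :
  is_derive x 1 f l <->
  (forall e, 0 < e -> exists2 d, 0 < d & forall h, `|h| < d ->
     `|f (x + h) - f x - h * l| <= e * `|h|).
Proof.
split=> [[df <-] e e0|H].
  have /cvgrPdist_le/(_ e e0) := df.
  move=> /nbhs_ballP[d /= d0 Hd]; exists d => // h hd.
  have [->|h0] := eqVneq h 0; first by rewrite addr0 subrr mul0r subr0 normr0 mulr0.
  have := Hd h; rewrite -ball_normE/= sub0r normrN => /(_ hd h0).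
  rewrite [(_ *: 1 : R)]mulr1 -['D_1 f x]/(derive f x 1) => Hh.
  have -> : f (x + h) - f x - h * 'D_1 f x =
    - h * ('D_1 f x - h^-1 * (f (h + x) - f x)).
    by rewrite mulNr mulrBr mulrA mulfV// mul1r opprB (addrC h x).
  by rewrite normrM normrN mulrC ler_wpM2r.
apply: DeriveDef.
  apply/cvg_ex; exists l; apply/cvgrPdist_le => e e0.
  have [d d0 Hd] := H e e0; apply/nbhs_ballP; exists d => //= h.
  rewrite -ball_normE/= sub0r normrN => hd h0.
  rewrite [(_ *: 1 : R)]mulr1.
  have -> : l - h^-1 *: (f (h + x) - f x) = - h^-1 * (f (x + h) - f x - h * l).
    rewrite mulNr -mulrN opprB mulrBr mulrA mulVf// mul1r (addrC h x) //.
  rewrite normrM normrN normfV ler_pdivrMl ?normr_gt0// [leRHS]mulrC.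
  exact: Hd.
apply/cvg_lim => //; apply/cvgrPdist_le => e e0.
have [d d0 Hd] := H e e0; apply/nbhs_ballP; exists d => //= h.
rewrite -ball_normE/= sub0r normrN => hd h0.
rewrite [(_ *: 1 : R)]mulr1.
have -> : l - h^-1 *: (f (h + x) - f x) = - h^-1 * (f (x + h) - f x - h * l).
  rewrite mulNr -mulrN opprB mulrBr mulrA mulVf// mul1r (addrC h x) //.
rewrite normrM normrN normfV ler_pdivrMl ?normr_gt0// [leRHS]mulrC.
exact: Hd.
Qed.

Lemma is_derive_lineP (V : normedModType R) (f : V -> R) (x v : V) l :
  is_derive x v f l <-> is_derive (0 : R) 1 (fun h : R => f (x + h *: v)) l.
Proof.
have E : (fun h : R => f (h *: v + x)) = (fun h => f (x + h *: v)).
  by apply/funext => h; rewrite addrC.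
have key : 'D_1 (fun h : R => f (x + h *: v)) 0 = 'D_v f x.
  rewrite /derive; set F := (X in lim (X @ _)); set F' := (X in _ = lim (X @ _)).
  suff -> : F = F' by [].
  apply/funext => h; rewrite /F /F' /=.
  by rewrite addr0 scale0r addr0 [h *: 1]mulr1 [X in f X]addrC.
split=> [[df <-]|[df <-]]; apply: DeriveDef => //.
  by move: df => /derivable1P; rewrite E.
by apply/derivable1P; rewrite E.
Qed.

Lemma is_derive_line (V : normedModType R) (f : V -> R) (x v : V) (t : R) l :
  is_derive (x + t *: v) v f l -> is_derive t 1 (fun h : R => f (x + h *: v)) l.
Proof.
move=> /is_derive_lineP/derive1P H; apply/derive1P => e /H[d d0 Hd].
exists d => // h /Hd; rewrite !add0r scale0r addr0.
by rewrite scalerDl addrA.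
Qed.

Lemma is_derive_lineD (V : normedModType R) (f : V -> R) (x v : V) l :
  derivable f x v -> 'D_v f x = l -> is_derive x v f l.
Proof. by move=> df <-; apply: DeriveDef. Qed.

Lemma MVT1 (g g' : R -> R) (a b : R) : a <= b ->
  (forall t, a <= t <= b -> isd t g (g' t)) ->
  exists2 c, a <= c <= b & g b - g a = g' c * (b - a).
Proof.
move=> ab dg.
have [||c] := @MVT_segment R g g' a b ab.
- by move=> x; rewrite in_itv/= => /andP[ax xb]; apply: dg; rewrite !ltW.
- apply: derivable_within_continuous => x; rewrite in_itv/= => xab.
  by have [] := dg _ xab.
- by rewrite in_itv/= => cab E; exists c.
Qed.

Lemma is_derive_cont (g : R -> R) (t l : R) : isd t g l -> {for t, continuous g}.
Proof. by move=> [dg _]; apply/differentiable_continuous/derivable1_diffP. Qed.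

(* Changing the coordinates one at a time from [x] to [y]. *)
Lemma incr_tele N (f : 'rV[R]_N -> R) (x y : 'rV[R]_N) :
  (forall z i, `|z - x| <= `|y - x| -> derivable f z (basis_vec i)) ->
  exists c : 'I_N -> 'rV[R]_N, (forall i, `|c i - x| <= `|y - x|) /\
    f y - f x = \sum_i partial i f (c i) * (y 0 i - x 0 i).
Proof.
move=> df.
pose z (k : nat) : 'rV[R]_N := \row_j (if (j < k)%N then y 0 j else x 0 j).
have zk (k : 'I_N) s : 0 <= s <= 1 ->
    `|z k + (s * (y 0 k - x 0 k)) *: basis_vec k - x| <= `|y - x|.
  move=> /andP[s0 s1]; apply: norm_le_coords => // j; rewrite !mxE eqxx/=.
  have [jk|jk|jk] := ltngtP j k.
  - rewrite (_ : (j == k) = false) ?mulr0 ?addr0; last by apply/eqP => jk'; rewrite jk' ltnn in jk.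
    by have := coord_le_norm (y - x) j; rewrite !mxE.
  - rewrite (_ : (j == k) = false) ?mulr0 ?addr0; last by apply/eqP => jk'; rewrite jk' ltnn in jk.
    by rewrite subrr normr0.
  - have -> : j = k by exact/val_inj.
    rewrite eqxx mulr1 addrAC subrr add0r normrM ger0_norm//.
    have := coord_le_norm (y - x) k; rewrite !mxE; apply: le_trans.
    by rewrite ler_piMl.
have step (k : 'I_N) : exists2 c, `|c - x| <= `|y - x| &
    f (z k.+1) - f (z k) = partial k f c * (y 0 k - x 0 k).
  pose D := y 0 k - x 0 k.
  (* The edge is parametrized by $[0,1]$ with velocity $D e_k$, so that the sign of [D] does not
     matter. *)
  have dl (s : R) : 0 <= s <= 1 -> isd s (fun s => f (z k + s *: (D *: basis_vec k)))
       (D * partial k f (z k + s *: (D *: basis_vec k))).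
    move=> s01; apply: is_derive_line.
    have dk : derivable f (z k + s *: (D *: basis_vec k)) (basis_vec k).
      by apply: df; rewrite scalerA; exact: zk.
    apply/is_derive_lineP/derive1P => e e0.
    have /is_derive_lineP/derive1P : is_derive (z k + s *: (D *: basis_vec k)) (basis_vec k) f (partial k f (z k + s *: (D *: basis_vec k))).
      exact: is_derive_lineD.
    have D1 : 0 < `|D| + 1 by rewrite ltr_wpDl.
    move=> /(_ (e / (`|D| + 1))) [|d d0 Hd]; first by rewrite divr_gt0.
    exists (d / (`|D| + 1)); first by rewrite divr_gt0.
    move=> h hd; have := Hd (h * D); rewrite !add0r !scale0r addr0 scalerA mulrA => Hh.
    rewrite (scalerA h); apply: (le_trans (Hh _)).
      rewrite normrM; rewrite ltr_pdivlMr// in hd; apply: le_lt_trans hd.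
      by rewrite ler_wpM2l// lerDl.
    rewrite normrM mulrAC ler_pdivrMr//.
    by rewrite mulrA ler_wpM2l ?lerDl// mulr_ge0// ltW.
  have [c c01 E] := MVT1 ler01 dl.
  exists (z k + c *: (D *: basis_vec k)); first by rewrite scalerA; exact: zk.
  rewrite subr0 mulr1 mulrC in E; rewrite -E scale0r addr0; congr (f _ - f _).
  apply/rowP => j; rewrite !mxE mul1r eqxx/= ltnS leq_eqVlt.
  have [->|jk] := eqVneq j k; first by rewrite eqxx/= ltnn mulr1 addrC subrK.
  by rewrite (_ : (j == k :> nat) = false) ?mulr0 ?addr0//; apply/negbTE.
pose c i := sval (cid2 (step i)).
exists c; split; first by move=> i; rewrite /c; case: cid2.
have zN : z N = y by apply/rowP => j; rewrite !mxE ltn_ord.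
have z0 : z 0%N = x by apply/rowP => j; rewrite !mxE.
rewrite -zN -[in f x]z0 -(telescope_sumr (f \o z)) // big_mkord.
apply: eq_bigr => i _ /=; rewrite /c; case: cid2 => //= c' _ ->.
by rewrite zN.
Qed.

(** Total differentiability of [f] never has to be defined: [incr_tele] writes its increment with
    partial derivatives at intermediate points, and these converge because the partial derivatives
    are continuous at [g t]. *)
Lemma chain_curve N (f : 'rV[R]_N -> R) (g : R -> 'rV[R]_N) (g' : 'I_N -> R) (t : R) :
  (\forall z \near g t, forall i, derivable f z (basis_vec i)) ->
  (forall i, {for g t, continuous (partial i f)}) ->
  (forall i, isd t (fun s => g s 0 i) (g' i)) ->
  isd t (fun s => f (g s)) (\sum_i partial i f (g t) * g' i).
Proof.
move=> /nbhs_normP[r r0 Hr] cf dg.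
have gc : {for t, continuous g}.
  apply/contP => e e0.
  have [i|d d0 Hd] := @fin_delta R N (fun i h => `|g (t + h) 0 i - g t 0 i| < e).
    have [d d0 Hd] := (contP _ _).1 (is_derive_cont (dg i)) e e0.
    by exists d => // h hd; apply: Hd; rewrite addrAC subrr add0r.
  exists d => // y yt; apply: norm_lt_coords => // i.
  by have := Hd _ yt i; rewrite !mxE [t + _]addrC subrK.
apply/derive1P => e e0.
(* Half of [e] pays for the variation of the partial derivatives, against increments of [g] of size
   at most $(|g'_i|+1)|h|$; the other half pays for the linearization error of [g], weighted by the
   partial derivatives at [g t]. *)
pose B : R := 1 + \sum_i `|g' i|.
have B0 : 0 < B by rewrite ltr_wpDr// sumr_ge0.
pose S : R := 1 + \sum_i `|partial i f (g t)|.
have S0 : 0 < S by rewrite ltr_wpDr// sumr_ge0.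
pose e1 := e / 2 / (B + N%:R + 1).
have BN0 : 0 < B + N%:R + 1 by rewrite ltr_wpDl// addr_ge0 ?ler0n// ltW.
have e10 : 0 < e1 by rewrite !divr_gt0.
have cfi : exists2 d, 0 < d & forall y, `|y - g t| < d -> forall i, `|partial i f y - partial i f (g t)| < e1.
  have [i|d d0 Hd] := @fin_delta _ N (fun i h => `|partial i f (g t + h) - partial i f (g t)| < e1).
    have [d d0 Hd] := (contP _ _).1 (cf i) e1 e10.
    by exists d => // h hd; apply: Hd; rewrite addrAC subrr add0r.
  by exists d => // y yt i; have := Hd _ yt i; rewrite [g t + _]addrC subrK.
have [d1 d10 Hd1] := cfi.
pose e2 := Num.min 1 (e / 2 / S).
have e20 : 0 < e2 by rewrite lt_min ltr01 !divr_gt0.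
have dgi : exists2 d, 0 < d & forall h, `|h| < d -> forall i, `|g (t + h) 0 i - g t 0 i - h * g' i| <= e2 * `|h|.
  by apply: (@fin_delta R) => i; exact: (derive1P _ _ _).1 (dg i) e2 e20.
have [d2 d20 Hd2] := dgi.
have [d3 d30 Hd3] := (contP _ _).1 gc (Num.min r d1) (ltac:(by rewrite lt_min r0 d10)).
exists (Num.min d2 d3); first by rewrite lt_min d20 d30.
move=> h; rewrite lt_min => /andP[hd2 hd3].
have : `|t + h - t| < d3 by rewrite addrAC subrr add0r.
move=> /Hd3.
rewrite lt_min => /andP[gr gd].
have [|c [Hc ->]] := @incr_tele _ f (g t) (g (t + h)).
  by move=> z i zle; apply: Hr; exact: le_lt_trans gr.
rewrite mulr_sumr -sumrB.
have -> : \sum_i (partial i f (c i) * (g (t + h) 0 i - g t 0 i) - h * (partial i f (g t) * g' i))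
  = \sum_i ((partial i f (c i) - partial i f (g t)) * (g (t + h) 0 i - g t 0 i)) +
    \sum_i (partial i f (g t) * (g (t + h) 0 i - g t 0 i - h * g' i)).
  rewrite -big_split/=; apply: eq_bigr => i _; ring.
rewrite (le_trans (ler_normD _ _))// [in leRHS](splitr e) mulrDl lerD//.
- rewrite (le_trans (ler_norm_sum _ _ _))//.
  apply: (@le_trans _ _ (\sum_i e1 * ((`|g' i| + 1) * `|h|))).
    apply: ler_sum => i _; rewrite normrM ler_pM//.
      by apply/ltW/Hd1; apply: le_lt_trans (Hc i) gd.
    have H := Hd2 _ hd2 i.
    have -> : g (t + h) 0 i - g t 0 i = (g (t + h) 0 i - g t 0 i - h * g' i) + h * g' i by rewrite subrK.
    rewrite (le_trans (ler_normD _ _))// mulrDl mul1r [leRHS]addrC lerD//.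
      by apply: (le_trans H); rewrite ler_piMl// ge_min lexx.
    by rewrite normrM mulrC.
  rewrite -mulr_sumr -mulr_suml mulrA ler_wpM2r// /e1 mulrAC ler_pdivrMr//.
  rewrite ler_wpM2l ?divr_ge0 ?ltW// big_split/= sumr_const card_ord /B.
  set X := \sum_(i < N) _; lra.
- rewrite (le_trans (ler_norm_sum _ _ _))//.
  apply: (@le_trans _ _ (\sum_i `|partial i f (g t)| * (e2 * `|h|))).
    by apply: ler_sum => i _; rewrite normrM ler_wpM2l//; exact: Hd2.
  rewrite -mulr_suml mulrA ler_wpM2r//.
  apply: (@le_trans _ _ (S * (e / 2 / S))).
    rewrite ler_pM//; first by rewrite sumr_ge0.
    - exact: ltW.
    - by rewrite /S lerDr.
    - by rewrite ge_min lexx orbT.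
  by rewrite mulrC divfK// gt_eqF.
Qed.

End calculus_basics.

(** * Smooth functions: algebra, chain rule and composition *)

Section smooth_theory.

Context {R : realType}.
Implicit Types (N : nat).
Local Notation isd t g l := (is_derive (t : R) (1 : R) (g : R -> R) (l : R)).

Lemma derive_eqnear N (f g : 'rV[R]_N -> R) (x v : 'rV[R]_N) :
  (\forall z \near x, f z = g z) -> 'D_v f x = 'D_v g x.
Proof. by move=> H; apply: near_eq_derive. Qed.

Lemma derivable_eqnear N (f g : 'rV[R]_N -> R) (x v : 'rV[R]_N) :
  (\forall z \near x, f z = g z) -> derivable f x v -> derivable g x v.
Proof. by move=> H; apply: near_eq_derivable. Qed.

Lemma cont_eqnear (V : normedModType R) (f g : V -> R) x :
  (\forall z \near x, f z = g z) -> {for x, continuous f} -> {for x, continuous g}.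
Proof.
move=> E; rewrite /prop_for /continuous_at -(nbhs_singleton E) => c.
by apply: cvg_trans c; apply: near_eq_cvg; apply: filterS E => z ->.
Qed.

Lemma cont_mul (V : normedModType R) (f g : V -> R) x :
  {for x, continuous f} -> {for x, continuous g} -> {for x, continuous (fun y => f y * g y)}.
Proof. by move=> cf cg; exact: (cvgM cf cg). Qed.

Lemma cont_sum (V : normedModType R) n (a : 'I_n -> V -> R) x :
  (forall k, {for x, continuous (a k)}) -> {for x, continuous (fun y => \sum_k a k y)}.
Proof.
elim: n a => [|n IH] a ca.
  rewrite (_ : (fun _ => _) = cst 0); first exact: cst_continuous.
  by apply/funext => y; rewrite big_ord0.
rewrite (_ : (fun _ => _) = (fun y => \sum_(k < n) a (widen_ord (leqnSn n) k) y + a ord_max y)).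
  by apply: cvgD; [apply: IH => k; exact: ca|exact: ca].
by apply/funext => y; rewrite big_ord_recr.
Qed.

Lemma partials_eqnear N (f g : 'rV[R]_N -> R) w (x : 'rV[R]_N) :
  (\forall z \near x, f z = g z) -> \forall z \near x, partials w f z = partials w g z.
Proof.
elim: w => //= i w IH /IH; move=> /nbhs_interior.
by apply: filterS => z; rewrite /partial => Hz; exact: derive_eqnear.
Qed.

Lemma partials_cat N w1 w2 (f : 'rV[R]_N -> R) :
  partials (w1 ++ w2) f = partials w1 (partials w2 f).
Proof. by rewrite /partials foldr_cat. Qed.

(* A structure rather than an alias: unification must not unfold [smooth_on]. *)
Record smooth N (Om : set 'rV[R]_N) (f : 'rV[R]_N -> R) : Prop :=
  Smooth { smoothP : smooth_on Om f }.

(* Coinduction: smooth functions are the largest class of continuous functions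
   stable under partial derivatives. *)
Lemma smooth_coind N (Om : set 'rV[R]_N) (S : ('rV[R]_N -> R) -> Prop) :
  open Om ->
  (forall f, S f -> forall x, Om x -> {for x, continuous f} /\
     forall i, derivable f x (basis_vec i)) ->
  (forall f i, S f -> exists2 g, S g & forall x, Om x -> partial i f x = g x) ->
  forall f, S f -> smooth Om f.
Proof.
move=> oO H1 H2 f Sf; constructor=> w.
have [g Sg Eg] : exists2 g, S g & forall x, Om x -> partials w f x = g x.
  elim: w => [|i w [g Sg Eg]]; first by exists f.
  have [h Sh Eh] := H2 g i Sg; exists h => // x Ox; rewrite -Eh//=.
  apply: derive_eqnear; near=> z; apply: Eg; near: z; exact: open_nbhs_nbhs.
move=> x Ox; have [c d] := H1 _ Sg _ Ox.
have E : \forall z \near x, g z = partials w f z.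
  by near=> z; rewrite Eg//; near: z; exact: open_nbhs_nbhs.
split; first exact: cont_eqnear E c.
by move=> i; apply: derivable_eqnear (d i).
Unshelve. all: by end_near. Qed.

Lemma smooth_partial N (Om : set 'rV[R]_N) f i :
  smooth Om f -> smooth Om (partial i f).
Proof. by move=> [sf]; constructor=> w x Ox; have := sf (w ++ [:: i]) x Ox; rewrite partials_cat. Qed.

Lemma smooth_partials N (Om : set 'rV[R]_N) f w :
  smooth Om f -> smooth Om (partials w f).
Proof. by move=> sf; elim: w => [//|i w IH]; exact: smooth_partial. Qed.

Lemma smooth_cont N (Om : set 'rV[R]_N) f x : smooth Om f -> Om x -> {for x, continuous f}.
Proof. by move=> [sf] Ox; have [] := sf [::] x Ox. Qed.

Lemma smooth_is_derive N (Om : set 'rV[R]_N) f x i :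
  smooth Om f -> Om x -> is_derive x (basis_vec i) f (partial i f x).
Proof. by move=> [sf] Ox; have [_ d] := sf [::] x Ox; exact: is_derive_lineD (d i) erefl. Qed.

Lemma smooth_subset N (Om Om' : set 'rV[R]_N) f : Om' `<=` Om -> smooth Om f -> smooth Om' f.
Proof. by move=> s [sf]; constructor=> w x Ox; apply: sf; exact: s. Qed.

Lemma smooth_eq N (Om : set 'rV[R]_N) f g : open Om ->
  (forall x, Om x -> f x = g x) -> smooth Om f -> smooth Om g.
Proof.
move=> oO E sf; apply: (@smooth_coind _ _ (fun g => exists2 f, smooth Om f & forall x, Om x -> f x = g x)) => //; last by exists f.
- move=> {}g [{}f {}sf {}E] x Ox.
  have En : \forall z \near x, f z = g z.
    by near=> z; rewrite E//; near: z; exact: open_nbhs_nbhs.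
  split; first by apply: cont_eqnear En _; exact: smooth_cont Ox.
  by move=> i; apply: derivable_eqnear En _; by case: (smooth_is_derive i sf Ox).
- move=> {}g i [{}f {}sf {}E]; exists (partial i f).
    by exists (partial i f) => //; exact: smooth_partial.
  move=> x Ox; apply: derive_eqnear.
  by near=> z; rewrite E//; near: z; exact: open_nbhs_nbhs.
Unshelve. all: by end_near. Qed.

Lemma smooth_local N (Om : set 'rV[R]_N) f :
  (forall x, Om x -> exists U g, [/\ open U, U x, smooth U g & forall z, U z -> f z = g z]) ->
  smooth Om f.
Proof.
move=> H; constructor=> w x /H[U [g [oU Ux sg E]]].
have [] : smooth U f by apply: (smooth_eq oU _ sg) => z Uz; rewrite E.
by move=> /(_ w x Ux).
Qed.

Lemma smooth_cst N (Om : set 'rV[R]_N) (c : R) : open Om -> smooth Om (fun=> c).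
Proof.
move=> oO; apply: (@smooth_coind _ _ (fun f => exists c, f = fun=> c)) => //; last by exists c.
- move=> f [{}c ->] x _; split; first exact: cst_continuous.
  by move=> i; exact: derivable_cst.
- move=> f i [{}c ->]; exists (fun=> 0); first by exists 0.
  by move=> x _; exact: derive_cst.
Qed.

Lemma derivable_coord N (x v : 'rV[R]_N) j : is_derive x v (fun y : 'rV[R]_N => y 0 j) (v 0 j).
Proof.
apply/is_derive_lineP/derive1P => e e0; exists 1 => // h _.
rewrite !mxE (_ : _ - _ - _ = 0) ?normr0 ?mulr_ge0// ?ltW//; ring.
Qed.

Lemma coord_cont N j : continuous (fun y : 'rV[R]_N => y 0 j).
Proof. exact: coord_continuous. Qed.

Lemma smooth_coord N (Om : set 'rV[R]_N) j : open Om -> smooth Om (fun x => x 0 j).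
Proof.
move=> oO; apply: (@smooth_coind _ _ (fun f => f = (fun x => x 0 j) \/ exists c, f = fun=> c)) => //; last by left.
- move=> f [->|[c ->]] x _.
    by split; [exact: coord_cont | move=> i; have [] := derivable_coord x (basis_vec i) j].
  by split; [exact: cst_continuous | move=> i; exact: derivable_cst].
- move=> f i [->|[c ->]].
    exists (fun=> basis_vec i 0 j); first by right; exists (basis_vec i 0 j).
    by move=> x _; rewrite /partial; have [_ ->] := derivable_coord x (basis_vec i) j.
  exists (fun=> 0); first by right; exists 0.
  by move=> x _; exact: derive_cst.
Qed.

(* Finite sums of products, the factors being taken in families stable under
   partial derivatives. *)
Lemma smooth_mul N (Om : set 'rV[R]_N) f g : open Om ->
  smooth Om f -> smooth Om g -> smooth Om (fun x => f x * g x).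
Proof.
move=> oO sf sg.
pose S h := exists n (a b : 'I_n -> 'rV[R]_N -> R),
  [/\ forall k, smooth Om (a k), forall k, smooth Om (b k) &
      h = fun x => \sum_k a k x * b k x].
have Sfg : S (fun x => f x * g x).
  exists 1%N, (fun=> f), (fun=> g); split => //.
  by apply/funext => x; rewrite big_ord1.
apply: (@smooth_coind _ _ S) => //.
- move=> h [n [a [b [sa sb ->]]]] x Ox; split.
    apply: cont_sum => k.
    by apply: cont_mul; [exact: smooth_cont (sa k) Ox|exact: smooth_cont (sb k) Ox].
  move=> i; have -> : (fun x => \sum_k a k x * b k x) = \sum_k (a k * b k).
    by apply/funext => y; rewrite fct_sumE.
  by apply: derivable_sum => k; apply: derivableM; [by case: (smooth_is_derive i (sa k) Ox)|by case: (smooth_is_derive i (sb k) Ox)].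
- move=> h i [n [a [b [sa sb ->]]]].
  exists (fun x => \sum_(k < n) partial i (a k) x * b k x + \sum_(k < n) a k x * partial i (b k) x).
    exists (n + n)%N, (fun k => match fintype.split k with inl k => partial i (a k) | inr k => a k end),
      (fun k => match fintype.split k with inl k => b k | inr k => partial i (b k) end); split.
    + by move=> k; case: fintype.split => // k'; exact: smooth_partial.
    + by move=> k; case: fintype.split => // k'; exact: smooth_partial.
    + apply/funext => x; rewrite big_split_ord/=; congr (_ + _); apply: eq_bigr => k _.
        by rewrite (unsplitK (inl k)).
      by rewrite (unsplitK (inr k)).
  move=> x Ox; rewrite /partial.
  have -> : (fun x => \sum_k a k x * b k x) = \sum_k (a k * b k).
    by apply/funext => y; rewrite fct_sumE.
  rewrite derive_sum; last by move=> k; apply: derivableM; [by case: (smooth_is_derive i (sa k) Ox)|by case: (smooth_is_derive i (sb k) Ox)].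
  rewrite -big_split/=; apply: eq_bigr => k _.
  rewrite deriveM; [|by case: (smooth_is_derive i (sa k) Ox)|by case: (smooth_is_derive i (sb k) Ox)].
  by rewrite addrC/=; congr (_ + _); rewrite mulrC.
Qed.

Lemma smooth_sum N (Om : set 'rV[R]_N) n (f : 'I_n -> 'rV[R]_N -> R) : open Om ->
  (forall k, smooth Om (f k)) -> smooth Om (fun x => \sum_k f k x).
Proof.
move=> oO sf.
pose S h := exists (a : 'I_n -> 'rV[R]_N -> R),
  (forall k, smooth Om (a k)) /\ h = fun x => \sum_k a k x.
apply: (@smooth_coind _ _ S) => //; last by exists f.
- move=> h [a [sa ->]] x Ox; split.
    by apply: cont_sum => k; exact: smooth_cont Ox.
  move=> i; have -> : (fun x => \sum_k a k x) = \sum_k (a k).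
    by apply/funext => y; rewrite fct_sumE.
  by apply: derivable_sum => k; by case: (smooth_is_derive i (sa k) Ox).
- move=> h i [a [sa ->]].
  exists (fun x => \sum_(k < n) partial i (a k) x).
    by exists (fun k => partial i (a k)); split => // k; exact: smooth_partial.
  move=> x Ox; rewrite /partial.
  have -> : (fun x => \sum_k a k x) = \sum_k (a k).
    by apply/funext => y; rewrite fct_sumE.
  by rewrite derive_sum// => k; by case: (smooth_is_derive i (sa k) Ox).
Qed.

Lemma smooth_add N (Om : set 'rV[R]_N) f g : open Om ->
  smooth Om f -> smooth Om g -> smooth Om (fun x => f x + g x).
Proof.
move=> oO sf sg.
have := @smooth_sum _ _ _ (fun k : 'I_2 => if k == ord0 then f else g) oO.
have -> : (fun x => \sum_k (if k == ord0 :> 'I_2 then f else g) x) = (fun x => f x + g x).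
  by apply/funext => x; rewrite !big_ord_recl big_ord0 addr0.
by apply => k; case: ifP.
Qed.

Lemma smooth_scale N (Om : set 'rV[R]_N) (c : R) f : open Om ->
  smooth Om f -> smooth Om (fun x => c * f x).
Proof. by move=> oO sf; apply: smooth_mul => //; exact: smooth_cst. Qed.

Lemma smooth_opp N (Om : set 'rV[R]_N) f : open Om ->
  smooth Om f -> smooth Om (fun x => - f x).
Proof.
move=> oO /(smooth_scale (-1) oO).
by apply: smooth_eq => // x _; rewrite mulN1r.
Qed.

Lemma smooth_sub N (Om : set 'rV[R]_N) f g : open Om ->
  smooth Om f -> smooth Om g -> smooth Om (fun x => f x - g x).
Proof. by move=> oO sf sg; apply: smooth_add => //; exact: smooth_opp. Qed.

Lemma smooth_prod N (Om : set 'rV[R]_N) (I : Type) (s : seq I) (f : I -> 'rV[R]_N -> R) : open Om ->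
  (forall k, smooth Om (f k)) -> smooth Om (fun x => \prod_(k <- s) f k x).
Proof.
move=> oO sf; elim: s => [|a s IH].
  by apply: smooth_eq (smooth_cst 1 oO) => // x _; rewrite big_nil.
by apply: smooth_eq (smooth_mul oO (sf a) IH) => // x _; rewrite big_cons.
Qed.

Lemma smooth_exp N (Om : set 'rV[R]_N) f n : open Om ->
  smooth Om f -> smooth Om (fun x => f x ^+ n).
Proof.
move=> oO sf; elim: n => [|n IH]; first exact: smooth_cst.
by apply: smooth_eq (smooth_mul oO sf IH) => // x _; rewrite exprS.
Qed.

Lemma cont_coords (V : normedModType R) N (g : V -> 'rV[R]_N) x :
  (forall i, {for x, continuous (fun y => g y 0 i)}) -> {for x, continuous g}.
Proof.
move=> H; apply/contP => e e0.
have [i|d d0 Hd] := @fin_delta R V N (fun i h => `|g (x + h) 0 i - g x 0 i| < e).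
  have [d d0 Hd] := (contP _ _).1 (H i) e e0.
  by exists d => // h hd; apply: Hd; rewrite addrAC subrr add0r.
exists d => // y yx; apply: norm_lt_coords => // i.
by have := Hd _ yx i; rewrite !mxE [x + _]addrC subrK.
Qed.

Lemma smooth_chain N (Om : set 'rV[R]_N) f (g : R -> 'rV[R]_N) (g' : 'I_N -> R) (t : R) :
  open Om -> smooth Om f -> Om (g t) ->
  (forall i, isd t (fun s => g s 0 i) (g' i)) ->
  isd t (fun s => f (g s)) (\sum_i partial i f (g t) * g' i).
Proof.
move=> oO sf Og dg; apply: chain_curve => //.
  near=> z => i; suff Oz : Om z by (case: (smooth_is_derive i sf Oz)).
  near: z; exact: open_nbhs_nbhs.
by move=> i; apply: smooth_cont Og; exact: smooth_partial.
Unshelve. all: by end_near. Qed.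

Lemma smooth_dir N (Om : set 'rV[R]_N) f (x v : 'rV[R]_N) :
  open Om -> smooth Om f -> Om x -> is_derive x v f (\sum_i partial i f x * v 0 i).
Proof.
move=> oO sf Ox; apply/is_derive_lineP.
have := @smooth_chain _ _ f (fun h => x + h *: v) (fun i => v 0 i) 0 oO sf.
rewrite scale0r addr0; apply => // i.
have := derivable_coord x v i.
by move=> /is_derive_lineP.
Qed.

(** The class used for coinduction consists of the finite sums of $a_k\,(b_k\circ g)$: by the chain
    rule a partial derivative of such a sum is again one, the new terms being indexed by the pairs
    of a summand and a coordinate of [g]. *)
Lemma smooth_comp p q (Om : set 'rV[R]_p) (Om' : set 'rV[R]_q) (g : 'rV[R]_p -> 'rV[R]_q)
   (f : 'rV[R]_q -> R) : open Om -> open Om' ->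
  (forall i, smooth Om (fun x => g x 0 i)) -> (forall x, Om x -> Om' (g x)) ->
  smooth Om' f -> smooth Om (fun x => f (g x)).
Proof.
move=> oO oO' sg gO sf.
have gc x : Om x -> {for x, continuous g}.
  by move=> Ox; apply: cont_coords => i; exact: smooth_cont Ox.
pose S h := exists n (a : 'I_n -> 'rV[R]_p -> R) (b : 'I_n -> 'rV[R]_q -> R),
  [/\ forall k, smooth Om (a k), forall k, smooth Om' (b k) &
      h = fun x => \sum_k a k x * b k (g x)].
have dfg h x i : smooth Om' h -> Om x ->
    is_derive x (basis_vec i) (fun x => h (g x)) (\sum_j partial j h (g x) * partial i (fun y => g y 0 j) x).
  move=> sh Ox; apply/is_derive_lineP.
  have := @smooth_chain _ _ h (fun s => g (x + s *: basis_vec i)) (fun j => partial i (fun y => g y 0 j) x) 0 oO' sh.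
  rewrite scale0r addr0; apply; first exact: gO.
  move=> j; apply: (is_derive_lineP (fun y => g y 0 j) _ _ _).1; apply: is_derive_lineD => //.
  by case: (smooth_is_derive i (sg j) Ox).
have Sfg : S (fun x => f (g x)).
  exists 1%N, (fun _ _ => 1), (fun=> f); split => //; first by move=> k; exact: smooth_cst.
  by apply/funext => x; rewrite big_ord1 mul1r.
apply: (@smooth_coind _ _ S) => //.
- move=> h [n [a [b [sa sb ->]]]] x Ox; split.
    apply: cont_sum => k; apply: cont_mul; first exact: smooth_cont (sa k) Ox.
    apply: (@continuous_comp _ _ _ g (b k)); first exact: gc.
    exact: smooth_cont (gO _ Ox).
  move=> i; have -> : (fun x => \sum_k a k x * b k (g x)) = \sum_k (a k * (b k \o g)).
    by apply/funext => y; rewrite fct_sumE.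
  apply: derivable_sum => k; apply: derivableM; first by case: (smooth_is_derive i (sa k) Ox).
  by have [] := dfg _ x i (sb k) Ox.
- move=> h i [n [a [b [sa sb ->]]]].
  exists (fun x => \sum_(k < n) partial i (a k) x * b k (g x) +
     \sum_(z < #|{: 'I_n * 'I_q}|) (a (enum_val z).1 x * partial i (fun y => g y 0 (enum_val z).2) x) *
         partial (enum_val z).2 (b (enum_val z).1) (g x)).
    exists (n + #|{: 'I_n * 'I_q}|)%N,
      (fun k => match fintype.split k with inl k => partial i (a k) | inr z =>
          fun x => a (enum_val z).1 x * partial i (fun y => g y 0 (enum_val z).2) x end),
      (fun k => match fintype.split k with inl k => b k | inr z => partial (enum_val z).2 (b (enum_val z).1) end); split.
    + move=> k; case: fintype.split => k'; first exact: smooth_partial.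
      by apply: smooth_mul => //; exact: smooth_partial.
    + by move=> k; case: fintype.split => // k'; exact: smooth_partial.
    + apply/funext => x; rewrite big_split_ord/=; congr (_ + _); apply: eq_bigr => k _.
        by rewrite (unsplitK (inl k)).
      by rewrite (unsplitK (inr k)).
  move=> x Ox; rewrite /partial.
  have -> : (fun x => \sum_k a k x * b k (g x)) = \sum_k (a k * (b k \o g)).
    by apply/funext => y; rewrite fct_sumE.
  have db k : derivable (b k \o g) x (basis_vec i) by have [] := dfg _ x i (sb k) Ox.
  rewrite derive_sum; last by move=> k; apply: derivableM => //; by case: (smooth_is_derive i (sa k) Ox).
  rewrite -(big_enum_val (A := {: 'I_n * 'I_q}) (fun z => a z.1 x * 'D_(basis_vec i) (fun y => g y 0 z.2) x *
     'D_(basis_vec z.2) (b z.1) (g x)))/=.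
  rewrite -(pair_bigA _ (fun k j => a k x * 'D_(basis_vec i) (fun y => g y 0 j) x *
     'D_(basis_vec j) (b k) (g x)))/= -big_split/=.
  apply: eq_bigr => k _; rewrite deriveM//; last by case: (smooth_is_derive i (sa k) Ox).
  rewrite [LHS]addrC; congr (_ + _); first exact: mulrC.
  have [_ E] := dfg _ x i (sb k) Ox.
  rewrite (_ : 'D_(basis_vec i) (b k \o g) x = \sum_j partial j (b k) (g x) * partial i (fun y => g y 0 j) x)//.
  rewrite [LHS]mulr_sumr; apply: eq_bigr => j _.
  by rewrite -mulrA; congr (_ * _); rewrite mulrC.
Qed.

End smooth_theory.

(** * Symmetry of second derivatives, Taylor bound, joint smoothness *)

Section smooth_theory2.
Context {R : realType}.
Implicit Types (N p q : nat).
Local Notation isd t g l := (is_derive (t : R) (1 : R) (g : R -> R) (l : R)).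

Lemma basis_MVT N (Om : set 'rV[R]_N) f (x : 'rV[R]_N) i (h : R) :
  0 <= h -> smooth Om f -> (forall t, 0 <= t <= h -> Om (x + t *: basis_vec i)) ->
  exists2 c, 0 <= c <= h & f (x + h *: basis_vec i) - f x = partial i f (x + c *: basis_vec i) * h.
Proof.
move=> h0 sf HO.
have [|c ch E] := @MVT1 R (fun t => f (x + t *: basis_vec i)) (fun t => partial i f (x + t *: basis_vec i)) 0 h h0.
  by move=> t th; apply: is_derive_line; apply: smooth_is_derive sf _; exact: HO.
by exists c => //; rewrite scale0r addr0 subr0 in E.
Qed.

Lemma norm_basis_vec N (i : 'I_N) : `|(basis_vec i : 'rV[R]_N)| <= 1.
Proof.
apply: norm_le_coords => // j; rewrite mxE eqxx/=.
by case: (j == i); rewrite ?normr1 ?normr0.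
Qed.

Lemma close_values (P Q S S' e : R) : `|S' - P| < e / 2 -> `|S - Q| < e / 2 -> S' = S -> `|P - Q| <= e.
Proof. by rewrite !ltr_norml ler_norml => /andP[? ?] /andP[? ?] ?; apply/andP; split; lra. Qed.

Lemma schwarz N (Om : set 'rV[R]_N) f (x : 'rV[R]_N) i j :
  open Om -> smooth Om f -> Om x ->
  partial i (partial j f) x = partial j (partial i f) x.
Proof.
move=> oO sf Ox.
have /nbhs_normP[r r0 Hr] : nbhs x Om by exact: open_nbhs_nbhs.
have sij := smooth_partial i (smooth_partial j sf).
have sji := smooth_partial j (smooth_partial i sf).
apply/eqP; rewrite -subr_eq0 -normr_le0; apply/ler_addgt0Pr => e e0; rewrite add0r.
have e20 : 0 < e / 2 by rewrite divr_gt0.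
have [d1 d10 H1] := (contP _ _).1 (smooth_cont sij Ox) _ e20.
have [d2 d20 H2] := (contP _ _).1 (smooth_cont sji Ox) _ e20.
pose d := Num.min r (Num.min d1 d2).
have d0 : 0 < d by rewrite !lt_min r0 d10 d20.
pose h := d / 4.
have h0 : 0 < h by rewrite divr_gt0.
have near_x s t : 0 <= s <= h -> 0 <= t <= h -> forall a b : 'I_N, `|x + s *: basis_vec a + t *: basis_vec b - x| < d.
  move=> /andP[s0 sh] /andP[t0 th] a b; rewrite addrAC [x + _]addrC addrK.
  apply: (le_lt_trans (ler_normD _ _)); rewrite !normrZ !ger0_norm//.
  apply: (@le_lt_trans _ _ (h + h)).
    rewrite lerD//.
      by apply: le_trans sh; rewrite ler_piMr// norm_basis_vec.
    by apply: le_trans th; rewrite ler_piMr// norm_basis_vec.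
  rewrite /h; lra.
have inO z : `|z - x| < d -> Om z by rewrite lt_min => /andP[? _]; exact: Hr.
have hh : 0 <= h <= h by rewrite lexx ltW.
have z0 : 0 <= (0:R) <= h by rewrite lexx ltW.
(* second difference evaluated with the increments in either order *)
have key a b : exists2 z, `|z - x| < d &
    f (x + h *: basis_vec a + h *: basis_vec b) - f (x + h *: basis_vec a)
     - (f (x + h *: basis_vec b) - f x) = partial b (partial a f) z * h * h.
  pose phi (s : R) := f (x + s *: basis_vec a + h *: basis_vec b) - f (x + s *: basis_vec a).
  have [|c ch E] := @MVT1 R phi (fun s => partial a f (x + s *: basis_vec a + h *: basis_vec b) - partial a f (x + s *: basis_vec a)) 0 h (ltW h0).
    move=> t th.
    have D1 : isd t (fun s => f (x + s *: basis_vec a + h *: basis_vec b)) (partial a f (x + t *: basis_vec a + h *: basis_vec b)).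
      have -> : (fun s => f (x + s *: basis_vec a + h *: basis_vec b)) = (fun s => f (x + h *: basis_vec b + s *: basis_vec a)).
        by apply/funext => s; congr (f _); rewrite addrAC.
      have -> : x + t *: basis_vec a + h *: basis_vec b = x + h *: basis_vec b + t *: basis_vec a by rewrite addrAC.
      by apply: is_derive_line; apply: smooth_is_derive sf _; apply: inO; exact: near_x.
    have D2 : isd t (fun s => f (x + s *: basis_vec a)) (partial a f (x + t *: basis_vec a)).
      apply: is_derive_line; apply: smooth_is_derive sf _; apply: inO.
      by have := near_x t 0 th z0 a b; rewrite scale0r addr0.
    exact: is_deriveB.
  have [|c2 ch2 E2] := @basis_MVT _ Om (partial a f) (x + c *: basis_vec a) b h (ltW h0) (smooth_partial a sf).
    by move=> t th; apply: inO; exact: near_x.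
  exists (x + c *: basis_vec a + c2 *: basis_vec b); first exact: near_x.
  rewrite -E2; rewrite subr0 in E; rewrite -E /phi !scale0r !addr0; ring.
have [z zd Ez] := key j i; have [z' zd' Ez'] := key i j.
have EE : partial i (partial j f) z = partial j (partial i f) z'.
  move: Ez Ez'; move: (partial i (partial j f) z) (partial j (partial i f) z') => P Q Ez Ez'.
  have hn : h != 0 by rewrite gt_eqF.
  apply: (mulIf hn); apply: (mulIf hn); rewrite -Ez -Ez' [x + h *: basis_vec j + _]addrAC.
  by move: (f _) (f _) (f _) (f _) => a b c k; ring.
have b1 : `|partial i (partial j f) z - partial i (partial j f) x| < e / 2.
  by apply: H1; move: zd; rewrite !lt_min => /and3P[].
have b2 : `|partial j (partial i f) z' - partial j (partial i f) x| < e / 2.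
  by apply: H2; move: zd'; rewrite !lt_min => /and3P[].
exact: close_values b1 b2 EE.
Qed.

Lemma compact_cball N (r : R) : compact [set x : 'rV[R]_N | `|x| <= r].
Proof.
apply: bounded_closed_compact.
  by exists r; split; [exact: num_real|move=> M rM x /= /le_trans; apply; exact: ltW].
have -> : [set x : 'rV[R]_N | `|x| <= r] = Num.norm @^-1` [set y | y <= r] by [].
by apply: closed_comp => [x _|]; [exact: norm_continuous|exact: closed_le].
Qed.

Lemma compact_sub_cball N (C : set 'rV[R]_N) : compact C ->
  exists2 r, 0 < r & forall x, C x -> `|x| <= r.
Proof.
move=> /compact_bounded[M [_ HM]]; exists (Num.max 1 (M + 1)); first by rewrite lt_max ltr01.
by move=> x Cx; apply: HM => //; rewrite lt_max ltrDl ltr01 orbT.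
Qed.

Lemma compact_cont_bounded N (C : set 'rV[R]_N) (f : 'rV[R]_N -> R) : compact C ->
  (forall x, C x -> {for x, continuous f}) -> exists2 B, 0 < B & forall x, C x -> `|f x| <= B.
Proof.
move=> cC cf.
have cf' : {within C, continuous f}.
  by apply: continuous_in_subspaceT => x /set_mem Cx; exact: cf.
have /compact_bounded[M [_ HM]] := continuous_compact cf' cC.
exists (Num.max 1 (M + 1)); first by rewrite lt_max ltr01.
by move=> x Cx; apply: (HM (Num.max 1 (M+1))); [rewrite lt_max ltrDl ltr01 orbT|exists x].
Qed.

Lemma taylor2 N f (x : 'rV[R]_N) i (h B : R) : smooth setT f ->
  (forall t, `|t| <= `|h| -> `|partial i (partial i f) (x + t *: basis_vec i)| <= B) ->
  `|f (x + h *: basis_vec i) - f x - h * partial i f x| <= B * h ^+ 2.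
Proof.
move=> sf HB.
have B0 : 0 <= B by apply: le_trans (HB 0 _); rewrite ?normr0.
(* The derivative is taken at an arbitrary point [a] of the segment: [a = 0] serves for $h\ge0$, and
   the far end serves for $h<0$, where the segment is run from $x+he_i$ to $x$. *)
have key (y : 'rV[R]_N) (s : R) : 0 <= s -> (forall t, 0 <= t <= s -> `|partial i (partial i f) (y + t *: basis_vec i)| <= B) ->
  forall a, 0 <= a <= s -> `|f (y + s *: basis_vec i) - f y - s * partial i f (y + a *: basis_vec i)| <= B * s ^+ 2.
  move=> s0 Hs a as_.
  have [c cs ->] := @basis_MVT _ setT f y i s s0 sf (fun _ _ => I).
  rewrite mulrC -mulrBr normrM ger0_norm// expr2 mulrCA ler_wpM2l//.
  have D u v : 0 <= u -> u <= v -> v <= s -> `|partial i f (y + v *: basis_vec i) - partial i f (y + u *: basis_vec i)| <= B * s.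
    move=> u0 uv vs.
    have vu : 0 <= v - u by rewrite subr_ge0.
    have [c' c's] := @basis_MVT _ setT (partial i f) (y + u *: basis_vec i) i (v - u) vu (smooth_partial i sf) (fun _ _ => I).
    rewrite -addrA -scalerDl [u + _]addrC subrK => ->.
    rewrite normrM ler_pM//.
      rewrite -addrA -scalerDl; apply: Hs; move: c's => /andP[? ?].
      by apply/andP; split; [rewrite addr_ge0|rewrite (le_trans _ vs)// -lerBrDl].
    by rewrite ger0_norm//; lra.
  move: cs as_ => /andP[c0 cs] /andP[a0 as_].
  have [ac|/ltW ca] := leP a c; first exact: D.
  by rewrite distrC; exact: D.
have [h0|h0] := leP 0 h.
  have := key x h h0 _ 0; rewrite scale0r addr0; apply => //; last by rewrite lexx.
  by move=> t /andP[t0 th]; apply: HB; rewrite !ger0_norm.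
have nh0 : 0 <= - h by rewrite oppr_ge0 ltW.
have := key (x + h *: basis_vec i) (- h) nh0 _ (- h).
rewrite -!addrA -!scalerDl subrr scale0r addr0 sqrrN => H.
rewrite -normrN !opprD !opprK.
have -> : - f (x + h *: basis_vec i) + (f x + h * partial i f x) = f x + (- f (x + h *: basis_vec i) - - h * partial i f x) by ring.
apply: H; last by rewrite lexx nh0.
move=> t /andP[t0 th]; rewrite -addrA -scalerDl; apply: HB.
rewrite [leRHS]ltr0_norm// ler_norml; apply/andP; split; lra.
Qed.

Definition smap p q (g : 'rV[R]_p -> 'rV[R]_q) := forall i, smooth setT (fun x => g x 0 i).

Lemma smooth_compT p q (g : 'rV[R]_p -> 'rV[R]_q) f : smap g -> smooth setT f -> smooth setT (fun x => f (g x)).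
Proof. by move=> sg; apply: smooth_comp => //; exact: openT. Qed.

Lemma smap_comp p q r (g : 'rV[R]_p -> 'rV[R]_q) (f : 'rV[R]_q -> 'rV[R]_r) :
  smap g -> smap f -> smap (fun x => f (g x)).
Proof. by move=> sg sf i; apply: (smooth_compT sg (sf i)). Qed.

Lemma smap_cont p q (g : 'rV[R]_p -> 'rV[R]_q) : smap g -> continuous g.
Proof. by move=> sg x; apply: cont_coords => i; exact: smooth_cont (sg i) I. Qed.

Lemma smap_id p : smap (@id 'rV[R]_p).
Proof. by move=> i; apply: smooth_coord; exact: openT. Qed.

Lemma smap_cst p q (c : 'rV[R]_q) : smap (fun _ : 'rV[R]_p => c).
Proof. by move=> i; apply: smooth_cst; exact: openT. Qed.

Lemma smap_lsub p q : smap (@lsubmx R 1 p q).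
Proof. by move=> i; apply: smooth_eq (smooth_coord (lshift q i) openT) => [|x _]; [exact: openT|rewrite mxE]. Qed.

Lemma smap_rsub p q : smap (@rsubmx R 1 p q).
Proof. by move=> i; apply: smooth_eq (smooth_coord (rshift p i) openT) => [|x _]; [exact: openT|rewrite mxE]. Qed.

Lemma smap_row p q r (f : 'rV[R]_p -> 'rV[R]_q) (g : 'rV[R]_p -> 'rV[R]_r) :
  smap f -> smap g -> smap (fun x => row_mx (f x) (g x)).
Proof.
move=> sf sg i; rewrite -(splitK i); case: (fintype.split i) => j /=.
  by apply: smooth_eq (sf j) => [|x _]; [exact: openT|rewrite row_mxEl].
by apply: smooth_eq (sg j) => [|x _]; [exact: openT|rewrite row_mxEr].
Qed.

Lemma smap_add p q (f g : 'rV[R]_p -> 'rV[R]_q) : smap f -> smap g -> smap (fun x => f x + g x).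
Proof.
move=> sf sg i; apply: smooth_eq (smooth_add openT (sf i) (sg i)) => [|x _]; [exact: openT|by rewrite mxE].
Qed.

Lemma smap_scale p q (c : 'rV[R]_p -> R) (f : 'rV[R]_p -> 'rV[R]_q) : smooth setT c -> smap f -> smap (fun x => c x *: f x).
Proof.
move=> sc sf i; apply: smooth_eq (smooth_mul openT sc (sf i)) => [|x _]; [exact: openT|by rewrite mxE].
Qed.

Lemma smap_opp p q (f : 'rV[R]_p -> 'rV[R]_q) : smap f -> smap (fun x => - f x).
Proof.
move=> sf i; apply: smooth_eq (smooth_opp openT (sf i)) => [|x _]; [exact: openT|by rewrite mxE].
Qed.

(** Two vector variables are merged into one row vector, so that smooth dependence on parameters, on
    integration variables and on the point is always smoothness of one function on one space. *)
Definition jsmooth p N (H : 'rV[R]_p -> 'rV[R]_N -> R) :=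
  smooth setT (fun z : 'rV[R]_(p + N) => H (lsubmx z) (rsubmx z)).

Lemma jsmoothP p N q (H : 'rV[R]_p -> 'rV[R]_N -> R) (f : 'rV[R]_q -> 'rV[R]_p) (g : 'rV[R]_q -> 'rV[R]_N) :
  jsmooth H -> smap f -> smap g -> smooth setT (fun x => H (f x) (g x)).
Proof.
move=> jH sf sg; have := smooth_compT (smap_row sf sg) jH.
by apply: smooth_eq => [|x _]; [exact: openT|rewrite row_mxKl row_mxKr].
Qed.

Lemma jsmooth_fix p N (H : 'rV[R]_p -> 'rV[R]_N -> R) x : jsmooth H -> smooth setT (H x).
Proof. by move=> jH; apply: (jsmoothP jH); [exact: smap_cst|exact: smap_id]. Qed.

Lemma jpartialE p N (H : 'rV[R]_p -> 'rV[R]_N -> R) i :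
  (fun z : 'rV[R]_(p + N) => partial i (H (lsubmx z)) (rsubmx z)) =
  partial (rshift p i) (fun z => H (lsubmx z) (rsubmx z)).
Proof.
apply/funext => z; rewrite /partial /derive.
set F := (X in lim (X @ _)); set F' := (X in _ = lim (X @ _)).
suff -> : F = F' by [].
apply/funext => h; rewrite /F /F' /=; congr (_ *: (H _ _ - _)).
  apply/rowP => j; rewrite !mxE eqxx/=.
  by rewrite (_ : (lshift N j == rshift p i) = false) ?mulr0 ?add0r// eq_lrshift.
apply/rowP => j; rewrite !mxE eqxx/=.
by rewrite (eq_rshift p).
Qed.

Lemma jsmooth_partial p N (H : 'rV[R]_p -> 'rV[R]_N -> R) i :
  jsmooth H -> jsmooth (fun x => partial i (H x)).
Proof. by rewrite /jsmooth jpartialE; exact: smooth_partial. Qed.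

Lemma jsmooth_partials p N (H : 'rV[R]_p -> 'rV[R]_N -> R) w :
  jsmooth H -> jsmooth (fun x => partials w (H x)).
Proof.
by move=> jH; elim: w => [//|i w IH]; exact: (jsmooth_partial i IH).
Qed.

Lemma jsmooth_tr_app p N (H : 'rV[R]_p -> 'rV[R]_N -> R) (L : diffop R N) :
  jsmooth H -> jsmooth (fun x => diffop_tr_app L (H x)).
Proof.
move=> jH; apply: (@smooth_sum R _ _ (nterms L)); first exact: openT.
move=> k; apply: smooth_mul; first exact: openT.
  by apply: smooth_cst; exact: openT.
apply: (jsmooth_partials (H := fun x y => coef k y * H x y)); apply: smooth_mul => //; first exact: openT.
by apply: (smooth_compT (@smap_rsub _ _)); constructor; exact: coef_smooth.
Qed.

Lemma smooth_app N (L : diffop R N) f : smooth setT f -> smooth setT (diffop_app L f).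
Proof.
move=> sf; apply: smooth_sum; first exact: openT.
move=> k; apply: smooth_mul; first exact: openT.
  by constructor; exact: coef_smooth.
exact: smooth_partials.
Qed.

Lemma smooth_tr_app N (L : diffop R N) f : smooth setT f -> smooth setT (diffop_tr_app L f).
Proof.
move=> sf; apply: smooth_sum; first exact: openT.
move=> k; apply: smooth_scale; first exact: openT.
apply: smooth_partials; apply: smooth_mul => //; first exact: openT.
by constructor; exact: coef_smooth.
Qed.

End smooth_theory2.

(** * Integration of compactly supported functions *)

Section integration.
Context {R : realType}.
Implicit Types (n N p q : nat).
Notation T := (measurableTypeR R).

Lemma rat_approx n (x : 'rV[R]_n) (e : R) : 0 < e ->
  exists q : 'rV[rat]_n, forall i, `|x 0 i - ratr (q 0 i)| < e.
Proof.
move=> e0.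
have H i : exists q : rat, `|x 0 i - ratr q| < e.
  have [q] := @rat_in_itvoo R (x 0 i - e) (x 0 i + e) (ltac:(lra)).
  by rewrite in_itv/= => /andP[h1 h2]; exists q; rewrite ltr_norml; apply/andP; split; lra.
exists (\row_i sval (cid (H i))) => i; rewrite mxE; by case: cid.
Qed.

(* The open sets of [R^n] are countable unions of rational cubes. *)
Lemma measurable_open_preimage d (X : measurableType d) n (phi : X -> 'rV[R]_n) (U : set 'rV[R]_n) :
  (forall i, measurable_fun setT (fun x => phi x 0 i : T)) -> open U -> measurable [set x | U (phi x)].
Proof.
move=> mphi oU.
pose box (z : 'rV[rat]_n * nat) : set 'rV[R]_n := [set y | forall i, `|y 0 i - ratr (z.1 0 i)| < z.2.+1%:R^-1].
have -> : [set x | U (phi x)] = \bigcup_(z : 'rV[rat]_n * nat) [set x | box z `<=` U /\ box z (phi x)].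
  apply/seteqP; split => [x Ux|x [z _ [zU zx]]]; last exact: zU.
  have /nbhs_normP[r r0 Hr] : nbhs (phi x) U by exact: open_nbhs_nbhs.
  have [k kr] : exists k : nat, k.+1%:R^-1 < r / 2.
    have r20 : 0 < r / 2 by rewrite divr_gt0.
    exists (Num.truncn (r / 2)^-1); rewrite invf_plt ?posrE ?ltr0n//.
    by have /andP[_] := truncn_itv (ltW (ltac:(by rewrite invr_gt0) : 0 < (r / 2)^-1)).
  have [q Hq] := @rat_approx n (phi x) k.+1%:R^-1 (ltac:(by rewrite invr_gt0 ltr0n)).
  exists (q, k) => //; split => // y Hy; apply: Hr; apply: norm_lt_coords => // i.
  rewrite !mxE; have h1 := Hq i; have h2 := Hy i; rewrite /= in h2.
  rewrite (_ : y 0 i - phi x 0 i = (y 0 i - ratr (q 0 i)) - (phi x 0 i - ratr (q 0 i))); last by ring.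
  apply: (le_lt_trans (ler_normB _ _)); rewrite (splitr r).
  by apply: ltrD; [exact: lt_trans h2 kr|exact: lt_trans h1 kr].
apply: countable_bigcupT_measurable => [|z]; first exact: countableP.
have [zU|nzU] := pselect (box z `<=` U); last first.
  rewrite (_ : [set _ | _] = set0)//; apply/seteqP; split => x //= -[].
  by [].
rewrite (_ : [set _ | _] = \bigcap_(i in [set: 'I_n]) ((fun x => phi x 0 i : T) @^-1` [set y | `|y - ratr (z.1 0 i)| < z.2.+1%:R^-1])).
  apply: fin_bigcap_measurable => // i _; rewrite -[X in measurable X]setTI; apply: mphi => //.
  apply: measurable_realfun.open_measurable.
  rewrite (_ : [set y | _] = ball (ratr (z.1 0 i) : R) z.2.+1%:R^-1).
    exact: ball_open.
  by apply/seteqP; split => y; rewrite -ball_normE/= distrC.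
apply/seteqP; split => [x [_ bx] i _|x bx]; first exact: bx.
by split => // i; exact: (bx i I).
Qed.

Lemma measurable_comp_cont d (X : measurableType d) n (phi : X -> 'rV[R]_n) (F : 'rV[R]_n -> R) :
  (forall i, measurable_fun setT (fun x => phi x 0 i : T)) -> continuous F ->
  measurable_fun setT (fun x => F (phi x)).
Proof.
move=> mphi cF; apply: (measurability (@measurable_realfun.RGenOInfty.G R)).
  exact: measurable_realfun.RGenOInfty.measurableE.
move=> _ [_ [a ->] <-]; rewrite setTI.
apply: (@measurable_open_preimage _ _ _ phi (F @^-1` `]a, +oo[)) => //.
by apply: open_comp => [x _|]; [exact: cF|exact: interval_open].
Qed.

Definition tovec n (t : n.-tuple T) : 'rV[R]_n := \row_i tnth t i.

Lemma measurable_tovec n (F : 'rV[R]_n -> R) : continuous F ->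
  measurable_fun setT (fun t : n.-tuple T => F (tovec t)).
Proof.
move=> cF; apply: measurable_comp_cont => // i.
rewrite (_ : (fun _ => _) = (fun t : n.-tuple T => tnth t i)); first exact: measurable_tnth.
by apply/funext => t; rewrite mxE.
Qed.

(** Bounded and supported on a set of finite measure: a class of integrable functions large enough
    for all the integrals below, and stable under slicing. *)
Definition fsb d (X : measurableType d) (m : {measure set X -> \bar R}) (h : X -> R) :=
  measurable_fun setT h /\ exists A B,
    [/\ measurable A, (m A < +oo)%E, forall x, `|h x| <= B & forall x, ~ A x -> h x = 0].

Lemma fsb_integrable d (X : measurableType d) (m : {measure set X -> \bar R}) (h : X -> R) :
  fsb m h -> m.-integrable setT (EFin \o h).
Proof.
move=> [mh [A [B [mA fA hB h0]]]].
have -> : EFin \o h = (EFin \o h) \_ A.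
  by apply/funext => x; rewrite patchE; case: ifPn => // /negP xA; rewrite /= h0// => Ax; apply: xA; rewrite inE.
apply/(integrable_mkcond _ mA); apply: measurable_bounded_integrable => //.
  exact: measurable_funTS.
by exists B; split; [exact: num_real|move=> M BM x _; exact: le_trans (ltW BM)].
Qed.

Lemma fsb_Fubini d1 d2 (X1 : measurableType d1) (X2 : measurableType d2)
  (m1 : {sigma_finite_measure set X1 -> \bar R}) (m2 : {sigma_finite_measure set X2 -> \bar R})
  (h : X1 * X2 -> R) (A1 : set X1) (A2 : set X2) (B : R) :
  measurable_fun setT h -> measurable A1 -> measurable A2 -> (m1 A1 < +oo)%E -> (m2 A2 < +oo)%E ->
  (forall z, `|h z| <= B) -> (forall z, ~ (A1 z.1 /\ A2 z.2) -> h z = 0) ->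
  [/\ (m1 \x m2)%E.-integrable setT (EFin \o h),
   \int[(m1 \x m2)%E]_z h z = \int[m1]_x \int[m2]_y h (x, y) &
   \int[m1]_x \int[m2]_y h (x, y) = \int[m2]_y \int[m1]_x h (x, y)].
Proof.
move=> mh mA1 mA2 fA1 fA2 hB h0.
have ih : (m1 \x m2)%E.-integrable setT (EFin \o h).
  apply: fsb_integrable; split => //; exists (A1 `*` A2), B; split => //.
    exact: measurableX.
  by rewrite [ltLHS](product_measure1E m1 m2 mA1 mA2) lte_mul_pinfty// ge0_fin_numE.
have i2 x : m2.-integrable setT (EFin \o (fun y => h (x, y))).
  apply: fsb_integrable; split; first exact: measurableT_comp mh _.
  exists A2, B; split => // y A2y; apply: h0 => -[]//.
have i1 y : m1.-integrable setT (EFin \o (fun x => h (x, y))).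
  apply: fsb_integrable; split; first exact: measurableT_comp mh _.
  exists A1, B; split => // x A1x; apply: h0 => -[]//.
have E1 : (\int[m1]_x (\int[m2]_y h (x, y))%:E = \int[m1]_x \int[m2]_y (h (x, y))%:E)%E.
  apply: eq_integral => x _; rewrite /Rintegral fineK//.
  by have := integrable_fin_num measurableT (i2 x).
have E2 : (\int[m2]_y (\int[m1]_x h (x, y))%:E = \int[m2]_y \int[m1]_x (h (x, y))%:E)%E.
  apply: eq_integral => y _; rewrite /Rintegral fineK//.
  by have := integrable_fin_num measurableT (i1 y).
split => //; rewrite /Rintegral.
  by rewrite E1 -(integral12_prod_meas1 ih).
by rewrite E1 E2; congr fine; exact: (Fubini ih).
Qed.

Definition boxt n (r : R) : set (n.-tuple T) := [set t | forall i, `|tnth t i| <= r].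

Lemma measurable_boxt n r : measurable (@boxt n r).
Proof.
rewrite (_ : boxt r = \bigcap_(i in [set: 'I_n]) ((fun t : n.-tuple T => tnth t i) @^-1` [set y | `|y| <= r])).
  apply: fin_bigcap_measurable => // i _; rewrite -[X in measurable X]setTI; apply: measurable_tnth => //.
  rewrite (_ : [set y : R | `|y| <= r] = `[- r, r]%classic); first exact: measurable_itv.
  by apply/seteqP; split => y; rewrite /= in_itv/= ler_norml.
apply/seteqP; split => [x bx i _|x bx i]; [exact: bx|exact: (bx i I)].
Qed.

Lemma lebesgue_itv_lty (r : R) : (lebesgue_measure [set y : T | (`|y| <= r)%R] < +oo)%E.
Proof.
rewrite (_ : [set y : R | `|y| <= r] = [set` `[- r, r]]).
  by rewrite lebesgue_measure_itv; case: ifP => _; rewrite ?ltry//= -EFinB ltry.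
by apply/seteqP; split => y; rewrite /= in_itv/= ler_norml.
Qed.

Lemma measurable_itvr (r : R) : measurable ([set y : T | `|y| <= r]).
Proof.
rewrite (_ : [set y : R | `|y| <= r] = `[- r, r]%classic); first exact: measurable_itv.
by apply/seteqP; split => y; rewrite /= in_itv/= ler_norml.
Qed.

Lemma boxt_lty n r : (lebesgue_tuple n (@boxt n r) < +oo)%E.
Proof.
elim: n => [|n IH].
  by rewrite /= diracE; apply: (@le_lt_trans _ _ 1%E); [case: (_ \in _); rewrite lee_fin|exact: ltry].
rewrite /= /lebesgue_cons /pushforward.
rewrite (_ : _ @^-1` _ = [set y : T | `|y| <= r] `*` boxt r).
  rewrite product_measure1E.
  - rewrite lte_mul_pinfty//; first by rewrite ge0_fin_numE// lebesgue_itv_lty.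
  - exact: measurable_itvr.
  - exact: measurable_boxt.
apply/seteqP; split => -[x t] /=.
  move=> H; split; first by have := H ord0; rewrite tnth0.
  by move=> i; have := H (lift ord0 i); rewrite tnthS.
move=> [xr tr] i; case: (unliftP ord0 i) => [j ->|->]; last by rewrite tnth0.
by rewrite tnthS; exact: tr.
Qed.

Definition Cc N (f : 'rV[R]_N -> R) :=
  continuous f /\ exists r, forall x, r < `|x| -> f x = 0.

Lemma Cc_bounded N (f : 'rV[R]_N -> R) : Cc f -> exists2 B, 0 < B & forall x, `|f x| <= B.
Proof.
move=> [cf [r fr]]; have [B B0 HB] := compact_cont_bounded (@compact_cball R N r) (fun x _ => cf x).
exists B => // x; have [xr|xr] := leP `|x| r; first exact: HB.
by rewrite fr// normr0 ltW.
Qed.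

Lemma Cc_compact N (f : 'rV[R]_N -> R) (C : set 'rV[R]_N) : compact C -> continuous f ->
  (forall x, ~ C x -> f x = 0) -> Cc f.
Proof.
move=> /compact_sub_cball[r r0 Hr] cf f0; split => //; exists r => x rx; apply: f0 => /Hr.
by rewrite leNgt rx.
Qed.

Lemma tovec_box n (t : n.-tuple T) r : 0 <= r -> boxt r t <-> `|tovec t| <= r.
Proof.
move=> r0; split=> [H|H i].
  by apply: norm_le_coords => // i; rewrite mxE; exact: H.
by have := coord_le_norm (tovec t) i; rewrite mxE => /le_trans; exact.
Qed.

Lemma Cc_fsb N (f : 'rV[R]_N -> R) : Cc f -> fsb (lebesgue_tuple N) (fun t => f (tovec t)).
Proof.
move=> Cf; have [B B0 HB] := Cc_bounded Cf; move: Cf => [cf [r fr]].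
split; first exact: measurable_tovec.
(* The radius provided by [Cc] may be negative, whence the maximum with 0, here and in later
   proofs. *)
exists (boxt (Num.max 0 r)), B; split => //.
- exact: measurable_boxt.
- exact: boxt_lty.
- move=> t nt; apply: fr; rewrite ltNge; apply/negP => H; apply: nt.
  by apply/tovec_box; rewrite ?le_max ?lexx// H orbT.
Qed.

Lemma Cc_integrable N (f : 'rV[R]_N -> R) : Cc f ->
  (lebesgue_tuple N).-integrable setT (EFin \o (fun t => f (tovec t))).
Proof. by move=> /Cc_fsb; exact: fsb_integrable. Qed.

Lemma Cc_add N (f g : 'rV[R]_N -> R) : Cc f -> Cc g -> Cc (fun x => f x + g x).
Proof.
move=> [cf [r fr]] [cg [s gs]]; split; first by move=> x; exact: (cvgD (cf x) (cg x)).
exists (Num.max r s) => x; rewrite gt_max => /andP[/fr-> /gs->]; exact: addr0.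
Qed.

Lemma Cc_mull N (f g : 'rV[R]_N -> R) : continuous f -> Cc g -> Cc (fun x => f x * g x).
Proof.
move=> cf [cg [s gs]]; split; first by move=> x; apply: cont_mul; [exact: cf|exact: cg].
by exists s => x /gs->; rewrite mulr0.
Qed.

Lemma Cc_mulr N (f g : 'rV[R]_N -> R) : Cc f -> continuous g -> Cc (fun x => f x * g x).
Proof.
move=> Cf cg; have := Cc_mull cg Cf; congr Cc.
by apply/funext => x; rewrite mulrC.
Qed.

Lemma Cc_scale N (c : R) (g : 'rV[R]_N -> R) : Cc g -> Cc (fun x => c * g x).
Proof. by apply: (@Cc_mull _ (fun=> c)); move=> x; exact: cst_continuous. Qed.

Lemma Cc_norm N (f : 'rV[R]_N -> R) : Cc f -> Cc (fun x => `|f x|).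
Proof.
move=> [cf [r fr]]; split; first by move=> x; apply: (continuous_comp (cf x)); exact: norm_continuous.
by exists r => x /fr ->; rewrite normr0.
Qed.

Notation I := integral_rV.

Lemma intD N (f g : 'rV[R]_N -> R) : Cc f -> Cc g -> I (fun x => f x + g x) = I f + I g.
Proof. by move=> Cf Cg; rewrite /I RintegralD//; exact: Cc_integrable. Qed.

Lemma intZ N (c : R) (f : 'rV[R]_N -> R) : Cc f -> I (fun x => c * f x) = c * I f.
Proof. by move=> Cf; rewrite /I RintegralZl//; exact: Cc_integrable. Qed.

Lemma intN N (f : 'rV[R]_N -> R) : Cc f -> I (fun x => - f x) = - I f.
Proof.
move=> Cf; rewrite -mulN1r -intZ//; congr I; apply/funext => x; exact/esym/mulN1r.
Qed.

Lemma intB N (f g : 'rV[R]_N -> R) : Cc f -> Cc g -> I (fun x => f x - g x) = I f - I g.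
Proof.
move=> Cf Cg; rewrite intD// ?intN//.
have := Cc_scale (-1) Cg; congr Cc; apply/funext => x; exact: mulN1r.
Qed.

Lemma int0 N : I (fun _ : 'rV[R]_N => 0) = 0.
Proof. by rewrite /I /Rintegral integral0. Qed.

Lemma Cc0 N : Cc (fun _ : 'rV[R]_N => 0 : R).
Proof. by split; [move=> x; exact: cst_continuous|exists 0]. Qed.

Lemma Cc_sum N n (f : 'I_n -> 'rV[R]_N -> R) : (forall k, Cc (f k)) -> Cc (fun x => \sum_k f k x).
Proof.
elim: n f => [|n IH] f Cf.
  by have := Cc0 N; congr Cc; apply/funext => x; rewrite big_ord0.
have := Cc_add (IH (fun k => f (widen_ord (leqnSn n) k)) (fun k => Cf _)) (Cf ord_max).
by congr Cc; apply/funext => x; rewrite big_ord_recr.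
Qed.

Lemma int_sum N n (f : 'I_n -> 'rV[R]_N -> R) : (forall k, Cc (f k)) -> I (fun x => \sum_k f k x) = \sum_k I (f k).
Proof.
elim: n f => [|n IH] f Cf.
  by rewrite big_ord0 -[RHS](int0 N); congr I; apply/funext => x; rewrite big_ord0.
rewrite big_ord_recr/= -IH// -intD//; last exact: Cc_sum.
by congr I; apply/funext => x; rewrite big_ord_recr.
Qed.

Lemma int_le N (f g : 'rV[R]_N -> R) : Cc f -> Cc g -> (forall x, f x <= g x) -> I f <= I g.
Proof.
move=> Cf Cg fg; apply: le_Rintegral => //; try exact: Cc_integrable.
Qed.

Definition vol N (r : R) : R := fine (lebesgue_tuple N (boxt r)).

Lemma int_bound N (f : 'rV[R]_N -> R) (B r : R) : continuous f -> 0 <= r -> (forall x, r < `|x| -> f x = 0) ->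
  (forall x, `|x| <= r -> `|f x| <= B) -> `|I f| <= B * vol N r.
Proof.
move=> cf r0 fr fB.
have Cf : Cc f by split => //; exists r.
apply: (le_trans (le_normr_Rintegral _ (Cc_integrable Cf))) => //.
have -> : B * vol N r = \int[lebesgue_tuple N]_(t in boxt r) B.
  by rewrite Rintegral_cst//; exact: measurable_boxt.
rewrite [leRHS]Rintegral_mkcond; apply: le_Rintegral => //.
- by have := Cc_integrable (Cc_norm Cf).
- rewrite (_ : _ \o _ = (EFin \o cst B) \_ (boxt r)).
    apply: (integrable_mkcond (EFin \o cst B) (measurable_boxt r)).1.
    apply: measurable_bounded_integrable => //; [exact: measurable_boxt|exact: boxt_lty|].
    by exists `|B|; split; [exact: num_real|move=> M BM x _; rewrite /= ltW].
  by apply/funext => t; rewrite /= !patchE; case: ifP.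
- move=> t _; rewrite patchE; case: ifPn => [/set_mem/tovec_box H|/negP H].
    by apply: fB; exact: H.
  rewrite fr ?normr0// ltNge; apply/negP => H'; apply: H; rewrite inE.
  exact/tovec_box.
Qed.

Lemma vol_ge0 N r : 0 <= vol N r.
Proof. by rewrite fine_ge0. Qed.

Lemma int_swap p q (H : 'rV[R]_p -> 'rV[R]_q -> R) (r : R) :
  continuous (fun z : 'rV[R]_(p + q) => H (lsubmx z) (rsubmx z)) ->
  (forall x y, r < `|x| \/ r < `|y| -> H x y = 0) ->
  I (fun x => I (H x)) = I (fun y => I (H^~ y)).
Proof.
move=> cH H0.
have CH : Cc (fun z : 'rV[R]_(p + q) => H (lsubmx z) (rsubmx z)).
  split=> //; exists (Num.max 0 r) => z; rewrite gt_max => /andP[z0 rz]; apply: H0.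
  have [xr|xr] := leP `|lsubmx z| r; last by left.
  right; rewrite ltNge; apply/negP => yr; move: rz; rewrite ltNge => /negP; apply.
  apply: norm_le_coords; first exact: le_trans xr.
  move=> i; rewrite -(splitK i); case: (fintype.split i) => j /=.
    by have := le_trans (coord_le_norm (lsubmx z) j) xr; rewrite mxE.
  by have := le_trans (coord_le_norm (rsubmx z) j) yr; rewrite mxE.
have [B B0 HB] := Cc_bounded CH.
pose h (z : p.-tuple T * q.-tuple T) := H (tovec z.1) (tovec z.2).
have hE z : h z = (fun z : 'rV[R]_(p + q) => H (lsubmx z) (rsubmx z)) (row_mx (tovec z.1) (tovec z.2)).
  by rewrite /= row_mxKl row_mxKr.
have [] := @fsb_Fubini _ _ _ _ (lebesgue_tuple p) (lebesgue_tuple q) h (boxt (Num.max 0 r)) (boxt (Num.max 0 r)) B => //; try exact: measurable_boxt; try exact: boxt_lty.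
- rewrite (_ : h = (fun z => (fun z : 'rV[R]_(p + q) => H (lsubmx z) (rsubmx z)) (row_mx (tovec z.1) (tovec z.2)))); last exact/funext.
  apply: (@measurable_comp_cont _ _ (p + q) (fun z : p.-tuple T * q.-tuple T => row_mx (tovec z.1) (tovec z.2)) (fun z : 'rV[R]_(p + q) => H (lsubmx z) (rsubmx z))) => // i.
  rewrite -(splitK i); case: (fintype.split i) => j /=.
    rewrite (_ : (fun _ => _) = (fun z : p.-tuple T * q.-tuple T => tnth z.1 j)); last by apply/funext => z; rewrite row_mxEl mxE.
    exact: (measurableT_comp (measurable_tnth j) measurable_fst).
  rewrite (_ : (fun _ => _) = (fun z : p.-tuple T * q.-tuple T => tnth z.2 j)); last by apply/funext => z; rewrite row_mxEr mxE.
  exact: (measurableT_comp (measurable_tnth j) measurable_snd).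
- by move=> z; rewrite hE; exact: HB.
- move=> z nz; apply: H0.
  have m0 : 0 <= Num.max 0 r by rewrite le_max lexx.
  have [xr|xr] := leP `|tovec z.1| r; last by left.
  right; rewrite ltNge; apply/negP => yr; apply: nz.
  by split; apply/tovec_box => //; rewrite le_max ?xr ?yr orbT.
Qed.

(** The dimension is written [1 + n], convertible with [n.+1]: the block form gives smoothness in
    [y], while [ord0] and [lift] match the recursion that defines the measure. *)
Definition vcons n (x : R) (y : 'rV[R]_n) : 'rV[R]_(1 + n) := row_mx (const_mx x) y.

Lemma vcons0 n x (y : 'rV[R]_n) : vcons x y 0 ord0 = x.
Proof.
have -> : ord0 = lshift n (ord0 : 'I_1) by exact/val_inj.
by rewrite row_mxEl mxE.
Qed.

Lemma vconsS n x (y : 'rV[R]_n) i : vcons x y 0 (lift ord0 i) = y 0 i.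
Proof.
have -> : lift ord0 i = rshift 1 i by exact/val_inj.
by rewrite row_mxEr.
Qed.

Lemma tovec_cons n (z : T * n.-tuple T) : tovec (cons_pair z) = vcons z.1 (tovec z.2) :> 'rV_(n.+1).
Proof.
apply/rowP => i; case: (unliftP ord0 i) => [j ->|->].
  by rewrite vconsS !mxE tnthS.
by rewrite vcons0 !mxE tnth0.
Qed.

Lemma vcons_norm n x (y : 'rV[R]_n) r : `|vcons x y| <= r -> `|x| <= r /\ `|y| <= r.
Proof.
move=> H; split.
  by have := le_trans (coord_le_norm _ ord0) H; rewrite vcons0.
apply: norm_le_coords; first exact: le_trans H.
by move=> i; have := le_trans (coord_le_norm _ (lift ord0 i)) H; rewrite vconsS.
Qed.

Lemma int_rec n (f : 'rV[R]_(1 + n) -> R) : Cc f ->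
  I f = \int[lebesgue_measure]_x I (fun y : 'rV[R]_n => f (vcons x y)) /\
  I f = I (fun y : 'rV[R]_n => \int[lebesgue_measure]_x f (vcons x y)).
Proof.
move=> Cf; have [B B0 HB] := Cc_bounded Cf; have [cf [r fr]] := Cf.
pose h (z : T * n.-tuple T) := f (vcons z.1 (tovec z.2)).
have [] := @fsb_Fubini _ _ _ _ (@lebesgue_measure R) (lebesgue_tuple n) h [set y : T | `|y| <= Num.max 0 r] (boxt (Num.max 0 r)) B => //.
- apply: (@measurable_comp_cont _ _ (1 + n) (fun z : T * n.-tuple T => vcons z.1 (tovec z.2)) f) => // i; case: (unliftP ord0 i) => [j ->|->].
    rewrite (_ : (fun _ => _) = (fun z : T * n.-tuple T => tnth z.2 j)); last by apply/funext => z; rewrite vconsS mxE.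
    exact: (measurableT_comp (measurable_tnth j) measurable_snd).
  rewrite (_ : (fun _ => _) = (fun z : T * n.-tuple T => z.1)); last by apply/funext => z; rewrite vcons0.
  exact: measurable_fst.
- exact: measurable_itvr.
- exact: measurable_boxt.
- exact: lebesgue_itv_lty.
- exact: boxt_lty.
- move=> z; exact: HB.
- move=> z nz; apply: fr; rewrite ltNge; apply/negP => /vcons_norm[h1 h2]; apply: nz; split.
    by rewrite /= le_max h1 orbT.
  by apply/tovec_box; rewrite le_max ?lexx// h2 orbT.
move=> ih E1 E2.
have E : I f = \int[(lebesgue_measure \x lebesgue_tuple n)%E]_z h z.
  rewrite /I /Rintegral.
  congr fine.
  have H := @integral_pushforward _ _ _ _ R (@cons_pair R n) (@measurable_cons_pair R n) (lebesgue_measure \x lebesgue_tuple n)%E setT (EFin \o (fun t => f (tovec t))).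
  have E' : (EFin \o (fun t : (1 + n).-tuple T => f (tovec t))) \o (@cons_pair R n) = EFin \o h.
    by apply/funext => z; rewrite /= tovec_cons.
  rewrite E' in H; apply: (etrans (H _ _ _)) => //.
  by apply/measurable_realfun.measurable_EFinP; exact: measurable_tovec.
by split; rewrite E E1// E2.
Qed.

End integration.

(** * Fundamental theorem of calculus, triangular maps, integration by parts *)

Section integration2.
Context {R : realType}.
Implicit Types (n N p q : nat).
Local Notation isd t g l := (is_derive (t : R) (1 : R) (g : R -> R) (l : R)).
Notation I := integral_rV.

Lemma cont_subT (V : normedModType R) (f g : V -> R) : continuous f -> continuous g -> continuous (fun y => f y - g y).
Proof. by move=> cf cg x; exact: (cvgB (cf x) (cg x)). Qed.

Lemma cont_mulT (V : normedModType R) (f g : V -> R) : continuous f -> continuous g -> continuous (fun y => f y * g y).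
Proof. by move=> cf cg x; exact: (cvgM (cf x) (cg x)). Qed.

Lemma smoothT_cont N (f : 'rV[R]_N -> R) : smooth setT f -> continuous f.
Proof. by move=> sf x; exact: smooth_cont sf Logic.I. Qed.

Lemma Cc_sub N (f g : 'rV[R]_N -> R) : Cc f -> Cc g -> Cc (fun x => f x - g x).
Proof.
move=> Cf Cg; have := Cc_add Cf (Cc_scale (-1) Cg); congr Cc.
by apply/funext => x; rewrite mulN1r.
Qed.

Lemma Rint_prim (g P : R -> R) (u v : R) : u < v -> continuous g ->
  (forall x, isd x P (g x)) -> (forall x, ~~ (u <= x <= v) -> g x = 0) ->
  \int[lebesgue_measure]_x g x = P v - P u.
Proof.
move=> uv cg dP g0.
have -> : \int[lebesgue_measure]_x g x = \int[lebesgue_measure]_(x in `[u, v]) g x.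
  rewrite [RHS]Rintegral_mkcond; apply: eq_Rintegral => x _; rewrite patchE.
  case: ifPn => // /negP H; apply: g0; apply/negP => xuv; apply: H.
  by rewrite inE /= in_itv.
rewrite /Rintegral (@continuous_FTC2 R g P u v)//.
- exact: continuous_subspaceT.
- split; first by move=> x _; have [] := dP x.
    apply: cvg_at_right_filter; exact: is_derive_cont (dP u).
  apply: cvg_at_left_filter; exact: is_derive_cont (dP v).
- by move=> x _; rewrite derive1E; have [_ ->] := dP x.
Qed.

Lemma R_integrable (g : R -> R) (r : R) : continuous g -> (forall x, r < `|x| -> g x = 0) ->
  lebesgue_measure.-integrable setT (EFin \o g).
Proof.
move=> cg g0; apply: fsb_integrable; split; first exact: measurable_realfun.continuous_measurable_fun.
have cw : {within `[- r, r], continuous g} by exact: continuous_subspaceT.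
have /compact_bounded[M [_ HM]] := continuous_compact cw (@segment_compact R _ _).
exists [set y : R | `|y| <= r], (Num.max 0 (M + 1)); split.
- exact: measurable_itvr.
- exact: lebesgue_itv_lty.
- move=> x; have [xr|xr] := leP `|x| r; last by rewrite g0// normr0 le_max lexx.
  apply: HM; first by rewrite lt_max ltrDl ltr01 orbT.
  by exists x => //; rewrite /= in_itv/= -ler_norml.
- by move=> x /negP; rewrite -ltNge; exact: g0.
Qed.

Lemma Rprim_exists (g : R -> R) (r : R) : continuous g -> (forall x, r < `|x| -> g x = 0) ->
  exists P, forall x, isd x P (g x).
Proof.
move=> cg g0.
have ig := R_integrable cg g0.
exists (fun x => \int[lebesgue_measure]_(t in `]-oo, x]) g t) => x.
have xx : x < x + 1 by rewrite ltrDl.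
have [||d e] := @continuous_FTC1 R g -oo%O x (x + 1) xx _ _ (cg x).
- by apply: integrableS ig => //; exact: measurable_itv.
- by first [done|rewrite ltNyBS|rewrite /Order.lt/=|rewrite lt_neqAle].
by rewrite -e; rewrite derive1E; apply: DeriveDef.
Qed.

(** Both integrals are increments of primitives, [P] and $a^{-1}P(a\,\cdot+c)$, over intervals that
    correspond to each other. *)
Lemma Rint_affine (g : R -> R) (a c r : R) : 0 < a -> continuous g -> (forall x, r < `|x| -> g x = 0) ->
  \int[lebesgue_measure]_x g (a * x + c) = a^-1 * \int[lebesgue_measure]_x g x.
Proof.
move=> a0 cg g0; have [P dP] := Rprim_exists cg g0.
have a0' : a != 0 by rewrite gt_eqF.
pose s := Num.max 0 r + 1.
have s0 : 0 < s by rewrite ltr_wpDl// le_max lexx.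
have rs : r < s by rewrite /s ltr_pwDr// le_max lexx orbT.
have gs x : ~~ (- s <= x <= s) -> g x = 0.
  by rewrite -ler_norml -ltNge => H; apply: g0; exact: lt_trans H.
rewrite (@Rint_prim g P (- s) s)//; last lra.
apply: (etrans (@Rint_prim (fun x => g (a * x + c)) (fun x => a^-1 * P (a * x + c)) ((- s - c) / a) ((s - c) / a) _ _ _ _)).
- by rewrite ltr_pM2r ?invr_gt0//; lra.
- move=> x; apply: (@continuous_comp _ _ _ (fun x => a * x + c) g); last exact: cg.
  by apply: cvgD; [apply: cvgM; [exact: cvg_cst|exact: cvg_id]|exact: cvg_cst].
- move=> x; have /derive1P H := dP (a * x + c).
  apply/derive1P => e e0; have [d d0 Hd] := H _ e0.
  exists (d / a); first by rewrite divr_gt0.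
  move=> h; rewrite ltr_pdivlMr// => hd.
  have := Hd (a * h); rewrite normrM gtr0_norm// mulrC => /(_ hd).
  rewrite (_ : a * (x + h) + c = a * x + c + a * h); last ring.
  move=> Hh; rewrite (_ : _ - _ - _ = a^-1 * (P (a * x + c + a * h) - P (a * x + c) - a * h * g (a * x + c))); last by field.
  rewrite normrM normfV (gtr0_norm a0) ler_pdivrMl//.
  by apply: (le_trans Hh); rewrite mulrC mulrCA.
- move=> x H; apply: gs; apply: contra H => /andP[h1 h2].
  by rewrite ler_pdivrMr// ler_pdivlMr// [x * a]mulrC; apply/andP; split; lra.
- by rewrite -mulrBr; congr (_ * (P _ - P _)); rewrite mulrC divfK// subrK.
Qed.

Lemma unif_cont_param p q (H : 'rV[R]_p -> 'rV[R]_q -> R) (C : set 'rV[R]_q) x0 e : compact C -> 0 < e ->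
  continuous (fun z : 'rV[R]_(p + q) => H (lsubmx z) (rsubmx z)) ->
  exists2 d, 0 < d & forall x y, `|x - x0| < d -> C y -> `|H x y - H x0 y| < e.
Proof.
move=> cC e0 cH.
have /nbhs_normP[d d0 Hd] : \forall x \near x0, C `<=` (fun y => `|H x y - H x0 y| < e).
  apply: ((compact_near_coveringP C).1 cC _ (nbhs x0) (fun x y => `|H x y - H x0 y| < e)) => y Cy.
  have e20 : 0 < e / 2 by rewrite divr_gt0.
  have [d d0 Hd] := (contP _ _).1 (cH (row_mx x0 y)) _ e20; rewrite row_mxKl row_mxKr in Hd.
  have key x' y' : `|x' - x0| < d -> `|y' - y| < d -> `|H x' y' - H x0 y| < e / 2.
    move=> hx hy; have := Hd (row_mx x' y'); rewrite row_mxKl row_mxKr; apply.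
    rewrite opp_row_mx add_row_mx; apply: norm_lt_coords => // i.
    rewrite -(splitK i); case: (fintype.split i) => j /=.
      by rewrite row_mxEl; apply: le_lt_trans hx; exact: coord_le_norm.
    by rewrite row_mxEr; apply: le_lt_trans hy; exact: coord_le_norm.
  exists (ball y d, ball x0 d); first by split; exact: nbhsx_ballx.
  move=> [y' x'] /= []; rewrite -!ball_normE/= => hy hx.
  rewrite distrC in hy; rewrite distrC in hx.
  rewrite -(subrKA (H x0 y)) (splitr e); apply: (le_lt_trans (ler_normD _ _)); apply: ltrD; first exact: key.
  by rewrite distrC; apply: key => //; rewrite subrr normr0.
by exists d => // x y xd Cy; exact: Hd.
Qed.

Lemma cont_fixl p q (H : 'rV[R]_p -> 'rV[R]_q -> R) x :
  continuous (fun z : 'rV[R]_(p + q) => H (lsubmx z) (rsubmx z)) -> continuous (H x).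
Proof.
move=> cH y.
have E : H x = (fun z : 'rV[R]_(p + q) => H (lsubmx z) (rsubmx z)) \o (row_mx x).
  by apply/funext => y'; rewrite /= row_mxKl row_mxKr.
rewrite E; apply: continuous_comp; last exact: cH.
by apply: smap_cont; apply: smap_row; [exact: smap_cst|exact: smap_id].
Qed.

Lemma int_param_cont p q (H : 'rV[R]_p -> 'rV[R]_q -> R) (r : R) :
  continuous (fun z : 'rV[R]_(p + q) => H (lsubmx z) (rsubmx z)) ->
  (forall x y, r < `|y| -> H x y = 0) -> continuous (fun x => I (H x)).
Proof.
move=> cH H0 x0; apply/contP => e e0.
pose s := Num.max 0 r.
have s0 : 0 <= s by rewrite le_max lexx.
have Hs x y : s < `|y| -> H x y = 0 by rewrite gt_max => /andP[_]; exact: H0.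
have CH x : Cc (H x) by split; [exact: cont_fixl|exists s; exact: Hs].
have V0 : 0 < vol (R := R) q s + 1 by rewrite ltr_wpDl// vol_ge0.
have e'0 : 0 < e / (vol q s + 1) by rewrite divr_gt0.
have [d d0 Hd] := @unif_cont_param _ _ H _ x0 _ (@compact_cball R q s) e'0 cH.
exists d => // x xd; rewrite -intB//.
apply: (@le_lt_trans _ _ (e / (vol q s + 1) * vol q s)).
  apply: int_bound => //.
  - by apply: cont_subT; exact: cont_fixl.
  - by move=> y ys; rewrite !Hs// subrr.
  - by move=> y ys; apply: ltW; exact: Hd.
by rewrite mulrAC ltr_pdivrMr// ltr_pM2l// ltrDl.
Qed.

Lemma continuous_vcons n (y : 'rV[R]_n) : continuous (fun x : R => vcons x y).
Proof.
move=> x; apply: cont_coords => i; case: (unliftP (ord0 : 'I_n.+1) i) => [j ->|->].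
  rewrite (_ : (fun _ => _) = cst (y 0 j)); first exact: cst_continuous.
  by apply/funext => x'; rewrite vconsS.
rewrite (_ : (fun _ => _) = id); first exact: cvg_id.
by apply/funext => x'; rewrite vcons0.
Qed.

Lemma Cc_vconsl n (f : 'rV[R]_(1 + n) -> R) x : Cc f -> Cc (fun y => f (vcons x y)).
Proof.
move=> [cf [r fr]]; split.
  move=> y; apply: (@continuous_comp _ _ _ (vcons x) f); last exact: cf.
  by apply: smap_cont; apply: smap_row; [exact: smap_cst|exact: smap_id].
exists r => y yr; apply: fr; rewrite ltNge; apply/negP => /vcons_norm[_].
by rewrite leNgt yr.
Qed.

Lemma cont_vconsr n (f : 'rV[R]_(1 + n) -> R) y : continuous f -> continuous (fun x => f (vcons x y)).
Proof.
move=> cf x; apply: (@continuous_comp _ _ _ (fun x => vcons x y) f); last exact: cf.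
exact: continuous_vcons.
Qed.

Lemma cont_int_vcons n (f : 'rV[R]_(1 + n) -> R) : Cc f -> continuous (fun x => I (fun y : 'rV[R]_n => f (vcons x y))).
Proof.
move=> [cf [r fr]] x.
have := @int_param_cont 1 n (fun u y => f (row_mx u y)) r.
move=> /(_ _ _)H.
have cx : {for x, continuous (fun x : R => const_mx x : 'rV[R]_1)}.
  apply: cont_coords => i; rewrite (_ : (fun _ => _) = id); first exact: cvg_id.
  by apply/funext => z; rewrite mxE.
apply: (@continuous_comp _ _ _ (fun x : R => const_mx x : 'rV[R]_1) (fun u => I (fun y => f (row_mx u y)))) => //.
apply: H.
  rewrite (_ : (fun _ => _) = f)//; by apply/funext => z; rewrite hsubmxK.
move=> u y yr; apply: fr; apply: (lt_le_trans yr); apply: norm_le_coords => // i.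
by have := coord_le_norm (row_mx u y) (rshift 1 i); rewrite row_mxEr.
Qed.

Lemma int0_vcons n (f : 'rV[R]_(1 + n) -> R) (r x : R) : (forall z, r < `|z| -> f z = 0) -> r < `|x| ->
  I (fun y : 'rV[R]_n => f (vcons x y)) = 0.
Proof.
move=> fr xr; rewrite -[RHS](int0 n); congr I; apply/funext => y; apply: fr.
by rewrite ltNge; apply/negP => /vcons_norm[]; rewrite leNgt xr.
Qed.

Definition triang n (a : 'I_n -> R) (c : 'I_n -> 'rV[R]_n -> R) (y : 'rV[R]_n) : 'rV[R]_n :=
  \row_j (a j * y 0 j + c j y).

Lemma int_triang n (a : 'I_n -> R) (c : 'I_n -> 'rV[R]_n -> R) (F : 'rV[R]_n -> R) :
  (forall j, 0 < a j) -> (forall j, continuous (c j)) ->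
  (forall (j : 'I_n) (y y' : 'rV[R]_n), (forall i : 'I_n, (i < j)%N -> y 0 i = y' 0 i) -> c j y = c j y') ->
  Cc F -> Cc (fun y => F (triang a c y)) ->
  I (fun y => F (triang a c y)) = (\prod_j a j)^-1 * I F.
Proof.
elim: n a c F => [|n IH] a c F a0 cc ctri CF CFt.
  rewrite big_ord0 invr1 mul1r; congr I; apply/funext => y; congr F.
  by apply/rowP => -[].
have cFt : continuous (fun y => F (triang a c y)) by have [] := CFt.
have [E1 _] := int_rec CFt; have [E2 _] := int_rec CF.
rewrite E1 E2 big_ord_recl.
pose c0 := c ord0 0.
pose c' x j y := c (lift ord0 j) (vcons x y : 'rV_(n.+1)).
have tE x y : triang a c (vcons x y : 'rV_(n.+1)) = vcons (a ord0 * x + c0) (triang (fun j => a (lift ord0 j)) (c' x) y).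
  apply/rowP => i; case: (unliftP ord0 i) => [j ->|->].
    by rewrite vconsS mxE vconsS [RHS]mxE.
  by rewrite vcons0 mxE vcons0; congr (_ + _); apply: ctri => i'; rewrite ltn0.
have inner x : I (fun y : 'rV[R]_n => F (triang a c (vcons x y : 'rV_(n.+1)))) =
    (\prod_j a (lift ord0 j))^-1 * I (fun y : 'rV[R]_n => F (vcons (a ord0 * x + c0) y)).
  under [X in I X]funext do rewrite tE.
  apply: (IH _ (c' x) (fun y => F (vcons (a ord0 * x + c0) y))) => //.
  - move=> j y; apply: (@continuous_comp _ _ _ (vcons x) (c (lift ord0 j))); last exact: cc.
    by apply: smap_cont; apply: smap_row; [exact: smap_cst|exact: smap_id].
  - move=> j y y' yy'; apply: ctri => i; case: (unliftP ord0 i) => [k ->|-> _].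
      by rewrite !vconsS => kj; apply: yy'; exact: kj.
    by rewrite !vcons0.
  - exact: Cc_vconsl.
  - have := Cc_vconsl x CFt; congr Cc; by apply/funext => y; rewrite tE.
under eq_Rintegral do rewrite inner.
have [cF [r Fr]] := CF.
pose g x := I (fun y : 'rV[R]_n => F (vcons x y)).
have cg : continuous g by exact: cont_int_vcons.
have g0 x : r < `|x| -> g x = 0 by exact: int0_vcons.
pose g' x := (\prod_j a (lift ord0 j))^-1 * g x.
have cg' : continuous g' by move=> x; apply: cvgM; [exact: cvg_cst|exact: cg].
have g'0 x : r < `|x| -> g' x = 0 by move=> xr; rewrite /g' g0// mulr0.
rewrite -[LHS]/(\int[lebesgue_measure]_x g' (a ord0 * x + c0)).
rewrite (Rint_affine _ (a0 ord0) cg' g'0).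
rewrite invfM -mulrA; congr (_ * _); rewrite /g'.
have /= := @Rint_affine.
move=> _; rewrite RintegralZl//.
exact: R_integrable cg g0.
Qed.

Lemma partial_supp N (f : 'rV[R]_N -> R) (C : set 'rV[R]_N) i : closed C -> (forall x, ~ C x -> f x = 0) ->
  forall x, ~ C x -> partial i f x = 0.
Proof.
move=> cC f0 x Cx.
have -> : partial i f x = partial i (fun=> 0) x.
  apply: derive_eqnear; near=> z; apply: f0; near: z.
  by apply: open_nbhs_nbhs; split => //; exact: closed_openC.
exact: derive_cst.
Unshelve. all: by end_near. Qed.

Lemma partials_supp N (f : 'rV[R]_N -> R) (C : set 'rV[R]_N) w : closed C -> (forall x, ~ C x -> f x = 0) ->
  forall x, ~ C x -> partials w f x = 0.
Proof.
by move=> cC f0; elim: w => [//|i w IH]; exact: partial_supp cC IH.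
Qed.

Lemma closed_cball N (r : R) : closed [set x : 'rV[R]_N | `|x| <= r].
Proof. by apply: compact_closed; [exact: norm_hausdorff|exact: compact_cball]. Qed.

Lemma Cc_partial N (f : 'rV[R]_N -> R) i : smooth setT f -> Cc f -> Cc (partial i f).
Proof.
move=> sf [cf [r fr]]; split; first by move=> x; exact: smooth_cont (smooth_partial i sf) Logic.I.
exists r => x xr; apply: (@partial_supp _ f [set x | `|x| <= r]).
- exact: closed_cball.
- by move=> z /negP; rewrite -ltNge; exact: fr.
- by apply/negP; rewrite -ltNge.
Qed.

Lemma Cc_partials N (f : 'rV[R]_N -> R) w : smooth setT f -> Cc f -> Cc (partials w f).
Proof.
by move=> sf Cf; elim: w => [//|i w IH]; apply: Cc_partial => //; exact: smooth_partials.
Qed.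

Lemma partial_mul N (f g : 'rV[R]_N -> R) i x : smooth setT f -> smooth setT g ->
  partial i (fun x => f x * g x) x = partial i f x * g x + f x * partial i g x.
Proof.
move=> sf sg; have df := smooth_is_derive i sf (x := x) Logic.I; have dg := smooth_is_derive i sg (x := x) Logic.I.
rewrite /partial (_ : (fun x => f x * g x) = f * g)// deriveM//.
  by rewrite addrC; congr (_ + _); exact: mulrC.
all: by [case: df|case: dg].
Qed.

Lemma int_partial_ord0 n (f : 'rV[R]_(1 + n) -> R) : smooth setT f -> Cc f -> I (partial (ord0 : 'I_(n.+1)) f) = 0.
Proof.
move=> sf Cf; have Cp := Cc_partial (ord0 : 'I_(n.+1)) sf Cf.
have [_ ->] := @int_rec R n _ Cp.
rewrite -[RHS](int0 (R := R) n); congr I; apply/funext => y.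
have [cf [r fr]] := Cf.
pose s := Num.max 0 r + 1.
have s0 : 0 < s by rewrite ltr_wpDl// le_max lexx.
have rs : r < s by rewrite /s ltr_pwDr// le_max lexx orbT.
have f0 x : s <= `|x| -> f (vcons x y) = 0.
  move=> sx; apply: fr; rewrite ltNge; apply/negP => /vcons_norm[].
  by rewrite leNgt (lt_le_trans rs sx).
have vE x : vcons 0 y + x *: (basis_vec (ord0 : 'I_(n.+1)) : 'rV[R]_(n.+1)) = vcons x y :> 'rV_(1 + n).
  apply/rowP => i; case: (unliftP (ord0 : 'I_n.+1) i) => [j ->|->].
    rewrite vconsS [LHS]mxE vconsS [X in _ + X]mxE [basis_vec _ _ _]mxE eqxx/=.
    by rewrite mulr0 addr0.
  by rewrite vcons0 [LHS]mxE vcons0 [X in _ + X]mxE [basis_vec _ _ _]mxE !eqxx/= mulr1 add0r.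
apply: (etrans (@Rint_prim (fun x => partial (ord0 : 'I_(n.+1)) f (vcons x y)) (fun x => f (vcons x y)) (- s) s _ _ _ _)).
- lra.
- by apply: cont_vconsr; have [] := Cp.
- move=> x; have := @is_derive_line R 'rV[R]_(1 + n) f (vcons 0 y) (basis_vec (ord0 : 'I_(n.+1))) x (partial (ord0 : 'I_(n.+1)) f (vcons x y)).
  have fE : (fun h => f (vcons 0 y + h *: (basis_vec (ord0 : 'I_(n.+1)) : 'rV[R]_(n.+1)))) = (fun x => f (vcons x y)).
    by apply/funext => h; rewrite vE.
  by rewrite fE vE; apply; exact: smooth_is_derive sf _.
- move=> x; rewrite -ler_norml -ltNge => xs.
  apply: (@partial_supp _ f [set x | `|x| <= r]).
  + exact: closed_cball.
  + by move=> z /negP; rewrite -ltNge; exact: fr.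
  + by move=> /vcons_norm[]; rewrite leNgt (lt_trans rs xs).
- by rewrite !f0 ?subrr// ?normrN ger0_norm// ltW.
Qed.

Lemma int_partial0 N (f : 'rV[R]_N -> R) i : smooth setT f -> Cc f -> I (partial i f) = 0.
Proof.
case: N f i => [f []//|n].
elim: n => [|n IH] f i sf Cf.
  by rewrite (ord1 i); exact: (@int_partial_ord0 0).
case: (unliftP ord0 i) => [j ->|->]; last exact: (@int_partial_ord0 n.+1).
have Cp := Cc_partial (lift ord0 j) sf Cf.
have [-> _] := @int_rec R n.+1 _ Cp.
rewrite -[RHS](_ : \int[lebesgue_measure]_x (fun=> 0 : R) x = 0); last by rewrite /Rintegral integral0.
apply: eq_Rintegral => x _.
pose H (u : 'rV[R]_1) (y : 'rV[R]_n.+1) := f (row_mx u y).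
have sH : smooth setT (fun y : 'rV[R]_n.+1 => f (vcons x y)).
  by apply: (smooth_compT (g := fun y : 'rV[R]_n.+1 => (vcons x y : 'rV[R]_(1 + n.+1))) _ sf); apply: smap_row; [exact: smap_cst|exact: smap_id].
rewrite -[RHS](IH _ j sH (Cc_vconsl x Cf)); congr I; apply/funext => y.
have := jpartialE H j; move=> /(congr1 (fun F => F (vcons x y : 'rV_(1 + n.+1)))).
rewrite row_mxKl row_mxKr => /esym.
rewrite (_ : (fun z : 'rV[R]_(1 + n.+1) => H (lsubmx z) (rsubmx z)) = f); last by apply/funext => z; rewrite /H hsubmxK.
by rewrite (_ : rshift 1 j = lift ord0 j)//; exact/val_inj.
Qed.

Lemma int_by_parts N (f g : 'rV[R]_N -> R) i : smooth setT f -> smooth setT g -> Cc f ->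
  I (fun x => f x * partial i g x) = - I (fun x => partial i f x * g x).
Proof.
move=> sf sg Cf.
have cg : continuous g by move=> x; exact: smooth_cont sg Logic.I.
have cpg : continuous (partial i g) by move=> x; exact: smooth_cont (smooth_partial i sg) Logic.I.
have := int_partial0 i (smooth_mul openT sf sg) (Cc_mulr Cf cg).
rewrite (_ : partial i _ = (fun x => partial i f x * g x + f x * partial i g x)); last first.
  by apply/funext => x; exact: partial_mul.
rewrite intD; [|exact: Cc_mulr (Cc_partial i sf Cf) cg|exact: Cc_mulr Cf cpg].
by move=> /eqP; rewrite addrC addr_eq0 => /eqP.
Qed.

Lemma int_by_parts_word N (f g : 'rV[R]_N -> R) w : smooth setT f -> smooth setT g -> Cc f ->
  I (fun x => f x * partials w g x) = (-1) ^+ size w * I (fun x => partials (rev w) f x * g x).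
Proof.
move=> + sg; elim: w f => [|i w IH] f sf Cf; first by rewrite expr0 mul1r.
rewrite -[partials (i :: w) g]/(partial i (partials w g)) int_by_parts//; last exact: smooth_partials.
rewrite IH; [|exact: smooth_partial|exact: Cc_partial].
by rewrite rev_cons -cats1 partials_cat /= exprS mulN1r mulNr.
Qed.

(** If only [g] has compact support, the integration by parts starts from the right-hand side, with
    the reversed words, and the two signs $(-1)^{|w|}$ cancel. *)
Lemma int_transpose N (L : diffop R N) (f g : 'rV[R]_N -> R) : smooth setT f -> smooth setT g -> Cc f \/ Cc g ->
  I (fun x => f x * diffop_app L g x) = I (fun x => diffop_tr_app L f x * g x).
Proof.
move=> sf sg Cfg.
have ck k : continuous (@coef R N L k) by move=> x; have [] := @coef_smooth _ _ L k [::] x Logic.I.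
have sck k : smooth setT (@coef R N L k) by constructor; exact: coef_smooth.
have cf : continuous f by move=> x; exact: smooth_cont sf Logic.I.
have cg : continuous g by move=> x; exact: smooth_cont sg Logic.I.
have cpw w (h : 'rV[R]_N -> R) : smooth setT h -> continuous (partials w h) by move=> sh; exact: smoothT_cont (smooth_partials w sh).
have scf k : smooth setT (fun x => @coef R N L k x * f x) by apply: (smooth_mul openT (sck k) sf).
rewrite (_ : (fun x => f x * diffop_app L g x) = (fun x => \sum_(k < nterms L) (coef k x * f x) * partials (word k) g x)); last first.
  by apply/funext => x; rewrite mulr_sumr; apply: eq_bigr => k _; rewrite mulrCA mulrA.
rewrite [RHS](_ : _ = I (fun x => \sum_(k < nterms L) ((-1) ^+ size (word k) * (partials (rev (word k)) (fun y => coef k y * f y) x * g x)))); last first.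
  by congr I; apply/funext => x; rewrite mulr_suml; apply: eq_bigr => k _; rewrite mulrA.
case: Cfg => [Cf|Cg].
  rewrite !int_sum; last first.
  - by move=> k; apply: Cc_mulr; [exact: Cc_mull|exact: cpw].
  - by move=> k; apply: Cc_scale; apply: Cc_mulr => //; apply: Cc_partials => //; exact: Cc_mull.
  apply: eq_bigr => k _; rewrite int_by_parts_word//; last exact: Cc_mull.
  by rewrite intZ//; apply: Cc_mulr => //; apply: Cc_partials => //; exact: Cc_mull.
rewrite !int_sum; last first.
- by move=> k; apply: Cc_mull; [move=> x; exact: cont_mul (ck k x) (cf x)|exact: Cc_partials].
- by move=> k; apply: Cc_scale; apply: Cc_mull => //; exact: cpw.
apply: eq_bigr => k _; rewrite intZ; last by apply: Cc_mull => //; exact: cpw.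
have := @int_by_parts_word N g (fun y => coef k y * f y) (rev (word k)) sg (scf k) Cg.
rewrite revK size_rev => E.
rewrite [X in _ * X](_ : _ = I (fun x => g x * partials (rev (word k)) (fun y => coef k y * f y) x)); last first.
  by congr I; apply/funext => x; exact: mulrC.
rewrite E mulrA -exprMn_comm; last exact: commr_refl.
by rewrite mulrNN mulr1 expr1n mul1r; congr I; apply/funext => x; exact: mulrC.
Qed.

(** A remainder of size $Bh^2$ with [B] fixed survives integration and passage to the limit.
    Together with [taylor2] it gives differentiation under the integral sign and of series. *)
Lemma is_derive_quad N (f : 'rV[R]_N -> R) x i (l B : R) :
  (forall h, `|h| <= 1 -> `|f (x + h *: basis_vec i) - f x - h * l| <= B * h ^+ 2) ->
  is_derive x (basis_vec i) f l.
Proof.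
move=> H; apply/is_derive_lineP/derive1P => e e0.
have B0 : 0 <= B by have := H 1; rewrite normr1 expr1n mulr1 => /(_ (lexx _)); exact: le_trans.
have B1 : 0 < B + 1 by rewrite ltr_wpDl.
exists (Num.min 1 (e / (B + 1))); first by rewrite lt_min ltr01 divr_gt0.
move=> h; rewrite lt_min => /andP[h1 h2]; rewrite add0r scale0r addr0.
apply: (le_trans (H h (ltW h1))).
rewrite -(real_normK (num_real h)).
rewrite expr2 mulrA ler_wpM2r//.
rewrite ltr_pdivlMr// in h2; apply: le_trans (ltW h2); rewrite mulrC ler_wpM2l//.
by rewrite lerDl.
Qed.

Lemma jpartialEl p q (K : 'rV[R]_p -> 'rV[R]_q -> R) i :
  (fun z : 'rV[R]_(p + q) => partial i (K^~ (rsubmx z)) (lsubmx z)) =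
  partial (lshift q i) (fun z => K (lsubmx z) (rsubmx z)).
Proof.
apply/funext => z; rewrite /partial /derive.
set F := (X in lim (X @ _)); set F' := (X in _ = lim (X @ _)).
suff -> : F = F' by [].
apply/funext => h; rewrite /F /F' /=; congr (_ *: (K _ _ - _)).
  by apply/rowP => j; rewrite !mxE eqxx/= (eq_lshift q).
apply/rowP => j; rewrite !mxE eqxx/=.
by rewrite (_ : (rshift p j == lshift q i) = false) ?mulr0 ?add0r// eq_rlshift.
Qed.

Lemma jsmooth_partiall p q (K : 'rV[R]_p -> 'rV[R]_q -> R) i : jsmooth K -> jsmooth (fun x y => partial i (K^~ y) x).
Proof. by move=> jK; rewrite /jsmooth (jpartialEl K); exact: smooth_partial. Qed.

Lemma partial_cst0 p q (K : 'rV[R]_p -> 'rV[R]_q -> R) i y : (forall x, K x y = 0) -> forall x, partial i (K^~ y) x = 0.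
Proof.
move=> K0 x; rewrite (_ : K^~ y = fun=> 0); first exact: derive_cst.
by apply/funext.
Qed.

Lemma jsmooth_fixr p q (H : 'rV[R]_p -> 'rV[R]_q -> R) y : jsmooth H -> smooth setT (H^~ y).
Proof. by move=> jH; apply: (jsmoothP jH); [exact: smap_id|exact: smap_cst]. Qed.

Lemma jsmooth_Cc p q (K : 'rV[R]_p -> 'rV[R]_q -> R) r x : jsmooth K -> (forall x y, r < `|y| -> K x y = 0) -> Cc (K x).
Proof.
by move=> jK K0; split; [exact: smoothT_cont (jsmooth_fix x jK)|exists r; exact: K0].
Qed.

Lemma is_derive_int p q (K : 'rV[R]_p -> 'rV[R]_q -> R) (r : R) i x : jsmooth K -> (forall x y, r < `|y| -> K x y = 0) ->
  is_derive x (basis_vec i) (fun x => I (K x)) (I (fun y => partial i (K^~ y) x)).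
Proof.
move=> jK K0.
have jP := jsmooth_partiall i jK.
have jPP := jsmooth_partiall i jP.
have cc := @compact_cball R (p + q) (Num.max (`|x| + 1) r).
have [B B0 HB] := compact_cont_bounded cc (fun z _ => smooth_cont jPP (x := z) Logic.I).
pose s := Num.max 0 r.
have K0s x' y : s < `|y| -> K x' y = 0 by rewrite gt_max => /andP[_]; exact: K0.
have P0s x' y : s < `|y| -> partial i (K^~ y) x' = 0.
  by move=> ys; apply: partial_cst0 => z; exact: K0s.
have CK x' : Cc (K x') by exact: jsmooth_Cc K0s.
have CP : Cc (fun y => partial i (K^~ y) x) by exact: jsmooth_Cc P0s.
apply: (@is_derive_quad _ _ _ _ _ (B * vol q s)) => h h1.
have C1 := Cc_sub (CK (x + h *: basis_vec i)) (CK x).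
have C2 := Cc_scale h CP.
rewrite -intB// -intZ// -intB// mulrAC; apply: int_bound.
- by have [] := Cc_sub C1 C2.
- by rewrite le_max lexx.
- by move=> y ys; rewrite !K0s// P0s// mulr0 !subrr.
- move=> y ys; apply: taylor2; first exact: jsmooth_fixr.
  move=> t th.
  have := HB (row_mx (x + t *: basis_vec i) y); rewrite row_mxKl row_mxKr; apply.
  apply: norm_le_coords; first by rewrite le_max addr_ge0.
  move=> j; rewrite -(splitK j); case: (fintype.split j) => k /=.
    rewrite row_mxEl; apply: (le_trans (coord_le_norm _ _)).
    rewrite le_max; apply/orP; left; apply: (le_trans (ler_normD _ _)); rewrite lerD2l normrZ.
    apply: (@le_trans _ _ `|t|); first by rewrite ler_piMr// norm_basis_vec.
    exact: le_trans h1.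
  rewrite row_mxEr; apply: (le_trans (coord_le_norm _ _)).
  move: ys; rewrite /s !le_max => /orP[y0|->]; last by rewrite orbT.
  by apply/orP; left; apply: (le_trans y0); rewrite addr_ge0.
Qed.

Lemma smooth_int p q (H : 'rV[R]_p -> 'rV[R]_q -> R) (r : R) :
  jsmooth H -> (forall x y, r < `|y| -> H x y = 0) ->
  smooth setT (fun x => I (H x)).
Proof.
move=> jH H0.
pose S (g : 'rV[R]_p -> R) := exists K : 'rV[R]_p -> 'rV[R]_q -> R,
  [/\ jsmooth K, (forall x y, r < `|y| -> K x y = 0) & g = (fun x => I (K x))].
have SH : S (fun x => I (H x)) by exists H.
apply: (@smooth_coind _ _ _ S) => //.
- exact: openT.
- move=> g [K [jK K0 ->]] x _; split.
    by apply: (@int_param_cont _ _ _ r) => //; exact: smoothT_cont jK.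
  by move=> i; case: (is_derive_int i x jK K0).
- move=> g i [K [jK K0 ->]]; exists (fun x => I (fun y => partial i (K^~ y) x)).
    exists (fun x y => partial i (K^~ y) x); split => //; first exact: jsmooth_partiall.
    by move=> x y yr; apply: partial_cst0 => z; exact: K0.
  by move=> x _; rewrite /partial; case: (is_derive_int i x jK K0).
Qed.

Lemma partials_int p q (H : 'rV[R]_p -> 'rV[R]_q -> R) (r : R) w :
  jsmooth H -> (forall x y, r < `|y| -> H x y = 0) ->
  [/\ jsmooth (fun x y => partials w (H^~ y) x), (forall x y, r < `|y| -> partials w (H^~ y) x = 0) &
  forall x, partials w (fun x => I (H x)) x = I (fun y => partials w (H^~ y) x)].
Proof.
move=> jH H0; elim: w => [//|i w [j1 z1 e1]]; split.
- exact: (jsmooth_partiall i j1).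
- by move=> x y yr; apply: (partial_cst0 (K := fun x y => partials w (H^~ y) x)) => z; exact: z1.
- move=> x; rewrite /= (_ : partials w (fun x => I (H x)) = fun x => I (fun y => partials w (H^~ y) x)); last exact/funext.
  by rewrite /partial; case: (is_derive_int i x j1 z1).
Qed.

Lemma tr_app_int N q (L : diffop R N) (H : 'rV[R]_N -> 'rV[R]_q -> R) (r : R) x :
  jsmooth H -> (forall x y, r < `|y| -> H x y = 0) ->
  diffop_tr_app L (fun x => I (H x)) x = I (fun y => diffop_tr_app L (H^~ y) x).
Proof.
move=> jH H0; rewrite /diffop_tr_app.
have CH x' : Cc (H x') by exact: jsmooth_Cc H0.
have P k := @partials_int N q (fun x y => @coef R N L k x * H x y) r (rev (word k)).
have jk k : jsmooth (fun x y => @coef R N L k x * H x y).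
  apply: smooth_mul => //; first exact: openT.
  by apply: (smooth_compT (@smap_lsub _ _ _)); constructor; exact: coef_smooth.
have k0 k x' y : r < `|y| -> @coef R N L k x' * H x' y = 0 by move=> yr; rewrite H0// mulr0.
rewrite int_sum; last first.
  by move=> k; apply: Cc_scale; have [j z _] := P k (jk k) (k0 k); exact: jsmooth_Cc z.
apply: eq_bigr => k _; have [j z e] := P k (jk k) (k0 k).
rewrite intZ; last exact: jsmooth_Cc z.
rewrite -e; congr (_ * partials _ _ _); apply/funext => x'.
by rewrite intZ.
Qed.

End integration2.

(** * Bump functions and cutoffs *)

Section bumps.
Context {R : realType}.
Implicit Types (n N p q : nat).
Local Notation isd t g l := (is_derive (t : R) (1 : R) (g : R -> R) (l : R)).
Notation I := integral_rV.
Notation T := (measurableTypeR R).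

Lemma isd_comp (f g : R -> R) (t l m : R) : isd t g l -> isd (g t) f m -> isd t (fun s => f (g s)) (m * l).
Proof.
by move=> dg df; exact: (is_derive1_comp df dg).
Qed.

(** The powers of $1/t$ make the family of the functions $t^{-n}e^{-1/t}$, extended by 0, closed
    under differentiation up to linear combinations. *)
Definition flat (n : nat) (t : R) : R := if 0 < t then t^-1 ^+ n * expR (- t^-1) else 0.

(** From $s/n\le1+s/n\le e^{s/n}$, raised to the power [n]. *)
Lemma expX_le (n : nat) (s : R) : 0 < s -> s ^+ n <= n%:R ^+ n * expR s.
Proof.
move=> s0; have [->|n0] := posnP n; first by rewrite !expr0 mul1r -expR0 ler_expR ltW.
have nn : (n%:R : R) != 0 by rewrite pnatr_eq0 -lt0n.
have -> : expR s = expR (s / n%:R) ^+ n by rewrite -expRM_natl mulrC divfK.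
rewrite -exprMn; apply: lerXn2r; rewrite ?nnegrE; [exact: ltW|by rewrite mulr_ge0// expR_ge0|].
apply: (@le_trans _ _ (n%:R * (1 + s / n%:R))); first by rewrite mulrDr mulr1 mulrC divfK// lerDr.
by rewrite ler_wpM2l// expR_ge1Dx.
Qed.

Lemma flat_deriv n t : isd t (flat n) (flat n.+2 t - n%:R * flat n.+1 t).
Proof.
have [t0|t0|<-] := ltgtP 0 t; last first.
- apply/derive1P => e e0.
  have f0 m : flat m 0 = 0 by rewrite /flat ltxx.
  rewrite !f0 mulr0 subr0.
  pose A : R := n.+2%:R ^+ n.+2.
  have A0 : 0 < A by rewrite exprn_gt0.
  exists (e / A); first by rewrite divr_gt0.
  move=> h hd; rewrite add0r mulr0 !subr0 /flat; case: ifPn => h0; last by rewrite normr0 mulr_ge0// ltW.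
  have ih0 : 0 < h^-1 by rewrite invr_gt0.
  rewrite ger0_norm; last by rewrite mulr_ge0 ?expR_ge0// exprn_ge0// ltW.
  rewrite (gtr0_norm h0) expRN.
  rewrite (gtr0_norm h0) ltr_pdivlMr// in hd.
  have := expX_le n.+2 ih0; rewrite -/A => H.
  rewrite ler_pdivrMr ?expR_gt0//.
  (* Two powers of [h] are spared, so that [flat n h] is at most $Ah^2$ and has derivative 0 at the
     origin. *)
  have -> : h^-1 ^+ n = h^-1 ^+ n.+2 * h ^+ 2.
    by rewrite -[n.+2]addn2 exprD -mulrA -exprMn mulVf ?expr1n ?mulr1// gt_eqF.
  apply: (@le_trans _ _ (A * expR h^-1 * h ^+ 2)); first by rewrite ler_wpM2r// exprn_ge0// ltW.
  have -> : A * expR h^-1 * h ^+ 2 = (h * A) * h * expR h^-1 by ring.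
  apply: ler_wpM2r; first exact: expR_ge0.
  by apply: ler_wpM2r; exact: ltW.
- have f0 m : flat m t = 0 by rewrite /flat ltNge (ltW t0).
  rewrite !f0 mulr0 subr0; apply/derive1P => e e0.
  exists (- t); first by rewrite oppr_gt0.
  move=> h hd; rewrite mulr0 subr0 f0 subr0 /flat.
  have : t + h < 0 by move: hd; rewrite ltr_norml => /andP[_]; lra.
  by move=> th; rewrite ltNge (ltW th)/= normr0 mulr_ge0// ltW.
- have d1 : isd t (fun t : R => t^-1) (- (t ^- 2)).
    have tn0 : (id t : R) != 0 by exact: lt0r_neq0.
    have E := @deriveV R R id t 1 tn0 (@derivable_id _ _ t 1).
    apply: DeriveDef; first exact: (@derivableV R R id t 1 tn0 (@derivable_id _ _ t 1)).
    by rewrite E derive_id /GRing.scale/= mulr1.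
  have d2 : isd t (fun t : R => t^-1 ^+ n) (n%:R * t^-1 ^+ n.-1 * (- (t ^- 2))).
    apply: (isd_comp (f := fun s => s ^+ n) d1).
    have E : 'D_1 (fun x : R => x ^+ n) t^-1 = n%:R * t^-1 ^+ n.-1.
      by rewrite exp_derive /GRing.scale/= mulr1.
    by rewrite -E; apply: DeriveDef => //; exact: exprn_derivable.
  have d3 : isd t (fun t : R => expR (- t^-1)) (expR (- t^-1) * (t ^- 2)).
    apply: (isd_comp (f := expR) (g := fun t => - t^-1)).
      by have := is_deriveN d1; rewrite opprK.
  have d4 : isd t (fun t => t^-1 ^+ n * expR (- t^-1)) (flat n.+2 t - n%:R * flat n.+1 t).
    apply: (is_derive_eq (is_deriveM d2 d3)).
    rewrite /flat t0 /GRing.scale /=.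
    rewrite -!exprVn; set s := t^-1; set E := expR _.
    by case: n d2 => [|n] _; rewrite /= !exprS ?expr0; ring.
  apply/derive1P => e e0; move/derive1P/(_ e e0): d4 => [d d0 H].
  exists (Num.min d t); first by rewrite lt_min d0.
  move=> h; rewrite lt_min => /andP[hd ht].
  have th : 0 < t + h by move: ht; rewrite ltr_norml => /andP[]; lra.
  by move: (H h hd); rewrite /flat t0 th.
Qed.

Lemma smooth_flat n : smooth setT (fun x : 'rV[R]_1 => flat n (x 0 0)).
Proof.
pose S (f : 'rV[R]_1 -> R) := exists m (c : 'I_m -> R) (k : 'I_m -> nat), f = fun x => \sum_i c i * flat (k i) (x 0 0).
have SF : S (fun x => flat n (x 0 0)).
  by exists 1%N, (fun=> 1), (fun=> n); apply/funext => x; rewrite big_ord1 mul1r.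
have dS m (c : 'I_m -> R) (k : 'I_m -> nat) (x : 'rV[R]_1) i : is_derive x (basis_vec i) (fun x : 'rV[R]_1 => \sum_i c i * flat (k i) (x 0 0))
    (\sum_i c i * (flat (k i).+2 (x 0 0) - (k i)%:R * flat (k i).+1 (x 0 0))).
  apply/is_derive_lineP.
  have -> : (fun h => \sum_i0 c i0 * flat (k i0) ((x + h *: basis_vec i) 0 0)) = \sum_i0 (fun h => c i0 * flat (k i0) (x 0 0 + h)).
    apply/funext => h; rewrite fct_sumE; apply: eq_bigr => j _.
    by rewrite (ord1 i) !mxE !eqxx mulr1.
  apply: is_derive_sum => j.
  have /derive1P H := flat_deriv (k j) (x 0 0).
  have D : isd 0 (fun h => flat (k j) (x 0 0 + h)) (flat (k j).+2 (x 0 0) - (k j)%:R * flat (k j).+1 (x 0 0)).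
    apply/derive1P => e /H[d d0 Hd]; exists d => // h /Hd.
    by rewrite add0r addr0.
  exact: (is_deriveZ (c j) D).
apply: (@smooth_coind _ _ _ S) => //.
- exact: openT.
- move=> f [m [c [k ->]]] x _; split; last by move=> i; case: (dS m c k x i).
  apply: cont_sum => j; apply: cont_mul; first exact: cst_continuous.
  apply: (@continuous_comp _ _ _ (fun x : 'rV[R]_1 => x 0 0) (flat (k j))); first exact: coord_cont.
  exact: is_derive_cont (flat_deriv (k j) _).
- move=> f i [m [c [k ->]]].
  exists (fun x => \sum_i c i * (flat (k i).+2 (x 0 0) - (k i)%:R * flat (k i).+1 (x 0 0))).
    exists (m + m)%N, (fun j => match fintype.split j with inl j => c j | inr j => - (c j * (k j)%:R) end),
      (fun j => match fintype.split j with inl j => (k j).+2 | inr j => (k j).+1 end).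
    apply/funext => x; rewrite big_split_ord/= -big_split/=; apply: eq_bigr => j _.
    by rewrite (unsplitK (inl j)) (unsplitK (inr j)); ring.
  by move=> x _; rewrite /partial; case: (dS m c k x i).
Qed.

Lemma smooth_flat_comp N (g : 'rV[R]_N -> R) : smooth setT g -> smooth setT (fun x => flat 0 (g x)).
Proof.
move=> sg; have sm : smap (fun x : 'rV[R]_N => const_mx (g x) : 'rV[R]_1).
  by move=> i; apply: smooth_eq sg => [|x _]; [exact: openT|rewrite mxE].
by apply: smooth_eq (smooth_compT sm (smooth_flat 0)) => [|x _]; [exact: openT|rewrite mxE].
Qed.

(** The inner difference is nonpositive for $t\le0$ and equals [flat 0 1] for $t\ge1$; the outer
    [flat 0] kills the first range smoothly and the quotient normalizes the second. *)
Definition sstep (t : R) : R := flat 0 (flat 0 1 - flat 0 (1 - t)) / flat 0 (flat 0 1).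

Lemma flat0_gt0 t : 0 < t -> 0 < flat 0 t.
Proof. by move=> t0; rewrite /flat t0 expr0 mul1r expR_gt0. Qed.

Lemma flat0_le0 t : t <= 0 -> flat 0 t = 0.
Proof. by move=> t0; rewrite /flat ltNge t0. Qed.

Lemma flat0_ge0 t : 0 <= flat 0 t.
Proof. by have [t0|t0] := leP t 0; [rewrite flat0_le0|rewrite ltW// flat0_gt0]. Qed.

Lemma flat0_mono s t : s <= t -> flat 0 s <= flat 0 t.
Proof.
move=> st; have [s0|s0] := leP s 0; first by rewrite flat0_le0// flat0_ge0.
have t0 := lt_le_trans s0 st.
by rewrite /flat s0 t0 !expr0 !mul1r ler_expR lerN2 lef_pV2.
Qed.

Lemma sstep1 t : 1 <= t -> sstep t = 1.
Proof.
move=> t1; rewrite /sstep (@flat0_le0 (1 - t)) ?subr0 ?divff//; last by rewrite subr_le0.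
by rewrite gt_eqF// flat0_gt0// flat0_gt0.
Qed.

Lemma sstep0 t : t <= 0 -> sstep t = 0.
Proof.
move=> t0; rewrite /sstep (@flat0_le0 (_ - _)) ?mul0r// subr_le0.
by apply: flat0_mono; lra.
Qed.

Lemma sstep_ge0 t : 0 <= sstep t.
Proof. by rewrite /sstep divr_ge0// flat0_ge0. Qed.

Lemma sstep_le1 t : sstep t <= 1.
Proof.
rewrite /sstep ler_pdivrMr ?mul1r; last by rewrite flat0_gt0// flat0_gt0.
by apply: flat0_mono; rewrite lerBlDr lerDl flat0_ge0.
Qed.

Lemma smooth_sstep_comp N (g : 'rV[R]_N -> R) : smooth setT g -> smooth setT (fun x => sstep (g x)).
Proof.
move=> sg; apply: smooth_mul; [exact: openT| |apply: smooth_cst; exact: openT].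
apply: smooth_flat_comp; apply: smooth_sub; [exact: openT|apply: smooth_cst; exact: openT|].
apply: smooth_flat_comp; apply: smooth_sub => //; [exact: openT|apply: smooth_cst; exact: openT].
Qed.

(** The norm is the maximum of the coordinates, so a product of steps in one variable is adapted to
    its balls: $2-u^2$ is at least 1 for $|u|\le1$ and negative for $|u|\ge2$. *)
Definition cube_bump N (a : 'rV[R]_N) (r : R) (x : 'rV[R]_N) : R :=
  \prod_i sstep (2 - ((x 0 i - a 0 i) / r) ^+ 2).

Lemma smooth_cube_bump N (a : 'rV[R]_N) r : smooth setT (cube_bump a r).
Proof.
apply: smooth_prod; first exact: openT.
move=> i; apply: smooth_sstep_comp; apply: smooth_sub; [exact: openT|apply: smooth_cst; exact: openT|].
apply: smooth_exp; first exact: openT.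
apply: smooth_mul; [exact: openT| |apply: smooth_cst; exact: openT].
by apply: smooth_sub; [exact: openT|apply: smooth_coord; exact: openT|apply: smooth_cst; exact: openT].
Qed.

Lemma cube_bump1 N (a x : 'rV[R]_N) r : 0 < r -> `|x - a| <= r -> cube_bump a r x = 1.
Proof.
move=> r0 xa; rewrite /cube_bump big1// => i _; apply: sstep1.
suff : ((x 0 i - a 0 i) / r) ^+ 2 <= 1 by lra.
rewrite -(real_normK (num_real _)) expr_le1//.
rewrite normrM normfV (gtr0_norm r0) ler_pdivrMr// mul1r.
by have := le_trans (coord_le_norm (x - a) i) xa; rewrite !mxE.
Qed.

Lemma cube_bump0 N (a x : 'rV[R]_N) r : 0 < r -> ~ (`|x - a| <= 2 * r) -> cube_bump a r x = 0.
Proof.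
move=> r0 xa.
have [i xi] : exists i, 2 * r < `|x 0 i - a 0 i|.
  apply/not_existsP => H; apply: xa; apply: norm_le_coords; first by rewrite mulr_ge0// ltW.
  by move=> i; rewrite !mxE leNgt; apply/negP => Hi; exact: (H i).
rewrite /cube_bump (bigD1 i)//= sstep0 ?mul0r//.
have : 2 < `|(x 0 i - a 0 i) / r|.
  by rewrite normrM normfV (gtr0_norm r0) ltr_pdivlMr.
rewrite -(real_normK (num_real ((x 0 i - a 0 i) / r))); move: `|_ / r| => u u2; nra.
Qed.

Lemma cube_bump_itv N (a x : 'rV[R]_N) r : 0 <= cube_bump a r x <= 1.
Proof.
rewrite /cube_bump; elim/big_ind: _ => [|u v /andP[u0 u1] /andP[v0 v1]|i _].
- by rewrite ler01 lexx.
- by rewrite mulr_ge0//= mulr_ile1.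
- by rewrite sstep_ge0 sstep_le1.
Qed.

Lemma compact_closed_ball N (a : 'rV[R]_N) (r : R) : compact [set x | `|x - a| <= r].
Proof.
apply: (@subclosed_compact _ _ [set x : 'rV[R]_N | `|x| <= `|a| + r]).
- rewrite (_ : [set x | _] = (fun x => `|x - a|) @^-1` [set y | y <= r])//.
  apply: closed_comp => [x _|]; last exact: closed_le.
  apply: (@continuous_comp _ _ _ (fun x : 'rV[R]_N => x - a) Num.norm); last exact: norm_continuous.
  by apply: (@smap_cont _ _ _ (fun x : 'rV[R]_N => x - a)); apply: smap_add; [exact: smap_id|exact: smap_cst].
- exact: compact_cball.
- by move=> x /= xa; rewrite -(subrK a x) addrC; apply: (le_trans (ler_normD _ _)); rewrite lerD2l.
Qed.

Lemma compact_bigcup_seq (X : topologicalType) (Z : eqType) (s : seq Z) (F : Z -> set X) :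
  (forall a, a \in s -> compact (F a)) -> compact (\bigcup_(a in [set` s]) F a).
Proof.
elim: s => [|a s IH] cF.
  rewrite (_ : \bigcup_(_ in _) _ = set0); first exact: compact0.
  by apply/seteqP; split => x //= -[].
rewrite (_ : \bigcup_(_ in _) _ = F a `|` \bigcup_(b in [set` s]) F b).
  apply: compactU; first by apply: cF; rewrite mem_head.
  by apply: IH => b bs; apply: cF; rewrite inE bs orbT.
apply/seteqP; split => x.
  by move=> [b /=]; rewrite inE => /orP[/eqP ->|bs] Fb; [left|right; exists b].
by move=> [Fa|[b /= bs Fb]]; [exists a; rewrite //= mem_head|exists b; rewrite //= inE bs orbT].
Qed.

Lemma compact_ball_cover N (K : set 'rV[R]_N) (rad : 'rV[R]_N -> R) : compact K -> (forall x, K x -> 0 < rad x) ->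
  exists s : seq 'rV[R]_N, (forall x, x \in s -> K x) /\ forall x, K x -> exists2 a, a \in s & `|x - a| < rad a.
Proof.
rewrite compact_cover => cK r0.
have [||D DK KD] := cK _ K (fun a => ball a (rad a)).
- by move=> a Ka; apply: ball_open; exact: r0.
- by move=> x Kx; exists x => //; apply: ballxx; exact: r0.
exists (finmap.enum_fset D); split.
  by move=> x xD; apply/set_mem; apply: DK.
move=> x /KD[a aD]; rewrite -ball_normE/= => xa; exists a => //.
by rewrite distrC.
Qed.

Lemma open_ball_sub N (Om : set 'rV[R]_N) x : open Om -> Om x -> exists2 r, 0 < r & forall y, `|y - x| <= 2 * r -> Om y.
Proof.
move=> oO Ox; have /nbhs_normP[d d0 Hd] : nbhs x Om by exact: open_nbhs_nbhs.
exists (d / 4); first by rewrite divr_gt0.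
by move=> y yx; apply: Hd; apply: (le_lt_trans yx); lra.
Qed.

(** With bumps $b_a$ on a finite cover, $1-\prod_a(1-b_a)$ equals 1 where some $b_a$ does and 0
    where all vanish; no division by a sum of bumps is involved. *)
Lemma cutoff_exists N (K Om : set 'rV[R]_N) : compact K -> open Om -> K `<=` Om ->
  exists chi : 'rV[R]_N -> R, [/\ smooth setT chi,
    exists C, [/\ compact C, C `<=` Om & forall x, ~ C x -> chi x = 0],
    exists V, [/\ open V, K `<=` V & forall x, V x -> chi x = 1] & forall x, 0 <= chi x <= 1].
Proof.
move=> cK oO KO.
have H x : exists r, K x -> 0 < r /\ forall y, `|y - x| <= 2 * r -> Om y.
  have [Kx|nKx] := pselect (K x); last by exists 0.
  by have [r r0 Hr] := open_ball_sub oO (KO _ Kx); exists r.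
have [rad Hrad] := choice H.
have [s [sK sc]] := compact_ball_cover cK (fun x Kx => (Hrad x Kx).1).
exists (fun x => 1 - \prod_(a <- s) (1 - cube_bump a (rad a) x)); split.
- apply: smooth_sub; [exact: openT|apply: smooth_cst; exact: openT|].
  apply: smooth_prod; first exact: openT.
  by move=> a; apply: smooth_sub; [exact: openT|apply: smooth_cst; exact: openT|exact: smooth_cube_bump].
- exists (\bigcup_(a in [set` s]) [set x | `|x - a| <= 2 * rad a]); split.
  + by apply: compact_bigcup_seq => a _; exact: compact_closed_ball.
  + by move=> x [a /= /sK Ka]; exact: (Hrad a Ka).2.
  + move=> x nx; rewrite big_seq big1 ?subrr// => a as_.
    rewrite cube_bump0 ?subr0//; first exact: (Hrad a (sK a as_)).1.
    by move=> xa; apply: nx; exists a.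
- exists (\bigcup_(a in [set` s]) ball a (rad a)); split.
  + by apply: bigcup_open => a /= /sK Ka; apply: ball_open; exact: (Hrad a Ka).1.
  + by move=> x /sc[a as_ xa]; exists a => //; rewrite -ball_normE/= distrC.
  + move=> x [a /= as_]; rewrite -ball_normE/= distrC => xa.
    rewrite (big_rem a)//= cube_bump1 ?subrr ?mul0r ?subr0//; first exact: (Hrad a (sK a as_)).1.
    exact: ltW.
- move=> x; suff /andP[h1 h2] : 0 <= \prod_(a <- s) (1 - cube_bump a (rad a) x) <= 1.
    by apply/andP; split; lra.
  elim/big_ind: _ => [|u v /andP[u0 u1] /andP[v0 v1]|a _].
  + by rewrite ler01 lexx.
  + by rewrite mulr_ge0//= mulr_ile1.
  + have /andP[h1 h2] := cube_bump_itv a x (rad a); by apply/andP; split; lra.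
Qed.

Definition boxa n (a : 'I_n -> R) (r : R) : set (n.-tuple T) := [set t | forall i, `|tnth t i - a i| <= r].

Lemma measurable_itva (a r : R) : measurable ([set y : T | `|y - a| <= r]).
Proof.
rewrite (_ : [set y : R | `|y - a| <= r] = `[a - r, a + r]%classic); first exact: measurable_itv.
by apply/seteqP; split => y; rewrite /= in_itv/= ler_distl.
Qed.

Lemma measurable_boxa n a r : measurable (@boxa n a r).
Proof.
rewrite (_ : boxa a r = \bigcap_(i in [set: 'I_n]) ((fun t : n.-tuple T => tnth t i) @^-1` [set y | `|y - a i| <= r])).
  apply: fin_bigcap_measurable => // i _; rewrite -[X in measurable X]setTI; apply: measurable_tnth => //.
  exact: measurable_itva.
apply/seteqP; split => [x bx i _|x bx i]; [exact: bx|exact: (bx i Logic.I)].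
Qed.

Lemma boxa_gt0 n a r : 0 < r -> (0 < lebesgue_tuple n (@boxa n a r))%E.
Proof.
move=> r0; elim: n a => [|n IH] a.
  have -> : lebesgue_tuple 0 (boxa a r) = 1%E by rewrite /= diracE mem_set// => -[].
  by rewrite lte_fin ltr01.
rewrite /= /lebesgue_cons /pushforward.
rewrite (_ : _ @^-1` _ = [set y : T | `|y - a ord0| <= r] `*` boxa (fun i => a (lift ord0 i)) r).
  rewrite product_measure1E.
  - apply: mule_gt0; last exact: IH.
    rewrite (_ : [set y : R | `|y - a ord0| <= r] = [set` `[a ord0 - r, a ord0 + r]]).
      have H : (0 < lebesgue_measure (`[(a ord0 - r)%R, (a ord0 + r)%R]%classic : set R))%E.
        rewrite lebesgue_measure_itv/= lte_fin ifT; last by lra.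
        by rewrite -EFinB lte_fin; lra.
      exact: H.
    by apply/seteqP; split => y; rewrite /= in_itv/= ler_distl.
  - exact: measurable_itva.
  - exact: measurable_boxa.
apply/seteqP; split => -[x t] /=.
  move=> H; split; first by have := H ord0; rewrite tnth0.
  by move=> i; have := H (lift ord0 i); rewrite tnthS.
move=> [xr tr] i; case: (unliftP ord0 i) => [j ->|->]; last by rewrite tnth0.
by rewrite tnthS; exact: tr.
Qed.

Lemma int_gt0 N (f : 'rV[R]_N -> R) (a : 'rV[R]_N) (c r : R) : Cc f -> (forall x, 0 <= f x) -> 0 < r -> 0 < c ->
  (forall x, `|x - a| <= r -> c <= f x) -> 0 < I f.
Proof.
move=> Cf f0 r0 c0 fc.
pose B := boxa (fun i => a 0 i) r.
have mB : measurable B by exact: measurable_boxa.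
have iF := Cc_integrable Cf.
have Bt t : B t <-> `|tovec t - a| <= r.
  split=> [H|H i]; first by apply: norm_le_coords; [exact: ltW|move=> i; rewrite !mxE; exact: H].
  by have := le_trans (coord_le_norm _ i) H; rewrite !mxE.
have Blty : (lebesgue_tuple N B < +oo)%E.
  apply: (@le_lt_trans _ _ (lebesgue_tuple N (boxt (`|a| + r)))); last exact: boxt_lty.
  apply: le_measure; rewrite ?inE//; first exact: measurable_boxt.
  move=> t /Bt H; apply/tovec_box; first by rewrite addr_ge0// ltW.
  by rewrite -(subrK a (tovec t)) addrC; apply: (le_trans (ler_normD _ _)); rewrite lerD2l.
apply: (@lt_le_trans _ _ (c * fine (lebesgue_tuple N B))).
  by rewrite mulr_gt0// fine_gt0// Blty boxa_gt0.
rewrite -Rintegral_cst// Rintegral_mkcond; apply: le_Rintegral => //.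
  rewrite (_ : _ \o _ = (EFin \o cst c) \_ B).
    apply: (integrable_mkcond (EFin \o cst c) mB).1.
    apply: measurable_bounded_integrable => //.
    by exists `|c|; split; [exact: num_real|move=> M BM x _; rewrite /= ltW].
  by apply/funext => t; rewrite /= !patchE; case: ifP.
move=> t _; rewrite patchE; case: ifPn => [/set_mem/Bt H|_]; [exact: fc|exact: f0].
Qed.

Lemma testP N (Om : set 'rV[R]_N) phi : test Om phi <->
  (smooth setT phi /\ exists C : set 'rV[R]_N, [/\ compact C, C `<=` Om & forall x, ~ C x -> phi x = 0]).
Proof. by split=> -[]; [move=> ? ?; split|move=> []]. Qed.

Lemma test_smooth N (Om : set 'rV[R]_N) phi : test Om phi -> smooth setT phi.
Proof. by move=> /testP[]. Qed.

Lemma test_Cc N (Om : set 'rV[R]_N) phi : test Om phi -> Cc phi.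
Proof. by move=> /testP[sp [C [cC _ p0]]]; apply: (Cc_compact cC) => //; exact: smoothT_cont. Qed.

Lemma test_mul N (Om : set 'rV[R]_N) f phi : smooth setT f -> test Om phi -> test Om (fun x => f x * phi x).
Proof.
move=> sf /testP[sp [C [cC CO p0]]]; apply/testP; split; first exact: smooth_mul openT sf sp.
by exists C; split => // x /p0 ->; rewrite mulr0.
Qed.

Lemma test_mulr N (Om : set 'rV[R]_N) f phi : test Om phi -> smooth setT f -> test Om (fun x => phi x * f x).
Proof.
move=> tp sf; have := test_mul sf tp; congr test; apply/funext => x; exact: mulrC.
Qed.

Lemma test_scale N (Om : set 'rV[R]_N) c phi : test Om phi -> test Om (fun x => c * phi x).
Proof. by apply: test_mul; apply: smooth_cst; exact: openT. Qed.

Lemma test_add N (Om : set 'rV[R]_N) phi psi : test Om phi -> test Om psi -> test Om (fun x => phi x + psi x).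
Proof.
move=> /testP[sp [C [cC CO p0]]] /testP[sq [D [cD DO q0]]]; apply/testP; split; first exact: smooth_add openT sp sq.
exists (C `|` D); split; first exact: compactU.
  by move=> x [/CO|/DO].
by move=> x /not_orP[/p0 -> /q0 ->]; rewrite addr0.
Qed.

Lemma test_sub N (Om : set 'rV[R]_N) phi psi : test Om phi -> test Om psi -> test Om (fun x => phi x - psi x).
Proof.
move=> tp tq; have := test_add tp (test_scale (-1) tq); congr test.
by apply/funext => x; rewrite mulN1r.
Qed.

Lemma test0 N (Om : set 'rV[R]_N) : test Om (fun=> 0 : R).
Proof.
apply/testP; split; first by apply: smooth_cst; exact: openT.
by exists set0; split => //; exact: compact0.
Qed.

Lemma test_subset N (Om Om' : set 'rV[R]_N) phi : Om `<=` Om' -> test Om phi -> test Om' phi.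
Proof.
move=> OO /testP[sp [C [cC CO p0]]]; apply/testP; split => //; exists C; split => //.
exact: subset_trans OO.
Qed.

Lemma compact_closedR N (C : set 'rV[R]_N) : compact C -> closed C.
Proof. by apply: compact_closed; exact: norm_hausdorff. Qed.

Lemma test_partials N (Om : set 'rV[R]_N) phi w : test Om phi -> test Om (partials w phi).
Proof.
move=> /testP[sp [C [cC CO p0]]]; apply/testP; split; first exact: smooth_partials.
by exists C; split => //; apply: partials_supp => //; exact: compact_closedR.
Qed.

Lemma test_sum N (Om : set 'rV[R]_N) n (f : 'I_n -> 'rV[R]_N -> R) : (forall k, test Om (f k)) ->
  test Om (fun x => \sum_k f k x).
Proof.
elim: n f => [|n IH] f tf.
  by have := test0 Om; congr test; apply/funext => x; rewrite big_ord0.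
have := test_add (IH (fun k => f (widen_ord (leqnSn n) k)) (fun k => tf _)) (tf ord_max).
by congr test; apply/funext => x; rewrite big_ord_recr.
Qed.

Lemma test_tr_app N (Om : set 'rV[R]_N) (L : diffop R N) phi : test Om phi -> test Om (diffop_tr_app L phi).
Proof.
move=> tp; apply: test_sum => k; apply: test_scale; apply: test_partials; apply: test_mul => //.
by constructor; exact: coef_smooth.
Qed.

Lemma test_app N (Om : set 'rV[R]_N) (L : diffop R N) phi : test Om phi -> test Om (diffop_app L phi).
Proof.
move=> tp; apply: test_sum => k; apply: test_mul; last exact: test_partials.
by constructor; exact: coef_smooth.
Qed.

Lemma fundamental_lemma N (Om : set 'rV[R]_N) (g : 'rV[R]_N -> R) : open Om ->
  (forall x, Om x -> {for x, continuous g}) ->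
  (forall phi, test Om phi -> I (fun x => g x * phi x) = 0) ->
  forall x, Om x -> g x = 0.
Proof.
move=> oO cg Hg.
have key (h : 'rV[R]_N -> R) : (forall x, Om x -> {for x, continuous h}) ->
  (forall phi, test Om phi -> I (fun x => h x * phi x) = 0) -> forall x, Om x -> ~ (0 < h x).
  move=> ch Hh x Ox hx.
  have hx2 : 0 < h x / 2 by rewrite divr_gt0.
  have [d d0 Hd] := (contP _ _).1 (ch _ Ox) _ hx2.
  have [r r0 Hr] := open_ball_sub oO Ox.
  pose e := Num.min r (d / 4).
  have e0 : 0 < e by rewrite lt_min r0 divr_gt0.
  have hpos y : `|y - x| <= 2 * e -> h x / 2 <= h y.
    move=> yx; have : `|y - x| < d.
      by apply: (le_lt_trans yx); have : e <= d / 4 by [rewrite ge_min lexx orbT]; lra.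
    by move=> /Hd; rewrite ltr_norml => /andP[]; lra.
  have inO y : `|y - x| <= 2 * e -> Om y.
    by move=> yx; apply: Hr; apply: (le_trans yx); rewrite ler_wpM2l// ge_min lexx.
  have tb : test Om (cube_bump x e).
    split; first by case: (smooth_cube_bump x e).
    exists [set y | `|y - x| <= 2 * e]; split => //; first exact: compact_closed_ball.
    by move=> y ny; exact: cube_bump0.
  have supp y : ~ (`|y - x| <= 2 * e) -> h y * cube_bump x e y = 0 by move=> ny; rewrite cube_bump0// mulr0.
  have := Hh _ tb; apply/eqP; rewrite gt_eqF//.
  apply: (@int_gt0 _ _ x (h x / 2) e) => //.
  - apply: (@Cc_compact _ N _ [set y | `|y - x| <= 2 * e]); [exact: compact_closed_ball| |exact: supp].
    move=> y.
    have [yO|yO] := pselect (Om y).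
      by apply: cont_mul; [exact: ch|exact: smoothT_cont (smooth_cube_bump x e) y].
    (* Outside [Om] nothing is known about [h], but there the bump vanishes in a whole
       neighbourhood. *)
    have E : \forall z \near y, 0 = h z * cube_bump x e z.
      near=> z; rewrite supp//; near: z; apply: open_nbhs_nbhs; split; last by move=> /inO.
      by apply: closed_openC; apply: compact_closed; [exact: norm_hausdorff|exact: compact_closed_ball].
    by apply: (cont_eqnear E); exact: cst_continuous.
  - move=> y; have [yx|/negP yx] := boolP (`|y - x| <= 2 * e); last by rewrite supp.
    have /andP[b0 _] := cube_bump_itv x y e.
    by rewrite mulr_ge0// (le_trans _ (hpos _ yx))// ltW.
  - move=> y yx; rewrite cube_bump1// mulr1; apply: hpos; apply: (le_trans yx).
    by rewrite ler_peMl ?ltW// ltr1n.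
move=> x Ox; apply/eqP; rewrite eq_le !leNgt; apply/andP; split; apply/negP; first exact: key.
move=> gx; apply: (key (fun x => - g x) _ _ x Ox).
- by move=> y Oy; exact: (cvgN (cg y Oy)).
- move=> phi tphi; rewrite (_ : (fun x => - g x * phi x) = (fun x => g x * - phi x)); last by apply/funext => y; rewrite mulrN mulNr.
  apply: Hg; have := test_scale (-1) tphi; congr test.
  by apply/funext => y; rewrite mulN1r.
- by rewrite oppr_gt0.
Unshelve. all: by end_near. Qed.

End bumps.

(** * Left-invariant fields and the Lie bracket *)

Section lie_theory.
Context {R : realType} {N : nat}.
Variable G : carnot_group R N.
Local Notation E := 'rV[R]_N.
Local Notation isd t g l := (is_derive (t : R) (1 : R) (g : R -> R) (l : R)).
Local Notation "x ** y" := (Defs.mul G x y) (at level 40, left associativity).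
Implicit Types (v w x y u : E) (F H : E -> R).

Lemma isd_unique (g : R -> R) (t l l' : R) : isd t g l -> isd t g l' -> l = l'.
Proof. by move=> [_ <-] [_ <-]. Qed.

Lemma mulg0 x : x ** 0 = x.
Proof. by have := mul_exp G 1 0 x; rewrite scale1r scale0r addr0 scale1r. Qed.

Lemma mul0g x : 0 ** x = x.
Proof. exact: mul_id_l. Qed.

Lemma mulgN x : x ** - x = 0.
Proof. by have := mul_exp G 1 (-1) x; rewrite scale1r scaleN1r subrr scale0r. Qed.

Lemma mulNg x : - x ** x = 0.
Proof. by have := mul_exp G (-1) 1 x; rewrite scale1r scaleN1r addNr scale0r. Qed.

Lemma invgE x : Defs.inv G x = - x.
Proof. by rewrite -[LHS]mulg0 -(mulgN x) (mul_assoc G) (mul_inv_l G) mul0g. Qed.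

Lemma mulgA x y z : x ** (y ** z) = x ** y ** z.
Proof. exact: mul_assoc. Qed.

Lemma mulKg x y : - x ** (x ** y) = y.
Proof. by rewrite mulgA mulNg mul0g. Qed.

Lemma mulVKg x y : x ** (- x ** y) = y.
Proof. by rewrite mulgA mulgN mul0g. Qed.

Lemma smap_mul p (f g : 'rV[R]_p -> E) : smap f -> smap g -> smap (fun t : 'rV[R]_p => f t ** g t).
Proof.
move=> sf sg i; have s : jsmooth (fun x y => (x ** y) 0 i) by constructor; exact: mul_smooth.
exact: (jsmoothP s sf sg).
Qed.

(** Written with partial derivatives, so that linearity in the direction is plain algebra; it is the
    directional derivative for smooth functions ([Df_derive]). The lock keeps unification from
    unfolding it. *)
Definition Df : E -> (E -> R) -> E -> R := locked (fun v F x => \sum_i partial i F x * v 0 i).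

Lemma DfE v F x : Df v F x = \sum_i partial i F x * v 0 i.
Proof. by rewrite /Df -lock. Qed.

Lemma Df_isd v F x : smooth setT F -> isd 0 (fun h => F (x + h *: v)) (Df v F x).
Proof. by move=> sF; rewrite DfE; apply: (is_derive_lineP _ _ _ _).1; exact: smooth_dir openT sF Logic.I. Qed.

Lemma Df_derive v F x : smooth setT F -> 'D_v F x = Df v F x.
Proof. by move=> sF; rewrite DfE; have [_] := smooth_dir v openT sF (x := x) Logic.I. Qed.

Lemma Df_linv (a b : R) v w F x : Df (a *: v + b *: w) F x = a * Df v F x + b * Df w F x.
Proof.
rewrite !DfE !mulr_sumr -big_split/=; apply: eq_bigr => i _; rewrite !mxE.
by move: (partial i F x) => P; ring.
Qed.

Lemma partial_lin i (a b : R) F H x : smooth setT F -> smooth setT H ->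
  partial i (fun y => a * F y + b * H y) x = a * partial i F x + b * partial i H x.
Proof.
move=> sF sH; have dF := smooth_is_derive i sF (x := x) Logic.I; have dH := smooth_is_derive i sH (x := x) Logic.I.
by have [_] := is_deriveD (is_deriveZ a dF) (is_deriveZ b dH).
Qed.

Lemma Df_scaleF (a : R) v F x : smooth setT F -> Df v (fun y => a * F y) x = a * Df v F x.
Proof.
move=> sF; rewrite !DfE mulr_sumr; apply: eq_bigr => i _; rewrite mulrA; congr (_ * _).
by have [_] := is_deriveZ a (smooth_is_derive i sF (x := x) Logic.I).
Qed.

Lemma Df_linF (a b : R) v F H x : smooth setT F -> smooth setT H ->
  Df v (fun y => a * F y + b * H y) x = a * Df v F x + b * Df v H x.
Proof.
move=> sF sH; rewrite !DfE !mulr_sumr -big_split/=; apply: eq_bigr => i _; rewrite partial_lin//.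
by move: (partial i F x) (partial i H x) => P Q; ring.
Qed.

(** The left-invariant field of [v] as a derivation of functions; in this form left invariance is
    associativity ([Lf_trans]) and brackets are commutators ([Lf_comm]). *)
Definition Lf v F x : R := Df v (fun y => F (x ** y)) 0.

Lemma smooth_trans F x : smooth setT F -> smooth setT (fun y => F (x ** y)).
Proof. by move=> sF; apply: smooth_compT sF; apply: smap_mul; [exact: smap_cst|exact: smap_id]. Qed.

Lemma jsmooth_trans F : smooth setT F -> jsmooth (fun x y => F (x ** y)).
Proof. by move=> sF; apply: smooth_compT sF; apply: smap_mul; [exact: smap_lsub|exact: smap_rsub]. Qed.

Lemma smooth_Lf v F : smooth setT F -> smooth setT (Lf v F).
Proof.
move=> sF; rewrite (_ : Lf v F = fun x => \sum_i partial i (fun y => F (x ** y)) 0 * v 0 i); last by apply/funext => x; rewrite /Lf DfE.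
apply: smooth_sum; first exact: openT.
move=> i; apply: smooth_mul; [exact: openT| |apply: smooth_cst; exact: openT].
by apply: (jsmoothP (jsmooth_partial i (jsmooth_trans sF))); [exact: smap_id|exact: smap_cst].
Qed.

Lemma Lf_trans v F x y : Lf v (fun z => F (x ** z)) y = Lf v F (x ** y).
Proof. by rewrite /Lf (_ : (fun z => F (x ** (y ** z))) = fun z => F (x ** y ** z))//; apply/funext => z; rewrite mulgA. Qed.

Lemma Lf_transE v F x : (fun y => Lf v F (x ** y)) = Lf v (fun z => F (x ** z)).
Proof. by apply/funext => y; rewrite Lf_trans. Qed.

Lemma Lf0 v F : Lf v F 0 = Df v F 0.
Proof. by rewrite /Lf (_ : (fun y => F (0 ** y)) = F)//; apply/funext => y; rewrite mul0g. Qed.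

Lemma Lf_linv (a b : R) v w F x : Lf (a *: v + b *: w) F x = a * Lf v F x + b * Lf w F x.
Proof. exact: Df_linv. Qed.

Lemma Lf_linF (a b : R) v F H x : smooth setT F -> smooth setT H ->
  Lf v (fun y => a * F y + b * H y) x = a * Lf v F x + b * Lf v H x.
Proof. by move=> sF sH; rewrite /Lf Df_linF//; exact: smooth_trans. Qed.

Definition co (i : 'I_N) : E -> R := fun x => x 0 i.

Lemma smooth_co i : smooth setT (co i).
Proof. by apply: smooth_coord; exact: openT. Qed.

Lemma Df_co v x i : Df v (co i) x = v 0 i.
Proof.
have d := derivable_coord x v i; have [_ <-] := d.
by rewrite -Df_derive//; exact: smooth_co.
Qed.

(** As a function of its first argument, [M] at the point [x] is the differential at 0 of the left
    translation by [x]. *)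
Definition M : E -> E -> E := locked (left_field (Defs.mul G)).

Lemma ME : M = left_field (Defs.mul G).
Proof. by rewrite /M -lock. Qed.

Lemma left_fieldE v x i : M v x 0 i = Lf v (co i) x.
Proof.
have sm j := smooth_trans x (smooth_co j).
rewrite ME /left_field derive_mx; first by rewrite mxE; exact: Df_derive (sm i).
apply/derivable_mxP => a b; rewrite (ord1 a).
by have [] := smooth_dir v openT (sm b) (x := 0) Logic.I.
Qed.

Lemma Lf_field v F x : smooth setT F -> Lf v F x = Df (M v x) F x.
Proof.
move=> sF; apply: (@isd_unique (fun h : R => F (x ** (h *: v))) 0).
  by have := Df_isd v 0 (smooth_trans x sF); under eq_fun do rewrite add0r.
have := @smooth_chain R N setT F (fun h : R => x ** (h *: v)) (fun i => M v x 0 i) 0 openT sF Logic.I.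
rewrite DfE scale0r mulg0; apply => i; rewrite left_fieldE.
by have := Df_isd v 0 (smooth_trans x (smooth_co i)); under eq_fun do rewrite add0r.
Qed.

Lemma M0 v : M v 0 = v.
Proof. by apply/rowP => i; rewrite left_fieldE Lf0 Df_co. Qed.

Lemma Df_prod v F H x : smooth setT F -> smooth setT H ->
  Df v (fun y => F y * H y) x = Df v F x * H x + F x * Df v H x.
Proof.
move=> sF sH; rewrite !DfE mulr_sumr mulr_suml -big_split/=; apply: eq_bigr => i _.
by rewrite partial_mul//; move: (partial i F x) (partial i H x) => P Q; ring.
Qed.

Lemma Df_sum v n (F : 'I_n -> E -> R) x : (forall k, smooth setT (F k)) ->
  Df v (fun y => \sum_k F k y) x = \sum_k Df v (F k) x.
Proof.
elim: n F => [|n IH] F sF.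
  rewrite big_ord0 DfE big1// => i _; rewrite (_ : partial i _ x = 0) ?mul0r//.
  rewrite (_ : (fun y => _) = fun=> 0); first exact: derive_cst.
  by apply/funext => y; rewrite big_ord0.
have := @Df_linF 1 1 v (fun y => \sum_(k < n) F (widen_ord (leqnSn n) k) y) (F ord_max) x.
rewrite !mul1r IH// big_ord_recr/= => <-//.
  by congr Df; apply/funext => y; rewrite big_ord_recr/= !mul1r.
by apply: smooth_sum => //; exact: openT.
Qed.

Definition br : E -> E -> E := locked (lie (Defs.mul G)).

Lemma brE : br = lie (Defs.mul G).
Proof. by rewrite /br -lock. Qed.

Lemma br0E v w i : br v w 0 i = Df v (Lf w (co i)) 0 - Df w (Lf v (co i)) 0.
Proof.
have key u z : ('D_u (M z) 0 : E) 0 i = Df u (Lf z (co i)) 0.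
  have sL j := smooth_Lf z (smooth_co j).
  have fE j : (fun x => M z x 0 j) = Lf z (co j) by apply/funext => y; rewrite left_fieldE.
  rewrite derive_mx; first by rewrite mxE fE; exact: Df_derive (sL i).
  apply/derivable_mxP => a b; rewrite (ord1 a) fE.
  by have [] := smooth_dir u openT (sL b) (x := 0) Logic.I.
have sub (a b : E) : (a - b) 0 i = a 0 i - b 0 i by rewrite !mxE.
by rewrite brE /lie /field_bracket -ME !M0 sub !key.
Qed.

Lemma Df_scaleFr (a : R) v F x : smooth setT F -> Df v (fun y => F y * a) x = Df v F x * a.
Proof. move=> sF; rewrite [RHS]mulrC -Df_scaleF// (_ : (fun y => F y * a) = fun y => a * F y)//.
by apply/funext => y; rewrite mulrC. Qed.

Lemma Df_comm v w F x : smooth setT F -> Df v (Df w F) x = Df w (Df v F) x.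
Proof.
move=> sF.
have ex u z : Df u (Df z F) x = \sum_i \sum_j partial j (partial i F) x * u 0 j * z 0 i.
  have sP i : smooth setT (fun y => partial i F y * z 0 i).
    by apply: smooth_mul; [exact: openT|exact: smooth_partial|apply: smooth_cst; exact: openT].
  have -> : Df z F = fun y => \sum_i partial i F y * z 0 i by apply/funext => y; rewrite DfE.
  rewrite Df_sum//; apply: eq_bigr => i _; rewrite Df_scaleFr; last exact: smooth_partial.
  by rewrite DfE mulr_suml.
rewrite !ex exchange_big/=; apply: eq_bigr => i _; apply: eq_bigr => j _.
by rewrite (schwarz j i openT sF Logic.I) mulrAC.
Qed.

(** The second order parts cancel by symmetry of second derivatives; what remains is the difference
    of the derivatives of the coefficients of the two fields, that is, the bracket at 0. *)
Lemma Lf_comm0 v w F : smooth setT F ->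
  Lf v (Lf w F) 0 - Lf w (Lf v F) 0 = Df (br v w) F 0.
Proof.
move=> sF; rewrite !Lf0.
have fE u : Lf u F = fun y => \sum_i Lf u (co i) y * partial i F y.
  by apply/funext => y; rewrite Lf_field// DfE; apply: eq_bigr => i _; rewrite left_fieldE mulrC.
have sm u i : smooth setT (fun y => Lf u (co i) y * partial i F y).
  by apply: smooth_mul; [exact: openT|exact: smooth_Lf (smooth_co i)|exact: smooth_partial].
have ex u z : Df u (Lf z F) 0 = \sum_i Df u (Lf z (co i)) 0 * partial i F 0 + Df u (Df z F) 0.
  rewrite fE Df_sum// (eq_bigr (fun i => Df u (Lf z (co i)) 0 * partial i F 0 + z 0 i * Df u (partial i F) 0)); last first.
    move=> i _; rewrite Df_prod; [|exact: smooth_Lf (smooth_co i)|exact: smooth_partial].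
    by rewrite Lf0 Df_co.
  rewrite big_split/=; congr (_ + _).
  have -> : Df z F = fun y => \sum_i partial i F y * z 0 i by apply/funext => y; rewrite DfE.
  rewrite Df_sum; last by move=> i; apply: smooth_mul; [exact: openT|exact: smooth_partial|apply: smooth_cst; exact: openT].
  by apply: eq_bigr => i _; rewrite Df_scaleFr 1?mulrC//; exact: smooth_partial.
rewrite !ex (Df_comm w v 0 sF) [RHS]DfE opprD addrACA subrr addr0 -sumrB; apply: eq_bigr => i _.
by rewrite br0E -mulrBl mulrC.
Qed.

(** Both sides commute with left translations, which reduces the identity to the origin. *)
Lemma Lf_comm v w F x : smooth setT F ->
  Lf v (Lf w F) x - Lf w (Lf v F) x = Lf (br v w) F x.
Proof.
move=> sF; have E u z : Lf u (Lf z F) x = Lf u (Lf z (fun y => F (x ** y))) 0.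
  by rewrite -Lf_transE Lf_trans mulg0.
by rewrite (E v w) (E w v) (Lf_comm0 v w (smooth_trans x sF)).
Qed.

Lemma vec_ext v w : (forall F, smooth setT F -> Lf v F 0 = Lf w F 0) -> v = w.
Proof. by move=> H; apply/rowP => i; have := H _ (smooth_co i); rewrite !Lf0 !Df_co. Qed.

Lemma Lf_lie v w F : smooth setT F -> Lf (br v w) F = fun x => 1 * Lf v (Lf w F) x + (-1) * Lf w (Lf v F) x.
Proof. by move=> sF; apply/funext => x; rewrite -(Lf_comm v w x sF) mul1r mulN1r. Qed.

Lemma lie_anti v w : br v w = - br w v.
Proof.
apply: vec_ext => F sF; have := @Lf_linv (-1) 0 (br w v) 0 F 0.
move: (Lf_comm v w 0 sF) (Lf_comm w v 0 sF).
move: (br v w) (br w v) (Lf v (Lf w F) 0) (Lf w (Lf v F) 0) => p q r t <- E.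
by rewrite scaleN1r scale0r addr0 -E => ->; move: (Lf 0 F 0) => z; ring.
Qed.

Lemma lie_linr (a b : R) v w u : br v (a *: w + b *: u) = a *: br v w + b *: br v u.
Proof.
apply: vec_ext => F sF; have sL z := smooth_Lf z sF.
rewrite Lf_linv -(Lf_comm v (a *: w + b *: u) 0 sF) -(Lf_comm v w 0 sF) -(Lf_comm v u 0 sF).
have -> : Lf (a *: w + b *: u) F = fun y => a * Lf w F y + b * Lf u F y by apply/funext => y; exact: Lf_linv.
rewrite (Lf_linF a b v 0 (sL w) (sL u)) (Lf_linv a b w u (Lf v F) 0).
by move: (Lf v (Lf w F) 0) (Lf v (Lf u F) 0) (Lf w (Lf v F) 0) (Lf u (Lf v F) 0) => p q r t; ring.
Qed.

Lemma lie_linl (a b : R) v w u : br (a *: w + b *: u) v = a *: br w v + b *: br u v.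
Proof. by rewrite lie_anti lie_linr (lie_anti v w) (lie_anti v u) !scalerN -opprD opprK. Qed.

Lemma lie0r v : br v 0 = 0.
Proof. by have := lie_linr 0 0 v 0 0; rewrite !scale0r addr0. Qed.

Lemma lie0l v : br 0 v = 0.
Proof. by rewrite lie_anti lie0r oppr0. Qed.

Lemma lieZl (c : R) v w : br (c *: v) w = c *: br v w.
Proof. by have := lie_linl c 0 w v 0; rewrite !scale0r !addr0. Qed.

Lemma lieZr (c : R) v w : br v (c *: w) = c *: br v w.
Proof. by have := lie_linr c 0 v w 0; rewrite !scale0r !addr0. Qed.

Lemma lieDl v w u : br (v + w) u = br v u + br w u.
Proof. by have := lie_linl 1 1 u v w; rewrite (scale1r v) (scale1r w) (scale1r (br v u)) (scale1r (br w u)). Qed.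

Lemma lieDr v w u : br u (v + w) = br u v + br u w.
Proof. by have := lie_linr 1 1 u v w; rewrite (scale1r v) (scale1r w) (scale1r (br u v)) (scale1r (br u w)). Qed.

Lemma lie_suml n (a : 'I_n -> E) w : br (\sum_k a k) w = \sum_k br (a k) w.
Proof.
elim: n a => [|n IH] a; first by rewrite !big_ord0 lie0l.
by rewrite !big_ord_recr/= lieDl IH.
Qed.

Lemma lie_sumr n (a : 'I_n -> E) w : br w (\sum_k a k) = \sum_k br w (a k).
Proof.
elim: n a => [|n IH] a; first by rewrite !big_ord0 lie0r.
by rewrite !big_ord_recr/= lieDr IH.
Qed.

(** A tangent vector is determined by its derivation ([vec_ext]); after that the identity holds for
    commutators in any associative algebra. *)
Lemma jacobi a b c : br a (br b c) = br (br a b) c + br b (br a c).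
Proof.
apply: vec_ext => F sF; have sL z := smooth_Lf z sF; have sLL z y := smooth_Lf z (sL y).
have := @Lf_linv 1 1 (br (br a b) c) (br b (br a c)) F 0; rewrite !scale1r !mul1r => ->.
have E p q r : Lf (br p (br q r)) F 0 =
    Lf p (Lf q (Lf r F)) 0 - Lf p (Lf r (Lf q F)) 0 - (Lf q (Lf r (Lf p F)) 0 - Lf r (Lf q (Lf p F)) 0).
  rewrite -(Lf_comm p (br q r) 0 sF) (Lf_lie q r sF) (Lf_linF 1 (-1) p 0 (sLL q r) (sLL r q)).
  by rewrite -(Lf_comm q r 0 (sL p)) mul1r mulN1r.
have A : Lf (br (br a b) c) F 0 = - Lf (br c (br a b)) F 0.
  move: (Lf_comm (br a b) c 0 sF) (Lf_comm c (br a b) 0 sF).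
  by move: (br _ c) (br c _) => p q <- <-; rewrite opprB.
rewrite A (E a b c) (E c a b) (E b a c).
move: (Lf a (Lf b _) _) (Lf a (Lf c _) _) (Lf b (Lf a _) _) (Lf b (Lf c _) _) (Lf c (Lf a _) _) (Lf c (Lf b _) _) => p q r s t u.
by ring.
Qed.

End lie_theory.

(** * Dilations *)

Section dilations.
Context {R : realType} {N : nat}.
Variable G : carnot_group R N.
Local Notation E := 'rV[R]_N.
Local Notation isd t g l := (is_derive (t : R) (1 : R) (g : R -> R) (l : R)).
Local Notation "x ** y" := (Defs.mul G x y) (at level 40, left associativity).
Local Notation br := (@br R N G).
Local Notation M := (@M R N G).
Local Notation Lf := (@Lf R N G).
Local Notation lay := (@layer R N (deg G)).
Local Notation dil := (dilation G).
Local Notation e_ := (@basis_vec R N).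
Implicit Types (v w x y u : E) (F H : E -> R).

Lemma vec_sum v : v = \sum_k v 0 k *: e_ k.
Proof. exact: row_sum_delta. Qed.

Lemma sum_coord n (a : 'I_n -> E) i : (\sum_k a k) 0 i = \sum_k a k 0 i.
Proof. by rewrite summxE. Qed.

Lemma layer_lin n (c : 'I_n -> R) (a : 'I_n -> E) k : (forall i, lay k (a i)) -> lay k (\sum_i c i *: a i).
Proof.
move=> H j jk; rewrite sum_coord big1// => i _.
by rewrite mxE (H i j jk) mulr0.
Qed.

Lemma layer_sub k v w : lay k v -> lay k w -> lay k (v - w).
Proof. by move=> H1 H2 j jk; rewrite mxE [X in _ + X]mxE H1// H2// subrr. Qed.

Lemma layer_out k v : ~~ (1 <= k <= nlayers G)%N -> lay k v -> v = 0.
Proof.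
move=> kn H; apply/rowP => j; rewrite mxE; apply: H; apply: contraNN kn => /eqP <-.
exact: deg_bounds.
Qed.

Lemma basis_layer k : lay (deg G k) (e_ k).
Proof. by move=> j jk; rewrite mxE eqxx/=; case: eqP => // jE; rewrite jE eqxx in jk. Qed.

Lemma span_mem (A : set E) v : A v -> lin_span A v.
Proof. by move=> Av; exists 1%N, (fun=> 1), (fun=> v); split=> //; rewrite big_ord1 scale1r. Qed.

Lemma lie_layer1 j v w : lay 1 v -> lay j w -> lay j.+1 (br v w).
Proof.
move=> v1 wj; have mem : lie_span (Defs.mul G) (lay 1) (lay j) (br v w).
  by apply: span_mem; exists v, w; split=> //; rewrite brE.
have [j1|j1] := boolP (1 <= j < nlayers G)%N; first by rewrite (bracket_layer j1) in mem.
have [jn|jn] := eqVneq j (nlayers G).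
  by rewrite jn bracket_last in mem; rewrite mem => k _; rewrite mxE.
rewrite (_ : w = 0) ?lie0r; first by move=> k _; rewrite mxE.
apply: layer_out wj; apply: contraNN j1 => /andP[-> h]/=.
by rewrite ltn_neqAle jn.
Qed.

(** The stratification prescribes only the brackets with the first layer. A vector of layer $i+1$ is
    a combination of brackets $[p,q]$ with $p$ in layer 1 and $q$ in layer $i$, and the Jacobi
    identity reduces $[[p,q],w]$ to brackets with $p$ and with $q$. *)
Lemma lie_layer i j v w : lay i v -> lay j w -> lay (i + j) (br v w).
Proof.
elim: i j v w => [|i IH] j v w vi wj.
  by rewrite (@layer_out 0 v) // lie0l => k _; rewrite mxE.
have [i0|i0] := posnP i; first by rewrite i0 in vi *; exact: lie_layer1.
have [iN|iN] := boolP (1 <= i.+1 <= nlayers G)%N; last first.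
  by rewrite (@layer_out i.+1 v) // lie0l => k _; rewrite mxE.
have bl : (1 <= i < nlayers G)%N by rewrite i0.
move: vi; rewrite -(bracket_layer bl) => -[n [c [a [Ha ->]]]].
rewrite lie_suml; under eq_bigr do rewrite lieZl.
apply: layer_lin => k; have [p [q [p1 qi ->]]] := Ha k.
rewrite -brE (_ : br (br p q) w = br p (br q w) - br q (br p w)).
  apply: layer_sub; first exact: lie_layer1 p1 (IH _ _ _ qi wj).
  by rewrite addSnnS; exact: IH qi (lie_layer1 p1 wj).
by rewrite (jacobi G p q w) addrK.
Qed.

(** Bracketing strictly raises the degree, every degree being at least 1: $[v,\cdot]$ is strictly
    triangular for the grading. *)
Lemma lie_raise v k j : (deg G j <= deg G k)%N -> br v (e_ k) 0 j = 0.
Proof.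
move=> jk; rewrite [in LHS](vec_sum v) lie_suml sum_coord big1// => l _.
rewrite lieZl mxE (lie_layer (@basis_layer l) (@basis_layer k)) ?mulr0//.
rewrite neq_ltn; apply/orP; left; apply: (leq_ltn_trans jk).
by rewrite -[ltnLHS]add0n ltn_add2r; case/andP: (deg_bounds G l).
Qed.

Lemma dilE t x j : dil t x 0 j = t ^+ deg G j * x 0 j.
Proof. by rewrite mxE. Qed.

Lemma dilD t x y : dil t (x + y) = dil t x + dil t y.
Proof. by apply/rowP => j; rewrite dilE [RHS]mxE !dilE mxE mulrDr. Qed.

Lemma dilZ t (c : R) x : dil t (c *: x) = c *: dil t x.
Proof. by apply/rowP => j; rewrite dilE [RHS]mxE dilE mxE mulrCA. Qed.

Lemma dil0 t : dil t 0 = 0.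
Proof. by apply/rowP => j; rewrite dilE !mxE mulr0. Qed.

Lemma dilN t x : dil t (- x) = - dil t x.
Proof. by rewrite -scaleN1r dilZ scaleN1r. Qed.

Lemma dil1 x : dil 1 x = x.
Proof. by apply/rowP => j; rewrite dilE expr1n mul1r. Qed.

Lemma dilM s t x : dil s (dil t x) = dil (s * t) x.
Proof. by apply/rowP => j; rewrite !dilE mulrA exprMn. Qed.

Lemma dilK t x : t != 0 -> dil t^-1 (dil t x) = x.
Proof. by move=> t0; rewrite dilM mulVf// dil1. Qed.

Lemma dilVK t x : t != 0 -> dil t (dil t^-1 x) = x.
Proof. by move=> t0; rewrite dilM mulfV// dil1. Qed.

Lemma dil_sum t n (a : 'I_n -> E) : dil t (\sum_k a k) = \sum_k dil t (a k).
Proof.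
elim: n a => [|n IH] a; first by rewrite !big_ord0 dil0.
by rewrite !big_ord_recr/= dilD IH.
Qed.

Lemma dil_layer t k v : lay k v -> dil t v = t ^+ k *: v.
Proof.
move=> vk; apply/rowP => j; rewrite dilE mxE.
by have [->//|jk] := eqVneq (deg G j) k; rewrite vk// !mulr0.
Qed.

Lemma dil_lie t v w : dil t (br v w) = br (dil t v) (dil t w).
Proof.
rewrite {1 2}(vec_sum v) dil_sum !lie_suml dil_sum; apply: eq_bigr => k _.
rewrite dilZ !lieZl dilZ; congr (_ *: _).
rewrite {1 2}(vec_sum w) dil_sum !lie_sumr dil_sum; apply: eq_bigr => l _.
rewrite dilZ !lieZr dilZ; congr (_ *: _).
rewrite (dil_layer t (@basis_layer k)) (dil_layer t (@basis_layer l)) lieZl lieZr scalerA -exprD.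
exact: dil_layer (lie_layer (@basis_layer k) (@basis_layer l)).
Qed.

(* The inverse of [M p]. *)
Definition Nf p q : E := \row_i Df q (fun y => co i (- p ** y)) p.

Lemma smooth_translate p i : smooth setT (fun y => co i (p ** y)).
Proof. exact: smooth_trans (smooth_co i). Qed.

Lemma Df_comp F (g : E -> E) q x : smooth setT F -> smap g ->
  Df q (fun y => F (g y)) x = Df (\row_i Df q (fun y => co i (g y)) x) F (g x).
Proof.
move=> sF sg; have sFg := smooth_compT sg sF.
apply: (isd_unique (Df_isd q x sFg)).
have := @smooth_chain R N setT F (fun h : R => g (x + h *: q)) (fun i => Df q (fun y => co i (g y)) x) 0 openT sF Logic.I.
have -> : Df (\row_i Df q (fun y => co i (g y)) x) F (g x) =
    \sum_i partial i F (g (x + 0 *: q)) * Df q (fun y => co i (g y)) x.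
  by rewrite scale0r addr0 DfE; apply: eq_bigr => i _; rewrite mxE.
by apply => i; exact: Df_isd (sg i).
Qed.

Lemma smap_trans p : smap (fun y => p ** y).
Proof. by apply: smap_mul; [exact: smap_cst|exact: smap_id]. Qed.

Lemma M_Nf p q : M (Nf p q) p = q.
Proof.
apply/rowP => j; rewrite left_fieldE /Lf.
have := Df_comp q p (smooth_translate p j) (smap_trans (- p)).
rewrite mulNg => <-; rewrite (_ : (fun y => co j (p ** (- p ** y))) = co j) ?Df_co//.
by apply/funext => y; rewrite mulVKg.
Qed.

Lemma Nf_M p v : Nf p (M v p) = v.
Proof.
apply/rowP => i; rewrite mxE -(Lf_field G v p (smooth_translate (- p) i)) Lf_trans mulNg Lf0.
exact: Df_co.
Qed.

Lemma Lf_sumv n (a : 'I_n -> E) F x : Lf (\sum_k a k) F x = \sum_k Lf (a k) F x.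
Proof.
elim: n a => [|n IH] a.
  by rewrite !big_ord0; have := Lf_linv G 0 0 0 0 F x; rewrite scale0r addr0 !mul0r addr0.
by rewrite !big_ord_recr/= -IH; have := Lf_linv G 1 1 (\sum_(k < n) a (widen_ord (leqnSn n) k)) (a ord_max) F x; rewrite !scale1r !mul1r.
Qed.

Lemma Lf_scalev (c : R) v F x : Lf (c *: v) F x = c * Lf v F x.
Proof. by have := Lf_linv G c 0 v 0 F x; rewrite scale0r mul0r !addr0. Qed.

Lemma Lf_basis v F x : Lf v F x = \sum_k v 0 k * Lf (e_ k) F x.
Proof. by rewrite {1}(vec_sum v) Lf_sumv; apply: eq_bigr => k _; rewrite Lf_scalev. Qed.

(** In exponential coordinates $s\mapsto sv$ is a one-parameter subgroup, hence an integral curve of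
    the left-invariant field of [v]. *)
Lemma Mline v (s : R) : M v (s *: v) = v.
Proof.
apply/rowP => i; rewrite left_fieldE; apply: (isd_unique (g := fun h => co i (s *: v ** (h *: v))) (t := 0)).
  by have := Df_isd v 0 (smooth_translate (s *: v) i); under eq_fun do rewrite add0r.
under eq_fun do rewrite mul_exp /co mxE; apply/derive1P => e e0; exists 1 => // h _.
rewrite add0r (_ : _ - _ = 0); first by rewrite normr0 mulr_ge0// ltW.
by ring.
Qed.

(** The identity $M\,y\,y=y$ differentiated at [p] in the direction [w]: the first term comes from
    the vector argument, the second from the base point. *)
Lemma Df_line w p i : Lf w (co i) p + Df w (Lf p (co i)) p = w 0 i.
Proof.
have sL k := smooth_Lf G (e_ k) (smooth_co i).
have -> : w 0 i = Df w (fun y => \sum_k co k y * Lf (e_ k) (co i) y) p.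
  rewrite -(Df_co w p i); congr (Df _ _ _); apply/funext => y.
  by rewrite -Lf_basis -left_fieldE; have := Mline y 1; rewrite scale1r => ->.
rewrite Df_sum; last by move=> k; apply: smooth_mul (sL k); [exact: openT|exact: smooth_co].
rewrite (eq_bigr (fun k => w 0 k * Lf (e_ k) (co i) p + p 0 k * Df w (Lf (e_ k) (co i)) p)); last first.
  by move=> k _; rewrite Df_prod ?Df_co//; exact: smooth_co.
rewrite big_split/= -Lf_basis; congr (_ + _).
rewrite (_ : Lf p (co i) = fun y => \sum_k p 0 k * Lf (e_ k) (co i) y); last by apply/funext => y; exact: Lf_basis.
rewrite Df_sum; last by move=> k; apply: smooth_mul (sL k); [exact: openT|apply: smooth_cst; exact: openT].
by apply: eq_bigr => k _; rewrite Df_scaleF.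
Qed.

Lemma smooth_Nf w i : smooth setT (fun p => Nf p w 0 i).
Proof.
have sj : jsmooth (fun p y => co i (- p ** y)).
  apply: smooth_compT (smooth_co i); apply: smap_mul; last exact: smap_rsub.
  by apply: smap_opp; exact: smap_lsub.
rewrite (_ : (fun p => _) = fun p => \sum_k partial k (fun y => co i (- p ** y)) p * w 0 k); last first.
  by apply/funext => p; rewrite mxE DfE.
apply: smooth_sum; first exact: openT.
move=> k; apply: smooth_mul; [exact: openT| |apply: smooth_cst; exact: openT].
by apply: (jsmoothP (jsmooth_partial k sj)); exact: smap_id.
Qed.

(* [s w = M (b s) (s x)] expresses the differential of the exponential map; the
   Maurer-Cartan equation gives [b' = w - [x, b]]. *)
Lemma dexp_ode x w (b := fun s : R => s *: Nf (s *: x) w) (s : R) i :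
  isd s (fun s => b s 0 i) ((w - br x (b s)) 0 i).
Proof.
have db k : exists l, isd s (fun s => b s 0 k) l.
  have H := @smooth_chain R N setT _ (fun h : R => h *: x) (fun i => x 0 i) s openT (smooth_Nf w k) Logic.I.
  have {}H := H (fun j => _).
  have D : isd s (fun h => Nf (h *: x) w 0 k) (\sum_j partial j (fun p => Nf p w 0 k) (s *: x) * x 0 j).
    apply: H => j; apply/derive1P => e e0; exists 1 => // h _.
    rewrite !mxE (_ : _ - _ - _ = 0); first by rewrite normr0 mulr_ge0// ltW.
    by ring.
  have := is_deriveM (is_derive_id s (1 : R)) D; rewrite (_ : id * _ = fun h => b h 0 k); last first.
    by apply/funext => h; rewrite /b mxE.
  by move=> ?; eexists; eassumption.
have /choice[b' Hb'] := db.
pose B' : E := \row_k b' k.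
pose p := s *: x.
suff -> : w - br x (b s) = B' by rewrite mxE; exact: Hb'.
have Mb h : M (b h) (h *: x) = h *: w.
  apply/rowP => j; rewrite left_fieldE Lf_scalev -left_fieldE M_Nf// mxE. by [].
suff H : M B' p = M (w - br x (b s)) p by rewrite -[RHS](Nf_M p) H Nf_M.
apply/rowP => j; rewrite !left_fieldE.
have sL k := smooth_Lf G (e_ k) (smooth_co j).
(* The curve $h\mapsto M(b(h))(hx)=hw$ is differentiated in two ways, by the product rule and
   directly, and the two velocities are compared. *)
have d1 : isd s (fun h => \sum_k b h 0 k * Lf (e_ k) (co j) (h *: x))
   (\sum_k (b' k * Lf (e_ k) (co j) p + b s 0 k * Df x (Lf (e_ k) (co j)) p)).
  rewrite (_ : (fun h => _) = \sum_k (fun h => b h 0 k * Lf (e_ k) (co j) (h *: x))); last by apply/funext => h; rewrite fct_sumE.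
  apply: is_derive_sum => k.
  have D : isd s (fun h => Lf (e_ k) (co j) (h *: x)) (Df x (Lf (e_ k) (co j)) p).
    have /derive1P H := Df_isd x p (sL k).
    apply/derive1P => e /H[d d0 Hd]; exists d => // h /Hd; rewrite !add0r scale0r addr0 /p -scalerDl; exact.
  have := is_deriveM (Hb' k) D.
  move=> H; apply: (is_derive_eq H); rewrite /GRing.scale/= addrC; congr (_ + _); exact: mulrC.
have d2 : isd s (fun h => \sum_k b h 0 k * Lf (e_ k) (co j) (h *: x)) (w 0 j).
  rewrite (_ : (fun h => _) = fun h => h * w 0 j).
    apply/derive1P => e e0; exists 1 => // h _.
    rewrite (_ : _ - _ - _ = 0); first by rewrite normr0 mulr_ge0// ltW.
    by ring.
  by apply/funext => h; rewrite -Lf_basis -left_fieldE Mb mxE.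
have := isd_unique d1 d2; rewrite big_split/=.
have -> : \sum_k b' k * Lf (e_ k) (co j) p = Lf B' (co j) p.
  by rewrite [RHS]Lf_basis; apply: eq_bigr => k _; rewrite mxE.
have -> : \sum_k b s 0 k * Df x (Lf (e_ k) (co j)) p = Lf x (Lf (b s) (co j)) p.
  rewrite (Lf_field G _ _ (smooth_Lf G (b s) (smooth_co j))) Mline.
  rewrite (_ : Lf (b s) (co j) = fun y => \sum_k b s 0 k * Lf (e_ k) (co j) y); last by apply/funext => y; exact: Lf_basis.
  rewrite Df_sum; last by move=> k; apply: smooth_mul (sL k); [exact: openT|apply: smooth_cst; exact: openT].
  by apply: eq_bigr => k _; rewrite Df_scaleF.
have E1 := Lf_comm G x (b s) p (smooth_co j).
(* At [p] the field of [b s] takes the value $sw$; moving the factor [s] onto [x] turns $sx$ into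
   the vector [p], and [Df_line] applies. *)
have E2 : Lf (b s) (Lf x (co j)) p = w 0 j - Lf w (co j) p.
  rewrite (Lf_field G _ _ (smooth_Lf G x (smooth_co j))) Mb -(Df_line w p j) addrC addKr.
  rewrite (_ : Lf p (co j) = fun y => s * Lf x (co j) y); last by apply/funext => y; rewrite /p Lf_scalev.
  rewrite Df_scaleF; last exact: smooth_Lf (smooth_co j).
  by rewrite !DfE mulr_sumr; apply: eq_bigr => k _; rewrite mxE mulrCA.
have E3 : Lf (w - br x (b s)) (co j) p = Lf w (co j) p - Lf (br x (b s)) (co j) p.
  by have := Lf_linv G 1 (-1) w (br x (b s)) (co j) p; rewrite scale1r scaleN1r mul1r mulN1r.
rewrite E3; move: E1 E2.
move: (Lf B' _ _) (Lf x _ _) (Lf (br _ _) _ _) (Lf (b s) (Lf x _) _) (Lf w _ _) => P1 P2 P3 P4 P5 <- -> H.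
by lra.
Qed.

End dilations.

(** * Dilations are automorphisms of the group *)

Section dilation_automorphism.
Context {R : realType} {N : nat}.
Variable G : carnot_group R N.
Local Notation E := 'rV[R]_N.
Local Notation isd t g l := (is_derive (t : R) (1 : R) (g : R -> R) (l : R)).
Local Notation "x ** y" := (Defs.mul G x y) (at level 40, left associativity).
Local Notation br := (@br R N G).
Local Notation M := (@M R N G).
Local Notation Nf := (@Nf R N G).
Local Notation Lf := (@Lf R N G).
Local Notation lay := (@layer R N (deg G)).
Local Notation dil := (dilation G).
Local Notation e_ := (@basis_vec R N).
Implicit Types (v w x y u : E) (F H : E -> R).

Lemma subE m (a b : 'rV[R]_m) i : (a - b) 0 i = a 0 i - b 0 i.
Proof. by rewrite !mxE. Qed.

Lemma isd_const (g : R -> R) : (forall t, isd t g 0) -> forall a b, g a = g b.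
Proof.
move=> dg; suff H a b : a <= b -> g a = g b.
  by move=> a b; have [/H|/ltW/H] := leP a b.
move=> ab; have [c _] := MVT1 ab (fun t _ => dg t).
by rewrite mul0r => /eqP; rewrite subr_eq0 => /eqP.
Qed.

Lemma isd_affine (a b t : R) : isd t (fun s => a + s * b) b.
Proof.
apply/derive1P => e e0; exists 1 => // h _.
have -> : a + (t + h) * b - (a + t * b) - h * b = 0 by ring.
by rewrite normr0 mulr_ge0// ltW.
Qed.

Lemma isd_line m (x v : 'rV[R]_m) (t : R) i : isd t (fun s => (x + s *: v) 0 i) (v 0 i).
Proof.
rewrite (_ : (fun s => _) = fun s => x 0 i + s * v 0 i); first exact: isd_affine.
by apply/funext => s; rewrite !mxE.
Qed.

Lemma jchain a b (H : 'rV[R]_a -> 'rV[R]_b -> R) (p : R -> 'rV[R]_a) (q : R -> 'rV[R]_b) (p' : 'rV[R]_a) (q' : 'rV[R]_b) (t : R) :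
  jsmooth H -> (forall i, isd t (fun s => p s 0 i) (p' 0 i)) ->
  (forall i, isd t (fun s => q s 0 i) (q' 0 i)) ->
  isd t (fun s => H (p s) (q s)) (Df p' (fun z => H z (q t)) (p t) + Df q' (H (p t)) (q t)).
Proof.
move=> jH dp dq.
have := @smooth_chain R _ setT _ (fun s => row_mx (p s) (q s)) (fun i => (row_mx p' q') 0 i) t openT jH Logic.I.
have -> : (fun s => H (lsubmx (row_mx (p s) (q s))) (rsubmx (row_mx (p s) (q s)))) = fun s => H (p s) (q s).
  by apply/funext => s; rewrite row_mxKl row_mxKr.
rewrite big_split_ord/= (eq_bigr (fun i => partial i (fun z => H z (q t)) (p t) * p' 0 i)); last first.
  by move=> i _; rewrite -jpartialEl row_mxKl row_mxKr row_mxEl.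
rewrite [X in _ + X](eq_bigr (fun i => partial i (H (p t)) (q t) * q' 0 i)); last first.
  by move=> i _; rewrite -jpartialE row_mxKl row_mxKr row_mxEr.
rewrite -!DfE; apply => i; case: (split_ordP i) => k ->.
  by under eq_fun do rewrite row_mxEl; rewrite row_mxEl.
by under eq_fun do rewrite row_mxEr; rewrite row_mxEr.
Qed.

Lemma lie_coord v w j : br v w 0 j = \sum_k w 0 k * br v (e_ k) 0 j.
Proof.
rewrite [in LHS](vec_sum w) lie_sumr sum_coord; apply: eq_bigr => k _.
by rewrite lieZr mxE.
Qed.

(** By [dexp_ode] and [dil_lie] the difference $e$ of the two sides, along $sx$ and multiplied by
    $s$, satisfies $e'=-[\delta_tx,e]$ and $e(0)=0$. As this system is strictly triangular in the
    degree ([lie_raise]), the components vanish by induction on the degree, without a general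
    uniqueness theorem. *)
Lemma dil_Nf t x w : dil t (Nf x w) = Nf (dil t x) (dil t w).
Proof.
pose b s := s *: Nf (s *: x) w; pose c s := s *: Nf (s *: dil t x) (dil t w).
pose e s := dil t (b s) - c s.
suff H n : forall j, (deg G j < n)%N -> forall s, e s 0 j = 0.
  apply/rowP => j; apply/eqP; rewrite -subr_eq0; apply/eqP.
  have := H (deg G j).+1 j (leqnn _) 1; rewrite /e /b /c !scale1r => <-.
  by rewrite subE.
elim: n => [//|n IH] j jn s.
have e0 : e 0 0 j = 0 by rewrite /e /b /c !scale0r dil0 subrr mxE.
rewrite -e0; apply: (isd_const (g := fun s => e s 0 j)) => {}s.
have eE : (fun s => e s 0 j) = fun s => t ^+ deg G j * b s 0 j - c s 0 j.
  by apply/funext => z; rewrite /e subE dilE.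
have := is_deriveB (is_deriveZ (t ^+ deg G j) (dexp_ode G x w s j)) (dexp_ode G (dil t x) (dil t w) s j).
move=> H; rewrite eE; apply: (is_derive_eq H).
rewrite -/(b s) -/(c s) /GRing.scale/=.
have ar (a1 a2 a3 : R) : a1 - a2 - (a1 - a3) = a3 - a2 by ring.
rewrite !subE mulrBr -!dilE dil_lie ar.
have : br (dil t x) (e s) 0 j = 0.
  rewrite lie_coord big1// => k _; have [kn|nk] := ltnP (deg G k) (deg G j).
    by rewrite IH ?mul0r//; exact: leq_trans kn jn.
  by rewrite lie_raise ?mulr0.
have -> : br (dil t x) (e s) = br (dil t x) (dil t (b s)) - br (dil t x) (c s).
  by rewrite -scaleN1r -lieZr scaleN1r -lieDr.
by rewrite subE => /eqP; rewrite subr_eq0 => /eqP ->; rewrite subrr.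
Qed.

Lemma dil_M t x v : dil t (M v x) = M (dil t v) (dil t x).
Proof. by rewrite -{2}(Nf_M G x v) dil_Nf M_Nf. Qed.

Lemma jsmooth_mul i : jsmooth (fun p q => co i (p ** q)).
Proof. exact: jsmooth_trans (smooth_co i). Qed.

Lemma isd_flow x v (s : R) i : isd s (fun s => co i (x ** (s *: v))) (M v (x ** (s *: v)) 0 i).
Proof.
rewrite left_fieldE /Lf.
have /derive1P H := Df_isd v 0 (smooth_translate G (x ** (s *: v)) i).
apply/derive1P => e /H[d d0 Hd]; exists d => // h /Hd.
by rewrite !add0r scale0r mulg0 -mulgA mul_exp.
Qed.

(** The curve $s\mapsto\delta_t(x\cdot sy)\cdot(-s\,\delta_ty)$ is constant: by [dil_M] its first
    factor follows the left-invariant field of $\delta_ty$, and the second factor moves back along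
    the same flow. Its values at 0 and 1 are compared. *)
Lemma dil_mul t x y : dil t (x ** y) = dil t x ** dil t y.
Proof.
suff H : dil t (x ** y) ** - dil t y = dil t x by rewrite -H -mulgA mulNg mulg0.
apply/rowP => i; pose y' := dil t y.
pose g (s : R) := co i (dil t (x ** (s *: y)) ** (s *: - y')).
have -> : dil t x 0 i = g 0 by rewrite /g !scale0r !mulg0.
have -> : (dil t (x ** y) ** - dil t y) 0 i = g 1 by rewrite /g !scale1r.
apply: isd_const => s; pose p := dil t (x ** (s *: y)).
have dp j : isd s (fun s => dil t (x ** (s *: y)) 0 j) (M y' p 0 j).
  have H := is_deriveZ (t ^+ deg G j) (isd_flow x y s j).
  rewrite (_ : (fun s => _) = t ^+ deg G j *: (fun s => co j (x ** (s *: y)))); last first.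
    by apply/funext => z; rewrite dilE.
  by apply: (is_derive_eq H); rewrite /p /y' -dil_M dilE.
have dq j : isd s (fun s => (s *: - y') 0 j) ((- y') 0 j).
  by have := isd_line 0 (- y') s j; under eq_fun do rewrite add0r.
have := jchain (jsmooth_mul i) dp dq; rewrite -/p => H; apply: (is_derive_eq H).
have sT := smooth_translate G p i.
have sr : smooth setT (fun y => co i (y ** (s *: - y'))).
  by apply: (jsmoothP (jsmooth_mul i)); [exact: smap_id|exact: smap_cst].
rewrite -(Lf_field G y' p sr) /Lf.
have -> : Df (- y') (fun q => co i (p ** q)) (s *: - y') = - Df y' (fun q => co i (p ** q)) (s *: - y').
  by have := Df_linv (-1) 0 y' 0 (fun q => co i (p ** q)) (s *: - y'); rewrite scaleN1r scale0r mul0r !addr0 mulN1r.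
apply/eqP; rewrite subr_eq0; apply/eqP.
have sl : smooth setT (fun y => co i (p ** y ** (s *: - y'))).
  apply: (jsmoothP (jsmooth_mul i)); last exact: smap_cst.
  exact: smap_trans.
apply: (isd_unique (Df_isd y' 0 sl)).
have := Df_isd y' (s *: - y') sT; congr (is_derive _ _ _ _); apply/funext => h.
by rewrite add0r -mulgA scalerN -scaleNr mul_exp -scalerDl addrC.
Qed.

End dilation_automorphism.

(** * Polynomial structure and Haar measure *)

Section group_structure.
Context {R : realType} {N : nat}.
Variable G : carnot_group R N.
Local Notation E := 'rV[R]_N.
Local Notation isd t g l := (is_derive (t : R) (1 : R) (g : R -> R) (l : R)).
Local Notation "x ** y" := (Defs.mul G x y) (at level 40, left associativity).
Local Notation dil := (dilation G).
Local Notation e_ := (@basis_vec R N).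
Local Notation I := (@integral_rV R _).
Implicit Types (v w x y u : E) (F H : E -> R).

Lemma hom_dimE : hom_dim G = (\sum_j deg G j)%N.
Proof.
have -> : (\sum_j deg G j = \sum_j \sum_(1 <= i < (nlayers G).+1) if deg G j == i then i else 0)%N.
  apply: eq_bigr => j _; rewrite (bigD1_seq (deg G j)) ?iota_uniq//=; last first.
    by rewrite mem_index_iota ltnS; exact: deg_bounds.
  by rewrite eqxx big1 ?addn0// => i; rewrite eq_sym => /negbTE ->.
rewrite exchange_big/=; apply: eq_bigr => i _.
by rewrite -big_mkcond sum_nat_const mulnC.
Qed.

Lemma isd_pow n (t : R) : isd t (fun s => s ^+ n) (n%:R * t ^+ n.-1).
Proof.
have -> : n%:R * t ^+ n.-1 = 'D_1 (fun x : R => x ^+ n) t.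
  by rewrite exp_derive /GRing.scale/= mulr1.
by apply: DeriveDef => //; exact: exprn_derivable.
Qed.

Lemma isd_mulr (g : R -> R) (t l c : R) : isd t g l -> isd t (fun s => g s * c) (l * c).
Proof.
move=> /(is_deriveZ c); rewrite /GRing.scale/= mulrC.
by congr (is_derive _ _ _ _); apply/funext => s; rewrite /GRing.scale/= mulrC.
Qed.

Lemma isd_dil (t : R) x j :
  isd t (fun s => dil s x 0 j) ((\row_j ((deg G j)%:R * t ^+ (deg G j).-1 * x 0 j)) 0 j).
Proof.
rewrite mxE; under eq_fun do rewrite dilE.
exact: isd_mulr (isd_pow _ _).
Qed.

Lemma Df_basis F x i : smooth setT F -> Df (e_ i) F x = partial i F x.
Proof. by move=> sF; rewrite -Df_derive. Qed.

Lemma Df_dil t v F x : smooth setT F -> Df v (fun z => F (dil t z)) x = Df (dil t v) F (dil t x).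
Proof.
move=> sF.
have sd : smap (fun z => dil t z).
  move=> j; under eq_fun do rewrite dilE.
  by apply: smooth_scale; [exact: openT|exact: smooth_co].
apply: (isd_unique (Df_isd v x (smooth_compT sd sF))).
have := Df_isd (dil t v) (dil t x) sF; congr (is_derive _ _ _ _).
by apply/funext => h; rewrite dilD dilZ.
Qed.

Lemma smap_dil t : smap (fun z => dil t z).
Proof.
move=> j; under eq_fun do rewrite dilE.
by apply: smooth_scale; [exact: openT|exact: smooth_co].
Qed.

(** Under dilations the derivative is homogeneous of degree $\deg j-\deg i\le0$. Hence $t^{\deg
    i-\deg j}$ times its value at the dilated points does not depend on $t\ne0$, and continuity at
    $t=0$ reduces it to the origin, where left translation is the identity. *)
Lemma partial_mul_deg x y i j : (deg G j <= deg G i)%N ->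
  partial i (fun z => co j (x ** z)) y = (i == j)%:R.
Proof.
move=> ji; pose P (a b : E) := partial i (fun z => co j (a ** z)) b.
have jP : jsmooth P by apply: jsmooth_partial; exact: jsmooth_mul.
have hom t : t ^+ deg G i * P (dil t x) (dil t y) = t ^+ deg G j * P x y.
  have sT a := smooth_translate G a j.
  rewrite /P -!Df_basis// -(Df_scaleF (t ^+ deg G j) _ _ (sT x)).
  have -> : (fun z => t ^+ deg G j * co j (x ** z)) = fun z => co j (dil t x ** dil t z).
    by apply/funext => z; rewrite -dil_mul /co dilE.
  rewrite (Df_dil t (e_ i) y (sT (dil t x))).
  rewrite (dil_layer t (@basis_layer _ _ G i)).
  have := Df_linv (t ^+ deg G i) 0 (e_ i) 0 (fun z => co j (dil t x ** z)) (dil t y).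
  by rewrite scale0r mul0r !addr0 => ->.
pose k := (deg G i - deg G j)%N.
pose g (t : R) := P (dil t x) (dil t y) * t ^+ k.
have gc t : t != 0 -> g t = P x y.
  move=> t0; have := hom t; rewrite -(subnK ji) exprD -/k => H.
  have /mulfI : t ^+ deg G j != 0 by rewrite expf_neq0.
  by apply; rewrite -H /g; ring.
have cg : {for 0, continuous g}.
  apply: is_derive_cont; apply: is_deriveM; last exact: isd_pow.
  by apply: jchain => //; exact: isd_dil.
rewrite -/(P x y); have <- : g 0 = P x y.
  apply/eqP; rewrite -subr_eq0 -normr_eq0; apply/negPn/negP => H.
  have e0 : 0 < `|g 0 - P x y| by rewrite lt_neqAle eq_sym H normr_ge0.
  have [d d0 Hd] := (contP _ _).1 cg _ e0.
  have := Hd (d / 2); rewrite subr0 gtr0_norm ?divr_gt0// gc ?gt_eqF ?divr_gt0// distrC ltxx.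
  have h : d / 2 < d by lra.
  by move=> /(_ h).
have d0 a : dil 0 a = 0 :> E.
  apply/rowP => l; rewrite dilE expr0n mxE.
  by have /andP[] := deg_bounds G l; case: (deg G l) => // m _ _; rewrite mul0r.
rewrite /g !d0 /P (_ : (fun z => co j (0 ** z)) = co j); last by apply/funext => z; rewrite mul0g.
rewrite -Df_basis ?Df_co; last exact: smooth_co.
rewrite mxE eqxx/= eq_sym; case: eqP => [ij|_]; last by rewrite mul0r.
by rewrite /k ij subnn expr0 mulr1.
Qed.

(** By [partial_mul_deg], $(xy)_j-y_j$ has zero derivative in every coordinate of [y] of degree at
    least $\deg j$. This triangular shape replaces the Baker-Campbell-Hausdorff formula, for the
    Haar measure as well as for Chow's theorem. *)
Lemma mul_tri x y y' j : (forall k, (deg G k < deg G j)%N -> y 0 k = y' 0 k) ->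
  (x ** y) 0 j - y 0 j = (x ** y') 0 j - y' 0 j.
Proof.
move=> yy'; have sT := smooth_translate G x j.
have [|c [_]] := @incr_tele R N (fun z => co j (x ** z)) y y'.
  by move=> z i _; case: (smooth_is_derive i sT (x := z) Logic.I).
rewrite (bigD1 j)//= partial_mul_deg// eqxx mul1r big1.
  by rewrite addr0 /co => H; lra.
move=> i ij; have [ji|ij'] := leqP (deg G j) (deg G i).
  by rewrite partial_mul_deg// (negbTE ij) mul0r.
by rewrite yy'// subrr mulr0.
Qed.

Lemma oppM x y : - (x ** y) = - y ** - x.
Proof. by rewrite -[RHS](mulKg G (x ** y)) -mulgA (mulgA G y) mulgN mul0g mulgN mulg0. Qed.

Lemma mul_lowr x y j : (forall k, (deg G k < deg G j)%N -> y 0 k = 0) -> (x ** y) 0 j = x 0 j + y 0 j.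
Proof.
move=> y0; have := @mul_tri x y 0 j; rewrite mulg0 mxE => H.
by rewrite -(subrK (y 0 j) ((x ** y) 0 j)) H ?subr0// => k kj; rewrite y0// mxE.
Qed.

Lemma mul_lowl x y j : (forall k, (deg G k < deg G j)%N -> x 0 k = 0) -> (x ** y) 0 j = x 0 j + y 0 j.
Proof.
move=> x0; have H := @mul_lowr (- y) (- x) j; rewrite -oppM in H.
have -> : (x ** y) 0 j = - (- (x ** y)) 0 j by rewrite [X in - X]mxE opprK.
rewrite H; first by rewrite !mxE opprD !opprK addrC.
by move=> k kj; rewrite mxE x0 ?oppr0.
Qed.

Lemma Cc_homeo F (g k : E -> E) : continuous g -> continuous k -> (forall x, k (g x) = x) -> Cc F -> Cc (fun x => F (g x)).
Proof.
move=> cg ck kg [cF [r Fr]]; split; first by move=> x; apply: (continuous_comp (cg x)); exact: cF.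
have bk : exists2 B, 0 < B & forall z, `|z| <= r -> `|k z| <= B.
  have cn : forall x : E, [set z | `|z| <= r] x -> {for x, continuous (fun z => `|k z|)}.
    by move=> x _; apply: (continuous_comp (ck x)); exact: norm_continuous.
  have [B B0 HB] := compact_cont_bounded (@compact_cball R N r) cn.
  by exists B => // z /HB; rewrite normr_id.
have [B B0 HB] := bk; exists B => x xB; apply: Fr.
by rewrite ltNge; apply: contraL xB => /HB; rewrite kg -leNgt.
Qed.

Lemma cont_dil t : continuous (fun y => dil t y).
Proof. exact: smap_cont (smap_dil t). Qed.

Lemma smap_act x t : smap (fun y => x ** dil t y).
Proof. exact: smap_comp (smap_dil t) (smap_trans G x). Qed.

Lemma Cc_act F x t : t != 0 -> Cc F -> Cc (fun y => F (x ** dil t y)).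
Proof.
move=> t0; apply: (@Cc_homeo F _ (fun z => dil t^-1 (- x ** z))).
- exact: smap_cont (smap_act x t).
- by apply: smap_cont; apply: smap_comp (smap_dil _); exact: smap_trans.
- by move=> z; rewrite mulKg dilK.
Qed.

(** The map $y\mapsto x\cdot\delta_ty$ is triangular with diagonal $t^{\deg j}$, and the degrees add
    up to $Q$. Translation invariance and scaling of the Lebesgue measure are obtained together. *)
Lemma haar F x t : 0 < t -> Cc F -> I (fun y => F (x ** dil t y)) = (t ^+ hom_dim G)^-1 * I F.
Proof.
move=> t0 CF; pose a j := t ^+ deg G j; pose c j y := (x ** dil t y) 0 j - a j * y 0 j.
have E1 : (fun y => F (x ** dil t y)) = fun y => F (triang a c y).
  apply/funext => y; congr (F _); apply/rowP => j; rewrite [RHS]mxE /c.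
  by rewrite addrC subrK.
rewrite E1 int_triang//.
- by congr (_^-1 * _); rewrite hom_dimE -prodrXr.
- by move=> j; rewrite exprn_gt0.
- move=> j; apply: cont_subT; first by apply: smoothT_cont; exact: smap_act.
  apply: cont_mulT; first exact: cst_continuous.
  exact: coord_cont.
(* [int_triang] orders the coordinates by index and [mul_tri] by degree; the monotonicity [deg_mono]
   passes from one to the other. *)
- move=> j y y' yy'; rewrite /c /a -!dilE; apply: mul_tri => k kj; rewrite !dilE yy'//.
  by rewrite ltnNge; apply: contraL kj => /(deg_mono G); rewrite -leqNgt.
- by rewrite -E1; apply: Cc_act => //; rewrite gt_eqF.
Qed.

End group_structure.

(** * Carnot-Caratheodory distance *)

Section curves.
Context {R : realType} {N : nat}.
Variable G : carnot_group R N.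
Local Notation E := 'rV[R]_N.
Local Notation isd t g l := (is_derive (t : R) (1 : R) (g : R -> R) (l : R)).
Local Notation "x ** y" := (Defs.mul G x y) (at level 40, left associativity).
Local Notation dil := (dilation G).
Local Notation M := (@M R N G).
Local Notation Lf := (@Lf R N G).
Local Notation e_ := (@basis_vec R N).
Local Notation mu := (@lebesgue_measure R).
Implicit Types (v w x y z xi : E).

Lemma line1P (f : R -> R) (x : 'rV[R]_1) i l :
  is_derive x (basis_vec i) (fun z : 'rV[R]_1 => f (z 0 0)) l <-> isd (x 0 0) f l.
Proof.
have E1 : (fun h : R => f ((x + h *: basis_vec i) 0 0)) = fun h => f (x 0 0 + h).
  by apply/funext => h; rewrite (ord1 i) !mxE !eqxx mulr1.
split=> [/is_derive_lineP|]; rewrite ?E1 => /derive1P H.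
  by apply/derive1P => e /H[d d0 Hd]; exists d => // h /Hd; rewrite add0r addr0.
apply/is_derive_lineP; rewrite E1; apply/derive1P => e /H[d d0 Hd]; exists d => // h /Hd.
by rewrite add0r addr0.
Qed.

Lemma derivable_isd (f : R -> R) t : derivable f t 1 -> isd t f (derive1 f t).
Proof. by move=> df; rewrite derive1E; apply: DeriveDef. Qed.

Lemma smooth1P (g : R -> R) : (forall n t, derivable (derive1n n g) t 1) <->
  smooth setT (fun x : 'rV[R]_1 => g (x 0 0)).
Proof.
split=> [H|sg n t].
  apply: (@smooth_coind _ _ _ (fun f => exists n, f = fun x : 'rV[R]_1 => derive1n n g (x 0 0))) => //.
  - exact: openT.
  - move=> f [n ->] x _; have D i := (line1P _ x i _).2 (derivable_isd (H n (x 0 0))); split.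
      apply: (@continuous_comp _ _ _ (fun z : 'rV[R]_1 => z 0 0) (derive1n n g)); first exact: coord_cont.
      exact: is_derive_cont (derivable_isd (H n (x 0 0))).
    by move=> i; case: (D i).
  - move=> f i [n ->]; exists (fun x : 'rV[R]_1 => derive1n n.+1 g (x 0 0)); first by exists n.+1.
    by move=> x _; rewrite /partial; case: ((line1P _ x i _).2 (derivable_isd (H n (x 0 0)))).
  - by exists 0%N.
have D (f : R -> R) s : smooth setT (fun x : 'rV[R]_1 => f (x 0 0)) ->
    isd s f (partial 0 (fun x : 'rV[R]_1 => f (x 0 0)) (const_mx s)).
  by move=> sf; have := smooth_is_derive 0 sf (x := const_mx s) Logic.I; move/line1P; rewrite mxE.
have S : smooth setT (fun x : 'rV[R]_1 => derive1n n g (x 0 0)).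
  elim: n => [//|n IH]; apply: smooth_eq (smooth_partial 0 IH) => [|x _]; first exact: openT.
  rewrite /= derive1E; have [_ ->] := D _ (x 0 0) IH; congr (partial _ _ _).
  by apply/rowP => i; rewrite mxE (ord1 i).
by have [] := D _ t S.
Qed.

Definition scurve (g : R -> E) := smap (fun x : 'rV[R]_1 => g (x 0 0)).

Lemma scurveP g : smooth_curve g <-> scurve g.
Proof.
split=> H i; first by apply: (smooth1P (fun s => g s 0 i)).1 => n t; exact: H.
by move=> n t; exact: ((smooth1P (fun s => g s 0 i)).2 (H i) n t).
Qed.

Definition vel (g : R -> E) (t : R) : E := \row_i derive1 (fun s => g s 0 i) t.

Lemma scurve_isd g t i : scurve g -> isd t (fun s => g s 0 i) (vel g t 0 i).
Proof.
move=> sg; rewrite mxE; apply: derivable_isd.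
exact: ((smooth1P (fun s => g s 0 i)).2 (sg i) 0%N t).
Qed.

Lemma vel_eq (g : R -> E) t v : (forall i, isd t (fun s => g s 0 i) (v 0 i)) -> vel g t = v.
Proof. by move=> H; apply/rowP => i; rewrite mxE derive1E; case: (H i). Qed.

Definition horiz x v := forall xi, dotr v xi ^+ 2 <=
  \sum_(j < N | deg G j == 1%N) dotr (M (e_ j) x) xi ^+ 2.

(** The condition only tests a vector against covectors, so a linear map [A] that carries one
    horizontal frame to the other transports it through its transpose [A']. *)
Lemma horiz_map (A A' : E -> E) x y v : (forall v xi, dotr (A v) xi = dotr v (A' xi)) ->
  (forall j, deg G j = 1%N -> M (e_ j) y = A (M (e_ j) x)) -> horiz x v -> horiz y (A v).
Proof.
move=> AA' MA H xi; rewrite AA'; apply: (le_trans (H _)).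
by apply: ler_sum => j /eqP j1; rewrite MA// AA'.
Qed.

(** A subunit curve as a list of smooth pieces, with the inequality at every time of each closed
    piece. This allows induction on the pieces and removes null sets; [reach_of_curve] and
    [curve_of_reach] show that no distance is changed. *)
Inductive reach : R -> E -> E -> Prop :=
| reach0 x : reach 0 x x
| reachS (T b : R) x (g : R -> E) : reach T x (g T) -> scurve g -> T < b ->
    (forall t, T <= t <= b -> horiz (g t) (vel g t)) -> reach b x (g b).

Lemma reach_ge0 T x y : reach T x y -> 0 <= T.
Proof. by elim=> {T x y} // T b x g _ T0 _ Tb _; exact: le_trans T0 (ltW Tb). Qed.

Lemma scurve_comp g (h : E -> E) : scurve g -> smap h -> scurve (fun t => h (g t)).
Proof. by move=> sg sh; exact: (smap_comp sg sh). Qed.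

Lemma reach_trans a T x y : reach T x y -> reach T (a ** x) (a ** y).
Proof.
elim=> {T x y} [x|T b x g _ IH sg Tb H]; first exact: reach0.
apply: (@reachS T b _ (fun t => a ** g t)) => //.
  by apply: scurve_comp => //; exact: smap_trans.
move=> t /H {}H.
pose A v : E := \row_i Df v (fun z => co i (a ** z)) (g t).
pose A' xi : E := \row_k \sum_i partial k (fun z => co i (a ** z)) (g t) * xi 0 i.
have sT := smooth_translate G a.
have -> : vel (fun t => a ** g t) t = A (vel g t).
  apply: vel_eq => i; rewrite mxE DfE.
  by apply: (smooth_chain openT (sT i)) => // j; exact: scurve_isd.
apply: (horiz_map (A' := A')) H => [v xi|j _].
  rewrite /dotr (eq_bigr (fun i => \sum_k partial k (fun z => co i (a ** z)) (g t) * v 0 k * xi 0 i)); last first.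
    by move=> i _; rewrite mxE DfE mulr_suml.
  rewrite exchange_big; apply: eq_bigr => k _; rewrite mxE mulr_sumr; apply: eq_bigr => i _.
  by move: (partial _ _ _) => P; ring.
apply/rowP => i; rewrite left_fieldE -Lf_trans mxE.
exact: Lf_field (sT i).
Qed.

(** The dilation multiplies the first-layer fields by [s]; running the dilated curve [s] times
    slower restores the subunit condition. *)
Lemma reach_dil (s : R) T x y : 0 < s -> reach T x y -> reach (s * T) (dil s x) (dil s y).
Proof.
move=> s0; elim=> {T x y} [x|T b x g _ IH sg Tb H]; first by rewrite mulr0; exact: reach0.
have sn : s != 0 by rewrite gt_eqF.
pose h t := dil s (g (s^-1 * t)).
have hE t : h (s * t) = dil s (g t) by rewrite /h mulKf.
rewrite -hE; apply: (@reachS (s * T)); first by rewrite hE.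
- move=> i; have sm : smap (fun x : 'rV[R]_1 => s^-1 *: x) by move=> j; apply: (smap_scale _ (@smap_id _ 1)); apply: smooth_cst; exact: openT.
  apply: smooth_eq (smooth_compT sm (scurve_comp sg (smap_dil G s) i)) => [|z _]; first exact: openT.
  have zE : (s^-1 *: z) 0 0 = s^-1 * z 0 0 by rewrite mxE.
  by rewrite /h zE.
- by rewrite ltr_pM2l.
move=> t /andP[t1 t2]; pose u := s^-1 * t.
have /H {}H : T <= u <= b by rewrite /u mulrC ler_pdivlMr// ler_pdivrMr// ![_ * s]mulrC t1.
pose A v := s^-1 *: dil s v.
have -> : vel h t = A (vel g u).
  apply: vel_eq => i; rewrite mxE dilE.
  have D1 : isd t (fun t => s^-1 * t) s^-1.
    by have := isd_affine 0 s^-1 t; under eq_fun do rewrite add0r mulrC.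
  have := isd_mulr (s ^+ deg G i) (isd_comp D1 (scurve_isd u i sg)).
  rewrite (_ : (fun t => _) = fun s0 => h s0 0 i); last by apply/funext => z; rewrite /h dilE mulrC.
  by congr (is_derive _ _ _ _); ring.
apply: (horiz_map (A' := A)) H => [v xi|j j1].
  by apply: eq_bigr => i _; rewrite mxE dilE [in RHS]mxE dilE; ring.
rewrite /A dil_M (dil_layer s (@basis_layer _ _ G j)) j1 expr1 /h.
by apply/rowP => i; rewrite mxE !left_fieldE Lf_scalev mulKf.
Qed.

Lemma reach_hor T x y k (c : R) : deg G k = 1%N -> reach T x y -> reach (T + `|c|) x (y ** (c *: e_ k)).
Proof.
move=> k1 H; have [->|c0] := eqVneq c 0; first by rewrite normr0 scale0r mulg0 addr0.
pose g t := y ** (((t - T) * Num.sg c) *: e_ k).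
have gT : g T = y by rewrite /g subrr mul0r scale0r mulg0.
have -> : y ** (c *: e_ k) = g (T + `|c|).
  by rewrite /g addrAC subrr add0r mulrC -numEsg.
apply: (@reachS T); rewrite ?gT//.
- rewrite /scurve /g.
  have sm : smap (fun x : 'rV[R]_1 => ((x 0 0 - T) * Num.sg c) *: e_ k).
    apply: smap_scale (smap_cst _ _) => //; apply: smooth_mul; [exact: openT| |apply: smooth_cst; exact: openT].
    by apply: smooth_sub; [exact: openT|exact: smooth_co|apply: smooth_cst; exact: openT].
  exact: smap_comp sm (smap_trans G y).
- by rewrite ltrDl normr_gt0.
move=> t _ xi.
have -> : vel g t = M (Num.sg c *: e_ k) (g t).
  apply: vel_eq => i; have := isd_flow G y (Num.sg c *: e_ k) (t - T) i.
  rewrite [(t - T) *: _]scalerA -/(g t).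
  have gE : (fun s => g s 0 i) = fun s => co i (y ** ((s - T) *: (Num.sg c *: e_ k))).
    by apply/funext => s; rewrite scalerA.
  rewrite gE; move/derive1P => D; apply/derive1P => e /D[d d0 Hd]; exists d => // h /Hd.
  by rewrite (addrAC t h).
have -> : dotr (M (Num.sg c *: e_ k) (g t)) xi = Num.sg c * dotr (M (e_ k) (g t)) xi.
  by rewrite /dotr mulr_sumr; apply: eq_bigr => i _; rewrite !left_fieldE Lf_scalev mulrA.
rewrite exprMn sqr_sg c0 mul1r (bigD1 k) ?k1//= lerDl.
by apply: sumr_ge0 => j _; exact: sqr_ge0.
Qed.

End curves.

(** * Comparison of the curves with [reach], and the bound on their speed *)

Section cc_metric.
Context {R : realType} {N : nat}.
Variable G : carnot_group R N.
Local Notation E := 'rV[R]_N.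
Local Notation isd t g l := (is_derive (t : R) (1 : R) (g : R -> R) (l : R)).
Local Notation "x ** y" := (Defs.mul G x y) (at level 40, left associativity).
Local Notation dil := (dilation G).
Local Notation M := (@M R N G).
Local Notation Lf := (@Lf R N G).
Local Notation e_ := (@basis_vec R N).
Local Notation mu := (@lebesgue_measure R).
Local Notation reach := (@reach R N G).
Local Notation horiz := (@horiz R N G).
Implicit Types (v w x y z xi : E).

Lemma derive1_vel (g : R -> E) t : scurve g -> derive1 g t = vel g t.
Proof.
move=> sg; rewrite derive1E derive_mx.
  by apply/rowP => i; rewrite !mxE derive1E.
by apply/derivable_mxP => a i; rewrite (ord1 a); case: (scurve_isd t i sg).
Qed.

Lemma derive1_eqnear (f g : R -> E) t : (\forall s \near t, f s = g s) -> derive1 f t = derive1 g t.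
Proof. by move=> fg; rewrite !derive1E; exact: near_eq_derive. Qed.

Lemma isd_cont_scurve (g : R -> E) i : scurve g -> continuous (fun t => g t 0 i).
Proof. by move=> sg t; exact: is_derive_cont (scurve_isd t i sg). Qed.

Lemma vel_cont (g : R -> E) i : scurve g -> continuous (fun t => vel g t 0 i).
Proof.
move=> sg t; have H := (smooth1P (fun s => g s 0 i)).2 (sg i) 1%N t.
rewrite (_ : (fun t => _) = derive1 (fun s => g s 0 i)); last by apply/funext => s; rewrite mxE.
exact: is_derive_cont (derivable_isd H).
Qed.

Definition horiz_gap (g : R -> E) xi (t : R) : R :=
  \sum_(j < N | deg G j == 1%N) dotr (M (e_ j) (g t)) xi ^+ 2 - dotr (vel g t) xi ^+ 2.

Lemma horiz_gap_cont g xi : scurve g -> continuous (horiz_gap g xi).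
Proof.
move=> sg; have cdot (w : R -> E) : (forall i, continuous (fun t => w t 0 i)) -> continuous (fun t => dotr (w t) xi ^+ 2).
  move=> cw t; have c1 : {for t, continuous (fun t => dotr (w t) xi)}.
    by apply: cont_sum => i; apply: cont_mul; [exact: cw|exact: cst_continuous].
  exact: (cont_mul c1 c1).
apply: cont_subT; last by apply: cdot => i; exact: vel_cont.
move=> t; rewrite (_ : (fun t => _) = fun t => \sum_(j < N) (if deg G j == 1%N then dotr (M (e_ j) (g t)) xi ^+ 2 else 0)); last first.
  by apply/funext => s; rewrite big_mkcond.
apply: cont_sum => j; case: (deg G j == 1%N); last exact: cst_continuous.
apply: cdot => i s; rewrite (_ : (fun t => _) = fun t => Lf (e_ j) (co i) (g t)); last first.
  by apply/funext => r; rewrite left_fieldE.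
apply: (continuous_comp (f := g)); first by apply: cont_coords => k; exact: isd_cont_scurve.
exact: smoothT_cont (smooth_Lf G (e_ j) (smooth_co i)) _.
Qed.

Lemma ae_sub d (X : measurableType d) (m : {measure set X -> \bar R}) (P Q : X -> Prop) :
  almost_everywhere m P -> (forall t, P t -> Q t) -> almost_everywhere m Q.
Proof. by move=> [A [mA A0 PA]] PQ; exists A; split=> // t /= nQ; apply: PA => /= /PQ. Qed.

Lemma ae_sub3 d (X : measurableType d) (m : {measure set X -> \bar R}) (P Q S U : X -> Prop) :
  almost_everywhere m P -> almost_everywhere m Q -> almost_everywhere m S ->
  (forall t, P t -> Q t -> S t -> U t) -> almost_everywhere m U.
Proof.
move=> HP HQ HS H; apply: (negligibleS _ (negligibleU (negligibleU HP HQ) HS)) => t /= nU.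
apply: contrapT => /not_orP[/not_orP[/contrapT p /contrapT q] /contrapT s].
by apply: nU; exact: H.
Qed.

Lemma ae_dense (P : R -> Prop) (a b : R) : a < b -> {ae mu, forall t, a < t < b -> P t} -> exists2 t, a < t < b & P t.
Proof.
move=> ab [A [mA A0 PA]]; apply: contrapT => H.
have sub : `]a, b[%classic `<=` A.
  move=> t /=; rewrite in_itv/= => tab; apply: PA => /= Pt; apply: H; exists t => //; exact: Pt.
have : (mu `]a, b[%classic <= mu A)%E by apply: le_measure => //; rewrite inE.
by rewrite A0 lebesgue_measure_itv/= lte_fin ab -EFinB lee_fin subr_le0 leNgt ab.
Qed.

(** For a fixed covector the gap between the two sides is continuous in time, and a set of full
    measure is dense; the endpoints are included because [g] is smooth beyond them. *)
Lemma horiz_ae (g : R -> E) (a b : R) : a < b -> scurve g ->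
  {ae mu, forall t, a < t < b -> horiz (g t) (vel g t)} ->
  forall t, a <= t <= b -> horiz (g t) (vel g t).
Proof.
move=> ab sg H t /andP[at_ tb] xi; rewrite -subr_ge0 leNgt; apply/negP => neg.
have e0 : 0 < - horiz_gap g xi t by rewrite oppr_gt0.
have [d d0 Hd] := (contP _ _).1 (@horiz_gap_cont g xi sg t) _ e0.
pose u := Num.max a (t - d); pose v := Num.min b (t + d).
have uv : u < v.
  by rewrite /u /v lt_min !gt_max ab/=; apply/andP; split; lra.
have [|s /andP[us sv] Hs] := @ae_dense (fun s => horiz (g s) (vel g s)) u v uv.
  apply: (ae_sub H) => s Hs /andP[us sv]; apply: Hs.
  by move: us sv; rewrite /u /v gt_max lt_min => /andP[-> _] /andP[-> _].
have {}Hs := Hs xi; rewrite -subr_ge0 in Hs.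
have sd : `|s - t| < d.
  move: us sv; rewrite /u /v gt_max lt_min => /andP[_ h1] /andP[_ h2].
  by rewrite ltr_norml; apply/andP; split; lra.
have := Hd s sd; rewrite ltr_norml => /andP[_]; move: Hs; rewrite -/(horiz_gap g xi s); lra.
Qed.

Lemma piece_mono (p : nat -> R) n : (forall k, (k < n)%N -> p k < p k.+1) ->
  forall i j, (i <= j <= n)%N -> p i <= p j.
Proof.
move=> H i; elim=> [|j IH] /andP[ij jn]; first by move: ij; rewrite leqn0 => /eqP ->.
move: ij; rewrite leq_eqVlt => /predU1P[->//|ij].
by apply: (le_trans (IH _) (ltW (H _ jn))); rewrite -ltnS ij ltnW.
Qed.

Lemma reach_of_curve T x y (gamma : R -> E) : piecewise_smooth T gamma -> gamma 0 = x -> gamma T = y ->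
  subunit G T gamma -> reach T x y.
Proof.
move=> [n [p [p0 pn pS Hp]]] <- <- sub.
have mono := piece_mono pS.
suff H k : (k <= n)%N -> reach (p k) (gamma 0) (gamma (p k)) by rewrite -pn; exact: H.
elim: k => [_|k IH kn]; first by rewrite p0; exact: reach0.
have [g /scurveP sg gE] := Hp k kn.
have E1 : gamma (p k) = g (p k) by apply: gE; rewrite lexx ltW// pS.
have E2 : gamma (p k.+1) = g (p k.+1) by apply: gE; rewrite lexx ltW// pS.
rewrite E2; apply: (reachS (T := p k)) => //; [by rewrite -E1; exact: IH (ltnW kn)|exact: pS|].
apply: horiz_ae => //; first exact: pS.
apply: (ae_sub sub) => t Ht /andP[t1 t2] xi.
have t0 : 0 <= t by apply: le_trans (ltW t1); rewrite -p0; apply: mono; rewrite /= ltnW.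
have tT : t <= T by apply: (le_trans (ltW t2)); rewrite -pn; apply: mono; rewrite kn/=.
have := Ht; rewrite t0 tT => /(_ isT xi).
have near_g : \forall s \near t, gamma s = g s.
  near=> s; apply: gE; apply/andP; split; apply: ltW; near: s; [exact: lt_nbhsr|exact: lt_nbhsl].
have gt : gamma t = g t by apply: gE; rewrite (ltW t1) (ltW t2).
rewrite (derive1_eqnear near_g) derive1_vel// gt => H.
by apply: (le_trans H); rewrite /jacobian_field -ME.
Unshelve. all: by end_near. Qed.

Lemma curve_of_reach T x y : reach T x y -> exists gamma : R -> E,
  [/\ piecewise_smooth T gamma, gamma 0 = x, gamma T = y & subunit G T gamma].
Proof.
elim=> {T x y} [x|T b x g rT [gamma [[n [p [p0 pn pS Hp]]] g0 gT sub]] sg Tb H].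
  exists (fun=> x); split=> //; first by exists 0%N, (fun=> 0).
  apply: aeW => t _ xi; rewrite (_ : derive1 _ t = 0); last by rewrite derive1E; exact: derive_cst.
  rewrite (_ : dotr 0 xi = 0) ?expr0n; first by apply: sumr_ge0 => j _; exact: sqr_ge0.
  by rewrite /dotr big1// => i _; rewrite mxE mul0r.
have T0 := reach_ge0 rT; have mono := piece_mono pS.
pose gam t := if t <= T then gamma t else g t.
have gamE t : T <= t -> gam t = g t.
  by rewrite /gam le_eqVlt => /predU1P[<-|Tt]; [rewrite lexx|rewrite leNgt Tt].
exists gam; split.
- exists n.+1, (fun k => if (k <= n)%N then p k else b); split => //.
  + by rewrite ltnn.
  + move=> k; rewrite ltnS => kn; rewrite kn; case: ltnP => nk; first exact: pS.
    by rewrite (_ : k = n) ?pn//; apply/eqP; rewrite eqn_leq kn.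
  + move=> k; rewrite ltnS => kn; rewrite kn; case: ltnP => nk.
      have [h sh hE] := Hp k nk; exists h => // t /[dup] tp /hE <-; rewrite /gam ifT//.
      case/andP: tp => _ tp; apply: (le_trans tp); rewrite -pn; apply: mono; rewrite nk/=; exact: leqnn.
    have -> : k = n by apply/eqP; rewrite eqn_leq kn.
    by exists g; [exact/scurveP|move=> t /andP[]; rewrite pn => /gamE].
- by rewrite /gam T0.
- by rewrite gamE// ltW.
(* At the two ends of the new piece the glued curve may fail to be differentiable; they form a null
   set. *)
have neT : {ae mu, forall t : R, t <> T}.
  exists [set T]; split => //; first exact: lebesgue_measure_set1.
  by move=> t /= /contrapT.
have neb : {ae mu, forall t : R, t <> b}.
  exists [set b]; split => //; first exact: lebesgue_measure_set1.
  by move=> t /= /contrapT.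
apply: (ae_sub3 sub neT neb) => t Ht tT tb /andP[t0 tb'] xi.
have {tb'} tb' : t < b by rewrite lt_neqAle tb' andbT; apply/eqP.
have [tlT|Tlt] := leP t T.
  have {}tlT : t < T by rewrite lt_neqAle tlT andbT; apply/eqP.
  rewrite (@derive1_eqnear _ gamma); last first.
    by near=> s; rewrite /gam ifT//; apply: ltW; near: s; exact: lt_nbhsl.
  by rewrite /gam (ltW tlT); apply: Ht; rewrite t0 ltW.
rewrite (@derive1_eqnear _ g); last first.
  by near=> s; rewrite gamE//; apply: ltW; near: s; exact: lt_nbhsr.
have := H t; rewrite (ltW Tlt) (ltW tb') => /(_ isT xi).
by rewrite derive1_vel// (gamE t (ltW Tlt)) /jacobian_field -ME.
Unshelve. all: by end_near. Qed.

Lemma cc_distE x y : cc_dist G x y = inf [set T | reach T x y].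
Proof.
rewrite /cc_dist; congr inf; apply/seteqP; split=> T /=.
  by move=> [_ [gamma [H1 H2 H3 H4]]]; exact: reach_of_curve H4.
by move=> /[dup] /reach_ge0 T0 /curve_of_reach H; split.
Qed.

(** In the unit ball horizontal velocities are bounded by some $A$, so that a curve issued from 0
    stays in this ball up to time $1/A$, at distance at most $A$ times the elapsed time. *)
Lemma reach_speed : exists2 A, 0 < A & forall T z, reach T 0 z -> Num.min `|z| 1 <= A * T.
Proof.
have cM : forall x : E, [set x | `|x| <= 1] x -> {for x, continuous (fun x => \sum_i \sum_(j < N) M (e_ j) x 0 i ^+ 2)}.
  move=> x _; apply: cont_sum => i; apply: cont_sum => j.
  have c1 : {for x, continuous (fun x => M (e_ j) x 0 i)}.
    rewrite (_ : (fun x => _) = Lf (e_ j) (co i)); last by apply/funext => r; rewrite left_fieldE.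
    exact: smoothT_cont (smooth_Lf G (e_ j) (smooth_co i)) _.
  exact: (cont_mul c1 c1).
have [B B0 HB] := compact_cont_bounded (@compact_cball R N 1) cM.
(* The constant [B] bounds the squares of the velocity components, and $r^2\le B$ implies $r\le
   B+1$. *)
pose A := B + 1; have A0 : 0 < A by rewrite /A; lra.
have speed x v : `|x| <= 1 -> horiz x v -> forall i, `|v 0 i| <= A.
  move=> x1 H i; have := H (e_ i); have dE w : dotr w (e_ i) = w 0 i.
    rewrite /dotr (bigD1 i)//= mxE !eqxx mulr1 big1 ?addr0// => j ji.
    by rewrite [e_ i 0 j]mxE (negbTE ji) andbF mulr0.
  rewrite dE (eq_bigr (fun j => M (e_ j) x 0 i ^+ 2)); last by move=> j _; rewrite dE.
  move=> Hi; have : v 0 i ^+ 2 <= B.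
    apply: (le_trans Hi); apply: (le_trans _ (le_trans (ler_norm _) (HB x x1))).
    rewrite [leRHS](bigD1 i)//= -[leLHS]addr0; apply: lerD.
      rewrite big_mkcond; apply: ler_sum => j _; case: ifP => // _; exact: sqr_ge0.
    by apply: sumr_ge0 => j _; apply: sumr_ge0 => k _; exact: sqr_ge0.
  rewrite -real_normK ?num_real// => {}Hi; rewrite /A.
  have := normr_ge0 (v 0 i); move: Hi; move: `|v 0 i| => r; nra.
exists A => // T z; move: {1 3}0 (erefl (0 : E)) => x0 x0E r.
suff H : A * T < 1 -> `|z| <= A * T.
  have [/H{}H|H1] := ltP (A * T) 1; first by rewrite ge_min H.
  by rewrite ge_min H1 orbT.
elim: r x0E => {T x0 z} [x -> _|T b x g r IH sg Tb H x0 bA]; first by rewrite normr0 mulr0.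
have {}IH := IH x0.
have TA : A * T < A * b by rewrite ltr_pM2l.
have {}IH : `|g T| <= A * T by apply: IH; exact: lt_trans bA.
have cg : continuous g by move=> t; apply: cont_coords => k; exact: isd_cont_scurve.
have AT0 : 0 <= A * T by exact: mulr_ge0 (ltW A0) (reach_ge0 r).
have step c : T <= c <= b -> (forall t, T < t < c -> `|g t| <= 1) -> `|g c| <= A * c.
  move=> /andP[Tc cb] Hc; have Ac0 : 0 <= A * c.
    by apply: (le_trans AT0); rewrite ler_pM2l.
  apply: norm_le_coords => // i.
  move: Tc; rewrite le_eqVlt => /predU1P[<-|Tc]; first exact: le_trans (coord_le_norm _ _) IH.
  have [|c' /[!in_itv]/= /andP[c1 c2] E1] := @MVT R (fun t => g t 0 i) (fun t => vel g t 0 i) T c Tc (fun t _ => scurve_isd t i sg).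
    by apply: continuous_subspaceT; exact: isd_cont_scurve.
  have -> : g c 0 i = g T 0 i + vel g c' 0 i * (c - T) by rewrite -E1 addrC subrK.
  apply: (le_trans (ler_normD _ _)).
  have -> : A * c = A * T + A * (c - T) by ring.
  apply: lerD; first exact: le_trans (coord_le_norm _ _) IH.
  rewrite normrM (gtr0_norm (_ : 0 < c - T)) ?subr_gt0// ler_pM2r ?subr_gt0//.
  apply: (speed (g c')); first by apply: Hc; rewrite c1.
  by apply: H; rewrite (ltW c1) (le_trans (ltW c2)).
apply: (step b); first by rewrite lexx ltW.
(* The infimum of [S] would be the first exit time. Up to it [step] applies and leaves the curve
   strictly inside the ball, hence also shortly afterwards, against the definition of the
   infimum. *)
pose S := [set t | T <= t <= b /\ 1 <= `|g t|].
apply: contrapT => /existsNP[t0 /not_implyP[/andP[t1 t2] /negP]]; rewrite -ltNge => gt0.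
have St0 : S t0 by split; [rewrite !ltW|exact: ltW].
have lbS : lbound S T by move=> t [/andP[]].
have hS : has_inf S by split; [exists t0|exists T].
have {t0 t1 t2 gt0 St0} [t0 [t1 t2 St0]] : exists t0, [/\ T < t0, t0 < b & S t0] by exists t0.
pose s := inf S; have Ts : T <= s by apply: lb_le_inf => //; exists t0.
have st0 : s <= t0 by apply: ge_inf => //; exists T.
have sb : s <= b by exact: le_trans st0 (ltW t2).
have Hs : `|g s| <= A * s.
  apply: (step s); first by rewrite Ts.
  move=> t /andP[Tt ts]; rewrite leNgt; apply/negP => g1.
  have : s <= t by apply: ge_inf; [exists T|split; [rewrite (ltW Tt) (le_trans (ltW ts))|exact: ltW]].
  by rewrite leNgt ts.
have gs1 : `|g s| < 1 by apply: (le_lt_trans Hs); apply: le_lt_trans bA; rewrite ler_pM2l.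
have e0 : 0 < 1 - `|g s| by rewrite subr_gt0.
have [d d0 Hd] := (contP _ _).1 (cg s) _ e0.
have [t [/andP[Tt tb] g1] td] := inf_adherent d0 hS.
have st : s <= t by apply: ge_inf; [exists T|split; [rewrite Tt|]].
have := Hd t; rewrite ger0_norm ?subr_ge0// ltrBlDl td => /(_ isT) H1.
have := ler_normD (g t - g s) (g s); rewrite subrK; lra.
Qed.

Lemma cc_ge0 x y : 0 <= cc_dist G x y.
Proof.
rewrite cc_distE; have [->|ne] := eqVneq [set T | reach T x y] set0; first by rewrite inf0.
by apply: lb_le_inf; [exact/set0P|move=> T /= /reach_ge0].
Qed.

End cc_metric.

(** * Chow's theorem, layer by layer *)

Section chow.
Context {R : realType} {N : nat}.
Variable G : carnot_group R N.
Local Notation E := 'rV[R]_N.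
Local Notation isd t g l := (is_derive (t : R) (1 : R) (g : R -> R) (l : R)).
Local Notation "x ** y" := (Defs.mul G x y) (at level 40, left associativity).
Local Notation br := (@br R N G).
Local Notation dil := (dilation G).
Local Notation M := (@M R N G).
Local Notation Lf := (@Lf R N G).
Local Notation lay := (@layer R N (deg G)).
Local Notation e_ := (@basis_vec R N).
Local Notation reach := (@reach R N G).
Implicit Types (v w x y z a : E).

Lemma Df_Lf_diag x j : Df x (Lf x (co j)) 0 = 0.
Proof.
apply: (isd_unique (Df_isd x 0 (smooth_Lf G x (smooth_co j)))).
rewrite (_ : (fun h => _) = fun h => x 0 j + h * 0); first exact: isd_affine.
by apply/funext => h; rewrite add0r -left_fieldE Mline mulr0 addr0.
Qed.

Lemma Df_add v w F x : Df (v + w) F x = Df v F x + Df w F x.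
Proof. by have := Df_linv 1 1 v w F x; rewrite !scale1r !mul1r. Qed.

Lemma Df_opp v F x : Df (- v) F x = - Df v F x.
Proof. by have := Df_linv (-1) 0 v 0 F x; rewrite scaleN1r scale0r mul0r !addr0 mulN1r. Qed.

(* In exponential coordinates the second order part of the product is
   antisymmetric, hence half the bracket. *)
Lemma br_half v w j : br v w 0 j = 2 * Df v (Lf w (co j)) 0.
Proof.
have sL u := smooth_Lf G u (smooth_co j).
have := Df_Lf_diag (v + w) j.
have -> : Lf (v + w) (co j) = fun y => 1 * Lf v (co j) y + 1 * Lf w (co j) y.
  by apply/funext => y; have := Lf_linv G 1 1 v w (co j) y; rewrite !scale1r.
rewrite Df_linF// !Df_add !Df_Lf_diag br0E; move: (Df v _ _) (Df w _ _) => P Q H.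
by lra.
Qed.

Lemma deg1_le k : (1 <= deg G k)%N.
Proof. by case/andP: (deg_bounds G k). Qed.

(** The component is smooth and homogeneous of degree 1 under dilations, so it equals its own
    derivative at $s=0$ along $s\mapsto\delta_sp$, and this curve leaves the origin in the direction
    of the first-layer part of [p]. *)
Lemma field_deg1 i w j p : lay i w -> deg G j = i.+1 ->
  M w p 0 j = Df (\row_k (if deg G k == 1%N then p 0 k else 0)) (Lf w (co j)) 0.
Proof.
move=> wi ji; have sF := smooth_Lf G w (smooth_co j).
have dp k : isd 0 (fun s => dil s p 0 k) ((\row_k (if deg G k == 1%N then p 0 k else 0)) 0 k).
  have := isd_dil G 0 p k; rewrite !mxE; have := deg1_le k.
  case: (deg G k) => [//|[|n]] _ /=; first by rewrite mulr1 mul1r.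
  by rewrite expr0n mulr0 mul0r.
have := @smooth_chain R N setT _ (fun s => dil s p) _ 0 openT sF Logic.I dp.
have d0 : dil 0 p = 0.
  apply/rowP => l; rewrite dilE expr0n mxE.
  by have := deg1_le l; case: (deg G l) => // m _; rewrite mul0r.
rewrite d0 DfE => H; apply: esym; apply: (isd_unique H).
rewrite (_ : (fun s => _) = fun s => 0 + s * M w p 0 j); first exact: isd_affine.
apply/funext => t; rewrite add0r; have [->|t0] := eqVneq t 0.
  by rewrite d0 mul0r -left_fieldE M0 wi// ji eqn_leq ltnn.
have /mulfI : t ^+ i != 0 by rewrite expf_neq0.
apply; rewrite -[in LHS]left_fieldE mulrA -exprSr -ji -dilE dil_M (dil_layer t wi).
by rewrite [RHS]left_fieldE Lf_scalev -left_fieldE.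
Qed.

(** The vector [v] prescribes the lowest layer of [z]; the higher layers stay free, because a group
    commutator realizes a bracket only up to terms of higher degree. *)
Definition lead i v z := (forall k, (deg G k < i)%N -> z 0 k = 0) /\ (forall k, deg G k = i -> z 0 k = v 0 k).

Lemma lead_mul i v w x y : lead i v x -> lead i w y -> lead i (v + w) (x ** y).
Proof.
move=> [x0 xv] [y0 yw]; split=> k ki.
  by rewrite mul_lowr ?x0 ?y0 ?addr0// => l lk; rewrite y0// (ltn_trans lk).
by rewrite mul_lowr ?xv ?yw ?mxE// => l lk; rewrite y0// -ki.
Qed.

Lemma lead_opp i v z : lead i v z -> lead i (- v) (- z).
Proof. move=> [z0 zv]; split=> k ki; first by rewrite mxE z0 ?oppr0.
by rewrite !mxE zv. Qed.

(** The Baker-Campbell-Hausdorff formula up to its first bracket, the last term being half of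
    $[v,w]_j$ by [br_half]. [mul_tri] replaces [z] by [w], and along the flow $b\mapsto a\cdot bw$
    the $j$-th velocity is constant by [field_deg1]. *)
Lemma lead_next i v w a z j : (1 <= i)%N -> lay 1 v -> lay i w -> lead 1 v a -> lead i w z -> deg G j = i.+1 ->
  (a ** z) 0 j = a 0 j + z 0 j + Df v (Lf w (co j)) 0.
Proof.
move=> i1 v1 wi [_ av] [z0 zw] ji.
have wj : w 0 j = 0 by apply: wi; rewrite ji eqn_leq ltnn.
have -> : (a ** z) 0 j = z 0 j + (a ** w) 0 j.
  have H : (a ** z) 0 j - z 0 j = (a ** w) 0 j - w 0 j.
    apply: mul_tri => k; rewrite ji ltnS leq_eqVlt => /predU1P[/zw//|ki].
    by rewrite z0// wi// neq_ltn ki.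
  by move: H; rewrite wj; move: ((a ** z) 0 j) (z 0 j) ((a ** w) 0 j) => P Q S; lra.
pose K := Df v (Lf w (co j)) 0.
have fK (b : R) : M w (a ** (b *: w)) 0 j = K.
  rewrite (field_deg1 _ wi ji).
  (* For $i=1$ the flow also moves the first layer, by $bw$; this contributes a multiple of the
     derivative of the field of [w] along [w], which vanishes at 0 by [Df_Lf_diag]. *)
  have -> : (\row_k (if deg G k == 1%N then (a ** (b *: w)) 0 k else 0)) = v + (if i == 1%N then b else 0) *: w :> E.
    apply/rowP => k; rewrite mxE [RHS]mxE [X in _ + X]mxE; case: eqP => [k1|/eqP k1].
      rewrite mul_lowr; last by move=> l; rewrite k1 ltnS leqNgt deg1_le.
      rewrite av// mxE; congr (_ + _); have [//|ni] := eqVneq i 1%N.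
      by rewrite wi ?mulr0// k1 eq_sym.
    rewrite v1// add0r; have [i1'|] := eqVneq i 1%N; last by rewrite mul0r.
    by rewrite wi ?mulr0// i1'.
  rewrite Df_add -/K; have [_|_] := eqVneq i 1%N; last first.
    by rewrite scale0r; have := Df_linv 0 0 0 0 (Lf w (co j)) 0; rewrite !scale0r !mul0r !addr0 => ->; rewrite addr0.
  have := Df_linv b 0 w 0 (Lf w (co j)) 0; rewrite scale0r mul0r !addr0 => ->.
  by rewrite Df_Lf_diag mulr0 addr0.
have dg b : isd b (fun b => co j (a ** (b *: w))) K by rewrite -(fK b); exact: isd_flow.
have [c _] := MVT1 ler01 (fun t _ => dg t).
rewrite scale1r scale0r mulg0 subr0 mulr1 /co => H; rewrite -/K; move: H.
by clear fK dg; move: ((a ** w) 0 j) (a 0 j) (z 0 j) K => P Q S U; lra.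
Qed.

(** The commutator [u] satisfies $u\cdot(za)=az$. In degrees up to $i$ the products $az$ and $za$
    are additive along the induction, which forces $u=0$ there; in degree $i+1$ they contain half of
    $[v,w]$ with opposite signs. *)
Lemma lead_comm i v w a z : (1 <= i)%N -> lay 1 v -> lay i w -> lead 1 v a -> lead i w z ->
  lead i.+1 (br v w) (a ** z ** (- a ** - z)).
Proof.
move=> i1 v1 wi la lz; set u := a ** z ** _.
have E1 : u ** (z ** a) = a ** z.
  by rewrite /u -!mulgA (mulgA G (- z)) mulNg mul0g mulNg mulg0.
have [_ av] := la; have [z0 zw] := lz.
have low n : (n <= i)%N -> forall k, (deg G k <= n)%N -> u 0 k = 0.
  elim: n => [_ k|n IH ni k kn]; first by rewrite leqn0 => /eqP k0; have := deg1_le k; rewrite k0.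
  have uk : forall l, (deg G l < deg G k)%N -> u 0 l = 0.
    by move=> l lk; apply: IH; rewrite ?(ltnW ni)// -ltnS (leq_trans lk).
  have zl : forall l, (deg G l < deg G k)%N -> z 0 l = 0.
    by move=> l lk; apply: z0; apply: (leq_trans lk); exact: leq_trans ni.
  have := mul_lowl (z ** a) uk; rewrite E1 mul_lowr// mul_lowl//.
  by move: (a 0 k) (z 0 k) (u 0 k) => P Q S; lra.
have low' k : (deg G k < i.+1)%N -> u 0 k = 0 by rewrite ltnS => ki; exact: (low i).
split=> // k ki.
have uk : forall l, (deg G l < deg G k)%N -> u 0 l = 0 by move=> l; rewrite ki; exact: low'.
have := mul_lowl (z ** a) uk; rewrite E1 (lead_next i1 v1 wi la lz ki).
have -> : (z ** a) 0 k = - (- a ** - z) 0 k.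
  by rewrite -oppM [in RHS]mxE opprK.
have v1' : lay 1 (- v) by move=> l l1; rewrite mxE v1 ?oppr0.
have wi' : lay i (- w) by move=> l li; rewrite mxE wi ?oppr0.
rewrite (lead_next i1 v1' wi' (lead_opp la) (lead_opp lz) ki).
have -> : Df (- v) (Lf (- w) (co k)) 0 = Df v (Lf w (co k)) 0.
  have -> : Lf (- w) (co k) = fun y => (-1) * Lf w (co k) y.
    by apply/funext => y; rewrite -scaleN1r Lf_scalev.
  by rewrite Df_opp Df_scaleF ?mulN1r ?opprK//; exact: smooth_Lf (smooth_co k).
rewrite br_half !mxE; move: (Df _ _ _) (a 0 k) (z 0 k) (u 0 k) => P Q S U; lra.
Qed.

Definition wval (s : seq ('I_N * R)) : E := foldr (fun p z => (p.2 *: e_ p.1) ** z) 0 s.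
Definition wlen (s : seq ('I_N * R)) : R := \sum_(p <- s) `|p.2|.
Definition whor (s : seq ('I_N * R)) := all (fun p => deg G p.1 == 1%N) s.

Lemma wval_cat s t : wval (s ++ t) = wval s ** wval t.
Proof. by elim: s => [|p s IH] /=; rewrite ?mul0g// IH mulgA. Qed.

Lemma reach_word s T x y : whor s -> reach T x y -> reach (T + wlen s) x (y ** wval s).
Proof.
elim: s T y => [|p s IH] T y /=; first by rewrite /wlen big_nil addr0 mulg0.
move=> /andP[/eqP p1 hs] /(reach_hor p.2 p1) r.
by rewrite /wlen big_cons addrA mulgA; exact: IH.
Qed.

(** Besides the length of the word the norm of the point is bounded, so that products of such points
    stay in a compact set and the bound can be propagated by [mul_bound]. *)
Definition wd (C : R) z := `|z| <= C /\ exists s, [/\ whor s, wlen s <= C & z = wval s].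

Lemma wd_mono C D z : C <= D -> wd C z -> wd D z.
Proof. move=> CD [zC [s [s1 s2 zE]]]; split; first exact: le_trans zC CD.
by exists s; split=> //; exact: le_trans s2 CD. Qed.

Lemma wd_opp C z : wd C z -> wd C (- z).
Proof.
move=> [zC [s [hs ls zE]]]; split; first by rewrite normrN.
exists (rev (map (fun p => (p.1, - p.2)) s)); split.
- by rewrite /whor all_rev all_map.
- rewrite /wlen bigop.big_rev big_map/=; apply: le_trans ls; rewrite le_eqVlt; apply/orP; left; apply/eqP.
  by apply: eq_bigr => p _; rewrite normrN.
- rewrite zE; elim: {hs ls zE} s => [|p s IH] /=; first by rewrite oppr0.
  by rewrite rev_cons -cats1 wval_cat -IH/= mulg0 scaleNr oppM.
Qed.

Lemma mul_bound C : exists2 D, 0 < D & forall x y, `|x| <= C -> `|y| <= C -> `|x ** y| <= D.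
Proof.
have cm : forall z : 'rV[R]_(N + N), [set z | `|z| <= C] z -> {for z, continuous (fun z : 'rV[R]_(N + N) => `|lsubmx z ** rsubmx z|)}.
  move=> z _; apply: (@continuous_comp _ _ _ (fun z : 'rV[R]_(N + N) => lsubmx z ** rsubmx z)); last exact: norm_continuous.
  by apply: smap_cont; apply: smap_mul; [exact: smap_lsub|exact: smap_rsub].
have [B B0 HB] := compact_cont_bounded (@compact_cball R _ C) cm.
exists B => // x y xC yC; have := HB (row_mx x y); rewrite row_mxKl row_mxKr normr_id; apply.
have C0 : 0 <= C by apply: le_trans xC.
apply: norm_le_coords => // i; case: (split_ordP i) => k ->.
  by rewrite row_mxEl; exact: le_trans (coord_le_norm _ _) xC.
by rewrite row_mxEr; exact: le_trans (coord_le_norm _ _) yC.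
Qed.

Lemma wd_mul C D : exists B, forall x y, wd C x -> wd D y -> wd B (x ** y).
Proof.
have [B B0 HB] := mul_bound (Num.max C D).
exists (Num.max B (C + D)) => x y [xC [s [hs ls xE]]] [yD [t [ht lt' yE]]]; split.
  by rewrite le_max; apply/orP; left; apply: HB; rewrite le_max ?xC// yD orbT.
rewrite xE yE.
exists (s ++ t); rewrite wval_cat; split => //; first by rewrite /whor all_cat; apply/andP.
by rewrite /wlen big_cat/= le_max; apply/orP; right; exact: lerD.
Qed.

Definition hit C i v := exists2 z, wd C z & lead i v z.

Lemma hit_mono C D i v : C <= D -> hit C i v -> hit D i v.
Proof. by move=> CD [z zC zl]; exists z => //; exact: wd_mono zC. Qed.

Lemma hit0 i C : 0 <= C -> hit C i 0.
Proof.
move=> C0; exists 0; last by split=> k _; rewrite !mxE.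
by split; [rewrite normr0|exists [::]; split=> //; rewrite /wlen big_nil].
Qed.

Lemma fin_max n (P : 'I_n -> R -> Prop) : (forall k C D, C <= D -> P k C -> P k D) ->
  (forall k, exists C, P k C) -> exists C, forall k, P k C.
Proof.
move=> mono /choice[C HC]; exists (\sum_k `|C k|) => k.
apply: mono (HC k); rewrite (bigD1 k)//=; apply: (le_trans (ler_norm _)).
by rewrite lerDl; apply: sumr_ge0.
Qed.

Lemma hit_sum n C i : exists D, forall a : 'I_n -> E, (forall k, hit C i (a k)) -> hit D i (\sum_k a k).
Proof.
elim: n => [|n [D IH]]; first by exists 0 => a _; rewrite big_ord0; exact: hit0.
have [B HB] := wd_mul D C; exists B => a Ha; rewrite big_ord_recr/=.
have [x xD lx] := IH (fun k => a (widen_ord (leqnSn n) k)) (fun k => Ha _).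
have [y yC ly] := Ha ord_max.
by exists (x ** y); [exact: HB|exact: lead_mul].
Qed.

Lemma hit1 (rho : R) : exists C, forall v, lay 1 v -> `|v| <= rho -> hit C 1 v.
Proof.
have [D HD] := hit_sum N rho 1; exists D => v v1 vr; rewrite (vec_sum v); apply: HD => k.
have rho0 : 0 <= rho by exact: le_trans vr.
have [k1|k1] := eqVneq (deg G k) 1%N; last by rewrite v1// scale0r; exact: hit0.
have vk : `|v 0 k| <= rho by exact: le_trans (coord_le_norm _ _) vr.
exists (v 0 k *: e_ k).
  split.
    rewrite normrZ; apply: (@le_trans _ _ (`|v 0 k| * 1)); last by rewrite mulr1.
    by apply: ler_wpM2l => //; exact: norm_basis_vec.
  exists [:: (k, v 0 k)]; split; [by rewrite /whor/= k1|by rewrite /wlen big_seq1|].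
  by rewrite /= mulg0.
by split=> // l; rewrite ltnS leqn0 => /eqP l0; have := deg1_le l; rewrite l0.
Qed.

(** The scalar [c] is put on the first-layer factor, so that [q] stays fixed; the commutator of a
    word leading with [c p] and a word leading with [q] has the required lowest layer. *)
Lemma hit_bracket i p q (rho : R) : (1 <= i)%N -> lay 1 p -> lay i q ->
  (forall rho, exists C, forall v, lay i v -> `|v| <= rho -> hit C i v) ->
  exists C, forall c : R, `|c| <= rho -> hit C i.+1 (c *: br p q).
Proof.
move=> i1 p1 qi Hi; have [C HC] := hit1 (rho * `|p|); have [D HD] := Hi `|q|.
have [B1 HB1] := wd_mul C D; have [B HB] := wd_mul B1 B1.
exists B => c crho; rewrite -lieZl.
have cp1 : lay 1 (c *: p) by move=> k k1; rewrite mxE p1 ?mulr0.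
have [a aC la] : hit C 1 (c *: p) by apply: HC => //; rewrite normrZ ler_wpM2r.
have [z zD lz] := HD q qi (lexx _).
exists (a ** z ** (- a ** - z)); last exact: lead_comm.
by apply: (HB); apply: HB1 => //; exact: wd_opp.
Qed.

(** Each basis vector of the next layer has one fixed expression by brackets, and only the
    coordinates of [v], bounded by [rho], vary. The length of the words is therefore uniform in
    [v]. *)
Lemma hit_layer i : (1 <= i <= nlayers G)%N -> forall rho : R, exists C, forall v, lay i v -> `|v| <= rho -> hit C i v.
Proof.
elim: i => [//|i IH] /andP[_ iN] rho.
have [->|i0] := posnP i; first exact: hit1.
have Hi := IH (introT andP (conj i0 (ltnW iN))).
have Hj (j : 'I_N) : exists C, forall v, lay i.+1 v -> `|v| <= rho -> hit C i.+1 (v 0 j *: e_ j).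
  have [ji|ji] := eqVneq (deg G j) i.+1; last first.
    by exists 0 => v vi _; rewrite vi// scale0r; exact: hit0.
  have bl : (1 <= i < nlayers G)%N by rewrite i0.
  have : lay i.+1 (e_ j) by rewrite -ji; exact: basis_layer.
  rewrite -(bracket_layer bl) => -[n [c [a [Ha eE]]]].
  have Hk (k : 'I_n) : exists C, forall t : R, `|t| <= rho -> hit C i.+1 (t *: (c k *: a k)).
    have [p [q [p1 qi ->]]] := Ha k.
    have [C HC] := hit_bracket (rho * `|c k|) i0 p1 qi Hi; exists C => t tr.
    by rewrite scalerA -brE; apply: HC; rewrite normrM ler_wpM2r.
  have [|C HC] := fin_max _ Hk.
    by move=> k C D CD H t tr; exact: hit_mono (H t tr).
  have [D HD] := hit_sum n C i.+1; exists D => v vi vr; rewrite eE scaler_sumr.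
  by apply: HD => k; apply: HC; exact: le_trans (coord_le_norm _ _) vr.
have [|C HC] := fin_max _ Hj.
  by move=> k C D CD H v v1 v2; exact: hit_mono (H v v1 v2).
have [D HD] := hit_sum N C i.+1; exists D => v vi vr; rewrite (vec_sum v).
by apply: HD => k; exact: HC.
Qed.

(** Once [z] matches [x] up to layer $i$, the next layer of the remainder $-z\cdot x$ is realized by
    a word that starts in that layer and so leaves the lower ones alone. After the last layer the
    remainder is exactly 0, without any inverse function theorem. *)
Lemma peel i : (i <= nlayers G)%N -> forall rho : R, exists C, forall x, `|x| <= rho ->
  exists2 z, wd C z & forall k, (deg G k <= i)%N -> (- z ** x) 0 k = 0.
Proof.
elim: i => [_ rho|i IH iN rho].
  exists 0 => x _; exists 0; first by split; [rewrite normr0|exists [::]; split=> //; rewrite /wlen big_nil].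
  by move=> k; rewrite leqn0 => /eqP k0; have := deg1_le k; rewrite k0.
have [C HC] := IH (ltnW iN) rho.
have [D D0 HD] := mul_bound (Num.max C rho).
have [B HB] := hit_layer (introT andP (conj (ltn0Sn i) iN)) D.
have [A HA] := wd_mul C B; exists A => x xr.
have [z zC zk] := HC x xr; pose y := - z ** x.
have yD : `|y| <= D by apply: HD; rewrite ?normrN le_max ?xr ?orbT//; case: zC => ->.
pose v : E := \row_k (if deg G k == i.+1 then y 0 k else 0).
have vi : lay i.+1 v by move=> k ki; rewrite mxE (negbTE ki).
have vD : `|v| <= D.
  apply: norm_le_coords => [|k]; first exact: ltW.
  rewrite mxE; case: ifP => _; first exact: le_trans (coord_le_norm _ _) yD.
  by rewrite normr0 ltW.
have [z' z'B [z'0 z'v]] := HB v vi vD.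
exists (z ** z'); first exact: HA.
move=> k ki; rewrite oppM -mulgA -/y mul_lowl; last first.
  by move=> l lk; rewrite mxE z'0 ?oppr0// (leq_trans lk).
rewrite mxE; move: ki; rewrite leq_eqVlt => /predU1P[ki|ki].
  by rewrite z'v// mxE ki eqxx addNr.
by rewrite z'0// oppr0 add0r; apply: zk; rewrite -ltnS.
Qed.

Lemma reach_bounded (rho : R) : exists2 C, 0 <= C & forall x, `|x| <= rho -> exists2 T, T <= C & reach T 0 x.
Proof.
have [C HC] := peel (leqnn _) rho.
exists `|C| => // x xr; have [z [_ [s [hs ls zE]]] zk] := HC x xr.
have -> : x = z.
  rewrite -[LHS](mulVKg G z) (_ : - z ** x = 0) ?mulg0//.
  by apply/rowP => k; rewrite mxE; apply: zk; case/andP: (deg_bounds G k).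
exists (wlen s); first exact: le_trans (ler_norm _).
by have := reach_word hs (reach0 G 0); rewrite add0r mul0g zE.
Qed.

Local Notation cc := (cc_dist G).

Lemma reach_any x y : [set T | reach T x y] !=set0.
Proof.
have [C _ H] := reach_bounded `|- x ** y|; have [T _ r] := H _ (lexx _).
by exists T; have := reach_trans x r; rewrite mulg0 mulVKg.
Qed.

Lemma reach_lb x y : has_lbound [set T | reach T x y].
Proof. by exists 0 => T /reach_ge0. Qed.

Lemma cc_bounded (rho : R) : exists2 C, 0 <= C & forall x, `|x| <= rho -> cc 0 x <= C.
Proof.
have [C C0 HC] := reach_bounded rho; exists C => // x /HC[T TC r].
by apply: le_trans TC; rewrite cc_distE; apply: ge_inf => //; exact: reach_lb.
Qed.

Lemma cc_trans_le a x y : cc (a ** x) (a ** y) <= cc x y.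
Proof.
rewrite !cc_distE; apply: lb_le_inf; first exact: reach_any.
by move=> T r; apply: ge_inf; [exact: reach_lb|exact: reach_trans].
Qed.

Lemma cc_trans a x y : cc (a ** x) (a ** y) = cc x y.
Proof. by apply/eqP; rewrite eq_le cc_trans_le/= -{1}(mulKg G a x) -{1}(mulKg G a y) cc_trans_le. Qed.

Lemma cc_dil (s : R) x y : 0 < s -> cc (dil s x) (dil s y) <= s * cc x y.
Proof.
move=> s0; rewrite !cc_distE -ler_pdivrMl//; apply: lb_le_inf; first exact: reach_any.
move=> T r; rewrite ler_pdivrMl//; apply: ge_inf; first exact: reach_lb.
exact: reach_dil.
Qed.

Lemma cc_norm : exists2 A, 0 < A & forall z, Num.min `|z| 1 <= A * cc 0 z.
Proof.
have [A A0 HA] := reach_speed G; exists A => // z.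
rewrite cc_distE -ler_pdivrMl//; apply: lb_le_inf; first exact: reach_any.
by move=> T r; rewrite ler_pdivrMl//; exact: HA.
Qed.

End chow.

(** * Series *)

Section series.
Context {R : realType}.
Notation I := integral_rV.
Implicit Types (a : nat -> R) (M L : R).

Definition half (n : nat) : R := 2^-1 ^+ n.

Lemma half_gt0 n : 0 < half n.
Proof. by rewrite exprn_gt0// invr_gt0. Qed.

Lemma halfS n : half n.+1 = half n / 2.
Proof. by rewrite /half exprSr. Qed.

Lemma half_le m n : (m <= n)%N -> half n <= half m.
Proof.
move=> /subnK <-; rewrite /half exprD ler_piMl ?exprn_ge0 ?invr_ge0//.
by rewrite exprn_ile1 ?invr_ge0// invf_le1 ?ler1n.
Qed.

Lemma half_small M (e : R) : 0 < e -> exists n, forall m, (n <= m)%N -> M * half m < e.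
Proof.
move=> e0; exists (Num.truncn (`|M| / e)).+1 => m nm.
have h : (`|M| / e < m.+1%:R)%R.
  apply: lt_le_trans (truncnS_gt _) _; rewrite ler_nat; exact: leqW.
apply: (@le_lt_trans _ _ (`|M| * half m)); first by rewrite ler_wpM2r ?ler_norm// ltW// half_gt0.
have p2 : (m.+1%:R : R) <= 2 ^+ m by rewrite -natrX ler_nat; exact: ltn_expl.
rewrite /half exprVn ltr_pdivrMr ?exprn_gt0// mulrC -ltr_pdivrMr//.
exact: lt_le_trans h p2.
Qed.

Lemma half_eq0 M K (x : R) : (forall n, (K <= n)%N -> `|x| <= M * half n) -> x = 0.
Proof.
move=> H; apply/eqP; rewrite -normr_eq0.
apply/negPn/negP => x0; have xp : 0 < `|x| by rewrite lt_neqAle eq_sym x0 normr_ge0.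
have [n Hn] := half_small M xp; have := Hn _ (leq_maxl n K).
by rewrite ltNge H// leq_maxr.
Qed.

Lemma half_le_lim M K (x y : R) : (forall n, (K <= n)%N -> x <= y + M * half n) -> x <= y.
Proof.
move=> H; rewrite leNgt; apply/negP => xy.
have xp : 0 < x - y by rewrite subr_gt0.
have [n Hn] := half_small M xp; have := Hn _ (leq_maxl n K).
by rewrite ltNge lerBlDl H// leq_maxr.
Qed.

Definition psum a n : R := \sum_(k < n) a k.

(** The limit is characterized by an error of order $2^{-n}$, which makes it unique ([tsum_uniq]);
    other sequences get the default value 0. *)
Definition tsum a : R := xget 0 [set L | exists M K, forall n, (K <= n)%N -> `|L - psum a n| <= M * half n].

(** The bound is the exact sum of the geometric majorant, which lets the induction on [d] close. *)
Lemma psum_tail a M K (q : R) : 0 <= q < 1 -> (forall k, (K <= k)%N -> `|a k| <= M * q ^+ k) ->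
  forall n d, (K <= n)%N -> `|psum a (n + d) - psum a n| <= M / (1 - q) * q ^+ n - M / (1 - q) * q ^+ (n + d).
Proof.
move=> /andP[q0 q1] Ha n; have q1n : 1 - q != 0 by rewrite subr_eq0 gt_eqF.
elim=> [|d IH] Kn; first by rewrite addn0 !subrr normr0.
rewrite addnS /psum big_ord_recr/= -/(psum a (n + d)) addrAC.
apply: (le_trans (ler_normD _ _)).
have := IH Kn; have := Ha (n + d)%N (leq_trans Kn (leq_addr _ _)).
have -> : M * q ^+ (n + d) = M / (1 - q) * q ^+ (n + d) - M / (1 - q) * q ^+ (n + d).+1.
  by rewrite exprS; field.
move: (M / (1 - q) * _) (M / (1 - q) * _) (M / (1 - q) * _) (`|_|) (`|_|) => t u v r s; lra.
Qed.

Lemma tsum_uniq a M K L : (forall n, (K <= n)%N -> `|L - psum a n| <= M * half n) -> tsum a = L.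
Proof.
move=> HL; rewrite /tsum; case: xgetP => [L' _ [M' [K' HL']]|/(_ L) []]; last by exists M, K.
apply/eqP; rewrite -subr_eq0; apply/eqP; apply: (@half_eq0 (M + M') (maxn K K')) => n; rewrite geq_max => /andP[Kn Kn'].
rewrite (_ : L' - L = (L' - psum a n) - (L - psum a n)); last by ring.
apply: (le_trans (ler_normB _ _)); have := HL n Kn; have := HL' n Kn'.
by move: (`|_|) (`|_|) (half n) => p q r; lra.
Qed.

Lemma geometric_tail a M K (q : R) : 0 < q < 1 -> (forall k, (K <= k)%N -> `|a k| <= M * q ^+ k) ->
  exists L, forall n, (K <= n)%N -> `|L - psum a n| <= M / (1 - q) * q ^+ n.
Proof.
move=> /andP[q0 q1] Ha; have q01 : 0 <= q < 1 by rewrite ltW.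
have M0 : 0 <= M.
  by have := Ha K (leqnn _) => /(le_trans (normr_ge0 _)); rewrite pmulr_lge0// exprn_gt0.
(* The limit is the infimum of the upper envelopes of the partial sums; by [cmp] every lower
   envelope lies below every upper one. *)
pose S := [set psum a n + M / (1 - q) * q ^+ n | n in [set n | (K <= n)%N]].
have cmp m n : (K <= m)%N -> (K <= n)%N -> psum a m - M / (1 - q) * q ^+ m <= psum a n + M / (1 - q) * q ^+ n.
  move=> Km Kn.
  have P j : 0 <= M / (1 - q) * q ^+ j by rewrite mulr_ge0 ?divr_ge0 ?subr_ge0 ?exprn_ge0// ltW.
  have [/subnK mn|/ltnW/subnK mn] := leqP m n.
    have := psum_tail q01 Ha (n - m) Km; rewrite addnC mn ler_norml => /andP[].
    by have := P n; have := P m; move: (psum a n) (psum a m) (_ * q ^+ m) (_ * q ^+ n) => p q' r s; lra.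
  have := psum_tail q01 Ha (m - n) Kn; rewrite addnC mn ler_norml => /andP[].
  by have := P n; have := P m; move: (psum a n) (psum a m) (_ * q ^+ m) (_ * q ^+ n) => p q' r s; lra.
have S0 : S !=set0 by exists (psum a K + M / (1 - q) * q ^+ K); exists K => //=; exact: leqnn.
have lb m : (K <= m)%N -> lbound S (psum a m - M / (1 - q) * q ^+ m).
  by move=> Km _ [n Kn <-]; exact: cmp.
exists (inf S) => n Kn; rewrite ler_distl; apply/andP; split.
  by apply: lb_le_inf => //; exact: lb.
by apply: ge_inf; [exists (psum a K - M / (1 - q) * q ^+ K); exact: lb|exists n].
Qed.

Lemma tsum_tail a M K : (forall k, (K <= k)%N -> `|a k| <= M * half k) ->
  forall n, (K <= n)%N -> `|tsum a - psum a n| <= 2 * M * half n.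
Proof.
have h01 : 0 < (2^-1 : R) < 1 by rewrite invr_gt0 ltr0Sn invf_lt1// ltr1n.
move=> /(geometric_tail h01)[L HL].
have E1 : M / (1 - 2^-1) = 2 * M by field.
by rewrite E1 in HL; rewrite (tsum_uniq HL).
Qed.

Variable N : nat.
Local Notation E := 'rV[R]_N.

Definition ssum (g : nat -> E -> R) (x : E) : R := tsum (fun k => g k x).

(** The rank from which the bound holds may depend on the derivative. This is what the gliding hump
    provides, and it makes the class stable under partial derivatives. *)
Definition fast (g : nat -> E -> R) := (forall k, smooth setT (g k)) /\
  forall w, exists K, forall k x, (K <= k)%N -> `|partials w (g k) x| <= half k.

Lemma fast_tail g : fast g -> exists K, forall n x, (K <= n)%N -> `|ssum g x - psum (fun k => g k x) n| <= 2 * half n.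
Proof.
move=> [_ /(_ [::])[K HK]]; exists K => n x Kn; rewrite -[2 * half n](_ : 2 * 1 * half n = _); last by rewrite mulr1.
by apply: (tsum_tail (K := K)) => // k Kk; rewrite mul1r; exact: HK.
Qed.

Lemma fast_partial g i : fast g -> fast (fun k => partial i (g k)).
Proof.
move=> [sg Hg]; split=> [k|w]; first exact: smooth_partial.
by have [K HK] := Hg (w ++ [:: i]); exists K => k x Kk; have := HK k x Kk; rewrite partials_cat.
Qed.

Lemma psum_cont (g : nat -> E -> R) n : (forall k, smooth setT (g k)) -> continuous (fun x => psum (fun k => g k x) n).
Proof. by move=> sg x; apply: cont_sum => k; exact: smoothT_cont. Qed.

Lemma ssum_cont g : fast g -> continuous (ssum g).
Proof.
move=> fg x; apply/contP => e e0; have [K HK] := fast_tail fg.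
have [n Hn] := half_small 4 (divr_gt0 e0 (ltr0Sn R 1)).
pose m := maxn n K; have mn : (n <= m)%N := leq_maxl _ _; have mK : (K <= m)%N := leq_maxr _ _.
have [d d0 Hd] := (contP _ _).1 (@psum_cont g m fg.1 x) _ (divr_gt0 e0 (ltr0Sn R 1)).
exists d => // y /Hd; have := HK m x mK; have := HK m y mK; have := Hn m mn.
move: (ssum g x) (ssum g y) (psum _ m) (psum _ m) (half m) => p q r s t h1.
rewrite !ler_norml !ltr_norml => /andP[? ?] /andP[? ?] /andP[? ?]; apply/andP; split; lra.
Qed.

(** The terms have Taylor remainders $b_kh^2$ with summable $b_k$: finitely many second derivatives
    are bounded by compactness of a segment, the others by $2^{-k}$. *)
Lemma ssum_derive g x i : fast g -> is_derive x (basis_vec i) (ssum g) (ssum (fun k => partial i (g k)) x).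
Proof.
move=> fg; have fg1 := fast_partial i fg; have fg2 := fast_partial i fg1.
have [K0 HK0] := fast_tail fg; have [K1 HK1] := fast_tail fg1.
have [K HK] := fg2.2 [::].
have bd k : exists B, 0 <= B /\ forall t : R, `|t| <= 1 -> `|partial i (partial i (g k)) (x + t *: basis_vec i)| <= B.
  have [B B0 HB] := compact_cont_bounded (@compact_cball R N (`|x| + 1)) (fun y _ => smoothT_cont (fg2.1 k) (x := y)).
  exists B; split=> [|t t1]; first exact: ltW.
  apply: HB; apply: (le_trans (ler_normD _ _)); rewrite lerD2l normrZ.
  by apply: (le_trans (ler_wpM2l (normr_ge0 _) (norm_basis_vec i))); rewrite mulr1.
have /choice[B HB] := bd.
pose C := \sum_(k < K) B k + 2 * half K.
pose b k := if (k < K)%N then B k else half k.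
have bE k t : `|t| <= 1 -> `|partial i (partial i (g k)) (x + t *: basis_vec i)| <= b k.
  move=> t1; rewrite /b; case: ltnP => kK; first exact: (HB k).2.
  exact: HK.
have sb n : \sum_(k < K + n) b k <= C - 2 * half (K + n).
  elim: n => [|n IH].
    rewrite addn0 /C addrK le_eqVlt; apply/orP; left; apply/eqP.
    by apply: eq_bigr => k _; rewrite /b ltn_ord.
  rewrite addnS big_ord_recr/= {2}/b ltnNge leq_addr/= halfS.
  by move: IH; move: (\sum_(k < _) _) (half _) C => p q r; lra.
apply: (@is_derive_quad R N _ x i _ C) => h h1.
(* Three tails are neglected, those of the series at the two points and that of the series of
   derivatives, each at most [2 * half n]. *)
apply: (@half_le_lim 6 (maxn K (maxn K0 K1))) => n; rewrite !geq_max => /and3P[nK n0 n1].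
have T k : `|g k (x + h *: basis_vec i) - g k x - h * partial i (g k) x| <= b k * h ^+ 2.
  by apply: taylor2 (fg.1 k) _ => t th; apply: bE; exact: le_trans th h1.
have P : `|psum (fun k => g k (x + h *: basis_vec i)) n - psum (fun k => g k x) n - h * psum (fun k => partial i (g k) x) n| <= C * h ^+ 2.
  rewrite /psum mulr_sumr -!sumrB; apply: (le_trans (ler_norm_sum _ _ _)).
  apply: (@le_trans _ _ ((\sum_(k < n) b k) * h ^+ 2)); first by rewrite mulr_suml; exact: ler_sum.
  apply: ler_wpM2r; first exact: sqr_ge0.
  rewrite -(subnKC nK); apply: (le_trans (sb _)).
  by rewrite gerBl mulr_ge0// ltW// half_gt0.
have h0 := HK0 n (x + h *: basis_vec i) n0; have h0' := HK0 n x n0; have h1' := HK1 n x n1.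
have h2 : `|h * ssum (fun k => partial i (g k)) x - h * psum (fun k => partial i (g k) x) n| <= 2 * half n.
  rewrite -mulrBr normrM; apply: le_trans h1'.
  by rewrite ler_piMl.
move: P h0 h0' h2.
move: (psum _ n) (psum _ n) (h * psum _ n) (ssum g _) (ssum g x) (h * ssum _ x) (C * h ^+ 2) (half n) => p q r s t u c z.
rewrite !ler_norml => /andP[? ?] /andP[? ?] /andP[? ?] /andP[? ?]; apply/andP; split; lra.
Qed.

Lemma smooth_ssum g : fast g -> smooth setT (ssum g).
Proof.
move=> fg; apply: (@smooth_coind _ _ _ (fun f => exists2 g, fast g & f = ssum g)) => //.
- exact: openT.
- move=> f [{}g {}fg ->] x _; split; first exact: ssum_cont.
  by move=> i; case: (ssum_derive x i fg).
- move=> f i [{}g {}fg ->]; exists (ssum (fun k => partial i (g k))).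
    by exists (fun k => partial i (g k)) => //; exact: fast_partial.
  by move=> x _; case: (ssum_derive x i fg).
- by exists g.
Qed.

End series.

(** * Distributions and transposes *)

Section distributions.
Context {R : realType} {N : nat}.
Notation I := integral_rV.
Local Notation E := 'rV[R]_N.
Implicit Types (phi psi chi f g : E -> R).

Lemma dist_lin Om (U : functional R N) (a : R) phi psi : distribution_on Om U -> test Om phi -> test Om psi ->
  U (fun x => a * phi x + psi x) = a * U phi + U psi.
Proof. by move=> [H _]; exact: H. Qed.

Lemma distD Om (U : functional R N) phi psi : distribution_on Om U -> test Om phi -> test Om psi ->
  U (fun x => phi x + psi x) = U phi + U psi.
Proof.
move=> dU t1 t2; have := dist_lin 1 dU t1 t2; rewrite mul1r => <-.
by congr U; apply/funext => x; rewrite mul1r.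
Qed.

Lemma distZ Om (U : functional R N) (a : R) phi : distribution_on Om U -> test Om phi ->
  U (fun x => a * phi x) = a * U phi.
Proof.
move=> dU t1; have U0 : U (fun=> 0) = 0.
  have := distD dU (test0 Om) (test0 Om); rewrite (_ : (fun x => 0 + 0) = fun=> 0).
    by move: (U _) => r; lra.
  by apply/funext => x; rewrite addr0.
have := dist_lin a dU t1 (test0 Om); rewrite U0 addr0 => <-.
by congr U; apply/funext => x; rewrite addr0.
Qed.

Lemma distB Om (U : functional R N) phi psi : distribution_on Om U -> test Om phi -> test Om psi ->
  U (fun x => phi x - psi x) = U phi - U psi.
Proof.
move=> dU t1 t2; rewrite -mulN1r -(distZ (-1) dU t2) -(distD dU t1 (test_scale (-1) t2)).
by congr U; apply/funext => x; rewrite mulN1r.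
Qed.

Lemma Cc_test Om g phi : open Om -> (forall x, Om x -> {for x, continuous g}) -> test Om phi ->
  Cc (fun x => g x * phi x).
Proof.
move=> oO cg [sp [C [cC CO C0]]]; have sphi : smooth setT phi by constructor.
apply: (Cc_compact cC) => [x|x /C0 ->]; last by rewrite mulr0.
have [xO|xO] := pselect (Om x); first by apply: cont_mul; [exact: cg|exact: smoothT_cont].
have E1 : \forall z \near x, 0 = g z * phi z.
  near=> z; rewrite C0 ?mulr0//; near: z; apply: open_nbhs_nbhs; split; last by move=> /CO.
  by apply: closed_openC; exact: compact_closedR.
by apply: (cont_eqnear E1); exact: cst_continuous.
Unshelve. all: by end_near. Qed.

Lemma dist_of_cont Om g : open Om -> (forall x, Om x -> {for x, continuous g}) -> distribution_on Om (of_fun g).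
Proof.
move=> oO cg; split.
  move=> a phi psi t1 t2; rewrite /of_fun -intZ; last exact: Cc_test oO cg t1.
  rewrite -intD; [|apply: Cc_scale; exact: Cc_test oO cg t1|exact: Cc_test oO cg t2].
  by congr I; apply/funext => x; ring.
move=> C cC CO; have [r r0 Hr] := compact_sub_cball cC.
have [B B0 HB] := compact_cont_bounded cC (fun x Cx => cg x (CO x Cx)).
exists (B * vol N r), 0%N => phi D sphi phi0 phiD.
have tphi : test Om phi by split=> //; exists C.
have D0 : 0 <= D by apply: le_trans (phiD [::] 0 isT).
rewrite mulrAC; apply: int_bound; rewrite ?(ltW r0)//.
- by have [] := Cc_test oO cg tphi.
- by move=> x rx; rewrite phi0 ?mulr0// => /Hr; rewrite leNgt rx.
- move=> x _; rewrite normrM; have [Cx|Cx] := pselect (C x).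
    by apply: ler_pM => //; [exact: HB|exact: phiD [::] x isT].
  by rewrite phi0// normr0 mulr0 mulr_ge0// ltW.
Qed.

(** Tested on Dirac masses, the homogeneity and the left invariance of the action on distributions
    become pointwise identities for the transpose ([tr_trans], [tr_dil]). *)
Lemma dist_eval (x : E) : distribution_on setT (fun phi => phi x : R).
Proof.
split=> // C _ _; exists 1, 0%N => phi B _ _ HB; rewrite mul1r; exact: (HB [::] x isT).
Qed.

Lemma dist_comb Om (U V : functional R N) (a : R) : distribution_on Om U -> distribution_on Om V ->
  distribution_on Om (fun phi => U phi + a * V phi).
Proof.
move=> dU dV; split.
  move=> b phi psi t1 t2; rewrite (dist_lin b dU t1 t2) (dist_lin b dV t1 t2).
  by move: (U phi) (U psi) (V phi) (V psi) => p q r s; ring.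
move=> C cC CO; have [M [m HM]] := dU.2 C cC CO; have [M' [m' HM']] := dV.2 C cC CO.
exists (M + `|a| * M'), (maxn m m') => phi B sphi phi0 HB.
rewrite mulrDl -mulrA; apply: (le_trans (ler_normD _ _)); apply: lerD.
  by apply: HM => // w x wm; apply: HB; rewrite leq_max wm.
rewrite normrM; apply: ler_wpM2l => //.
by apply: HM' => // w x wm; apply: HB; rewrite leq_max wm orbT.
Qed.

Lemma partial_add i f g : smooth setT f -> smooth setT g ->
  partial i (fun x => f x + g x) = fun x => partial i f x + partial i g x.
Proof.
move=> sf sg; apply/funext => x.
by have [_] := is_deriveD (smooth_is_derive i sf (x := x) Logic.I) (smooth_is_derive i sg (x := x) Logic.I).
Qed.

Lemma partials_add w f g : smooth setT f -> smooth setT g ->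
  partials w (fun x => f x + g x) = fun x => partials w f x + partials w g x.
Proof.
move=> sf sg; elim: w => [//|i w IH] /=.
by rewrite IH partial_add//; exact: smooth_partials.
Qed.

Lemma partialsZ w (a : R) f : smooth setT f -> partials w (fun y => a * f y) = fun y => a * partials w f y.
Proof.
move=> sf; elim: w => [//|i w IH] /=; rewrite IH; apply/funext => y.
by have [_] := is_deriveZ a (smooth_is_derive i (smooth_partials w sf) (x := y) Logic.I).
Qed.

Lemma partials_rcons w i f : partials (rcons w i) f = partials w (partial i f).
Proof. by rewrite -cats1 partials_cat. Qed.

(** The innermost derivative of the word is expanded by the product rule, which leaves words of
    order one less applied to products of [chi] or its partials with [phi] or its partials. *)
Lemma leibniz_bound (C : set E) m : compact C -> forall chi, smooth setT chi -> exists2 M, 0 <= M &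
  forall phi B, smooth setT phi -> (forall x, ~ C x -> phi x = 0) ->
  (forall w x, (size w <= m)%N -> `|partials w phi x| <= B) ->
  forall w x, (size w <= m)%N -> `|partials w (fun x => chi x * phi x) x| <= M * B.
Proof.
move=> cC; elim: m => [|m IH] chi schi.
  have [M M0 HM] := compact_cont_bounded cC (fun x _ => smoothT_cont schi (x := x)).
  exists M => [|phi B sphi phi0 HB [|//] x _]; first exact: ltW.
  rewrite /= normrM; have [Cx|/phi0 ->] := pselect (C x).
    by apply: ler_pM => //; [exact: HM|exact: (HB [::])].
  by rewrite normr0 mulr0 mulr_ge0 ?(ltW M0)// (le_trans _ (HB [::] x isT)).
have [M0 M00 HM0] := IH chi schi.
have /choice[M HM] : forall i : 'I_N, exists M, 0 <= M /\ forall phi B, smooth setT phi -> (forall x, ~ C x -> phi x = 0) ->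
    (forall w x, (size w <= m)%N -> `|partials w phi x| <= B) ->
    forall w x, (size w <= m)%N -> `|partials w (fun x => partial i chi x * phi x) x| <= M * B.
  by move=> i; have [M ? ?] := IH _ (smooth_partial i schi); exists M.
exists (M0 + \sum_i M i); first by rewrite addr_ge0// sumr_ge0// => i _; exact: (HM i).1.
move=> phi B sphi phi0 HB w x; have B0 : 0 <= B by apply: le_trans (HB [::] x isT).
have HBm v y : (size v <= m)%N -> `|partials v phi y| <= B by move=> vm; apply: HB; exact: leqW.
case: (lastP w) => [_|v i].
  apply: (le_trans (HM0 phi B sphi phi0 HBm [::] x isT)); apply: ler_wpM2r => //.
  by rewrite lerDl sumr_ge0// => i _; exact: (HM i).1.
rewrite size_rcons ltnS => vm; rewrite partials_rcons.
have -> : partial i (fun x => chi x * phi x) = fun x => partial i chi x * phi x + chi x * partial i phi x.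
  by apply/funext => y; rewrite partial_mul.
rewrite partials_add; [|apply: smooth_mul => //; [exact: openT|exact: smooth_partial]..].
apply: (le_trans (ler_normD _ _)); rewrite mulrDl addrC; apply: lerD.
  apply: HM0 => //; first exact: smooth_partial.
    by apply: partial_supp => //; exact: compact_closedR.
  by move=> u y um; rewrite -partials_rcons; apply: HB; rewrite size_rcons.
apply: le_trans ((HM i).2 phi B sphi phi0 HBm v x vm) _; apply: ler_wpM2r => //.
by rewrite (bigD1 i)//= lerDl sumr_ge0// => j _; exact: (HM j).1.
Qed.

Lemma dist_mul Om (U : functional R N) chi : distribution_on Om U -> smooth setT chi ->
  distribution_on Om (fun phi => U (fun x => chi x * phi x)).
Proof.
move=> dU schi; split.
  move=> a phi psi t1 t2; rewrite -(dist_lin a dU (test_mul schi t1) (test_mul schi t2)).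
  by congr U; apply/funext => x; ring.
move=> C cC CO; have [M [m HM]] := dU.2 C cC CO; have [M' M'0 HM'] := leibniz_bound m cC schi.
exists (M * M'), m => phi B /Smooth sphi phi0 HB; rewrite -mulrA; apply: HM.
- by case: (smooth_mul openT schi sphi).
- by move=> x /phi0 ->; rewrite mulr0.
- exact: HM'.
Qed.

Lemma tr_app_eqnear (L : diffop R N) f g x : (\forall z \near x, f z = g z) ->
  diffop_tr_app L f x = diffop_tr_app L g x.
Proof.
move=> fg; apply: eq_bigr => k _; congr (_ * _).
have E1 : \forall z \near x, coef k z * f z = coef k z * g z by near=> z; congr (_ * _); near: z.
exact: nbhs_singleton (partials_eqnear (rev (word k)) E1).
Unshelve. all: by end_near. Qed.

Lemma tr_app_lin (L : diffop R N) (a : R) f g x : smooth setT f -> smooth setT g ->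
  diffop_tr_app L (fun y => a * f y + g y) x = a * diffop_tr_app L f x + diffop_tr_app L g x.
Proof.
move=> sf sg; rewrite /diffop_tr_app mulr_sumr -big_split; apply: eq_bigr => k _ /=.
have sc : smooth setT (@coef R N L k) by constructor; exact: coef_smooth.
rewrite (_ : (fun y => _) = fun y => a * (coef k y * f y) + coef k y * g y); last first.
  by apply/funext => y; ring.
have scf : smooth setT (fun y => coef k y * f y) by apply: smooth_mul => //; exact: openT.
have scg : smooth setT (fun y => coef k y * g y) by apply: smooth_mul => //; exact: openT.
rewrite partials_add//; last by apply: smooth_scale => //; exact: openT.
by rewrite partialsZ// mulrDr mulrCA.
Qed.

Lemma tr_appZ (L : diffop R N) (a : R) f : smooth setT f ->
  diffop_tr_app L (fun y => a * f y) = fun x => a * diffop_tr_app L f x.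
Proof.
move=> sf; have s0 : smooth setT (fun _ : E => 0 : R) by apply: smooth_cst; exact: openT.
have H0 x : diffop_tr_app L (fun=> 0) x = 0.
  have := @tr_app_lin L 1 (fun=> 0) (fun=> 0) x s0 s0.
  have -> : (fun _ : E => 1 * 0 + 0) = (fun=> 0 : R) by apply/funext => y; rewrite mulr0 addr0.
  by move: (diffop_tr_app _ _ _) => r; lra.
apply/funext => x; have := tr_app_lin L a x sf s0; rewrite H0 addr0 => <-.
by congr (diffop_tr_app _ _ _); apply/funext => y; rewrite addr0.
Qed.

Lemma abs_int_le f g : Cc f -> Cc g -> (forall x, `|f x| <= g x) -> `|I f| <= I g.
Proof.
move=> Cf Cg fg; rewrite ler_norml; apply/andP; split.
  rewrite lerNl -intN//; apply: int_le => // [|x]; last by have := fg x; rewrite ler_norml => /andP[? _]; rewrite lerNl.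
  by have := Cc_scale (-1) Cf; congr Cc; apply/funext => x; rewrite mulN1r.
by apply: int_le => // x; exact: le_trans (ler_norm _) (fg x).
Qed.

End distributions.

(** * Consequences of homogeneity and left invariance *)

Section homogeneous_operators.
Context {R : realType} {N : nat}.
Variable G : carnot_group R N.
Notation I := integral_rV.
Local Notation E := 'rV[R]_N.
Local Notation "x ** y" := (Defs.mul G x y) (at level 40, left associativity).
Local Notation dil := (dilation G).
Implicit Types (phi psi chi f g theta : E -> R).

Lemma dil_norm s x : 0 <= s <= 1 -> `|dil s x| <= s * `|x|.
Proof.
move=> /andP[s0 s1]; apply: norm_le_coords => [|j]; first by rewrite mulr_ge0.
rewrite dilE normrM ger0_norm ?exprn_ge0//; apply: ler_pM => //; first by rewrite exprn_ge0.
  by have /andP[] := deg_bounds G j; case: (deg G j) => // m _ _; rewrite exprS ler_piMr// exprn_ile1.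
exact: coord_le_norm.
Qed.

Lemma test_act (x : E) (s : R) phi : s != 0 -> test setT phi -> test setT (fun y => phi (x ** dil s y)).
Proof.
move=> s0 [/Smooth sp [C [cC _ C0]]]; split; first by case: (smooth_compT (smap_act G x s) sp).
exists [set dil s^-1 (- x ** y) | y in C]; split => //.
  apply: continuous_compact cC; apply: continuous_subspaceT.
  by apply: smap_cont; apply: smap_comp (smap_trans G (- x)) (smap_dil G s^-1).
move=> y ny; apply: C0 => Cy; apply: ny; exists (x ** dil s y) => //.
by rewrite mulKg dilK.
Qed.

Lemma test_dil (s : R) phi : s != 0 -> test setT phi -> test setT (fun y => phi (dil s y)).
Proof. by move=> s0 tp; have := test_act 0 s0 tp; under eq_fun do rewrite mul0g. Qed.

Lemma test_trans (x : E) phi : test setT phi -> test setT (fun y => phi (x ** y)).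
Proof. by move=> tp; have := test_act x (oner_neq0 R) tp; under eq_fun do rewrite dil1. Qed.

Lemma partial_dil s i phi : smooth setT phi ->
  partial i (fun y => phi (dil s y)) = fun y => s ^+ deg G i * partial i phi (dil s y).
Proof.
move=> sp; apply/funext => y; have sc := smooth_compT (smap_dil G s) sp.
rewrite -Df_basis// (Df_dil G s (basis_vec i) y sp) (dil_layer s (@basis_layer _ _ G i)) -Df_basis//.
have := Df_linv (s ^+ deg G i) 0 (basis_vec i) 0 phi (dil s y).
by rewrite scale0r mul0r !addr0.
Qed.

Lemma partials_dil s w phi : smooth setT phi -> exists k,
  partials w (fun y => phi (dil s y)) = fun y => s ^+ k * partials w phi (dil s y).
Proof.
move=> sp; elim: w => [|i w [k IH]]; first by exists 0%N; apply/funext => y; rewrite expr0 mul1r.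
exists (k + deg G i)%N; rewrite /= IH; apply/funext => y.
have sw := smooth_partials w sp; have sc := smooth_compT (smap_dil G s) sw.
rewrite exprD -mulrA (_ : s ^+ deg G i * _ = partial i (fun z => partials w phi (dil s z)) y); last by rewrite partial_dil.
by have [_] := is_deriveZ (s ^+ k) (smooth_is_derive i sc (x := y) Logic.I).
Qed.

Lemma dist_dil (U : functional R N) (s : R) : 0 < s <= 1 -> distribution_on setT U ->
  distribution_on setT (fun phi => U (fun x => phi (dil s x))).
Proof.
move=> /andP[s0 s1] dU; have sn : s != 0 by rewrite gt_eqF.
split.
  by move=> a phi psi t1 t2; exact: (dist_lin a dU (test_dil sn t1) (test_dil sn t2)).
move=> C cC _; pose C' : set E := [set dil s^-1 y | y in C].
have cC' : compact C'.
  by apply: continuous_compact cC; apply: continuous_subspaceT; exact: cont_dil.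
have [M [m HM]] := dU.2 C' cC' (@subsetT _ _); exists M, m => phi B /Smooth sp phi0 HB.
apply: HM.
- by case: (smooth_compT (smap_dil G s) sp).
- by move=> x nx; apply: phi0 => Cx; apply: nx; exists (dil s x) => //; exact: dilK.
move=> w x wm; have [k ->] := partials_dil s w sp.
have B0 : 0 <= B by apply: le_trans (HB [::] x isT).
rewrite normrM -[leRHS]mul1r; apply: ler_pM => //; last exact: HB.
by rewrite ger0_norm ?exprn_ge0 ?(ltW s0)// exprn_ile1// ltW.
Qed.

Variables (lambda : R) (L : diffop R N).
Hypothesis lambda1 : 1 <= lambda.
Hypothesis hom : homogeneous G lambda (diffop_dist L).
Hypothesis inv : left_invariant G (diffop_dist L).
Local Notation Lt := (diffop_tr_app L).

Lemma tr_trans a phi x : test setT phi -> Lt (fun y => phi (a ** y)) x = Lt phi (a ** x).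
Proof.
move=> tp; have := inv (- a) (dist_eval x) tp.
by rewrite /diffop_dist /translate invgE opprK => ->.
Qed.

Lemma tr_dil (s : R) phi x : 0 < s -> test setT phi -> Lt (fun y => phi (dil s y)) x = s `^ lambda * Lt phi (dil s x).
Proof.
move=> s0 tp; have si : 0 < s^-1 by rewrite invr_gt0.
have := hom si (dist_eval x) tp; rewrite /diffop_dist /dilate invrK mulrCA.
have q0 : (s^-1 ^+ hom_dim G)^-1 != 0 by rewrite invr_neq0// expf_neq0// gt_eqF.
move=> /(mulfI q0) ->; rewrite mulrA -powRM ?(ltW s0) ?(ltW si)// mulfV ?gt_eqF//.
by rewrite powR1 mul1r.
Qed.

Lemma tr_act a (s : R) phi x : 0 < s -> test setT phi ->
  Lt (fun y => phi (a ** dil s y)) x = s `^ lambda * Lt phi (a ** dil s x).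
Proof.
move=> s0 tp; rewrite (@tr_dil s (fun z => phi (a ** z)) x s0 (test_trans a tp)).
by rewrite tr_trans.
Qed.

Lemma powR_gt1 : 2 `^ lambda != 1.
Proof.
rewrite gt_eqF//; apply: (@lt_le_trans _ _ (2 `^ 1)); first by rewrite powRr1// ltr1n.
by apply: ler_powR => //; rewrite ler1n.
Qed.

(* Every point is fixed by some homothety of ratio 2, so that a function
   multiplied by [2 `^ lambda] along homotheties vanishes. *)
Lemma fixed_homothety z : z ** - dil 2 z ** dil 2 z = z.
Proof. by rewrite -mulgA mulNg mulg0. Qed.

(** By locality the constant 1, which need not be a test function, may be replaced near [z] by a
    cutoff, and this cutoff by its composition with the homothety of ratio 2 fixing [z]. Hence the
    value [r] satisfies $r=2^\lambda r$. *)
Lemma tr_one z : Lt (fun=> 1) z = 0.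
Proof.
have [psi [sp [C [cC CO C0]] [V [oV KV V1]] _]] := @cutoff_exists R N [set z] setT (@compact_set1 _ z) openT (@subsetT _ _).
have tp : test setT psi by split; [case: sp|exists C].
have nV : \forall y \near z, V y by apply: open_nbhs_nbhs; split=> //; exact: KV.
have E1 : Lt (fun=> 1) z = Lt psi z.
  by apply: tr_app_eqnear; near=> y; rewrite V1//; near: y.
pose a := z ** - dil 2 z.
have E2 : Lt (fun=> 1) z = Lt (fun y => psi (a ** dil 2 y)) z.
  apply: tr_app_eqnear.
  have c : {for z, continuous (fun y => a ** dil 2 y)} by exact: smap_cont (smap_act G a 2) z.
  have nV' : \forall y \near a ** dil 2 z, V y by rewrite fixed_homothety.
  by near=> y; rewrite V1//; near: y; exact: c nV'.
have := tr_act a z (ltr0Sn R 1) tp; rewrite -E2 fixed_homothety -E1.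
move: (Lt _ z) => r /eqP; rewrite -subr_eq0 -{1}[r]mul1r -mulrBl mulf_eq0 subr_eq0 eq_sym.
by rewrite (negbTE powR_gt1) => /eqP.
Unshelve. all: by end_near. Qed.

Lemma tr_cutoff psi (V : set E) x : open V -> (forall y, V y -> psi y = 1) -> V x -> Lt psi x = 0.
Proof.
move=> oV V1 Vx; rewrite -(tr_one x); apply: tr_app_eqnear.
by near=> y; apply: V1; near: y; exact: open_nbhs_nbhs.
Unshelve. all: by end_near. Qed.

(** The pointwise scaling identities are available for the transpose only. They reach $l=\mathcal
    L1$ by duality: $\int\mathcal L^t\theta=\int\theta\,l$ for all test functions, so $l$ is
    multiplied by $2^\lambda$ along homotheties, and each point is fixed by one of them. *)
Lemma app_one z : diffop_app L (fun=> 1) z = 0.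
Proof.
have s1 : smooth setT (fun _ : E => 1 : R) by apply: smooth_cst; exact: openT.
pose l := diffop_app L (fun=> 1); have sl : smooth setT l := smooth_app L s1.
pose a := z ** - dil 2 z; pose act y := a ** dil 2 y; pose act' y := dil 2^-1 (- a ** y).
have sact' : smap act' by apply: smap_comp (smap_trans G (- a)) (smap_dil G _).
have n2 : (2 : R) != 0 by rewrite pnatr_eq0.
have actK y : act' (act y) = y by rewrite /act' /act mulKg dilK.
have IL theta : test setT theta -> I (Lt theta) = I (fun x => theta x * l x).
  move=> tt; rewrite (int_transpose L (test_smooth tt) s1); last by left; exact: test_Cc tt.
  by congr I; apply/funext => x; rewrite mulr1.
have key : forall x, setT x -> l (act' x) - 2 `^ lambda * l x = 0.
  apply: fundamental_lemma; first exact: openT.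
    move=> x _; apply: cont_subT; first exact: smoothT_cont (smooth_compT sact' sl).
    by apply: cont_mulT; [exact: cst_continuous|exact: smoothT_cont].
  move=> theta tt; have cl := smoothT_cont sl.
  have cla := smoothT_cont (smooth_compT sact' sl).
  have C1 : Cc (fun x => theta x * l (act' x)) by apply: Cc_mulr => //; exact: test_Cc tt.
  have C2 : Cc (fun x => theta x * l x) by apply: Cc_mulr => //; exact: test_Cc tt.
  have H1 := haar G a (ltr0Sn R 1) C1; have H2 := haar G a (ltr0Sn R 1) (test_Cc (test_tr_app L tt)).
  have := IL _ (test_act a n2 tt).
  rewrite (_ : Lt (fun y => theta (a ** dil 2 y)) = fun x => 2 `^ lambda * Lt theta (a ** dil 2 x)); last first.
    by apply/funext => x; rewrite tr_act.
  rewrite intZ; last by apply: (@Cc_act R N G _ a 2 n2); exact: test_Cc (test_tr_app L tt).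
  rewrite H2 IL// mulrCA.
  have -> : (fun x => theta (a ** dil 2 x) * l x) = fun y => theta (a ** dil 2 y) * l (act' (a ** dil 2 y)).
    by apply/funext => y; rewrite -/(act y) actK.
  rewrite H1; have q0 : ((2 : R) ^+ hom_dim G)^-1 != 0 by rewrite invr_neq0// expf_neq0.
  move=> /(mulfI q0) H.
  rewrite (_ : (fun x => _) = fun x => theta x * l (act' x) - 2 `^ lambda * (theta x * l x)); last first.
    by apply/funext => x; ring.
  by rewrite intB ?intZ//; [rewrite H subrr|exact: Cc_scale].
rewrite -/(l z); have := key z Logic.I; rewrite -[in act' z](fixed_homothety z) -/a -/(act z) actK.
move: (l z) => r /eqP; rewrite -{1}[r]mul1r -mulrBl mulf_eq0 subr_eq0 eq_sym.
by rewrite (negbTE powR_gt1) => /eqP.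
Qed.

(** The cancellation behind the small scales: against $\mathcal L^t\theta$ a function may be
    replaced by its difference with a constant. *)
Lemma int_tr0 theta : test setT theta -> I (Lt theta) = 0.
Proof.
move=> tt; have s1 : smooth setT (fun _ : E => 1 : R) by apply: smooth_cst; exact: openT.
have := int_transpose L (test_smooth tt) s1 (or_introl (test_Cc tt)).
rewrite (_ : (fun x => Lt theta x * 1) = Lt theta); last by apply/funext => x; rewrite mulr1.
by move=> <-; rewrite -[RHS](int0 N); congr I; apply/funext => x; rewrite app_one mulr0.
Qed.

End homogeneous_operators.

(** * The a priori estimate *)

Section estimate.
Context {R : realType} {N : nat}.
Variable G : carnot_group R N.
Notation I := integral_rV.
Local Notation E := 'rV[R]_N.
Local Notation "x ** y" := (Defs.mul G x y) (at level 40, left associativity).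
Local Notation dil := (dilation G).
Local Notation half := (@half R).
Implicit Types (phi psi chi f g u v : E -> R).
Variable L : diffop R N.
Local Notation Lt := (diffop_tr_app L).
Hypothesis Lt_hypo : hypoelliptic (diffop_tr_dist L).
Hypothesis N0 : (0 < N)%N.

Definition small (s : R) u := smooth setT u /\ forall x, ~ (`|dil s^-1 x| <= 1) -> u x = 0.

Lemma small_norm s u x : 0 < s <= 1 -> small s u -> s < `|x| -> u x = 0.
Proof.
move=> /andP[s0 s1] [_ u0] sx; apply: u0 => H.
have := @dil_norm R N G s (dil s^-1 x); rewrite dilVK ?gt_eqF// (ltW s0) s1 => /(_ isT) H2.
have : s * `|dil s^-1 x| <= s * 1 by rewrite ler_wpM2l// ltW.
by rewrite mulr1; lra.
Qed.

Lemma small_Cc s u : 0 < s <= 1 -> small s u -> Cc u.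
Proof.
move=> s01 su; split; first exact: smoothT_cont su.1.
by exists s => x sx; exact: small_norm s01 su sx.
Qed.

Definition bump0 : E -> R := cube_bump 0 1.

Lemma bump0_test : test setT bump0.
Proof.
split; first by case: (smooth_cube_bump (0 : E) 1).
exists [set x | `|x - 0| <= 2 * 1]; split=> //; first exact: compact_closed_ball.
by move=> x; exact: cube_bump0.
Qed.

(** The gain [s] is the volume of the support, of order $s^Q\le s$; [bump0] dominates the indicator
    of the unit ball and rescales by [haar]. *)
Lemma small_int s u phi (D : R) : 0 < s <= 1 -> (0 < hom_dim G)%N -> small s u -> (forall x, `|u x| <= 1) ->
  continuous phi -> (forall x, `|phi x| <= D) -> `|I (fun x => u x * phi x)| <= D * (s * I bump0).
Proof.
move=> /[dup] s01 /andP[s0 s1] Q0 su u1 cphi phiD; have si : 0 < s^-1 by rewrite invr_gt0.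
have D0 : 0 <= D by apply: le_trans (phiD 0).
have Cb := test_Cc bump0_test.
have b0 x : 0 <= bump0 x by have /andP[] := cube_bump_itv (0 : E) x 1.
have Ib : 0 <= I bump0 by rewrite -(int0 N); apply: int_le => //; exact: Cc0.
have Cbd : Cc (fun x => bump0 (dil s^-1 x)).
  have := Cc_act G 0 (lt0r_neq0 si) Cb; under eq_fun do rewrite mul0g; exact.
have E1 : I (fun x => D * bump0 (dil s^-1 x)) = D * (s ^+ hom_dim G * I bump0).
  rewrite intZ//; have := haar G 0 si Cb; under eq_fun do rewrite mul0g.
  by rewrite exprVn invrK => ->.
apply: (@le_trans _ _ (D * (s ^+ hom_dim G * I bump0))); last first.
  apply: ler_wpM2l => //; apply: ler_wpM2r => //.
  by case: (hom_dim G) Q0 => // n _; rewrite exprS ler_piMr ?(ltW s0)// exprn_ile1// ltW.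
rewrite -E1; apply: abs_int_le; [|exact: Cc_scale|].
  by apply: Cc_mulr => //; exact: small_Cc s01 su.
move=> x; rewrite normrM; have [H|H] := boolP (`|dil s^-1 x| <= 1).
  rewrite /bump0 cube_bump1 ?subr0// mulr1 -[leRHS]mul1r.
  by apply: ler_pM.
by rewrite su.2 ?normr0 ?mul0r; [rewrite mulr_ge0|exact/negP].
Qed.

(** A normalized hump violating the estimate: bounded by 1, at least $1/2$ at [x], with the
    derivatives of $\mathcal L^tv$ up to order $k$ below $8^{-k}$. As [x] is not 0, later humps can
    be supported away from it. *)
Definition bad (s : R) (k : nat) v (x : E) := [/\ small s v, forall y, `|v y| <= 1, x != 0, 1/2 <= `|v x| &
  forall w y, (size w <= k)%N -> `|partials w (Lt v) y| <= half k ^+ 3].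

Definition good (s : R) (m : nat) (C : R) := forall u (B : R), small s u ->
  (forall w x, (size w <= m)%N -> `|partials w (Lt u) x| <= B) -> forall x, `|u x| <= C * B.

Lemma bad_exists (s : R) k : 0 < s <= 1 -> ~ good s k ((half k ^+ 3)^-1) -> exists vx : (E -> R) * E, bad s k vx.1 vx.2.
Proof.
move=> s01 /existsNP[u /existsNP[B /not_implyP[su /not_implyP[HB /existsNP[x0 /negP]]]]].
rewrite -ltNge mulrC; set h := half k ^+ 3 => ux0.
have h0 : 0 < h by rewrite exprn_gt0// half_gt0.
have B0 : 0 <= B by apply: le_trans (HB [::] 0 isT).
have Cu := small_Cc s01 su; have cu := smoothT_cont su.1.
have [B' B'0 HB'] := Cc_bounded Cu.
pose A := [set `|u x| | x in [set: E]].
have hA : has_sup A by split; [exists `|u 0|; exists 0|exists B' => _ [x _ <-]; exact: HB'].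
pose S := sup A; have uS x : `|u x| <= S by apply: sup_upper_bound => //; exists x.
have S0 : 0 < S by apply: lt_le_trans (uS x0); apply: le_lt_trans ux0; rewrite divr_ge0// ltW.
have BS : B / S <= h.
  rewrite ler_pdivrMr// mulrC -ler_pdivrMr//; exact: ltW (lt_le_trans ux0 (uS x0)).
have [_ [x1 _ <-] x1S] := sup_adherent (divr_gt0 S0 (ltr0Sn R 3)) hA.
rewrite -/S in x1S.
pose v x := S^-1 * u x; have vE x : `|v x| = `|u x| / S by rewrite /v normrM normfV (gtr0_norm S0) mulrC.
have sv : smooth setT v by apply: smooth_scale su.1; exact: openT.
have v1 : 3/4 < `|v x1| by rewrite vE ltr_pdivlMr//; move: x1S; lra.
(* If the supremum is nearly attained at 0, the point is shifted slightly along a coordinate axis;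
   continuity lowers the value by less than $1/4$. *)
have [x xn vx] : exists2 x, x != 0 & 1/2 <= `|v x|.
  have [x10|x1n] := eqVneq x1 0; last by exists x1 => //; move: v1; lra.
  have q0 : 0 < 1/4 :> R by lra.
  have [d d0 Hd] := (contP _ _).1 (@smoothT_cont _ _ _ sv x1) _ q0.
  pose i : 'I_N := Ordinal N0; exists ((d / 2) *: basis_vec i).
    apply/eqP => /(congr1 (fun z : E => z 0 i)); rewrite !mxE !eqxx mulr1 => /eqP.
    by rewrite gt_eqF// divr_gt0.
  have := Hd ((d / 2) *: basis_vec i); rewrite x10 subr0 normrZ => H.
  have {}H : `|v ((d / 2) *: basis_vec i) - v 0| < 1/4.
    apply: H; rewrite gtr0_norm ?divr_gt0//; apply: (@le_lt_trans _ _ (d / 2 * 1)).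
      by apply: ler_wpM2l (norm_basis_vec i); rewrite ltW// divr_gt0.
    by lra.
  have := ler_normD (v 0 - v ((d / 2) *: basis_vec i)) (v ((d / 2) *: basis_vec i)).
  by rewrite subrK distrC -x10; move: v1 H; rewrite -x10; lra.
exists (v, x); split => //=.
- split=> // y /su.2; rewrite /v => ->; exact: mulr0.
- by move=> y; rewrite vE ler_pdivrMr// mul1r.
move=> w y wk; rewrite tr_appZ ?partialsZ; [|exact: smooth_tr_app su.1|exact: su.1].
rewrite normrM normfV (gtr0_norm S0) mulrC; apply: le_trans BS.
by rewrite ler_pM2r ?invr_gt0//; exact: HB.
Qed.

(** * The gliding hump *)

Section contradiction.
Hypothesis Q0 : (0 < hom_dim G)%N.
Hypothesis nogood : forall (s : R) m C, 0 < s <= 1 -> ~ good s m C.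
Variable F : R * nat -> (E -> R) * E.
Hypothesis HF : forall p, 0 < p.1 <= 1 -> bad p.1 p.2 (F p).1 (F p).2.

(** Half the norm of the last point keeps all later humps away from it; the factor $1/8$ makes $4^k$
    times the volume of the $k$-th support at most of order $2^{-k}$. *)
Fixpoint rad (n : nat) : R := if n is m.+1 then Num.min (rad m / 8) (`|(F (rad m, m)).2| / 2) else 1.
Definition vf n := (F (rad n, n)).1.
Definition xf n := (F (rad n, n)).2.

Lemma rad01 n : 0 < rad n <= 1.
Proof.
elim: n => [|n IH] /=; first by rewrite ltr01 lexx.
have [_ _ x0 _ _] := HF (p := (rad n, n)) IH; move/andP: IH => [r0 r1].
rewrite lt_min !divr_gt0 ?normr_gt0//= ge_min; apply/orP; left; move: r1; lra.
Qed.

Lemma rad_small n : rad n <= half n ^+ 3.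
Proof.
elim: n => [|n IH]; first by rewrite expr1n.
rewrite /= ge_min; apply/orP; left; rewrite halfS expr_div_n (_ : 2 ^+ 3 = 8); last by ring.
by rewrite ler_pM2r// invr_gt0.
Qed.

Lemma rad_anti m n : (m <= n)%N -> rad n <= rad m.
Proof.
elim: n => [|n IH]; first by rewrite leqn0 => /eqP ->.
rewrite leq_eqVlt => /predU1P[->//|/IH H]; apply: le_trans H => /=.
by rewrite ge_min; apply/orP; left; have /andP[r0 _] := rad01 n; move: r0; lra.
Qed.

Lemma vfP n : bad (rad n) n (vf n) (xf n).
Proof. exact: (HF (p := (rad n, n)) (rad01 n)). Qed.

Definition bterm phi (k : nat) : R := 4 ^+ k * I (fun x => vf k x * phi x).
(** The distribution $\sum_k4^kv_k$. Its image under $\mathcal L^t$ is smooth, since the derivatives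
    of $4^k\mathcal L^tv_k$ are eventually below $2^{-k}$, although the sum of the humps is
    unbounded near 0. *)
Definition Ubad : functional R N := fun phi => tsum (bterm phi).

Lemma pow4_half k : 4 ^+ k * half k ^+ 3 = half k.
Proof.
rewrite /half -exprM mulnC exprM -exprMn; congr (_ ^+ _).
by rewrite !exprS expr0; field.
Qed.

Lemma bterm_bound phi D k : continuous phi -> (forall x, `|phi x| <= D) -> `|bterm phi k| <= D * I bump0 * half k.
Proof.
move=> cphi phiD; have [sv v1 _ _ _] := vfP k.
have Ib : 0 <= I bump0.
  rewrite -(int0 N); apply: int_le; [exact: Cc0|exact: test_Cc bump0_test|].
  by move=> x; have /andP[] := cube_bump_itv (0 : E) x 1.
have D0 : 0 <= D by apply: le_trans (phiD 0).
rewrite normrM ger0_norm ?exprn_ge0// -[half k]pow4_half -mulrA mulrCA.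
have H := small_int (rad01 k) Q0 sv v1 cphi phiD.
rewrite [X in _ <= X](_ : _ = 4 ^+ k * (D * (half k ^+ 3 * I bump0))); last by ring.
apply: ler_wpM2l; first by rewrite exprn_ge0.
apply: (le_trans H); apply: ler_wpM2l => //; apply: ler_wpM2r => //; exact: rad_small.
Qed.

Lemma bterm_lin (a : R) phi psi k : test setT phi -> test setT psi ->
  bterm (fun x => a * phi x + psi x) k = a * bterm phi k + bterm psi k.
Proof.
move=> t1 t2; have [sv _ _ _ _] := vfP k; have Cv := small_Cc (rad01 k) sv.
have c1 := smoothT_cont (test_smooth t1); have c2 := smoothT_cont (test_smooth t2).
rewrite /bterm (_ : (fun x => _) = fun x => a * (vf k x * phi x) + vf k x * psi x); last by apply/funext => x; ring.
have C1 := Cc_mulr Cv c1.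
rewrite intD ?intZ//; [ring|exact: Cc_scale|exact: Cc_mulr].
Qed.

Lemma Ubad_dist : distribution_on setT Ubad.
Proof.
split.
  move=> a phi psi t1 t2.
  have [D1 D10 HD1] := Cc_bounded (test_Cc t1); have [D2 D20 HD2] := Cc_bounded (test_Cc t2).
  have T1 := tsum_tail (K := 0) (fun k _ => bterm_bound k (smoothT_cont (test_smooth t1)) HD1).
  have T2 := tsum_tail (K := 0) (fun k _ => bterm_bound k (smoothT_cont (test_smooth t2)) HD2).
  apply: (@tsum_uniq _ _ (`|a| * (2 * (D1 * I bump0)) + 2 * (D2 * I bump0)) 0%N) => n n0.
  have -> : psum (bterm (fun x => a * phi x + psi x)) n = a * psum (bterm phi) n + psum (bterm psi) n.
    by rewrite /psum mulr_sumr -big_split/=; apply: eq_bigr => k _; exact: bterm_lin.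
  rewrite (_ : _ - _ = a * (tsum (bterm phi) - psum (bterm phi) n) + (tsum (bterm psi) - psum (bterm psi) n)); last first.
    by rewrite /Ubad; ring.
  apply: (le_trans (ler_normD _ _)); rewrite mulrDl; apply: lerD; last exact: T2.
  by rewrite normrM -mulrA; apply: ler_wpM2l => //; exact: T1.
move=> C cC _; exists (2 * I bump0), 0%N => phi B /Smooth sp phi0 HB.
have := tsum_tail (K := 0) (fun k _ => bterm_bound k (smoothT_cont sp) (fun x => HB [::] x isT)) (leqnn 0).
by rewrite /psum big_ord0 subr0 (_ : 2 * I bump0 * B = 2 * (B * I bump0) * half 0)//; rewrite /half expr0; ring.
Qed.

Definition gbad (k : nat) : E -> R := fun x => 4 ^+ k * Lt (vf k) x.

Lemma gbad_fast : fast gbad.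
Proof.
split=> [k|w].
  by apply: smooth_scale; [exact: openT|apply: smooth_tr_app; have [[]] := vfP k].
exists (size w) => k x wk; have [[sv _] _ _ _ H] := vfP k.
rewrite partialsZ; last exact: smooth_tr_app sv.
rewrite normrM ger0_norm ?exprn_ge0// -(pow4_half k).
by apply: ler_wpM2l; [rewrite exprn_ge0|exact: H].
Qed.

Lemma Ubad_app phi : test setT phi -> diffop_tr_dist L Ubad phi = of_fun (ssum gbad) phi.
Proof.
move=> tp; have sp := test_smooth tp; have cp := smoothT_cont sp.
have [K HK] := fast_tail gbad_fast; have [D D0 HD] := Cc_bounded (test_Cc tp).
have [_ [r0 Hr0]] := test_Cc tp; pose r := `|r0|.
have Hr x : r < `|x| -> phi x = 0 by move=> rx; apply: Hr0; exact: le_lt_trans (ler_norm _) rx.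
apply: (@tsum_uniq _ _ (2 * D * vol N r) K) => n Kn.
have bE k : bterm (diffop_app L phi) k = I (fun x => gbad k x * phi x).
  have [[sv _] _ _ _ _] := vfP k.
  rewrite /bterm (int_transpose L sv sp); last by right; exact: test_Cc tp.
  rewrite -intZ; last by apply: Cc_mull (test_Cc tp); apply: smoothT_cont; exact: smooth_tr_app sv.
  by congr I; apply/funext => x; rewrite /gbad mulrA.
have cg k : continuous (gbad k) by exact: smoothT_cont (gbad_fast.1 k).
have -> : psum (bterm (diffop_app L phi)) n = I (fun x => psum (fun k => gbad k x) n * phi x).
  rewrite /psum (eq_bigr (fun k : 'I_n => I (fun x => gbad k x * phi x))); last by move=> k _; exact: bE.
  rewrite -(int_sum (f := fun k : 'I_n => fun x => gbad k x * phi x)); last first.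
    by move=> k; apply: Cc_mull (test_Cc tp); exact: cg.
  by congr I; apply/funext => x; rewrite mulr_suml.
have c1 : continuous (ssum gbad) by apply: ssum_cont; exact: gbad_fast.
have c2 : continuous (fun x => psum (fun k => gbad k x) n) by apply: psum_cont; exact: gbad_fast.1.
rewrite /of_fun -intB; [|exact: Cc_mull (test_Cc tp)|exact: Cc_mull (test_Cc tp)].
rewrite (_ : (fun x => _) = fun x => (ssum gbad x - psum (fun k => gbad k x) n) * phi x); last by apply/funext => x; rewrite mulrBl.
rewrite mulrAC; apply: int_bound; rewrite ?normr_ge0//.
- by apply: cont_mulT => //; exact: cont_subT.
- by move=> x rx; rewrite Hr// mulr0.
- move=> x _; rewrite normrM mulrAC; apply: ler_pM => //; first exact: HK.
Qed.

Lemma bad_absurd : False.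
Proof.
have oT := @openT E.
have dF : distribution_on setT (of_fun (ssum gbad)).
  by apply: dist_of_cont => // x _; exact: ssum_cont gbad_fast x.
have sF : smooth_distribution_on setT (of_fun (ssum gbad)).
  by exists (ssum gbad) => //; case: (smooth_ssum gbad_fast).
have [g /Smooth sg gE] := Lt_hypo oT Ubad_dist dF Ubad_app sF.
(* Outside the ball of radius [rad n] only the first [n] humps are present, so there the smooth
   representative is their finite sum. *)
have key n x : rad n < `|x| -> g x = psum (fun k => 4 ^+ k * vf k x) n.
  move=> nx; apply/eqP; rewrite -subr_eq0; apply/eqP.
  have oO : open [set x : E | rad n < `|x|].
    rewrite (_ : [set x | _] = ~` [set x : E | `|x| <= rad n]).
      by apply: closed_openC; exact: closed_cball.
    by apply/seteqP; split=> y /=; rewrite ltNge => /negP.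
  have cps : continuous (fun x => psum (fun k => 4 ^+ k * vf k x) n).
    apply: psum_cont => k; apply: smooth_scale => //; by have [[]] := vfP k.
  apply: (fundamental_lemma oO (g := fun x => g x - psum (fun k => 4 ^+ k * vf k x) n)) => // [y _|phi tphi].
    by apply: cont_subT => //; exact: smoothT_cont.
  have tp := test_subset (@subsetT _ _) tphi; have cp := smoothT_cont (test_smooth tp).
  have Cv k : Cc (vf k) by have [sv _ _ _ _] := vfP k; exact: small_Cc (rad01 k) sv.
  have vphi k x' : (n <= k)%N -> vf k x' * phi x' = 0.
    move=> nk; have [sv _ _ _ _] := vfP k; have [_ [C [_ CO C0]]] := tphi.
    have [/CO x'C|/C0 ->] := pselect (C x'); last by rewrite mulr0.
    by rewrite (small_norm (rad01 k) sv) ?mul0r//; apply: le_lt_trans x'C; exact: rad_anti.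
  have UE : Ubad phi = psum (bterm phi) n.
    apply: (@tsum_uniq _ _ 0 n) => j nj; rewrite mul0r -(subnKC nj).
    rewrite /psum big_split_ord/= opprD addrA subrr sub0r normrN big1 ?normr0// => k _.
    rewrite /bterm (_ : (fun x => _) = fun=> 0) ?int0 ?mulr0//.
    by apply/funext => y; rewrite vphi// leq_addr.
  have := gE _ tp; rewrite UE /of_fun => E1.
  rewrite (_ : (fun x => _) = fun x => g x * phi x - psum (fun k => 4 ^+ k * (vf k x * phi x)) n); last first.
    apply/funext => y; rewrite mulrBl /psum mulr_suml; congr (_ - _).
    by apply: eq_bigr => k _; rewrite mulrA.
  have C1 k : Cc (fun x => 4 ^+ k * (vf k x * phi x)) by apply: Cc_scale; exact: Cc_mulr.
  rewrite intB; [|exact: Cc_mull (smoothT_cont sg) (test_Cc tp)|by apply: (Cc_sum (f := fun k : 'I_n => fun x => 4 ^+ k * (vf k x * phi x))) => k; exact: C1].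
  rewrite -E1 (int_sum (f := fun k : 'I_n => fun x => 4 ^+ k * (vf k x * phi x))) //.
  rewrite /psum -sumrB big1// => k _; rewrite /bterm intZ ?subrr//; exact: Cc_mulr.
have [A A0 HA] := compact_cont_bounded (@compact_cball R N 1) (fun x _ => smoothT_cont sg (x := x)).
have [n Hn] := half_small (6 * A) (ltr01 : 0 < (1 : R)).
have [sv v1 x0 vx _] := vfP n.
have rx : rad n.+1 < `|xf n|.
  rewrite /= gt_min; apply/orP; right; rewrite -/(xf n).
  have xp : 0 < `|xf n| by rewrite normr_gt0.
  by lra.
have x1 : `|xf n| <= 1.
  rewrite leNgt; apply/negP => x1; move: vx; rewrite (small_norm (rad01 n) sv) ?normr0; first by lra.
  by have /andP[_ r1] := rad01 n; exact: le_lt_trans r1 x1.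
have := HA _ x1; rewrite (key n.+1)// /psum big_ord_recr/= => H.
(* At the point of hump [n] the earlier humps contribute at most $4^n/3$ and this one at least
   $4^n/2$. Hence $4^n/6$ is bounded by [A], which contradicts the choice of [n]. *)
have S4 (m : nat) : \sum_(k < m) (4 : R) ^+ k <= 4 ^+ m / 3.
  elim: m => [|m IH]; first by rewrite big_ord0 expr0; lra.
  by rewrite big_ord_recr/= exprS; move: IH; move: (\sum_(_ < _) _) ((4 : R) ^+ m) => p q; lra.
have P : `|\sum_(k < n) 4 ^+ k * vf k (xf n)| <= 4 ^+ n / 3.
  apply: le_trans (S4 n); apply: (le_trans (ler_norm_sum _ _ _)); apply: ler_sum => k _.
  by rewrite normrM ger0_norm ?exprn_ge0// ler_piMr ?exprn_ge0//; have [_ vk _ _ _] := vfP k.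
have Q : 4 ^+ n / 2 <= `|4 ^+ n * vf n (xf n)|.
  rewrite normrM ger0_norm ?exprn_ge0//; apply: ler_wpM2l; first by rewrite exprn_ge0.
  by move: vx; rewrite mul1r.
have T := ler_normD (\sum_(k < n) 4 ^+ k * vf k (xf n) + 4 ^+ n * vf n (xf n)) (- \sum_(k < n) 4 ^+ k * vf k (xf n)).
rewrite addrAC subrr add0r normrN in T.
have h4 : 1 <= 4 ^+ n * half n.
  by rewrite /half -exprMn (_ : 4 * 2^-1 = 2 :> R); [rewrite exprn_ege1// ler1n|field].
have h0 : 0 < half n := half_gt0 n; have := Hn n (leqnn n).
have X : 4 ^+ n <= 6 * A.
  move: H P Q T; move: (\sum_(i < n) _) (_ * vf n (xf n)) => X1 X2.
  by move: (`|X1 + X2|) (`|X1|) (`|X2|) => p q r; move: ((4 : R) ^+ n) => t; lra.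
have : 4 ^+ n * half n <= 6 * A * half n by rewrite ler_pM2r.
by lra.
Qed.

End contradiction.

Lemma local_estimate : (0 < hom_dim G)%N -> exists (s : R) m C, 0 < s <= 1 /\ good s m C.
Proof.
move=> Q0; apply: contrapT => H.
have nogood (s : R) m C : 0 < s <= 1 -> ~ good s m C by move=> s01 gs; apply: H; exists s, m, C.
(* A hump is chosen for every radius and order at once, because the radii are defined recursively
   from the chosen humps. *)
have /choice[F HF] : forall p : R * nat, exists vx, 0 < p.1 <= 1 -> bad p.1 p.2 vx.1 vx.2.
  move=> p; have [p01|] := boolP (0 < p.1 <= 1); last by exists (fun=> 0, 0).
  by have [vx ?] := bad_exists p01 (nogood _ p.2 _ p01); exists vx.
by apply: bad_absurd HF.
Qed.

End estimate.

(** * A Hahn-Banach extension *)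

Section hahn_banach.
Context {R : realType} (V : lmodType R).
Variables (D : set V) (p : V -> R) (W : set (V * R)).
Hypothesis D_lin : forall (a : R) x y, D x -> D y -> D (a *: x + y).
Hypothesis p_add : forall x y, D x -> D y -> p (x + y) <= p x + p y.
Hypothesis p_hom : forall (a : R) x, 0 < a -> D x -> p (a *: x) = a * p x.

(** A partial linear functional is represented by its graph, so that the union of a chain needs no
    gluing; domination forces the graph to be single-valued, as $p(0)=0$. *)
Definition dominated (S : set (V * R)) :=
  (forall (a : R) y z, S y -> S z -> S (a *: y.1 + z.1, a * y.2 + z.2)) /\
  (forall z, S z -> D z.1 /\ z.2 <= p z.1).

Hypothesis W_dom : dominated W.
Hypothesis W0 : W (0, 0).

Let D0 : D 0. Proof. by have [] := W_dom.2 _ W0. Qed.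

Let D_add x y : D x -> D y -> D (x + y).
Proof. by move=> Dx Dy; have := D_lin 1 Dx Dy; rewrite scale1r. Qed.

Let D_scale (a : R) x : D x -> D (a *: x).
Proof. by move=> Dx; have := D_lin a Dx D0; rewrite addr0. Qed.

Lemma dominated_extend S x0 : dominated S -> S (0, 0) -> D x0 -> exists c : R,
  dominated [set z | exists (a : R) y, S y /\ z = (a *: x0 + y.1, a * c + y.2)].
Proof.
move=> [Slin Sp] S0 Dx.
have DN v : D v -> D (v - x0) by move=> Dv; rewrite addrC -scaleN1r; exact: D_lin.
(* The admissible values at [x0] lie between the elements of [A] and the numbers $p(z+x_0)-z'$ for
   $(z,z')$ in the graph; subadditivity makes this range nonempty, and its least element is
   taken. *)
pose A := [set y.2 - p (y.1 - x0) | y in S].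
have ub z : S z -> ubound A (p (z.1 + x0) - z.2).
  move=> Sz _ [y Sy <-]; have [Dy _] := Sp _ Sy; have [Dz _] := Sp _ Sz.
  have [_ /= H] := Sp _ (Slin 1 _ _ Sy Sz); rewrite scale1r mul1r in H.
  have := p_add (DN _ Dy) (D_add Dz Dx).
  rewrite addrACA [- x0 + x0]addNr addr0; move: H; move: (p _) (p _) (p _) => q r s; lra.
have A0 : A !=set0 by exists ((0 : R) - p (0 - x0)), (0, 0).
have hA : has_sup A by split=> //; exists (p (0 + x0) - 0); exact: ub S0.
exists (sup A); split.
  move=> b _ _ [a [y [Sy ->]]] [a' [z [Sz ->]]]; exists (b * a + a'), (b *: y.1 + z.1, b * y.2 + z.2).
  split; first exact: Slin.
  by congr (_, _) => /=; [rewrite scalerDl scalerDr scalerA addrACA|ring].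
move=> _ [a [y [Sy ->]]]; have [Dy yp] := Sp _ Sy; split => /=; first exact: D_lin.
have Sscale (b : R) : S (b *: y.1, b * y.2) by have := Slin b _ _ Sy S0; rewrite !addr0.
have [a0|a0|<-] := ltgtP 0 a; last by rewrite scale0r mul0r !add0r.
  have H : sup A <= p (a^-1 *: y.1 + x0) - a^-1 * y.2 by apply: sup_le_ub => //; exact: (ub _ (Sscale a^-1)).
  have an : a != 0 by rewrite gt_eqF.
  have E : a *: x0 + y.1 = a *: (a^-1 *: y.1 + x0) by rewrite scalerDr scalerA mulfV// scale1r addrC.
  rewrite E p_hom//; last by apply: D_add => //; exact: D_scale.
  have : a * sup A <= a * (p (a^-1 *: y.1 + x0) - a^-1 * y.2) by rewrite ler_pM2l.
  by rewrite mulrBr mulrA mulfV// mul1r; move: (a * p _) (a * sup A) => q r; lra.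
pose b := - a; have b0 : 0 < b by rewrite oppr_gt0.
have bn : b != 0 by rewrite gt_eqF.
have H : b^-1 * y.2 - p (b^-1 *: y.1 - x0) <= sup A.
  by apply: sup_upper_bound => //; exists (b^-1 *: y.1, b^-1 * y.2).
have E : a *: x0 + y.1 = b *: (b^-1 *: y.1 - x0).
  by rewrite scalerBr scalerA mulfV// scale1r /b scaleNr opprK addrC.
rewrite E p_hom//; last by apply: DN; exact: D_scale.
have : b * (b^-1 * y.2 - p (b^-1 *: y.1 - x0)) <= b * sup A by rewrite ler_pM2l.
have -> : b * sup A = - (a * sup A) by rewrite /b mulNr.
by rewrite mulrBr mulrA mulfV// mul1r; move: (b * p _) (a * sup A) => q r; lra.
Qed.

Theorem hahn_banach : exists K : V -> R, [/\ forall z, W z -> K z.1 = z.2,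
  forall (a : R) x y, D x -> D y -> K (a *: x + y) = a * K x + K y & forall x, D x -> K x <= p x].
Proof.
(* Domination is required of the union with [W], not of [A] itself, so that the empty chain causes
   no exception. *)
have [|A [PA maxA]] := @Zorn_bigcup _ (fun A => dominated (A `|` W)).
  move=> F FP tot.
  have two y z : (\bigcup_(X in F) X `|` W) y -> (\bigcup_(X in F) X `|` W) z ->
      exists S, [/\ dominated S, S `<=` \bigcup_(X in F) X `|` W, S y & S z].
    have inc X : F X -> X `|` W `<=` \bigcup_(X in F) X `|` W.
      by move=> FX u [Xu|Wu]; [left; exists X|right].
    move=> [[X FX Xy]|Wy] [[Y FY Yz]|Wz].
    - have [XY|YX] := tot X Y FX FY.
        by exists (Y `|` W); split; [exact: FP|exact: inc|left; exact: XY|left].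
      by exists (X `|` W); split; [exact: FP|exact: inc|left|left; exact: YX].
    - by exists (X `|` W); split; [exact: FP|exact: inc|left|right].
    - by exists (Y `|` W); split; [exact: FP|exact: inc|right|left].
    - by exists W; split => //; move=> u; right.
  split=> [a y z Uy Uz|z Uz].
    by have [S [[Slin _] SU Sy Sz]] := two _ _ Uy Uz; apply: SU; exact: Slin.
  by have [S [[_ Sp] _ Sz _]] := two _ _ Uz Uz; exact: Sp.
pose S := A `|` W; have S0 : S (0, 0) by right.
have [Slin Sp] := PA.
have total x : D x -> exists r, S (x, r).
  move=> Dx; apply: contrapT => nx; have [c Hc] := dominated_extend PA S0 Dx.
  set S' := (X in dominated X) in Hc.
  have SS' : S `<=` S' by move=> z Sz; exists 0, z; split=> //; rewrite scale0r mul0r !add0r; case: z Sz.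
  apply: (maxA S'); last by rewrite setUidl// => z Wz; apply: SS'; right.
  split; first by move=> z Az; apply: SS'; left.
  move=> S'A; apply: nx; exists c; left; apply: S'A; exists 1, (0, 0); split=> //.
  by rewrite scale1r mul1r !addr0.
have p0 : p 0 = 0 by have := p_hom (ltr0Sn R 1) D0; rewrite scaler0; lra.
have uniq x r r' : S (x, r) -> S (x, r') -> r = r'.
  move=> Sr Sr'; have [_ /= h1] := Sp _ (Slin (-1) _ _ Sr Sr'); have [_ /= h2] := Sp _ (Slin (-1) _ _ Sr' Sr).
  by move: h1 h2; rewrite scaleN1r addNr p0; lra.
have /choice[K HK] : forall x, exists r, D x -> S (x, r).
  by move=> x; have [/total[r ?]|nx] := pselect (D x); [exists r|exists 0].
exists K; split.
- move=> [x r] Wz /=; have [Dx _] := Sp _ (or_intror Wz : S (x, r)).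
  by apply: (uniq x); [exact: HK|right].
- move=> a x y Dx Dy; apply: (uniq (a *: x + y)); first by apply: HK; exact: D_lin.
  exact: (Slin a _ _ (HK _ Dx) (HK _ Dy)).
- by move=> x Dx; have [_] := Sp _ (HK _ Dx).
Qed.

End hahn_banach.

(** * The dyadic kernel *)

Section fundamental_kernel.
Context {R : realType} {N : nat}.
Variable G : carnot_group R N.
Notation I := integral_rV.
Local Notation E := 'rV[R]_N.
Local Notation dil := (dilation G).
Implicit Types (phi psi chi f g u v theta : E -> R).

Lemma test_bound m phi : test setT phi -> exists B, forall w x, (size w <= m)%N -> `|partials w phi x| <= B.
Proof.
elim: m phi => [|m IH] phi tp; have [B B0 HB] := Cc_bounded (test_Cc tp).
  by exists B => -[|//] x _; exact: HB.
have /choice[D HD] : forall i : 'I_N, exists B, forall w x, (size w <= m)%N -> `|partials w (partial i phi) x| <= B.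
  by move=> i; apply: IH; exact: (test_partials [:: i] tp).
exists (B + \sum_i `|D i|) => w x; case: (lastP w) => [_|v i].
  by apply: (le_trans (HB x)); rewrite lerDl sumr_ge0.
rewrite size_rcons ltnS partials_rcons => vm; apply: (le_trans (HD i v x vm)).
apply: (le_trans (ler_norm _)); rewrite (bigD1 i)//= addrCA lerDl addr_ge0 ?(ltW B0)//.
exact: sumr_ge0.
Qed.

Lemma test_cut (Om : set E) g chi C : open Om -> smooth Om g -> smooth setT chi -> compact C -> C `<=` Om ->
  (forall x, ~ C x -> chi x = 0) -> test Om (fun x => g x * chi x).
Proof.
move=> oO sg sc cC CO C0; split; last by exists C; split=> // x /C0 ->; rewrite mulr0.
apply: smoothP; apply: smooth_local => x _; have [xO|xO] := pselect (Om x).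
  exists Om, (fun x => g x * chi x); split=> //.
  by apply: smooth_mul => //; exact: smooth_subset sc.
have oC : open (~` C) by apply: closed_openC; exact: compact_closedR.
exists (~` C), (fun=> 0); split=> //; first by move=> /CO.
  exact: smooth_cst.
by move=> z /C0 ->; rewrite mulr0.
Qed.

Lemma dist_subset (Om Om' : set E) (U : functional R N) : Om `<=` Om' -> distribution_on Om' U -> distribution_on Om U.
Proof.
move=> OO [H1 H2]; split.
  by move=> a phi psi t1 t2; apply: H1; exact: test_subset OO _.
by move=> C cC CO; apply: H2 => // x /CO /OO.
Qed.

Variables (lambda : R) (L : diffop R N).
Local Notation Lt := (diffop_tr_app L).
Hypothesis lambda1 : 1 <= lambda.
Hypothesis hom : homogeneous G lambda (diffop_dist L).
Hypothesis inv : left_invariant G (diffop_dist L).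
Hypothesis L_hypo : hypoelliptic (diffop_dist L).
Hypothesis Lt_hypo : hypoelliptic (diffop_tr_dist L).
Hypothesis N0 : (0 < N)%N.
Hypothesis Q0 : (0 < hom_dim G)%N.

Lemma compact_annulus (a b : R) : compact [set x : E | a <= `|x| <= b].
Proof.
apply: (@subclosed_compact _ _ [set x : E | `|x| <= b]); last 2 first.
- exact: compact_cball.
- by move=> x /= /andP[].
have cn : continuous (fun x : E => `|x|) by exact: norm_continuous.
rewrite (_ : [set x | _] = (fun x : E => `|x|) @^-1` [set t | a <= t] `&` (fun x : E => `|x|) @^-1` [set t | t <= b]).
  by apply: closedI; (apply: closed_comp; [by move=> x _; exact: cn|]); [exact: closed_ge|exact: closed_le].
by apply/seteqP; split=> x /=; [move=> /andP[]|move=> [-> ->]].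
Qed.

(* Hahn-Banach: evaluation at 0 of u is continuous in [Lt u]. *)
Lemma local_inverse : exists (s : R) (K : functional R N), [/\ 0 < s <= 1, distribution_on setT K &
  forall u, small G s u -> K (Lt u) = u 0].
Proof.
have [s [m [C [s01 Hs]]]] := local_estimate Lt_hypo N0 Q0.
have s_test u : small G s u -> test setT u.
  move=> su; split; first by case: su.1.
  exists [set x | `|x| <= s]; split => //; first exact: compact_cball.
  by move=> x /negP; rewrite -ltNge; exact: small_norm s01 su.
pose snorm phi := sup [set r | exists w x, (size w <= m)%N /\ r = `|partials w phi x|].
have sn_le phi w x : test setT phi -> (size w <= m)%N -> `|partials w phi x| <= snorm phi.
  move=> tp wm; have [B HB] := test_bound m tp; apply: sup_upper_bound; last by exists w, x.
  by split; [exists `|partials w phi x|, w, x|exists B => _ [v [y [vm ->]]]; exact: HB].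
have sn_ub phi B : (forall w x, (size w <= m)%N -> `|partials w phi x| <= B) -> snorm phi <= B.
  move=> HB; apply: sup_le_ub; first by exists `|partials [::] phi 0|, [::], 0.
  by move=> _ [v [y [vm ->]]]; exact: HB.
have sn_ge0 phi : test setT phi -> 0 <= snorm phi.
  by move=> tp; apply: le_trans (sn_le phi [::] 0 tp isT).
(* The estimate says nothing on the sign of [C]; the absolute value makes [p] a seminorm. *)
pose p phi := `|C| * snorm phi.
(* The graph of $\mathcal L^tu\mapsto u(0)$ on functions with small support. That the value depends
   on $\mathcal L^tu$ only is contained in its domination by [p], which is the a priori estimate. *)
pose W : set ((E -> R) * R) := [set z | exists u, small G s u /\ z = (Lt u, u 0)].
have oT := @openT E.
have lin_small (a : R) u v : small G s u -> small G s v -> small G s (a *: u + v).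
  move=> [su u0] [sv v0]; split; last by move=> x nx; rewrite /= !fctE u0// v0// /GRing.scale/= mulr0 addr0.
  by apply: smooth_add => //; exact: smooth_scale.
have D_lin (a : R) (f g : E -> R) : test setT f -> test setT g -> test setT (a *: f + g).
  by move=> tf tg; exact: test_add (test_scale a tf) tg.
have p_add (f g : E -> R) : test setT f -> test setT g -> p (f + g) <= p f + p g.
  move=> tf tg; rewrite /p -mulrDr; apply: ler_wpM2l => //; apply: sn_ub => w x wm.
  have -> : partials w (f + g) = fun x => partials w f x + partials w g x.
    exact: (partials_add w (test_smooth tf) (test_smooth tg)).
  by apply: (le_trans (ler_normD _ _)); apply: lerD; exact: sn_le.
have sn_hom (a : R) (f : E -> R) : test setT f -> snorm (a *: f) <= `|a| * snorm f.
  move=> tf; apply: sn_ub => w x wm.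
  have -> : partials w (a *: f) = fun x => a * partials w f x by exact: (partialsZ w a (test_smooth tf)).
  by rewrite normrM; apply: ler_wpM2l => //; exact: sn_le.
have p_hom (a : R) (f : E -> R) : 0 < a -> test setT f -> p (a *: f) = a * p f.
  move=> a0 tf; rewrite /p mulrCA; congr (_ * _); apply/eqP; rewrite eq_le.
  have := sn_hom a f tf; rewrite (gtr0_norm a0) => -> /=.
  have := sn_hom a^-1 (a *: f) (test_scale a tf); rewrite scalerA mulVf ?gt_eqF// scale1r.
  by rewrite gtr0_norm ?invr_gt0// -ler_pdivrMl ?invr_gt0// invrK.
have W_dom : dominated (test setT) p W.
  split.
    move=> a _ _ [u [su ->]] [v [sv ->]]; exists (a *: u + v); split; first exact: lin_small.
    congr (_, _); apply/funext => x.
    exact/esym/(tr_app_lin L a x (test_smooth (s_test _ su)) (test_smooth (s_test _ sv))).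
  move=> _ [u [su ->]] /=; have tL := test_tr_app L (s_test _ su); split => //.
  apply: (le_trans (ler_norm _)).
  have H := Hs u (snorm (Lt u)) su (fun w x wm => sn_le _ w x tL wm) 0.
  by apply: (le_trans H); apply: ler_wpM2r (ler_norm _); exact: sn_ge0.
have W0 : W (0, 0).
  have s0 : small G s (fun=> 0) by split=> //; exact: smooth_cst.
  exists (fun=> 0); split => //; congr (_, _); apply/funext => x.
  have := tr_appZ L 0 s0.1; rewrite (_ : (fun y => 0 * 0) = (fun=> 0)); last by apply/funext => y; rewrite mul0r.
  by move=> ->; rewrite mul0r.
have [K [KW Klin Kp]] := hahn_banach D_lin p_add p_hom W_dom W0.
exists s, K; split => //; last by move=> u su; have := KW (Lt u, u 0); apply; exists u.
split; first by move=> a phi psi t1 t2; exact: (Klin a phi psi t1 t2).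
move=> Cs cC _; exists `|C|, m => phi B sp phi0 HB.
have tp : test setT phi by split=> //; exists Cs.
have K0 : K 0 = 0.
  have := Klin 1 0 0 (test0 setT) (test0 setT); rewrite scaler0 addr0 mul1r.
  by move: (K 0) => r; lra.
have KN : K (- phi) = - K phi.
  have := Klin (-1) phi 0 tp (test0 setT); rewrite scaleN1r addr0 K0 addr0 mulN1r; exact.
have tN : test setT (- phi) by have := test_scale (-1) tp; congr test; apply/funext => x; rewrite mulN1r.
have pB : p phi <= `|C| * B by apply: ler_wpM2l => //; exact: sn_ub.
have pN : p (- phi) <= `|C| * B.
  apply: ler_wpM2l => //; apply: (le_trans _ (sn_ub _ _ HB)).
  by have := sn_hom (-1) phi tp; rewrite scaleN1r normrN1 mul1r.
rewrite ler_norml; apply/andP; split; last exact: le_trans (Kp _ tp) pB.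
by rewrite lerNl -KN; exact: le_trans (Kp _ tN) pN.
Qed.

(** The local inverse is multiplied by a cutoff. Since it is smooth off the origin by
    hypoellipticity of $\mathcal L$, the error is a smooth function [omega] coming from the annulus
    where the cutoff varies. Its integral is found by testing with a function equal to 1 on a large
    ball. *)
Lemma parametrix : exists (P : functional R N) (omega : E -> R) (rho : R), [/\ distribution_on setT P, test setT omega,
  forall psi, test setT psi -> P (Lt psi) = psi 0 - I (fun x => omega x * psi x),
  forall phi, test setT phi -> (forall x, `|x| <= rho -> phi x = 0) -> P phi = 0 & I omega = 1].
Proof.
have [s [K [s01 dK HK]]] := local_inverse; have oT := @openT E.
have [d d0 Hd] := (contP _ _).1 (@cont_dil R N G s^-1 0) _ (ltr01 : 0 < (1 : R)).
have {}Hd y : `|y| < d -> `|dil s^-1 y| < 1 by move=> yd; have := Hd y; rewrite dil0 !subr0; exact.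
(* The support of the cutoff, in the ball of radius $2r<d$, must lie in the dilated unit ball where
   [K] inverts [Lt]. *)
pose r := d / 3; have r0 : 0 < r by rewrite divr_gt0.
have r2 : 2 * r < d by rewrite /r; lra.
pose Om : set E := [set x | 0 < `|x|] `&` [set x | `|dil s^-1 x| < 1].
have oO : open Om.
  have cn : continuous (fun x : E => `|x|) by exact: norm_continuous.
  apply: openI.
    by apply: (@open_comp _ _ (fun x : E => `|x|) [set t | 0 < t]); [move=> x _; exact: cn|exact: open_gt].
  apply: (@open_comp _ _ (fun x : E => `|dil s^-1 x|) [set t | t < 1]); last exact: open_lt.
  by move=> x _; apply: continuous_comp; [exact: cont_dil|exact: cn].
have small_supp u : smooth setT u -> (forall x, 2 * r < `|x| -> u x = 0) -> small G s u.
  move=> su u0; split=> // x nx; apply: u0; rewrite ltNge; apply/negP => xr; apply: nx.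
  by apply: ltW; apply: Hd; exact: le_lt_trans r2.
(* On the punctured neighbourhood [K] solves the homogeneous equation, because evaluation at 0 kills
   the test functions there. *)
have LK phi : test Om phi -> diffop_dist L K phi = of_fun (fun=> 0) phi.
  move=> [/Smooth sp [C [cC CO C0]]]; rewrite /diffop_dist HK.
    rewrite C0 ?/of_fun; first by rewrite -[LHS](int0 N); congr I; apply/funext => x; rewrite mul0r.
    by move=> /CO[] /=; rewrite normr0 ltxx.
  by split=> // x nx; apply: C0 => /CO[_ /ltW].
have s0 : smooth Om (fun=> 0) by exact: smooth_cst.
have [kap /Smooth skap kapE] : smooth_distribution_on Om K.
  apply: (L_hypo oO (dist_subset (@subsetT _ _) dK) _ LK).
    by apply: dist_of_cont => // x _; exact: cst_continuous.
  by exists (fun=> 0) => //; case: s0.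
pose chi : E -> R := cube_bump 0 r.
have schi : smooth setT chi := smooth_cube_bump 0 r.
have chi1 x : `|x| <= r -> chi x = 1 by move=> xr; apply: cube_bump1 => //; rewrite subr0.
have chi0 x : 2 * r < `|x| -> chi x = 0 by move=> xr; apply: cube_bump0 => //; rewrite subr0 leNgt xr.
pose A : set E := [set x | r <= `|x| <= 2 * r].
have AO : A `<=` Om by move=> x /andP[x1 x2]; split; [exact: lt_le_trans x1|apply: Hd; exact: le_lt_trans r2].
have [eta [seta [C [cC CO C0]] [V [oV AV V1]] _]] := cutoff_exists (@compact_annulus r (2 * r)) oO AO.
pose kap' x := kap x * eta x.
have tkap : test setT kap' := test_subset (@subsetT _ _) (test_cut oO skap seta cC CO C0).
have skap' := test_smooth tkap.
pose omega x := chi x * diffop_app L kap' x - diffop_app L (fun y => chi y * kap' y) x.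
have tomega : test setT omega.
  by apply: test_sub; [apply: test_mul => //; exact: test_app|apply: test_app; exact: test_mul].
pose P phi := K (fun x => chi x * phi x).
have dP : distribution_on setT P := dist_mul dK schi.
have K0 : K (fun=> 0) = 0.
  rewrite -[RHS](mul0r (K (fun=> 0))) -(distZ 0 dK (test0 setT)); congr K; apply/funext => x; by rewrite mul0r.
have PL psi : test setT psi -> P (Lt psi) = psi 0 - I (fun x => omega x * psi x).
  move=> tp; have sp := test_smooth tp.
  have tcp : test setT (fun x => chi x * psi x) := test_mul schi tp.
  (* The commutator of [Lt] with the cutoff applied to [psi]: it lives on the annulus, where [K] is
     the smooth function [kap'] and integration by parts is possible. *)
  pose theta x := Lt (fun y => chi y * psi y) x - chi x * Lt psi x.
  have t1 : test setT (Lt (fun y => chi y * psi y)) := test_tr_app L tcp.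
  have t2 : test setT (fun x => chi x * Lt psi x) := test_mul schi (test_tr_app L tp).
  have ttheta : test setT theta := test_sub t1 t2.
  have th0 x : ~ A x -> theta x = 0.
    move=> /negP; rewrite negb_and -!ltNge => /orP[xr|xr].
      rewrite /theta (chi1 x (ltW xr)) mul1r (_ : Lt (fun y => chi y * psi y) x = Lt psi x) ?subrr//.
      apply: tr_app_eqnear; apply/nbhs_normP; exists (r - `|x|); first by rewrite subr_gt0.
      move=> y yx; rewrite chi1 ?mul1r//.
      by have := ler_normD (y - x) x; rewrite subrK; move: yx; lra.
    rewrite /theta (chi0 x xr) mul0r subr0 (_ : Lt (fun y => chi y * psi y) x = Lt (fun=> 0) x).
      have s00 : smooth setT (fun _ : E => 0 : R) by exact: smooth_cst.
      have := tr_appZ L 0 s00; rewrite (_ : (fun _ : E => 0 * 0) = (fun=> 0 : R)); last by apply/funext => y; rewrite mul0r.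
      by move=> ->; rewrite mul0r.
    apply: tr_app_eqnear; apply/nbhs_normP; exists (`|x| - 2 * r); first by rewrite subr_gt0.
    move=> y yx; rewrite chi0 ?mul0r//.
    by have := ler_normD (x - y) y; rewrite subrK distrC; move: yx; lra.
  have tthO : test Om theta.
    by split; [case: ttheta|exists A; split=> //; exact: compact_annulus].
  have -> : P (Lt psi) = K (Lt (fun y => chi y * psi y)) - K theta.
    rewrite -(distB dK t1 ttheta); congr K; apply/funext => x; rewrite /theta; ring.
  rewrite HK; last by apply: small_supp (test_smooth tcp) _ => x /chi0 ->; rewrite mul0r.
  rewrite chi1 ?normr0 ?(ltW r0)// mul1r (kapE _ tthO); congr (_ - _).
  have -> : of_fun kap theta = I (fun x => kap' x * theta x).
    congr I; apply/funext => x; rewrite /kap'; have [Ax|/th0 ->] := pselect (A x); last by rewrite !mulr0.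
    by rewrite V1 ?mulr1//; exact: AV.
  have ck := smoothT_cont skap'; have cchi := smoothT_cont schi.
  rewrite (_ : (fun x => kap' x * theta x) = fun x => Lt (fun y => chi y * psi y) x * kap' x - Lt psi x * (chi x * kap' x)); last first.
    by apply/funext => x; rewrite /theta; ring.
  have tck : test setT (fun x => chi x * kap' x) := test_mul schi tkap.
  rewrite intB; [|exact: Cc_mulr (test_Cc t1) ck|exact: Cc_mulr (test_Cc (test_tr_app L tp)) (smoothT_cont (test_smooth tck))].
  rewrite -(int_transpose L (test_smooth tcp) skap'); last by left; exact: test_Cc tcp.
  rewrite -(int_transpose L sp (test_smooth tck)); last by left; exact: test_Cc tp.
  rewrite -intB; [|exact: Cc_mulr (test_Cc tcp) (smoothT_cont (smooth_app L skap'))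
    |exact: Cc_mulr (test_Cc tp) (smoothT_cont (smooth_app L (test_smooth tck)))].
  by congr I; apply/funext => x; rewrite /omega; ring.
have Psupp phi : test setT phi -> (forall x, `|x| <= 2 * r -> phi x = 0) -> P phi = 0.
  move=> tp phi0; rewrite -K0; congr K; apply/funext => x.
  by have [/phi0 ->|/chi0 ->] := leP `|x| (2 * r); rewrite ?mulr0 ?mul0r.
exists P, omega, (2 * r); split => //.
have [_ [ro Hro]] := test_Cc tomega.
(* The test function is 1 on a ball that contains the supports of [omega] and of [chi]; there
   [Lt psi] vanishes by [tr_cutoff], so the parametrix identity reads $0=1-\int\omega$. *)
pose b := `|ro| + 2 * r + 1; have b0 : 0 < b by rewrite /b; have := normr_ge0 ro; lra.
pose psi : E -> R := cube_bump 0 b.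
have psi1 x : `|x| <= b -> psi x = 1 by move=> xb; apply: cube_bump1 => //; rewrite subr0.
have tpsi : test setT psi.
  split; first by case: (smooth_cube_bump (0 : E) b).
  exists [set x | `|x - 0| <= 2 * b]; split=> //; first exact: compact_closed_ball.
  by move=> x; exact: cube_bump0.
have Ltpsi x : `|x| <= 2 * r -> Lt psi x = 0.
  move=> xr; apply: (tr_cutoff lambda1 hom inv (V := [set y : E | `|y| < b])).
  - rewrite (_ : [set y | _] = (fun y : E => `|y|) @^-1` [set t | t < b])//.
    by apply: open_comp; [move=> y _; exact: norm_continuous|exact: open_lt].
  - by move=> y yb; apply: psi1; exact: ltW.
  - by rewrite /=; apply: (le_lt_trans xr); rewrite /b; have := normr_ge0 ro; lra.
have := PL psi tpsi; rewrite (Psupp _ (test_tr_app L tpsi) Ltpsi) psi1 ?normr0 ?(ltW b0)//.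
have -> : (fun x => omega x * psi x) = omega.
  apply/funext => x; have [xb|bx] := leP `|x| b; first by rewrite psi1// mulr1.
  rewrite Hro ?mul0r//; apply: le_lt_trans bx; rewrite /b; apply: (le_trans (ler_norm _)).
  by rewrite -addrA lerDl; lra.
by move: (I omega) => q; lra.
Qed.

(* The kernel is the smooth function representing [P - 2 ^ -lambda * P o delta_(1/2)],
   where P is the parametrix: the singularities cancel by homogeneity. *)
Theorem dyadic_kernel : exists kap omega : E -> R, [/\ test setT kap, test setT omega, I omega = 1 &
  forall psi, test setT psi -> I (fun x => kap x * Lt psi x) =
    I (fun x => omega x * psi (dil 2^-1 x)) - I (fun x => omega x * psi x)].
Proof.
have [P [omega [rho [dP tomega PL Psupp I1]]]] := parametrix; have oT := @openT E.
have h01 : 0 < (2^-1 : R) <= 1 by rewrite invr_gt0 ltr0Sn/= invf_le1// ler1n.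
have hn : (2^-1 : R) != 0 by rewrite invr_neq0// pnatr_eq0.
have n2 : (2 : R) != 0 by rewrite pnatr_eq0.
pose k : functional R N := fun phi => P phi + - (2 `^ lambda)^-1 * P (fun x => phi (dil 2^-1 x)).
have dk : distribution_on setT k := dist_comb _ dP (dist_dil G h01 dP).
have som := test_smooth tomega.
have kL psi : test setT psi -> k (Lt psi) = I (fun x => omega x * psi (dil 2^-1 x)) - I (fun x => omega x * psi x).
  move=> tp; have td := test_dil G hn tp.
  (* By homogeneity the factor $2^{-\lambda}$ is absorbed into [Lt]; the evaluations at 0 then
     cancel, the origin being fixed by dilations. *)
  have -> : k (Lt psi) = P (Lt psi) - P (Lt (fun x => psi (dil 2^-1 x))).
    rewrite /k mulNr; congr (_ - _).
    rewrite (_ : Lt (fun x => psi (dil 2^-1 x)) = fun x => 2^-1 `^ lambda * Lt psi (dil 2^-1 x)); last first.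
      by apply/funext => x; rewrite (tr_dil hom)// invr_gt0.
    rewrite (distZ _ dP (test_dil G hn (test_tr_app L tp))); congr (_ * _).
    have p0 : 2 `^ lambda != 0 :> R by rewrite gt_eqF// powR_gt0.
    by apply: (mulfI p0); rewrite mulfV// -powRM// ?invr_ge0// mulfV// powR1.
  rewrite !PL// dil0; move: (psi 0) (I _) (I _) => q r t; ring.
(* Rescaling gives $\int\omega\,(\psi\circ\delta_{1/2})=2^Q\int(\omega\circ\delta_2)\,\psi$: the
   image of [k] under $\mathcal L$ is the difference of two mollifiers, and hypoellipticity makes
   [k] a smooth function. *)
pose h x := 2 ^+ hom_dim G * omega (dil 2 x) - omega x.
have sh : smooth setT h.
  apply: smooth_sub => //; apply: smooth_scale => //; exact: smooth_compT (smap_dil G 2) som.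
have kh psi : test setT psi -> diffop_dist L k psi = of_fun h psi.
  move=> tp; rewrite /diffop_dist kL// /of_fun.
  have td := test_dil G hn tp; have cp := smoothT_cont (test_smooth tp); have cd := smoothT_cont (test_smooth td).
  have C1 : Cc (fun x => omega x * psi (dil 2^-1 x)) := Cc_mulr (test_Cc tomega) cd.
  have := haar G 0 (ltr0Sn R 1) C1; under eq_fun do rewrite mul0g.
  rewrite (_ : (fun y => omega (dil 2 y) * psi (dil 2^-1 (dil 2 y))) = fun y => omega (dil 2 y) * psi y); last first.
    by apply/funext => y; rewrite dilK.
  move=> H; have q0 : (2 : R) ^+ hom_dim G != 0 by rewrite expf_neq0.
  have -> : I (fun x => omega x * psi (dil 2^-1 x)) = 2 ^+ hom_dim G * I (fun y => omega (dil 2 y) * psi y).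
    by rewrite H mulrA mulfV// mul1r.
  have C2 : Cc (fun y => omega (dil 2 y) * psi y) by apply: Cc_mulr cp; exact: test_Cc (test_dil G n2 tomega).
  rewrite -intZ// -intB; [|exact: Cc_scale|exact: Cc_mulr (test_Cc tomega) cp].
  by congr I; apply/funext => x; rewrite /h; ring.
have [kap /Smooth skap kapE] : smooth_distribution_on setT k.
  apply: (L_hypo oT dk _ kh); last by exists h => //; case: sh.
  by apply: dist_of_cont => // x _; exact: smoothT_cont.
have kap0 x : rho < `|x| -> kap x = 0.
  have oO : open [set x : E | rho < `|x|].
    rewrite (_ : [set x | _] = ~` [set x : E | `|x| <= rho]).
      by apply: closed_openC; exact: closed_cball.
    by apply/seteqP; split=> y /=; rewrite ltNge => /negP.
  apply: (fundamental_lemma oO) => [y _|phi tphi]; first exact: smoothT_cont.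
  have tp := test_subset (@subsetT _ _) tphi.
  have phi0 y : `|y| <= rho -> phi y = 0.
    move=> yr; have [_ [C [_ CO C0]]] := tphi; apply: C0 => /CO /=; by rewrite ltNge yr.
  have := kapE _ tp; rewrite /k /of_fun => <-; rewrite !Psupp//; first by rewrite mulr0 addr0.
    exact: test_dil.
  (* The dilation $\delta_{1/2}$ contracts, so $\phi\circ\delta_{1/2}$ vanishes on the ball of
     radius [rho] whenever [phi] does. *)
  move=> y yr; apply: phi0; apply: le_trans yr; apply: le_trans (dil_norm G y _) _.
    by rewrite invr_ge0 ler0n/= invf_le1// ler1n.
  by rewrite ler_piMl// invf_le1// ler1n.
exists kap, omega; split => //.
  split; first by case: skap.
  exists [set x | `|x| <= rho]; split=> //; first exact: compact_cball.
  by move=> x /negP; rewrite -ltNge; exact: kap0.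
move=> psi tp; rewrite -kL//; exact/esym/(kapE _ (test_tr_app L tp)).
Qed.

End fundamental_kernel.

(** * Localization *)

Section dyadic_pieces.
Context {R : realType} {N : nat}.
Variable G : carnot_group R N.
Notation I := integral_rV.
Local Notation E := 'rV[R]_N.
Local Notation "x ** y" := (Defs.mul G x y) (at level 40, left associativity).
Local Notation dil := (dilation G).
Local Notation cc := (cc_dist G).
Implicit Types (phi psi f g : E -> R).

Lemma lip_ball m (h : 'rV[R]_m -> R) (rho : R) : smooth setT h -> exists2 B, 0 <= B & forall p q : 'rV[R]_m,
  `|p| <= rho -> `|q| <= rho -> `|h p| <= B /\ `|h q - h p| <= B * `|q - p|.
Proof.
move=> sh.
have [B0 B00 HB0] := compact_cont_bounded (@compact_cball R m rho) (fun x _ => smoothT_cont sh (x := x)).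
(* The intermediate points of [incr_tele] are only known to lie within $|q-p|\le2\rho$ of [p],
   whence the radius $3\rho$. *)
have /choice[B HB] : forall i : 'I_m, exists B, 0 < B /\ forall x, `|x| <= 3 * rho -> `|partial i h x| <= B.
  move=> i; have [B ? ?] := compact_cont_bounded (@compact_cball R m (3 * rho)) (fun x _ => smoothT_cont (smooth_partial i sh) (x := x)).
  by exists B.
have S0 : 0 <= \sum_i B i by apply: sumr_ge0 => i _; exact: ltW (HB i).1.
exists (B0 + \sum_i B i) => [|p q pr qr]; first by rewrite addr_ge0// ltW.
split; first by apply: le_trans (HB0 p pr) _; rewrite lerDl.
have [|c [Hc ->]] := @incr_tele R m h p q.
  by move=> z i _; case: (smooth_is_derive i sh (x := z) Logic.I).
apply: (le_trans (ler_norm_sum _ _ _)); apply: (@le_trans _ _ ((\sum_i B i) * `|q - p|)); last first.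
  by apply: ler_wpM2r => //; rewrite lerDr ltW.
rewrite mulr_suml; apply: ler_sum => i _; rewrite normrM.
have -> : q 0 i - p 0 i = (q - p) 0 i by rewrite subE.
apply: ler_pM => //; last exact: coord_le_norm.
apply: (HB i).2; have := Hc i; have := ler_normB q p; have := ler_normD (c i - p) p; rewrite subrK; lra.
Qed.

Lemma smap_dilv a (s : 'rV[R]_a -> R) (v : 'rV[R]_a -> E) : smooth setT s -> smap v -> smap (fun x => dil (s x) (v x)).
Proof.
move=> ss sv j; under eq_fun do rewrite dilE.
by apply: smooth_mul (sv j); [exact: openT|apply: smooth_exp ss; exact: openT].
Qed.

Lemma tr_app_supp (L : diffop R N) f (C : set E) : closed C -> (forall x, ~ C x -> f x = 0) ->
  forall x, ~ C x -> diffop_tr_app L f x = 0.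
Proof.
move=> cC f0 x nx; rewrite /diffop_tr_app big1// => k _; rewrite (partials_supp _ cC) ?mulr0// => y ny.
by rewrite f0// mulr0.
Qed.

Lemma test_supp (w : E -> R) : test setT w -> exists2 r, 0 < r & forall x, r < `|x| -> w x = 0.
Proof.
move=> tw; have [_ [r Hr]] := test_Cc tw; exists (`|r| + 1) => [|x xr]; first by rewrite ltr_wpDl.
by apply: Hr; apply: le_lt_trans xr; apply: (le_trans (ler_norm _)); rewrite lerDl.
Qed.

Notation P := (N + (1 + N))%N.
(** Base point, scale and offset are packed into one row vector, so that one compact ball of
    parameters gives bounds uniform in all three ([lip_ball]). *)
Definition mkp (x : E) (s : R) (eta : E) : 'rV[R]_P := row_mx x (row_mx (const_mx s) eta).
Definition px (p : 'rV[R]_P) : E := lsubmx p.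
Definition ps (p : 'rV[R]_P) : R := (lsubmx (rsubmx p) : 'rV[R]_1) 0 0.
Definition pe (p : 'rV[R]_P) : E := rsubmx (rsubmx p).

Lemma pxE x s eta : px (mkp x s eta) = x.
Proof. by rewrite /px row_mxKl. Qed.

Lemma psE x s eta : ps (mkp x s eta) = s.
Proof. by rewrite /ps row_mxKr row_mxKl mxE. Qed.

Lemma peE x s eta : pe (mkp x s eta) = eta.
Proof. by rewrite /pe row_mxKr row_mxKr. Qed.

Lemma row_norm a b (x : 'rV[R]_a) (y : 'rV[R]_b) r : `|x| <= r -> `|y| <= r -> `|row_mx x y| <= r.
Proof.
move=> xr yr; have r0 : 0 <= r by exact: le_trans xr.
apply: norm_le_coords => // i; case: (split_ordP i) => k ->.
  by rewrite row_mxEl; exact: le_trans (coord_le_norm _ _) xr.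
by rewrite row_mxEr; exact: le_trans (coord_le_norm _ _) yr.
Qed.

Lemma mkp_norm x s eta r : `|x| <= r -> `|s| <= r -> `|eta| <= r -> `|mkp x s eta| <= r.
Proof.
move=> xr sr er; apply: row_norm => //; apply: row_norm => //.
by apply: norm_le_coords => [|i]; [exact: le_trans sr|rewrite mxE].
Qed.

Lemma mkp_sub x s eta eta' : mkp x s eta - mkp x s eta' = mkp 0 0 (eta - eta').
Proof.
apply/rowP => i; rewrite subE; case: (split_ordP i) => k ->; first by rewrite !row_mxEl mxE subrr.
rewrite !row_mxEr; case: (split_ordP k) => l ->; first by rewrite !row_mxEl !mxE subrr.
by rewrite !row_mxEr subE.
Qed.

Lemma smap_p : [/\ smap (fun w : 'rV[R]_(P + N) => px (lsubmx w)), smooth setT (fun w : 'rV[R]_(P + N) => ps (lsubmx w)),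
  smap (fun w : 'rV[R]_(P + N) => pe (lsubmx w)) & smap (fun w : 'rV[R]_(P + N) => rsubmx w)].
Proof.
split.
- exact: smap_comp (@smap_lsub _ _ _) (@smap_lsub _ _ _).
- exact: (smap_comp (smap_comp (@smap_lsub R P N) (@smap_rsub R N (1 + N))) (@smap_lsub R 1 N)) 0.
- exact: smap_comp (smap_comp (@smap_lsub R P N) (@smap_rsub R N (1 + N))) (@smap_rsub R 1 N).
- exact: smap_rsub.
Qed.

Variables (lambda delta Cf : R) (L : diffop R N) (F phi kap : E -> R) (C0 : set E).
Local Notation Lt := (diffop_tr_app L).
Hypothesis lambda1 : 1 <= lambda.
Hypothesis hom : homogeneous G lambda (diffop_dist L).
Hypothesis inv : left_invariant G (diffop_dist L).
Hypothesis delta0 : 0 < delta.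
Hypothesis Cf0 : 0 <= Cf.
Hypothesis cF : continuous F.
Hypothesis C0c : compact C0.
Hypothesis FC0 : forall x y, C0 x -> C0 y -> `|F x - F y| <= Cf * cc x y `^ delta.
Hypothesis sphi : smooth setT phi.
Hypothesis phi0 : forall x, ~ C0 x -> phi x = 0.
Hypothesis tkap : test setT kap.

(* [piece s] pairs [L F] with [theta s x]: it is the part at scale [s] of the potential
   of the localization of [L F] by [phi]. *)
Definition theta (s : R) (x : E) : E -> R := fun y => phi y * kap (dil s^-1 (- y ** x)).
Definition piece (s : R) (x : E) : R := s `^ lambda * ((s ^+ hom_dim G)^-1 * I (fun y => F y * Lt (theta s x) y)).

Lemma tphi : test setT phi.
Proof. by split; [case: sphi|exists C0]. Qed.

Lemma skap : smooth setT kap.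
Proof. exact: test_smooth tkap. Qed.

Lemma test_theta s x : test setT (theta s x).
Proof.
apply: test_mulr tphi _; apply: smooth_compT skap; apply: smap_comp (smap_dil G _).
by apply: smap_mul; [exact: smap_opp (@smap_id _ _)|exact: smap_cst].
Qed.

(* [theta s] read at scale [s] around [x], and at unit scale in terms of [1 / s]: these stay
   jointly smooth as [s] tends to 0 and to infinity. *)
Definition Th1 (p : 'rV[R]_P) (z : E) : R := phi (px p ** dil (ps p) z) * kap (- z ** pe p).
Definition Th2 (p : 'rV[R]_P) (y : E) : R := phi y * kap (- dil (ps p) y ** px p ** pe p).

Lemma jTh1 : jsmooth Th1.
Proof.
have [sx ss se sz] := smap_p; apply: smooth_mul; first exact: openT.
  by apply: smooth_compT sphi; apply: smap_mul => //; exact: smap_dilv.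
by apply: smooth_compT skap; apply: smap_mul => //; exact: smap_opp.
Qed.

Lemma jTh2 : jsmooth Th2.
Proof.
have [sx ss se sz] := smap_p; apply: smooth_mul; first exact: openT.
  exact: smooth_compT sphi.
apply: smooth_compT skap; apply: smap_mul => //; apply: smap_mul => //.
by apply: smap_opp; exact: smap_dilv.
Qed.

(** The substitution $y=x\cdot\delta_sz$ absorbs both normalizing factors, $s^{-Q}$ through the Haar
    measure and $s^\lambda$ through homogeneity. A second point near [x] enters only through the
    offset [eta], so the factor [F] is the same for both points in a difference. *)
Lemma piece_near s x eta : 0 < s ->
  piece s (x ** dil s eta) = I (fun z => F (x ** dil s z) * Lt (Th1 (mkp x s eta)) z).
Proof.
move=> s0; set th := theta s (x ** dil s eta).
have tt : test setT th := test_theta _ _.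
have CF : Cc (fun y => F y * Lt th y) by apply: Cc_mull => //; exact: test_Cc (test_tr_app L tt).
rewrite /piece -(haar G x s0 CF) -intZ; last by apply: (@Cc_act R N G _ x s (lt0r_neq0 s0) CF).
congr I; apply/funext => z; rewrite mulrCA -(tr_act hom inv x z s0 tt); congr (_ * _); congr (Lt _ _).
apply/funext => w; rewrite /th /theta /Th1 pxE psE peE; congr (_ * kap _).
by rewrite oppM -mulgA mulKg dil_mul dilN !dilK ?gt_eqF.
Qed.

(** Left invariance and dilation turn [cc_norm] into a bound on the offset of [y] from [x] seen at
    scale [s]. *)
Lemma eta_bound : exists2 A, 0 < A & forall (s : R) x y, 0 < s ->
  Num.min `|dil s^-1 (- x ** y)| 1 <= A * (cc x y / s).
Proof.
have [A A0 HA] := cc_norm G; exists A => // s x y s0; apply: (le_trans (HA _)).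
rewrite ler_pM2l// mulrC; have si : 0 < s^-1 by rewrite invr_gt0.
have E1 : cc 0 (- x ** y) = cc x y by rewrite -(cc_trans G (- x) x) mulNg.
by have := cc_dil G 0 (- x ** y) si; rewrite dil0 E1.
Qed.

Lemma kap_supp : exists2 r, 0 < r & forall x, r < `|x| -> kap x = 0.
Proof. exact: test_supp tkap. Qed.

Lemma Th1_supp : exists2 r, 1 <= r & forall x s eta, 0 <= s <= 1 -> `|eta| <= 1 -> forall z,
  Th1 (mkp x s eta) z != 0 -> [/\ `|x| <= r, `|z| <= r & C0 (x ** dil s z)].
Proof.
have [rk rk0 Hk] := kap_supp; have [rc rc0 Hc] := compact_sub_cball C0c.
have [r1 r10 H1] := mul_bound G (Num.max 1 rk); have [r2 r20 H2] := mul_bound G (Num.max rc r1).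
exists (1 + r1 + r2) => [|x s eta s01 e1 z]; first by lra.
rewrite /Th1 pxE psE peE mulf_eq0 negb_or => /andP[p0 k0].
have Cz : C0 (x ** dil s z) by apply: contrapT => /phi0 E1; rewrite E1 eqxx in p0.
have zk : `|- z ** eta| <= rk by rewrite leNgt; apply/negP => /Hk E1; rewrite E1 eqxx in k0.
have zr : `|z| <= r1.
  have -> : z = eta ** - (- z ** eta) by rewrite oppM opprK mulVKg.
  by apply: H1; rewrite ?normrN le_max ?e1 ?zk ?orbT.
split=> //; last by lra.
have -> : x = x ** dil s z ** - dil s z by rewrite -mulgA mulgN mulg0.
apply: (le_trans (H2 _ _ _ _)); rewrite ?normrN ?le_max ?(Hc _ Cz)//; last by lra.
apply/orP; right; apply: (le_trans (dil_norm G z s01)); have /andP[s0 s1] := s01.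
by apply: le_trans zr; rewrite ler_piMl.
Qed.

(** As [h] has integral 0, [F] may be replaced by its oscillation from a point where [h] does not
    vanish; this choice keeps both points in [C0], where the Hoelder bound holds. Points at bounded
    distance come within a multiple of [s] under $\delta_s$, which produces $s^\delta$. *)
Lemma core_bound (r : R) : exists2 D, 0 <= D & forall x s (h : E -> R) beta, 0 < s <= 1 -> 0 <= r -> continuous h ->
  (forall z, h z != 0 -> `|z| <= r /\ C0 (x ** dil s z)) -> (forall z, `|h z| <= beta) -> I h = 0 ->
  `|I (fun z => F (x ** dil s z) * h z)| <= D * s `^ delta * beta.
Proof.
have [b b0 Hb] := mul_bound G `|r|; have [D D0 HD] := cc_bounded G b.
exists (Cf * D `^ delta * vol N r); first by rewrite !mulr_ge0 ?powR_ge0 ?vol_ge0.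
move=> x s h beta s01 r0 ch supp hb Ih; have /andP[s0 s1] := s01.
have beta0 : 0 <= beta by exact: le_trans (hb 0).
have Ch : Cc h by split=> //; exists r => z; rewrite ltNge => /negP zr; apply: contrapT => /eqP /supp[].
have cFa : continuous (fun z => F (x ** dil s z)).
  by move=> z; apply: continuous_comp; [exact: smap_cont (smap_act G x s) z|exact: cF].
have RHS0 : 0 <= Cf * D `^ delta * vol N r * s `^ delta * beta.
  by rewrite !mulr_ge0 ?powR_ge0 ?vol_ge0.
have [[z0 hz0]|nz] := pselect (exists z, h z != 0); last first.
  rewrite (_ : (fun z => _) = fun=> 0) ?int0 ?normr0//.
  apply/funext => z; have [->|hz] := eqVneq (h z) 0; first by rewrite mulr0.
  by exfalso; apply: nz; exists z.
have [z0r C00] := supp z0 hz0; pose c := F (x ** dil s z0).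
have -> : I (fun z => F (x ** dil s z) * h z) = I (fun z => (F (x ** dil s z) - c) * h z).
  rewrite (_ : (fun z => (F (x ** dil s z) - c) * h z) = fun z => F (x ** dil s z) * h z - c * h z); last first.
    by apply/funext => z; rewrite mulrBl.
  by rewrite intB ?intZ ?Ih ?mulr0 ?subr0//; [exact: Cc_mull|exact: Cc_scale].
have -> : Cf * D `^ delta * vol N r * s `^ delta * beta = (Cf * (s * D) `^ delta * beta) * vol N r.
  by rewrite powRM ?(ltW s0)//; ring.
apply: int_bound => //.
- by apply: cont_mulT => //; apply: cont_subT => //; exact: cst_continuous.
- move=> z zr; rewrite (_ : h z = 0) ?mulr0//; apply/eqP; apply/negPn/negP => /supp[].
  by rewrite leNgt zr.
move=> z _; rewrite normrM; have [->|hz] := eqVneq (h z) 0.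
  by rewrite normr0 mulr0 !mulr_ge0 ?powR_ge0.
have [zr Cz] := supp z hz; apply: ler_pM => //; apply: le_trans (FC0 Cz C00) _.
apply: ler_wpM2l => //; apply: ge0_ler_powR; rewrite ?nnegrE ?(ltW delta0) ?cc_ge0 ?mulr_ge0 ?(ltW s0)//.
rewrite cc_trans; apply: (le_trans (cc_dil G _ _ s0)); rewrite ler_pM2l//.
rewrite -(cc_trans G (- z)) mulNg; apply: HD; apply: Hb; rewrite ?normrN.
  exact: le_trans zr (ler_norm _).
exact: le_trans z0r (ler_norm _).
Qed.

Lemma test_Th1 x s eta : 0 < s -> test setT (Th1 (mkp x s eta)).
Proof.
move=> s0; rewrite /Th1 pxE psE peE; apply: test_mulr.
  exact: (test_act G x (lt0r_neq0 s0) tphi).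
apply: smooth_compT skap; apply: smap_mul; [exact: smap_opp (@smap_id _ _)|exact: smap_cst].
Qed.

Lemma Th1_tr_supp r x s eta : (forall z, Th1 (mkp x s eta) z != 0 -> [/\ `|x| <= r, `|z| <= r & C0 (x ** dil s z)]) ->
  forall z, Lt (Th1 (mkp x s eta)) z != 0 -> [/\ `|x| <= r, `|z| <= r & C0 (x ** dil s z)].
Proof.
move=> H z; pose C : set E := [set z | `|x| <= r /\ `|z| <= r] `&` [set z | C0 (x ** dil s z)].
have cC : closed C.
  have [xr|xr] := boolP (`|x| <= r); last first.
    rewrite (_ : C = set0); first exact: closed0.
    by apply/seteqP; split=> // y [[]]; rewrite (negbTE xr).
  apply: closedI.
    by rewrite (_ : [set z | _] = [set z : E | `|z| <= r]); [exact: closed_cball|apply/seteqP; split=> y //= []].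
  apply: (@closed_comp _ _ (fun z => x ** dil s z)); last exact: compact_closedR.
  by move=> y _; exact: smap_cont (smap_act G x s) y.
move=> nz; apply: contrapT => nC; move/eqP: nz; apply; apply: (tr_app_supp L cC); last first.
  by move=> [[h1 h2] h3]; apply: nC.
by move=> y ny; apply/eqP; apply/negPn/negP => /H[h1 h2 h3]; apply: ny.
Qed.

(** The base point [x] ranges over the whole group, but the function vanishes for $|x|>r$, and the
    family is jointly smooth up to $s=0$: only a compact set of parameters matters. *)
Lemma param_bound (Th : 'rV[R]_P -> E -> R) (r : R) : jsmooth Th -> 1 <= r ->
  (forall x s eta, 0 < s <= 1 -> `|eta| <= 1 -> forall z, Lt (Th (mkp x s eta)) z != 0 -> `|x| <= r /\ `|z| <= r) ->
  exists2 B, 0 <= B & forall x s eta z, 0 < s <= 1 -> `|eta| <= 1 ->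
    `|Lt (Th (mkp x s eta)) z| <= B /\ `|Lt (Th (mkp x s eta)) z - Lt (Th (mkp x s 0)) z| <= B * `|eta|.
Proof.
move=> jT r1 supp; have [B B0 HB] := lip_ball r (jsmooth_tr_app L jT).
have hE x s eta z : Lt (Th (mkp x s eta)) z = (fun w : 'rV[R]_(P + N) => Lt (Th (lsubmx w)) (rsubmx w)) (row_mx (mkp x s eta) z).
  by rewrite row_mxKl row_mxKr.
have nrm x s eta (z : E) : 0 < s <= 1 -> `|eta| <= 1 -> `|x| <= r -> `|z| <= r -> `|row_mx (mkp x s eta) z| <= r.
  move=> /andP[s0 s1] e1 xr zr; apply: row_norm => //; apply: mkp_norm => //; last exact: le_trans r1.
  by rewrite gtr0_norm//; exact: le_trans r1.
have e00 : `|0 : E| <= 1 by rewrite normr0.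
exists B => // x s eta z s01 e1; split.
  have [->|nz] := eqVneq (Lt (Th (mkp x s eta)) z) 0; first by rewrite normr0.
  have [xr zr] := supp _ _ _ s01 e1 z nz.
  by rewrite hE; have n1 := nrm _ _ _ _ s01 e1 xr zr; exact: (HB _ _ n1 n1).1.
have [E1|nz] := eqVneq (Lt (Th (mkp x s eta)) z - Lt (Th (mkp x s 0)) z) 0.
  by rewrite E1 normr0 mulr_ge0.
have [xr zr] : `|x| <= r /\ `|z| <= r.
  have [E1|nz1] := eqVneq (Lt (Th (mkp x s eta)) z) 0; last exact: supp s01 e1 z nz1.
  have [E2|nz2] := eqVneq (Lt (Th (mkp x s 0)) z) 0; last exact: supp s01 e00 z nz2.
  by rewrite E1 E2 subrr eqxx in nz.
have n1 := nrm _ _ _ _ s01 e1 xr zr; have n0 := nrm _ _ _ _ s01 e00 xr zr.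
rewrite !hE; apply: (le_trans (HB _ _ n0 n1).2); apply: ler_wpM2l => //.
have -> : row_mx (mkp x s eta) z - row_mx (mkp x s 0) z = row_mx (mkp 0 0 eta) 0.
  apply/rowP => i; rewrite subE; case: (split_ordP i) => k ->.
    by rewrite !row_mxEl -subE mkp_sub subr0.
  by rewrite !row_mxEr subrr mxE.
by apply: row_norm; rewrite ?normr0//; apply: mkp_norm; rewrite ?normr0.
Qed.

(** The size and the increments both come from [core_bound], applied to $\mathcal L^t$ of [Th1] and
    to its difference for two offsets; each of these has integral 0. *)
Lemma piece_small : exists2 c, 0 <= c & forall s x y, 0 < s <= 1 ->
  `|piece s x| <= c * s `^ delta /\ `|piece s x - piece s y| <= c * s `^ delta * (cc x y / s).
Proof.
have [r r1 Hr] := Th1_supp; have [D D0 HD] := core_bound r; have r0 : 0 <= r by lra.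
have [A A0 HA] := eta_bound.
have supp x s eta : 0 < s <= 1 -> `|eta| <= 1 -> forall z, Lt (Th1 (mkp x s eta)) z != 0 -> [/\ `|x| <= r, `|z| <= r & C0 (x ** dil s z)].
  by move=> /andP[s0 s1] e1; apply: Th1_tr_supp; apply: Hr => //; rewrite ltW.
have [|B B0 HB] := param_bound jTh1 r1 (r := r).
  by move=> x s eta s01 e1 z nz; have [] := supp x s eta s01 e1 z nz.
have bnd x s eta z s01 e1 := (HB x s eta z s01 e1).1.
have dif x s eta z s01 e1 := (HB x s eta z s01 e1).2.
have e00 : `|0 : E| <= 1 by rewrite normr0.
have cont x s eta : 0 < s -> continuous (Lt (Th1 (mkp x s eta))).
  by move=> s0; apply: smoothT_cont; exact: test_smooth (test_tr_app L (test_Th1 x eta s0)).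
have I0 x s eta : 0 < s -> I (Lt (Th1 (mkp x s eta))) = 0.
  by move=> s0; exact: (int_tr0 lambda1 hom inv (test_Th1 x eta s0)).
have one s x eta : 0 < s <= 1 -> `|eta| <= 1 -> `|piece s (x ** dil s eta)| <= D * s `^ delta * B.
  move=> s01 e1; have /andP[s0 _] := s01; rewrite piece_near//.
  apply: HD => //; [exact: cont| |by move=> z; exact: bnd|exact: I0].
  by move=> z nz; have [] := supp _ _ _ s01 e1 z nz.
have p0 s x : 0 < s <= 1 -> `|piece s x| <= D * s `^ delta * B.
  by move=> s01; have := one s x 0 s01 e00; rewrite dil0 mulg0.
have DB s : 0 <= D * s `^ delta * B by rewrite !mulr_ge0// powR_ge0.
(* For an offset larger than 1 the triangle inequality suffices, the minimum being 1. *)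
have two s x eta : 0 < s <= 1 -> `|piece s (x ** dil s eta) - piece s x| <= 2 * (D * s `^ delta * B) * Num.min `|eta| 1.
  move=> s01; have /andP[s0 s1] := s01; rewrite minEle; case: ifPn => [e1|_]; last first.
    rewrite mulr1; apply: (le_trans (ler_normB _ _)).
    by have := p0 s x s01; have := p0 s (x ** dil s eta) s01; lra.
  have Ex : piece s x = piece s (x ** dil s 0) by rewrite dil0 mulg0.
  rewrite Ex !piece_near//.
  have C1 e : Cc (fun z => F (x ** dil s z) * Lt (Th1 (mkp x s e)) z).
    apply: Cc_mull; last exact: test_Cc (test_tr_app L (test_Th1 x e s0)).
    by move=> z; apply: continuous_comp; [exact: smap_cont (smap_act G x s) z|exact: cF].
  rewrite -intB; [|exact: C1|exact: C1].
  rewrite (_ : (fun z => _) = fun z => F (x ** dil s z) * (Lt (Th1 (mkp x s eta)) z - Lt (Th1 (mkp x s 0)) z)); last first.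
    by apply/funext => z; rewrite mulrBr.
  have DBe := DB s.
  apply: (@le_trans _ _ (D * s `^ delta * (B * `|eta|))); last first.
    rewrite mulrA; apply: ler_wpM2r => //; lra.
  apply: HD => //.
  - by apply: cont_subT; exact: cont.
  - move=> z nz; have [E1|nz1] := eqVneq (Lt (Th1 (mkp x s eta)) z) 0; last by have [] := supp _ _ _ s01 e1 z nz1.
    have [E2|nz2] := eqVneq (Lt (Th1 (mkp x s 0)) z) 0; last by have [] := supp _ _ _ s01 e00 z nz2.
    by rewrite E1 E2 subrr eqxx in nz.
  - by move=> z; exact: dif.
  - rewrite intB ?I0 ?subrr//; apply: test_Cc; apply: test_tr_app; exact: test_Th1.
exists (2 * D * B * (1 + A)) => [|s x y s01]; first by rewrite !mulr_ge0 ?addr_ge0// ltW.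
have /andP[s0 s1] := s01; have DBs := DB s.
have E2 : 2 * D * B * (1 + A) * s `^ delta = 2 * (D * s `^ delta * B) * (1 + A) by ring.
split.
  apply: (le_trans (p0 s x s01)); rewrite E2.
  by move: (D * s `^ delta * B) DBs => q q0; nra.
have Ey : y = x ** dil s (dil s^-1 (- x ** y)) by rewrite dilVK ?gt_eqF// mulVKg.
rewrite distrC {1}Ey; apply: (le_trans (two s x _ s01)).
apply: (@le_trans _ _ (2 * (D * s `^ delta * B) * (A * (cc x y / s)))).
  by apply: ler_wpM2l (HA s x y s0); rewrite mulr_ge0.
rewrite E2; have cs : 0 <= cc x y / s by rewrite divr_ge0 ?cc_ge0// ltW.
rewrite mulrA; apply: ler_wpM2r => //; apply: ler_wpM2l; first by rewrite mulr_ge0.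
by lra.
Qed.

Lemma Th2_supp : exists2 r, 1 <= r & forall x u eta, 0 < u <= 1 -> `|eta| <= 1 -> forall y,
  Th2 (mkp x u eta) y != 0 -> `|x| <= r /\ C0 y.
Proof.
have [rk rk0 Hk] := kap_supp; have [rc rc0 Hc] := compact_sub_cball C0c.
have [r1 r10 H1] := mul_bound G (Num.max rc rk); have [r2 r20 H2] := mul_bound G (Num.max 1 r1).
exists (1 + r2) => [|x u eta /andP[u0 u1] e1 y]; first by lra.
rewrite /Th2 pxE psE peE mulf_eq0 negb_or => /andP[p0 k0].
have Cy : C0 y by apply: contrapT => /phi0 E1; rewrite E1 eqxx in p0.
have wk : `|- dil u y ** x ** eta| <= rk by rewrite leNgt; apply/negP => /Hk E1; rewrite E1 eqxx in k0.
split=> //; have -> : x = dil u y ** (- dil u y ** x ** eta) ** - eta.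
  by rewrite -(mulgA G (- dil u y)) mulVKg -mulgA mulgN mulg0.
apply: (@le_trans _ _ r2); last by lra.
apply: H2; rewrite ?normrN le_max ?e1//; apply/orP; right; apply: H1; rewrite le_max ?wk ?orbT//.
apply/orP; left; apply: (le_trans (dil_norm G y _)); first by rewrite ltW.
by apply: (@le_trans _ _ `|y|); [rewrite ler_piMl|exact: Hc].
Qed.

Lemma theta_Th2 s x y : 0 < s -> theta s y = Th2 (mkp (dil s^-1 x) s^-1 (dil s^-1 (- x ** y))).
Proof.
move=> s0; apply/funext => z; rewrite /Th2 pxE psE peE /theta; congr (_ * kap _).
by rewrite -dilN -!dil_mul -!mulgA mulVKg.
Qed.

(** No cancellation is used: [F] is bounded on [C0] and the weight $s^{\lambda-Q}$ is kept as it
    stands. Compactness applies because [theta], read at unit scale, depends smoothly on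
    $1/s\in(0,1]$ down to 0. *)
Lemma piece_large : exists2 c, 0 <= c & forall s x y, 1 <= s ->
  `|piece s x| <= c * (s `^ lambda / s ^+ hom_dim G) /\
  `|piece s x - piece s y| <= c * (s `^ lambda / s ^+ hom_dim G) * (cc x y / s).
Proof.
have [r r1 Hr] := Th2_supp; have [rc rc0 Hc] := compact_sub_cball C0c.
have [BF BF0 HF] := compact_cont_bounded C0c (fun x (_ : C0 x) => @cF x).
have [A A0 HA] := eta_bound; pose r' := r + rc.
have supp x u eta : 0 < u <= 1 -> `|eta| <= 1 -> forall z, Lt (Th2 (mkp x u eta)) z != 0 -> `|x| <= r /\ C0 z.
  move=> u01 e1 z nz; apply: contrapT => nC; move/eqP: nz; apply.
  have cC : closed [set z | `|x| <= r /\ C0 z].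
    have [xr|xr] := boolP (`|x| <= r).
      rewrite (_ : [set z | _] = C0); first exact: compact_closedR.
      by apply/seteqP; split=> y //= [].
    rewrite (_ : [set z | _] = set0); first exact: closed0.
    by apply/seteqP; split=> y //= [].
  apply: (tr_app_supp L cC) => // y ny; apply/eqP; apply/negPn/negP => H; apply: ny.
  exact: (Hr x u eta u01 e1 y H).
have [||B B0 HB] := param_bound jTh2 (r := r'); first by rewrite /r'; lra.
  move=> x u eta u01 e1 z nz; have [xr /Hc zr] := supp x u eta u01 e1 z nz.
  by split; [apply: (le_trans xr); rewrite lerDl ltW|apply: (le_trans zr); rewrite lerDr; lra].
have e00 : `|0 : E| <= 1 by rewrite normr0.
have sTh u x eta : smooth setT (Th2 (mkp x u eta)) := jsmooth_fix (mkp x u eta) jTh2.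
have bound (u : R) (h : E -> R) (beta : R) : 0 < u <= 1 -> continuous h -> (forall z, h z != 0 -> C0 z) -> (forall z, `|h z| <= beta) ->
    `|I (fun z => F z * h z)| <= BF * beta * vol N rc.
  move=> u01 ch sh hb; apply: int_bound => //; [by apply: cont_mulT|exact: ltW| |].
    move=> z zr; rewrite (_ : h z = 0) ?mulr0//; apply/eqP; apply/negPn/negP => /sh /Hc.
    by rewrite leNgt zr.
  have b0 : 0 <= beta by exact: le_trans (hb 0).
  move=> z _; rewrite normrM; have [->|hz] := eqVneq (h z) 0.
    by rewrite normr0 mulr0 (mulr_ge0 (ltW BF0) b0).
  by apply: ler_pM => //; exact: HF (sh z hz).
have cLt u x eta : continuous (Lt (Th2 (mkp x u eta))) by apply: smoothT_cont; apply: smooth_tr_app.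
pose K := BF * B * vol N rc; have K0 : 0 <= K by rewrite !mulr_ge0 ?vol_ge0// ltW.
have KA : 0 <= 2 * K * (1 + A) by rewrite mulr_ge0 ?addr_ge0 ?(ltW A0)// mulr_ge0.
exists (2 * K * (1 + A)) => // s x y s1.
have s0 : 0 < s by lra.
have u01 : 0 < s^-1 <= 1 by rewrite invr_gt0 s0 invf_le1.
pose w := s `^ lambda / s ^+ hom_dim G; have w0 : 0 <= w by rewrite divr_ge0 ?powR_ge0 ?exprn_ge0// ltW.
have pE z : piece s z = w * I (fun y => F y * Lt (theta s z) y) by rewrite /piece mulrA.
have one z : `|piece s z| <= w * K.
  rewrite pE normrM ger0_norm//; apply: ler_wpM2l => //.
  rewrite (theta_Th2 z z s0) mulNg dil0; apply: (bound s^-1) => //.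
    by move=> v nz; have [] := supp _ _ _ u01 e00 v nz.
  by move=> v; exact: (HB _ _ _ _ u01 e00).1.
have E2 : 2 * K * (1 + A) * w = 2 * (w * K) * (1 + A) by ring.
have wK : 0 <= w * K by rewrite mulr_ge0.
rewrite -/w E2; split.
  by apply: (le_trans (one x)); move: (w * K) wK => q q0; nra.
have two : `|piece s y - piece s x| <= 2 * (w * K) * Num.min `|dil s^-1 (- x ** y)| 1.
  rewrite minEle; case: ifPn => [e1|_]; last first.
    by rewrite mulr1; apply: (le_trans (ler_normB _ _)); have := one x; have := one y; lra.
  rewrite !pE -mulrBr normrM ger0_norm// (theta_Th2 x y s0) (theta_Th2 x x s0) mulNg dil0.
  set eta := dil s^-1 (- x ** y) in e1 *.
  have C1 e : `|e| <= 1 -> Cc (fun z => F z * Lt (Th2 (mkp (dil s^-1 x) s^-1 e)) z).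
    move=> e1'; apply: Cc_mull => //; apply: (Cc_compact C0c) => // z nz.
    by apply/eqP; apply/negPn/negP => H; apply: nz; have [] := supp _ _ _ u01 e1' z H.
  rewrite -intB; [|exact: C1|exact: C1].
  rewrite (_ : (fun z => _) = fun z => F z * (Lt (Th2 (mkp (dil s^-1 x) s^-1 eta)) z - Lt (Th2 (mkp (dil s^-1 x) s^-1 0)) z)); last first.
    by apply/funext => z; rewrite mulrBr.
  apply: (@le_trans _ _ (w * (BF * (B * `|eta|) * vol N rc))).
    apply: ler_wpM2l => //; apply: (bound s^-1) => //.
    - by apply: cont_subT; exact: cLt.
    - move=> z nz; have [E1|nz1] := eqVneq (Lt (Th2 (mkp (dil s^-1 x) s^-1 eta)) z) 0; last by have [] := supp _ _ _ u01 e1 z nz1.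
      have [E3|nz2] := eqVneq (Lt (Th2 (mkp (dil s^-1 x) s^-1 0)) z) 0; last by have [] := supp _ _ _ u01 e00 z nz2.
      by rewrite E1 E3 subrr eqxx in nz.
    - by move=> z; exact: (HB _ _ _ _ u01 e1).2.
  have -> : w * (BF * (B * `|eta|) * vol N rc) = (w * K) * `|eta| by rewrite /K; ring.
  by apply: ler_wpM2r => //; lra.
rewrite distrC; apply: (le_trans two).
apply: (@le_trans _ _ (2 * (w * K) * (A * (cc x y / s)))).
  by apply: ler_wpM2l (HA s x y s0); rewrite mulr_ge0.
have cs : 0 <= cc x y / s by rewrite divr_ge0 ?cc_ge0// ltW.
move: (w * K) (cc x y / s) wK cs => q1 q2 h1 h2; have h3 : 0 <= q1 * q2 by rewrite mulr_ge0.
by rewrite -subr_ge0 (_ : _ - _ = 2 * (q1 * q2)); [rewrite mulr_ge0|ring].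
Qed.

End dyadic_pieces.

(** * Pairing of the dyadic pieces with [Lt psi] *)

Section dyadic_pairing.
Context {R : realType} {N : nat}.
Variable G : carnot_group R N.
Notation I := integral_rV.
Local Notation E := 'rV[R]_N.
Local Notation "x ** y" := (Defs.mul G x y) (at level 40, left associativity).
Local Notation dil := (dilation G).
Local Notation cc := (cc_dist G).
Variables (lambda : R) (L : diffop R N) (F phi kap omega : E -> R) (C0 : set E).
Local Notation Lt := (diffop_tr_app L).
Hypothesis lambda1 : 1 <= lambda.
Hypothesis hom : homogeneous G lambda (diffop_dist L).
Hypothesis inv : left_invariant G (diffop_dist L).
Hypothesis Q0 : (0 < hom_dim G)%N.
Hypothesis cF : continuous F.
Hypothesis C0c : compact C0.
Hypothesis sphi : smooth setT phi.
Hypothesis phi0 : forall x, ~ C0 x -> phi x = 0.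
Hypothesis tkap : test setT kap.
Hypothesis tomega : test setT omega.
Hypothesis omega1 : I omega = 1.
Hypothesis key : forall psi, test setT psi -> I (fun x => kap x * Lt psi x) =
    I (fun x => omega x * psi (dil 2^-1 x)) - I (fun x => omega x * psi x).

Local Notation blk := (piece G lambda L F phi kap).
Local Notation th := (theta G phi kap).

(** Mollification of [psi] at scale [s]; it extends to $s=0$ as the identity because [omega] has
    integral 1 ([avg0]). *)
Definition avg (psi : E -> R) (s : R) (y : E) : R := I (fun z => omega z * psi (y ** dil s z)).
(** The distribution $\phi\,\mathcal LF$ tested on [w]. *)
Definition pairing (w : E -> R) : R := I (fun y => F y * Lt (fun y => phi y * w y) y).

Lemma pairing_supp w y : ~ C0 y -> F y * Lt (fun y => phi y * w y) y = 0.
Proof.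
move=> ny; rewrite (tr_app_supp L (compact_closedR C0c)) ?mulr0// => z /phi0 ->.
by rewrite mul0r.
Qed.

Lemma pairing_Cc w : smooth setT w -> Cc (fun y => F y * Lt (fun y => phi y * w y) y).
Proof.
move=> sw; apply: (Cc_compact C0c); last by move=> y; exact: pairing_supp.
apply: cont_mulT => //; apply: smoothT_cont; apply: smooth_tr_app.
by apply: smooth_mul => //; exact: openT.
Qed.

Lemma pairing_lin (a : R) v w : smooth setT v -> smooth setT w ->
  pairing (fun y => a * v y + w y) = a * pairing v + pairing w.
Proof.
move=> sv sw; rewrite /pairing -intZ -?intD; [|exact: Cc_scale (pairing_Cc sv)|exact: pairing_Cc|exact: pairing_Cc].
congr I; apply/funext => y; rewrite mulrCA -mulrDr -tr_app_lin; [|by apply: smooth_mul => //; exact: openT..].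
by congr (_ * Lt _ _); apply/funext => z; ring.
Qed.

Lemma pairingZ (a : R) v : smooth setT v -> pairing (fun y => a * v y) = a * pairing v.
Proof.
move=> sv; rewrite /pairing -intZ; last exact: pairing_Cc.
congr I; apply/funext => y; rewrite mulrCA; congr (_ * _).
rewrite (_ : (fun y => phi y * (a * v y)) = fun y => a * (phi y * v y)); last by apply/funext => z; rewrite mulrCA.
by rewrite tr_appZ//; apply: smooth_mul => //; exact: openT.
Qed.

Lemma pairing_cont (V : 'rV[R]_1 -> E -> R) : jsmooth V -> continuous (fun u => pairing (V u)).
Proof.
move=> jV; have [r r0 Hr] := compact_sub_cball C0c.
apply: (@int_param_cont _ _ _ _ r) => [|u y yr]; last first.
  by apply: pairing_supp => /Hr; rewrite leNgt yr.
apply: cont_mulT; first by move=> z; apply: continuous_comp; [exact: smap_cont (@smap_rsub _ _ _) z|exact: cF].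
apply: smoothT_cont; apply: (@jsmooth_tr_app _ _ _ (fun u y => phi y * V u y)).
by apply: smooth_mul => //; [exact: openT|exact: smooth_compT (@smap_rsub _ _ _) sphi].
Qed.

Lemma smooth_scalar (m : nat) : smooth setT (fun p : 'rV[R]_(1 + m) => (lsubmx p : 'rV[R]_1) 0 0).
Proof. exact: (@smap_lsub R 1 m) 0. Qed.

Lemma jsmooth_avg psi : smooth setT psi -> jsmooth (fun (u : 'rV[R]_1) y => avg psi (u 0 0) y).
Proof.
move=> sp; have [r r0 Hr] := test_supp tomega.
apply: (@smooth_int R (1 + N) N (fun p z => omega z * psi (rsubmx p ** dil ((lsubmx p : 'rV[R]_1) 0 0) z)) r); last first.
  by move=> p z /Hr ->; rewrite mul0r.
apply: smooth_mul; first exact: openT.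
  exact: smooth_compT (@smap_rsub _ _ _) (test_smooth tomega).
apply: smooth_compT sp; apply: smap_mul; first exact: smap_comp (@smap_lsub _ _ _) (@smap_rsub _ _ _).
apply: smap_dilv; last exact: smap_rsub.
exact: smooth_compT (@smap_lsub _ _ _) (@smooth_scalar N).
Qed.

Lemma smooth_avg psi s : smooth setT psi -> smooth setT (avg psi s).
Proof.
move=> sp; have := jsmooth_fix (const_mx s) (jsmooth_avg sp).
by rewrite mxE.
Qed.

Lemma avg0 psi : avg psi 0 = psi.
Proof.
apply/funext => y; rewrite /avg (_ : (fun z => _) = fun z => psi y * omega z); last first.
  apply/funext => z; rewrite (_ : dil 0 z = 0) ?mulg0 1?mulrC//.
  apply/rowP => j; rewrite dilE [RHS]mxE expr0n (_ : (deg G j == 0)%N = false) ?mul0r//.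
  by apply: gtn_eqF; case/andP: (@deg_bounds R N G j).
by rewrite intZ ?omega1 ?mulr1//; exact: test_Cc tomega.
Qed.

Lemma pairing_avg_small psi (e : R) : smooth setT psi -> 0 < e ->
  exists n0, forall n, (n0 <= n)%N -> `|pairing psi - pairing (avg psi (half n))| < e.
Proof.
move=> sp e0; have := pairing_cont (jsmooth_avg sp) (x := 0) => /contP /(_ e e0)[d d0 Hd].
have [n0 Hn] := half_small 1 d0; exists n0 => n nn.
have hn : 0 < half n :> R by exact: half_gt0.
have H1 : `|(const_mx (half n) : 'rV[R]_1) - 0| < d.
  rewrite subr0; apply: norm_lt_coords => // i; rewrite mxE gtr0_norm//.
  by have := Hn n nn; rewrite mul1r.
by have := Hd _ H1; rewrite !mxE avg0 distrC.
Qed.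

(** Reading the average in the variable $y\cdot\delta_sz$ gives $s^{-Q}$ times a function that
    depends smoothly on $1/s$ down to 0; the bound $1/s$ is what $Q\ge1$ leaves of it. *)
Lemma pairing_avg_large psi : test setT psi -> exists2 B, 0 <= B & forall s, 1 <= s -> `|pairing (avg psi s)| <= B / s.
Proof.
move=> tp; have sp := test_smooth tp; have [r r0 Hr] := test_supp tp.
pose V (u : 'rV[R]_1) (y : E) : R := I (fun x => omega (dil (u 0 0) (- y ** x)) * psi x).
have jV : jsmooth V.
  apply: (@smooth_int R (1 + N) N (fun p x => omega (dil ((lsubmx p : 'rV[R]_1) 0 0) (- rsubmx p ** x)) * psi x) r); last first.
    by move=> p z /Hr ->; rewrite mulr0.
  apply: smooth_mul; first exact: openT.
    apply: smooth_compT (test_smooth tomega); apply: smap_dilv.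
      exact: smooth_compT (@smap_lsub _ _ _) (@smooth_scalar N).
    apply: smap_mul; last exact: smap_rsub.
    by apply: smap_opp; exact: smap_comp (@smap_lsub _ _ _) (@smap_rsub _ _ _).
  exact: smooth_compT (@smap_rsub _ _ _) sp.
have [B B0 HB] := compact_cont_bounded (@compact_cball R 1 1) (fun x _ => pairing_cont jV (x := x)).
exists B => [|s s1]; first exact: ltW.
have s0 : 0 < s by lra.
have sV : smooth setT (V (const_mx s^-1)) := jsmooth_fix _ jV.
have -> : avg psi s = fun y => (s ^+ hom_dim G)^-1 * V (const_mx s^-1) y.
  apply/funext => y; rewrite /V mxE -(haar G y s0).
    rewrite /avg; congr I; apply/funext => z; rewrite mulKg.
    by rewrite dilK ?gt_eqF.
  apply: Cc_mull; last exact: test_Cc tp.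
  apply: smoothT_cont; apply: smooth_compT (test_smooth tomega).
  exact: smap_comp (smap_trans G _) (smap_dil G _).
rewrite pairingZ// normrM mulrC; apply: ler_pM => //.
  apply: HB; apply: norm_le_coords => // i; rewrite mxE ger0_norm ?invr_ge0 ?(ltW s0)//.
  by rewrite invf_le1.
rewrite ger0_norm ?invr_ge0 ?exprn_ge0 ?(ltW s0)// lef_pV2 ?posrE ?exprn_gt0//.
by rewrite -{1}(expr1 s) ler_weXn2l.
Qed.

(** After exchanging the integrals, the inner one at [y] is the kernel identity [key] for the test
    function $z\mapsto\psi(y\cdot\delta_sz)$; its two terms are the averages at the scales $s/2$ and
    $s$. *)
Lemma piece_pairing s psi : 0 < s -> test setT psi ->
  I (fun x => blk s x * Lt psi x) = pairing (avg psi (s / 2)) - pairing (avg psi s).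
Proof.
move=> s0 tp; have tL := test_tr_app L tp; have [r r0 Hr] := test_supp tL.
have [rc rc0 Hc] := compact_sub_cball C0c; have sp := test_smooth tp.
have jth : jsmooth (fun x y => th s x y).
  apply: smooth_mul; first exact: openT.
    exact: smooth_compT (@smap_rsub _ _ _) sphi.
  apply: smooth_compT (test_smooth tkap); apply: smap_comp (smap_dil G _).
  apply: smap_mul; last exact: smap_lsub.
  by apply: smap_opp; exact: smap_rsub.
have jth' : jsmooth (fun y x => th s x y * Lt psi x).
  apply: smooth_mul; [exact: openT| |exact: smooth_compT (@smap_rsub _ _ _) (test_smooth tL)].
  exact: (jsmoothP jth (@smap_rsub _ _ _) (@smap_lsub _ _ _)).
pose c := s `^ lambda / s ^+ hom_dim G.
have thC x y : ~ C0 y -> Lt (th s x) y = 0.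
  apply: (tr_app_supp L (compact_closedR C0c)) => z /phi0 E1.
  by rewrite /theta E1 mul0r.
have cth x : continuous (Lt (th s x)).
  by apply: smoothT_cont; apply: smooth_tr_app; exact: jsmooth_fix x jth.
have CFt x : Cc (fun y => F y * Lt (th s x) y).
  apply: (Cc_compact C0c) ; last by move=> y ny; rewrite thC// mulr0.
  exact: cont_mulT cF (cth x).
have E1 : I (fun x => blk s x * Lt psi x) = c * I (fun x => I (fun y => F y * Lt (th s x) y * Lt psi x)).
  rewrite -intZ.
    congr I; apply/funext => x; rewrite /piece -[X in _ = c * X](_ : Lt psi x * I (fun y => F y * Lt (th s x) y) = _).
      by rewrite /c; ring.
    by rewrite -intZ//; congr I; apply/funext => y; rewrite mulrC.
  rewrite (_ : (fun x => I _) = fun x => I (fun y => F y * Lt (th s x) y) * Lt psi x); last first.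
    by apply/funext => x; rewrite mulrC -intZ//; congr I; apply/funext => y; rewrite mulrC.
  apply: Cc_mull; last exact: test_Cc tL.
  apply: (@int_param_cont _ _ _ _ rc) => [|x y yr]; last first.
    by rewrite thC ?mulr0// => /Hc; rewrite leNgt yr.
  apply: cont_mulT; first by move=> z; apply: continuous_comp; [exact: smap_cont (@smap_rsub _ _ _) z|exact: cF].
  exact: smoothT_cont (jsmooth_tr_app L jth).
rewrite {}E1 (@int_swap _ _ _ (fun x y => F y * Lt (th s x) y * Lt psi x) (Num.max r rc)); last first.
- move=> x y [|]; rewrite gt_max => /andP[h1 h2]; first by rewrite Hr ?mulr0.
  by rewrite thC ?mulr0 ?mul0r// => /Hc; rewrite leNgt h2.
- apply: cont_mulT; last first.
    by apply: smoothT_cont; exact: smooth_compT (@smap_lsub _ _ _) (test_smooth tL).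
  apply: cont_mulT; first by move=> z; apply: continuous_comp; [exact: smap_cont (@smap_rsub _ _ _) z|exact: cF].
  exact: smoothT_cont (jsmooth_tr_app L jth).
(* The factor $s^\lambda$ in [c] is used to rescale [Lt psi], and $s^{-Q}$ cancels the change of
   variables around [y]. *)
have h2 y : c * I (fun x => th s x y * Lt psi x) = phi y * (avg psi (s / 2) y - avg psi s y).
  pose K x := kap (dil s^-1 (- y ** x)) * Lt psi x.
  have CK : Cc K.
    apply: Cc_mull; last exact: test_Cc tL.
    apply: smoothT_cont; apply: smooth_compT (test_smooth tkap).
    exact: smap_comp (smap_trans G _) (smap_dil G _).
  rewrite (_ : (fun x => _) = fun x => phi y * K x); last by apply/funext => x; rewrite /theta /K mulrA.
  rewrite intZ// mulrCA; congr (_ * _).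
  have sQ : s ^+ hom_dim G != 0 by rewrite expf_neq0 ?gt_eqF.
  have -> : I K = s ^+ hom_dim G * I (fun z => K (y ** dil s z)) by rewrite (haar G y s0 CK) mulrA mulfV ?mul1r.
  have ta := test_act G y (lt0r_neq0 s0) tp.
  have -> : avg psi (s / 2) y - avg psi s y = I (fun z => kap z * Lt (fun w => psi (y ** dil s w)) z).
    by rewrite (key ta) /avg; congr (I _ - _); apply/funext => z; rewrite dilM.
  rewrite mulrA /c mulfVK// -intZ; last exact: (@Cc_act R N G _ y s (lt0r_neq0 s0) CK).
  congr I; apply/funext => z; rewrite (tr_act hom inv y z s0 tp) /K mulKg dilK ?gt_eqF//.
  by rewrite mulrCA.
have sa t : smooth setT (avg psi t) by exact: smooth_avg.
rewrite -mulN1r addrC -pairing_lin//.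
(* [Lt] acts in [y] and is carried through the integral in [x], where [Lt psi x] is a scalar. *)
have h3 y : I (fun x => F y * Lt (th s x) y * Lt psi x) = F y * Lt (fun y => I (fun x => th s x y * Lt psi x)) y.
  rewrite (@tr_app_int _ _ _ L (fun y x => th s x y * Lt psi x) r) => [|//|v x /Hr ->]; last by rewrite mulr0.
  have E1 : (fun x => Lt (fun y => th s x y * Lt psi x) y) = fun x => Lt (th s x) y * Lt psi x.
    apply/funext => x; rewrite (_ : (fun y => _) = fun y => Lt psi x * th s x y); last by apply/funext => z; rewrite mulrC.
    by rewrite tr_appZ; [rewrite mulrC|exact: jsmooth_fix x jth].
  rewrite E1 -intZ; first by congr I; apply/funext => x; rewrite mulrA.
  apply: Cc_mull; last exact: test_Cc tL.
  by apply: smoothT_cont; exact: jsmooth_fixr y (jsmooth_tr_app L jth).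
have sI : smooth setT (fun y => I (fun x => th s x y * Lt psi x)).
  by apply: (smooth_int jth' (r := r)) => y x /Hr ->; rewrite mulr0.
rewrite /pairing -intZ.
  congr I; apply/funext => y; rewrite h3 mulrCA; congr (_ * _).
  have -> : c * Lt (fun y => I (fun x => th s x y * Lt psi x)) y = Lt (fun y => c * I (fun x => th s x y * Lt psi x)) y.
    by rewrite tr_appZ.
  by congr (Lt _ _); apply/funext => z; rewrite h2; ring.
under eq_fun do rewrite h3.
apply: (Cc_compact C0c); last first.
  move=> y ny; rewrite (tr_app_supp L (compact_closedR C0c)) ?mulr0// => z /phi0 E1.
  rewrite (_ : (fun x => _) = fun=> 0) ?int0//; apply/funext => x.
  by rewrite /theta E1 !mul0r.
by apply: cont_mulT => //; apply: smoothT_cont; exact: smooth_tr_app.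
Qed.

End dyadic_pairing.

(** * Hoelder bounds for dyadic series *)

Section holder_series.
Context {R : realType}.
Implicit Types (a b : nat -> R).

Lemma psum_telescope a b n : (forall k, a k = b k.+1 - b k) -> psum a n = b n - b 0%N.
Proof.
move=> ab; elim: n => [|n IH]; first by rewrite /psum big_ord0 subrr.
by rewrite /psum big_ord_recr/= -/(psum a n) IH ab addrC subrKA.
Qed.

Lemma powR_expr (x r : R) n : 0 <= x -> (x ^+ n) `^ r = (x `^ r) ^+ n.
Proof.
move=> x0; elim: n => [|n IH]; first by rewrite !expr0 powR1.
by rewrite !exprS powRM ?IH// exprn_ge0.
Qed.

Lemma pow2_gt1 (r : R) : 0 < r -> 1 < 2 `^ r.
Proof.
move=> r0; have E1 : 1 = 1 `^ r :> R by rewrite powR1.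
rewrite [X in X < _]E1; apply: gt0_ltr_powR => //; rewrite ?nnegrE//.
by rewrite ltr1n.
Qed.

Lemma half_powR (r : R) n : half n `^ r = (2 `^ r)^-1 ^+ n.
Proof.
have p0 : 2 `^ r != 0 by rewrite gt_eqF// powR_gt0.
rewrite powR_expr ?invr_ge0//; congr (_ ^+ _); apply: (mulIf p0).
by rewrite mulVf// -powRM ?invr_ge0// mulVf// powR1.
Qed.

(* The two bounds cross at the scale [half J] comparable to [d]; both sides of the
   sum decay geometrically away from it. *)
Lemma holder_small (delta : R) : 0 < delta < 1 -> exists2 K, 0 <= K & forall a (c d : R) n, 0 <= c -> 0 <= d ->
  (forall j, `|a j| <= 2 * (c * half j `^ delta)) -> (forall j, `|a j| <= c * half j `^ delta * (d / half j)) ->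
  `|psum a n| <= K * c * d `^ delta.
Proof.
(* The size bounds decay like $q^j=2^{-\delta j}$, the Lipschitz bounds grow like
   $p^j=2^{(1-\delta)j}$; both ratios are on the right side of 1 because $0<\delta<1$. *)
move=> /andP[de0 de1]; pose q : R := (2 `^ delta)^-1; pose p := 2 * q.
have g1 := pow2_gt1 de0; have q01 : 0 < q < 1 by rewrite invr_gt0 invf_lt1 ?powR_gt0 ?g1 ?ltr01// (lt_trans _ g1).
have /andP[q0 q1] := q01.
have p1 : 1 < p.
  have : 2 = 2 `^ delta * 2 `^ (1 - delta) :> R.
    by rewrite -powRD; [rewrite addrC subrK powRr1|rewrite pnatr_eq0/= implybT].
  move=> E1; rewrite /p {1}E1 mulrAC mulfV ?mul1r; last by rewrite gt_eqF// powR_gt0.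
  by apply: pow2_gt1; rewrite subr_gt0.
have p1' : 0 < p - 1 by rewrite subr_gt0.
have q1' : 0 < 1 - q by rewrite subr_gt0.
have hq j : half j `^ delta = q ^+ j by exact: half_powR.
have hp j : q ^+ j / half j = p ^+ j by rewrite /half /p exprMn -exprVn invrK mulrC.
exists (2 / (p - 1) + 2 / (1 - q)) => [|a c d n c0 d0 a1 a2].
  by rewrite addr_ge0// divr_ge0// ltW.
have [dz|dn] := eqVneq d 0.
  rewrite (_ : psum a n = 0) ?normr0 ?mulr_ge0 ?powR_ge0// ?addr_ge0 ?divr_ge0 ?(ltW p1') ?(ltW q1')//.
  rewrite /psum big1// => k _; apply/eqP; rewrite -normr_le0; apply: (le_trans (a2 k)).
  by rewrite dz mul0r mulr0.
have dp : 0 < d by rewrite lt_neqAle eq_sym dn.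
(* With [J] minimal, $2^{-J}<d\le2^{-(J-1)}$ unless $J=0$, in which case the sum governed by the
   Lipschitz bounds is empty. *)
have exJ : exists J, (half J < d) by have [J HJ] := half_small 1 dp; exists J; have := HJ J (leqnn _); rewrite mul1r.
case: (ex_minnP exJ) => J Jd Jmin.
have low m : `|psum a m| <= c * d / (p - 1) * (p ^+ m - 1).
  elim: m => [|m IH]; first by rewrite /psum big_ord0 normr0 subrr mulr0.
  rewrite /psum big_ord_recr/= -/(psum a m); apply: (le_trans (ler_normD _ _)).
  have := a2 m; rewrite hq => h; have E1 : c * q ^+ m * (d / half m) = c * d * p ^+ m by rewrite -hp; ring.
  have -> : c * d / (p - 1) * (p ^+ m.+1 - 1) = c * d / (p - 1) * (p ^+ m - 1) + c * d * p ^+ m.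
    by rewrite exprS; field; rewrite gt_eqF.
  by apply: lerD => //; rewrite -E1.
have high m : (J <= m)%N -> `|psum a m - psum a J| <= 2 * c / (1 - q) * q ^+ J.
  move=> Jm; have q01' : 0 <= q < 1 by rewrite ltW.
  have Ha k : (0 <= k)%N -> `|a k| <= 2 * c * q ^+ k by move=> _; rewrite -mulrA -hq.
  have := psum_tail q01' Ha (m - J) (leq0n J); rewrite subnKC// => /le_trans; apply.
  by rewrite gerBl mulr_ge0 ?exprn_ge0 ?divr_ge0 ?mulr_ge0// ltW.
have qJ : q ^+ J <= d `^ delta.
  have hJ : 0 < half J :> R by exact: half_gt0.
  by rewrite -hq; apply: ge0_ler_powR; rewrite ?nnegrE ?(ltW de0) ?(ltW Jd) ?(ltW hJ) ?(ltW dp).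
have d2 : d * (p ^+ J - 1) <= 2 * d `^ delta.
  case: J Jd Jmin qJ {high} => [|J] Jd Jmin qJ; first by rewrite expr0 subrr mulr0 mulr_ge0 ?powR_ge0.
  have dJ : d <= half J by rewrite leNgt; apply/negP => /Jmin; rewrite ltnn.
  apply: (@le_trans _ _ (d * p ^+ J.+1)); first by rewrite ler_wpM2l// gerBl.
  rewrite -hp mulrCA halfS; have hJ : 0 < half J :> R by exact: half_gt0.
  apply: (@le_trans _ _ (q ^+ J.+1 * 2)); last by rewrite mulrC ler_pM2l.
  rewrite ler_pM2l ?exprn_gt0// ler_pdivrMr ?divr_gt0//.
  by rewrite mulrCA mulfV// mulr1.
have tot : `|psum a n| <= c * d / (p - 1) * (p ^+ J - 1) + 2 * c / (1 - q) * q ^+ J.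
  have T0 : 0 <= 2 * c / (1 - q) * q ^+ J by rewrite mulr_ge0 ?exprn_ge0 ?divr_ge0 ?mulr_ge0// ltW.
  have [nJ|Jn] := leqP n J.
    apply: (le_trans (low n)); rewrite ler_wpDr//; apply: ler_wpM2l; first by rewrite divr_ge0 ?mulr_ge0// ltW.
    by rewrite lerB// ler_weXn2l// ltW.
  rewrite -(subrK (psum a J) (psum a n)); apply: (le_trans (ler_normD _ _)); rewrite addrC.
  by apply: lerD; [exact: low|exact: high (ltnW Jn)].
apply: (le_trans tot).
have -> : (2 / (p - 1) + 2 / (1 - q)) * c * d `^ delta = c / (p - 1) * (2 * d `^ delta) + 2 * c / (1 - q) * d `^ delta by ring.
apply: lerD; last by apply: ler_wpM2l => //; rewrite divr_ge0 ?mulr_ge0// ltW.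
have -> : c * d / (p - 1) * (p ^+ J - 1) = c / (p - 1) * (d * (p ^+ J - 1)) by ring.
by apply: ler_wpM2l => //; rewrite divr_ge0// ltW.
Qed.

(** One geometric series is enough: $d\le d^\delta$ for $d\le1$, where the Lipschitz bound is used,
    and $1\le d^\delta$ for $d\ge1$, where the size bound is used. *)
Lemma holder_large (delta w : R) b (c d : R) n : 0 < delta < 1 -> 0 <= w < 1 -> 0 <= c -> 0 <= d ->
  (forall j, `|b j| <= 2 * (c * w ^+ j)) -> (forall j, `|b j| <= c * w ^+ j * d) ->
  `|psum b n| <= 2 / (1 - w) * c * d `^ delta.
Proof.
move=> /andP[de0 de1] w01 c0 d0 b1 b2; have /andP[w0 w1] := w01.
have Hb k : (0 <= k)%N -> `|b k| <= 2 * c * d `^ delta * w ^+ k.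
  move=> _; have cw : 0 <= c * w ^+ k by rewrite mulr_ge0 ?exprn_ge0.
  have -> : 2 * c * d `^ delta * w ^+ k = c * w ^+ k * (2 * d `^ delta) by ring.
  have [d1|d1] := lerP d 1.
    apply: (le_trans (b2 k)); apply: ler_wpM2l => //.
    have [->|dn] := eqVneq d 0; first by rewrite mulr_ge0 ?powR_ge0.
    have : d <= d `^ delta by apply: ger1_powR; rewrite ?d1 ?(ltW de1)// lt_neqAle eq_sym dn d0.
    by have := powR_ge0 d delta; lra.
  apply: (le_trans (b1 k)); rewrite mulrC; apply: ler_wpM2l => //.
  have E1 : 1 = 1 `^ delta :> R by rewrite powR1.
  have : 1 <= d `^ delta.
    by rewrite [X in X <= _]E1; apply: ge0_ler_powR; rewrite ?nnegrE ?(ltW de0) ?(ltW d1) ?d0 ?ler01.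
  by lra.
have := psum_tail w01 Hb n (leqnn 0); rewrite add0n /psum big_ord0 subr0 -/(psum b n) expr0 mulr1 => /le_trans; apply.
have -> : 2 / (1 - w) * c * d `^ delta = 2 * c * d `^ delta / (1 - w) by ring.
by rewrite gerBl mulr_ge0 ?exprn_ge0 ?divr_ge0 ?mulr_ge0 ?powR_ge0// subr_ge0 ltW.
Qed.

Lemma geometric_small (q M e : R) : 0 < q < 1 -> 0 < e -> exists n0, forall n, (n0 <= n)%N -> M * q ^+ n < e.
Proof.
move=> /andP[q0 q1] e0; have M1 : 0 < `|M| + 1 by rewrite ltr_wpDl.
have : (fun n => q ^+ n) @ \oo --> (0 : R) by apply: cvg_expr; rewrite gtr0_norm.
move=> /cvgrPdist_lt /(_ (e / (`|M| + 1)))[|n0 _ H]; first by rewrite divr_gt0.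
exists n0 => n /H /=; rewrite sub0r normrN gtr0_norm ?exprn_gt0// ltr_pdivlMr// mulrC.
apply: le_lt_trans; apply: ler_wpM2r; first by rewrite exprn_ge0// ltW.
by apply: (le_trans (ler_norm _)); rewrite lerDl.
Qed.

End holder_series.

(** * Summation over all scales *)

Section dyadic_sum.
Context {R : realType} {N : nat}.
Variable G : carnot_group R N.
Notation I := integral_rV.
Local Notation E := 'rV[R]_N.
Local Notation "x ** y" := (Defs.mul G x y) (at level 40, left associativity).
Local Notation dil := (dilation G).
Local Notation cc := (cc_dist G).

(** The bound of the distance on the unit ball, given by Chow's theorem, is scaled down by a
    dilation; continuity of the group operations does the rest. *)
Lemma cc_small (x : E) (e : R) : 0 < e -> exists2 d, 0 < d & forall y, `|y - x| < d -> cc x y < e.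
Proof.
move=> e0; have [C C0 HC] := cc_bounded G 1; pose s := e / (C + 1).
have s0 : 0 < s by rewrite divr_gt0// ltr_wpDl.
have cn : {for x, continuous (fun y => dil s^-1 (- x ** y))}.
  exact: smap_cont (smap_comp (smap_trans G (- x)) (smap_dil G s^-1)) x.
have [d d0 Hd] := iffLR (contP _ _) cn 1 ltr01; exists d => // y /Hd.
rewrite mulNg dil0 subr0 => h.
rewrite -(cc_trans G (- x)) mulNg -(dilVK G (- x ** y) (lt0r_neq0 s0)) -{1}(dil0 G s).
apply: (le_lt_trans (cc_dil G _ _ s0)); apply: (@le_lt_trans _ _ (s * C)).
  by rewrite ler_pM2l//; exact: HC (ltW h).
by rewrite /s mulrAC ltr_pdivrMr ?ltr_wpDl// ltr_pM2l// ltrDl.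
Qed.

Lemma holder_cont (delta C : R) (f : E -> R) x : 0 < delta -> 0 <= C ->
  (\forall y \near x, `|f x - f y| <= C * cc x y `^ delta) -> {for x, continuous f}.
Proof.
move=> de0 C0 H; apply/contP => e e0; pose t := (e / (C + 1)) `^ delta^-1.
have C1 : 0 < C + 1 by rewrite ltr_wpDl.
have t0 : 0 < t by rewrite powR_gt0// divr_gt0.
have [d d0 Hd] := cc_small x t0; have [d1 d10 Hd1] := iffLR (nbhs_normP _ _) H.
exists (Num.min d d1) => [|y]; first by rewrite lt_min d0.
rewrite lt_min => /andP[/Hd h1 /Hd1 h2]; rewrite distrC; apply: (le_lt_trans h2).
apply: (@le_lt_trans _ _ (C * (e / (C + 1)))).
  apply: ler_wpM2l => //; apply: (@le_trans _ _ (t `^ delta)).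
    by apply: ge0_ler_powR; rewrite ?nnegrE ?cc_ge0 ?(ltW t0) ?(ltW h1) ?(ltW de0).
  by rewrite /t -powRrM mulVf ?gt_eqF// powRr1// divr_ge0// ltW.
by rewrite mulrCA gtr_pMr// ltr_pdivrMr// mul1r ltrDl.
Qed.

Variables (lambda delta Cf : R) (L : diffop R N) (F phi : E -> R) (C0 : set E).
Local Notation Lt := (diffop_tr_app L).
Hypothesis lambda_bounds : 1 <= lambda < (hom_dim G)%:R.
Hypothesis hom : homogeneous G lambda (diffop_dist L).
Hypothesis inv : left_invariant G (diffop_dist L).
Hypothesis delta_bounds : 0 < delta < 1.
Hypothesis Cf0 : 0 <= Cf.
Hypothesis cF : continuous F.
Hypothesis C0c : compact C0.
Hypothesis FC0 : forall x y, C0 x -> C0 y -> `|F x - F y| <= Cf * cc x y `^ delta.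
Hypothesis sphi : smooth setT phi.
Hypothesis phi0 : forall x, ~ C0 x -> phi x = 0.
Variables kap omega : E -> R.
Hypothesis tkap : test setT kap.
Hypothesis tomega : test setT omega.
Hypothesis omega1 : I omega = 1.
Hypothesis key : forall psi, test setT psi -> I (fun x => kap x * Lt psi x) =
    I (fun x => omega x * psi (dil 2^-1 x)) - I (fun x => omega x * psi x).

Local Notation piece := (piece G lambda L F phi kap).

Definition dya (k : nat) : E -> R := piece (half k).
(** The exponent starts at 1, the scale 1 being already that of [dya 0]. *)
Definition dyb (k : nat) : E -> R := piece (2 ^+ k.+1).

Lemma lambda_ge1 : 1 <= lambda. Proof. by case/andP: lambda_bounds. Qed.
Lemma delta_gt0 : 0 < delta. Proof. by case/andP: delta_bounds. Qed.

Lemma hom_dim_gt0 : (0 < hom_dim G)%N.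
Proof.
rewrite -(ltr_nat R); case/andP: lambda_bounds => h1 h2.
by apply: lt_trans h2; apply: lt_le_trans h1.
Qed.

(** The ratios of the two geometric majorants, $2^{-\delta}$ towards small scales and
    $2^{\lambda-Q}$ towards large ones. *)
Let qa : R := (2 `^ delta)^-1.
Let qb : R := 2 `^ lambda / 2 ^+ hom_dim G.

Lemma qa_bounds : 0 < qa < 1.
Proof. by have := pow2_gt1 delta_gt0 => h; rewrite invr_gt0 invf_lt1 ?powR_gt0 ?h. Qed.

Lemma qb_bounds : 0 < qb < 1.
Proof.
have p0 : 0 < 2 ^+ hom_dim G :> R by rewrite exprn_gt0.
rewrite divr_gt0 ?powR_gt0//= ltr_pdivrMr// mul1r -powR_mulrn//.
case/andP: lambda_bounds => _ h; rewrite -(subrK lambda (hom_dim G)%:R) powRD; last first.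
  by rewrite pnatr_eq0/= implybT.
by rewrite ltr_pMl ?powR_gt0// pow2_gt1// subr_gt0.
Qed.

Lemma weightE k : (2 ^+ k.+1) `^ lambda / (2 ^+ k.+1) ^+ hom_dim G = qb ^+ k.+1.
Proof. by rewrite powR_expr// exprAC expr_div_n. Qed.

Lemma half_itv k : 0 < (half k : R) <= 1.
Proof. by rewrite half_gt0/= -(expr0 2^-1) (half_le (R := R) (leq0n k)). Qed.

Lemma dya_bound : exists2 c, 0 <= c & forall k x y,
  `|dya k x| <= c * qa ^+ k /\ `|dya k x - dya k y| <= c * qa ^+ k * (cc x y / half k).
Proof.
have [c c0 Hc] := piece_small lambda_ge1 hom inv delta_gt0 Cf0 cF C0c FC0 sphi phi0 tkap.
by exists c => // k x y; have := Hc _ x y (half_itv k); rewrite half_powR.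
Qed.

Lemma dyb_bound : exists2 c, 0 <= c & forall k x y,
  `|dyb k x| <= c * qb ^+ k /\ `|dyb k x - dyb k y| <= c * qb ^+ k * cc x y.
Proof.
have [c c0 Hc] := piece_large G lambda L cF C0c sphi phi0 tkap.
exists c => // k x y; have s1 : 1 <= 2 ^+ k.+1 :> R by rewrite exprn_ege1// ler1n.
have /andP[qb0 qb1] := qb_bounds; have := Hc _ x y s1; rewrite weightE => -[h1 h2].
have h3 : c * qb ^+ k.+1 <= c * qb ^+ k.
  by rewrite ler_wpM2l// exprS ler_piMl ?exprn_ge0 ?(ltW qb0) ?(ltW qb1).
split; first exact: le_trans h1 h3.
apply: (le_trans h2); apply: ler_pM => //.
- by rewrite mulr_ge0 ?exprn_ge0 ?(ltW qb0).
- by rewrite divr_ge0 ?cc_ge0 ?exprn_ge0.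
- by rewrite ler_pdivrMr ?exprn_gt0// ler_peMr ?cc_ge0.
Qed.

Lemma lin_cont (C : R) (f : E -> R) : 0 <= C -> (forall x y, `|f x - f y| <= C * cc x y) -> continuous f.
Proof.
move=> C1 H x; apply: (@holder_cont 1 C) => //; near=> y.
by rewrite powRr1 ?cc_ge0.
Unshelve. all: by end_near. Qed.

Lemma dya_cont k : continuous (dya k).
Proof.
have [c c0 H] := dya_bound; have /andP[q0 _] := qa_bounds; have h0 : 0 < half k :> R by exact: half_gt0.
have K0 : 0 <= c * qa ^+ k / half k by rewrite divr_ge0 ?mulr_ge0 ?exprn_ge0 ?(ltW q0) ?(ltW h0).
apply: (lin_cont K0) => x y; have := (H k x y).2.
by rewrite (_ : c * qa ^+ k * (cc x y / half k) = c * qa ^+ k / half k * cc x y) //; ring.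
Qed.

Lemma dyb_cont k : continuous (dyb k).
Proof.
have [c c0 H] := dyb_bound; have /andP[q0 _] := qb_bounds.
have K0 : 0 <= c * qb ^+ k by rewrite mulr_ge0 ?exprn_ge0 ?(ltW q0).
by apply: (lin_cont K0) => x y; exact: (H k x y).2.
Qed.

Definition partial_dyadic (n : nat) (x : E) : R := psum (fun k => dya k x) n + psum (fun k => dyb k x) n.

Lemma cont_psum (a : nat -> E -> R) n : (forall k, continuous (a k)) -> continuous (fun x => psum (fun k => a k x) n).
Proof. by move=> ca x; apply: cont_sum => k; exact: ca. Qed.

Lemma partial_dyadic_cont n : continuous (partial_dyadic n).
Proof.
have ha := @cont_psum dya n dya_cont; have hb := @cont_psum dyb n dyb_cont.
by move=> x; exact: (cvgD (ha x) (hb x)).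
Qed.

(** The constant does not depend on [n], so that it passes to the limit. *)
Lemma partial_dyadic_holder : exists2 K, 0 <= K & forall n x y,
  `|partial_dyadic n x - partial_dyadic n y| <= K * cc x y `^ delta.
Proof.
have [ca ca0 Ha] := dya_bound; have [cb cb0 Hb] := dyb_bound.
have /andP[qa0 qa1] := qa_bounds; have qb01 := qb_bounds; have /andP[qb0 qb1] := qb01.
have [K1 K10 HK1] := holder_small delta_bounds.
exists (K1 * ca + 2 / (1 - qb) * cb) => [|n x y].
  by rewrite addr_ge0 ?mulr_ge0 ?invr_ge0 ?subr_ge0 ?(ltW qb1).
have E1 (a : nat -> E -> R) : psum (fun k => a k x) n - psum (fun k => a k y) n = psum (fun k => a k x - a k y) n.
  by rewrite /psum sumrB.
rewrite /partial_dyadic opprD addrACA !E1 mulrDl; apply: (le_trans (ler_normD _ _)); apply: lerD.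
  apply: HK1 => //; first exact: cc_ge0.
    move=> j; rewrite half_powR; apply: (le_trans (ler_normB _ _)).
    by have := (Ha j x y).1; have := (Ha j y y).1; move: (ca * _) => z; lra.
  by move=> j; rewrite half_powR; exact: (Ha j x y).2.
have w01 : 0 <= qb < 1 by rewrite (ltW qb0).
apply: holder_large => //; first exact: cc_ge0.
  move=> j; apply: (le_trans (ler_normB _ _)).
  by have := (Hb j x y).1; have := (Hb j y y).1; move: (cb * _) => z; lra.
by move=> j; exact: (Hb j x y).2.
Qed.

Lemma int_psum (a : nat -> E -> R) (h : E -> R) n : (forall k, continuous (a k)) -> Cc h ->
  I (fun x => psum (fun k => a k x) n * h x) = psum (fun k => I (fun x => a k x * h x)) n.
Proof.
move=> ca Ch; rewrite /psum -(@int_sum R N n (fun k x => a k x * h x)); last first.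
  by move=> k; exact: Cc_mull (ca k) Ch.
by congr I; apply/funext => x; rewrite mulr_suml.
Qed.

Lemma partial_dyadic_pairing n psi : test setT psi -> I (fun x => partial_dyadic n x * Lt psi x) =
  pairing L F phi (avg G omega psi (half n)) - pairing L F phi (avg G omega psi (2 ^+ n)).
Proof.
move=> tp; have CL : Cc (Lt psi) := test_Cc (test_tr_app L tp).
have [P [PE PP]] : exists P : R -> R, (forall s, P s = pairing L F phi (avg G omega psi s)) /\
    forall s, 0 < s -> I (fun x => piece s x * Lt psi x) = P (s / 2) - P s.
  exists (fun s => pairing L F phi (avg G omega psi s)); split=> // s s0.
  exact: (piece_pairing hom inv cF C0c sphi phi0 tkap tomega key s0 tp).
rewrite (_ : (fun x => _) = fun x => psum (fun k => dya k x) n * Lt psi x + psum (fun k => dyb k x) n * Lt psi x); last first.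
  by apply/funext => x; rewrite mulrDl.
rewrite intD; first last.
- by apply: Cc_mull => //; apply: cont_psum; exact: dyb_cont.
- by apply: Cc_mull => //; apply: cont_psum; exact: dya_cont.
rewrite (int_psum n dya_cont CL) (int_psum n dyb_cont CL).
have Pa k : I (fun x => dya k x * Lt psi x) = P (half k.+1) - P (half k).
  by rewrite halfS; apply: PP; exact: half_gt0.
have Pb k : I (fun x => dyb k x * Lt psi x) = - P (2 ^+ k.+1) - - P (2 ^+ k).
  have p2 : (2 : R) != 0 by rewrite pnatr_eq0.
  have -> : 2 ^+ k = 2 ^+ k.+1 / 2 :> R by rewrite exprS mulrAC mulfV ?mul1r.
  by rewrite opprK addrC; apply: PP; rewrite exprn_gt0.
(* The two telescopes run from scale 1 downwards and upwards; their values at scale 1 cancel. *)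
have Ea := psum_telescope n Pa; have Eb := psum_telescope (b := fun k => - P (2 ^+ k)) n Pb.
apply: (etrans (congr2 +%R Ea Eb)); rewrite -!PE /half !expr0.
by move: (P _) (P _) (P _) => u v w; ring.
Qed.

(** Convergence is uniform, by the size bounds alone. The pairing of the partial sums tends to that
    of [psi], as the averages at scale $2^{-n}$ tend to [psi] and those at scale $2^n$ to 0. *)
Lemma localized_function : exists g : E -> R, [/\ continuous g,
  exists2 K, 0 <= K & forall x y, `|g x - g y| <= K * cc x y `^ delta &
  forall psi, test setT psi -> I (fun x => g x * Lt psi x) = pairing L F phi psi].
Proof.
have [ca ca0 Ha] := dya_bound; have [cb cb0 Hb] := dyb_bound.
have qa01 := qa_bounds; have qb01 := qb_bounds.
have /choice[ga Hga] : forall x, exists l, forall n, (0 <= n)%N -> `|l - psum (fun k => dya k x) n| <= ca / (1 - qa) * qa ^+ n.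
  by move=> x; apply: geometric_tail => // k _; exact: (Ha k x x).1.
have /choice[gb Hgb] : forall x, exists l, forall n, (0 <= n)%N -> `|l - psum (fun k => dyb k x) n| <= cb / (1 - qb) * qb ^+ n.
  by move=> x; apply: geometric_tail => // k _; exact: (Hb k x x).1.
pose g x := ga x + gb x.
have lim e : 0 < e -> exists n0, forall n, (n0 <= n)%N -> forall x, `|g x - partial_dyadic n x| <= e.
  move=> e0; have e2 : 0 < e / 2 by rewrite divr_gt0.
  have [na Hna] := geometric_small (ca / (1 - qa)) qa01 e2; have [nb Hnb] := geometric_small (cb / (1 - qb)) qb01 e2.
  exists (maxn na nb) => n; rewrite geq_max => /andP[/Hna h1 /Hnb h2] x.
  rewrite /g /partial_dyadic opprD addrACA; apply: (le_trans (ler_normD _ _)).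
  have := Hga x n (leq0n n); have := Hgb x n (leq0n n); move: h1 h2.
  by move: (_ * qa ^+ n) (_ * qb ^+ n) `|_| `|_| => u v w z; lra.
have [K K0 HK] := partial_dyadic_holder.
have gH x y : `|g x - g y| <= K * cc x y `^ delta.
  apply/ler_addgt0Pr => e e0; have e2 : 0 < e / 2 by rewrite divr_gt0.
  have [n Hn] := lim _ e2; have h := Hn n (leqnn n); have := HK n x y; have := h x; have := h y.
  move: (partial_dyadic n x) (partial_dyadic n y) (K * _) => u v w h1 h2 h3.
  have -> : g x - g y = (g x - u) + (u - v) - (g y - v) by ring.
  have := ler_normB ((g x - u) + (u - v)) (g y - v); have := ler_normD (g x - u) (u - v); lra.
have cg : continuous g.
  move=> x; apply: (@holder_cont delta K) => //; first exact: delta_gt0.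
  by near=> y; exact: gH.
exists g; split=> //; first by exists K.
move=> psi tp; have CL : Cc (Lt psi) := test_Cc (test_tr_app L tp); have sp := test_smooth tp.
have CA := Cc_norm CL; have IA : 0 <= I (fun x => `|Lt psi x|).
  by rewrite -(@int0 R N); apply: int_le => //; exact: Cc0.
apply/eqP; rewrite -subr_eq0 -normr_le0; apply/ler_addgt0Pr => e e0; rewrite add0r.
(* The three errors are the uniform distance of the partial sum to [g], the average at the smallest
   scale and the average at the largest one. *)
have e3 : 0 < e / 3 by rewrite divr_gt0.
have e4 : 0 < e / 3 / (I (fun x => `|Lt psi x|) + 1) by rewrite divr_gt0// ltr_wpDl.
have [n1 H1] := lim _ e4.
have [n2 H2] := pairing_avg_small G L cF C0c sphi phi0 tomega omega1 sp e3.
have [B B0 HB] := pairing_avg_large (G := G) L hom_dim_gt0 cF C0c sphi phi0 tomega tp.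
have [n3 H3] := half_small B e3; pose n := maxn n1 (maxn n2 n3).
have h1 : `|I (fun x => g x * Lt psi x) - I (fun x => partial_dyadic n x * Lt psi x)| <= e / 3.
  have cp := @partial_dyadic_cont n; rewrite -intB; [|exact: Cc_mull|exact: Cc_mull].
  have E1 : (fun x => g x * Lt psi x - partial_dyadic n x * Lt psi x) = fun x => (g x - partial_dyadic n x) * Lt psi x.
    by apply/funext => x; rewrite mulrBl.
  rewrite E1; apply: (@le_trans _ _ (I (fun x => e / 3 / (I (fun x => `|Lt psi x|) + 1) * `|Lt psi x|))).
    apply: abs_int_le.
    - by apply: Cc_mull => //; exact: cont_subT.
    - exact: Cc_scale.
    - by move=> x; rewrite normrM; apply: ler_wpM2r => //; apply: H1; rewrite leq_maxl.
  rewrite intZ// mulrAC ler_pdivrMr ?ltr_wpDl// ler_pM2l// lerDl.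
  exact: ler01.
have h2 := H2 n (leq_trans (leq_maxl _ _) (leq_maxr _ _)).
have h3 : `|pairing L F phi (avg G omega psi (2 ^+ n))| <= e / 3.
  apply: (le_trans (HB _ _)); first by rewrite exprn_ege1// ler1n.
  by rewrite -exprVn; apply: ltW; exact: H3 n (leq_trans (leq_maxr _ _) (leq_maxr _ _)).
move: h1 h2 h3; rewrite partial_dyadic_pairing//.
move: (I _) (pairing _ _ _ psi) (pairing _ _ _ _) (pairing _ _ _ _) => u v w z.
rewrite !ler_norml !ltr_norml => /andP[h1 h1'] /andP[h2 h2'] /andP[h3 h3'].
by apply/andP; split; lra.
Unshelve. all: by end_near. Qed.

End dyadic_sum.

(** * Removability *)

Section removability.
Context {R : realType} {N : nat}.
Notation I := integral_rV.
Local Notation E := 'rV[R]_N.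

Lemma connected_rV : connected [set: E].
Proof.
have -> : [set: E] = \bigcup_(x in [set: E]) [set t *: x | t in [set: R]].
  by apply/seteqP; split=> // x _; exists x => //; exists 1 => //; rewrite scale1r.
apply: bigcup_connected.
  by exists 0 => x _; exists 0 => //; rewrite scale0r.
move=> x _; apply: connected_continuous_connected; first exact/connected_intervalP.
by apply: continuous_subspaceT => t; exact: scalel_continuous.
Qed.

(** Additivity of [U] suffices: splitting off $\theta b_a$ for one bump $b_a$ at a time does not
    change the value and multiplies the remainder by $1-b_a$. Once all bumps of a cover of the
    support are used, nothing remains. *)
Lemma vanishes_local (Om : set E) (U : functional R N) :
  (forall phi psi, test setT phi -> test setT psi -> U (fun x => phi x + psi x) = U phi + U psi) ->
  (forall x, Om x -> exists V, [/\ open V, V x & vanishes_on V U]) -> vanishes_on Om U.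
Proof.
move=> Ua Uloc phi tphi; have [sphi [C [cC CO C0]]] := tphi.
have U0 : U (fun=> 0) = 0.
  have := Ua _ _ (test0 setT) (test0 setT).
  have -> : (fun _ : E => 0 + 0 : R) = (fun=> 0) by apply/funext => y; rewrite addr0.
  by move: (U _) => u; lra.
have H x : exists r, C x -> 0 < r /\ exists V, vanishes_on V U /\ forall y, `|y - x| <= 2 * r -> V y.
  have [Cx|nC] := pselect (C x); last by exists 0.
  have [V [oV Vx UV]] := Uloc x (CO _ Cx); have [r r0 Hr] := open_ball_sub oV Vx.
  by exists r => _; split=> //; exists V.
have [rad Hrad] := choice H.
have [s [sC sc]] := compact_ball_cover cC (fun x Cx => (Hrad x Cx).1).
have s1 a : smooth setT (fun x : E => 1 - cube_bump a (rad a) x).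
  by apply: smooth_sub; [exact: openT|apply: smooth_cst; exact: openT|exact: smooth_cube_bump].
have split s' : {subset s' <= s} -> forall th, test setT th ->
    U th = U (fun x => th x * \prod_(a <- s') (1 - cube_bump a (rad a) x)).
  elim: s' => [|a s' IH] ss th tth.
    by congr U; apply/funext => x; rewrite big_nil mulr1.
  have Ca := sC a (ss a (mem_head _ _)); have [r0 [V [UV HV]]] := Hrad a Ca.
  have t1 := test_mulr tth (s1 a).
  have t2 : test V (fun x => th x * cube_bump a (rad a) x).
    have [sm _] := test_mulr tth (smooth_cube_bump a (rad a)); split=> //.
    exists [set x | `|x - a| <= 2 * rad a]; split=> //; first exact: compact_closed_ball.
    by move=> x /= nx; rewrite cube_bump0 ?mulr0.
  have -> : U th = U (fun x => th x * (1 - cube_bump a (rad a) x)) + U (fun x => th x * cube_bump a (rad a) x).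
    by rewrite -Ua//; [congr U; apply/funext => x; ring|exact: test_subset t2].
  rewrite (UV _ t2) addr0 (IH _ _ t1); last by move=> b bs; apply: ss; rewrite inE bs orbT.
  by congr U; apply/funext => x; rewrite big_cons mulrA.
have tT : test setT phi by exact: test_subset tphi.
rewrite (split s _ phi tT)//; apply: etrans U0; congr U; apply/funext => x.
have [/sc[a as_ xa]|nC] := pselect (C x); last by rewrite C0// mul0r.
rewrite (big_rem a)//= cube_bump1 ?subrr ?mul0r ?mulr0//; last exact: ltW.
exact: (Hrad a (sC a as_)).1.
Qed.

Variable G : carnot_group R N.
Local Notation cc := (cc_dist G).
Variables (lambda delta : R) (L : diffop R N) (K : set E).
Local Notation Lt := (diffop_tr_app L).
Hypothesis lambda_bounds : 1 <= lambda < (hom_dim G)%:R.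
Hypothesis hom : homogeneous G lambda (diffop_dist L).
Hypothesis inv : left_invariant G (diffop_dist L).
Hypothesis L_hypo : hypoelliptic (diffop_dist L).
Hypothesis Lt_hypo : hypoelliptic (diffop_tr_dist L).
Hypothesis delta_bounds : 0 < delta < 1.
Hypothesis cK : compact K.

Lemma lip_cont (Om : set E) f x : open Om -> lip G delta Om f -> Om x -> {for x, continuous f}.
Proof.
move=> oO [C [C0 H]] Ox; have /andP[d0 _] := delta_bounds.
apply: (@holder_cont R N G delta C f x d0 (ltW C0)).
by near=> y; apply: H => //; near: y; exact: open_nbhs_nbhs.
Unshelve. all: by end_near. Qed.

Lemma dist_Lt_add (Om : set E) f : open Om -> lip G delta Om f -> forall phi psi, test Om phi -> test Om psi ->
  diffop_dist L (of_fun f) (fun x => phi x + psi x) = diffop_dist L (of_fun f) phi + diffop_dist L (of_fun f) psi.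
Proof.
move=> oO lf phi psi t1 t2; rewrite /diffop_dist.
have df : distribution_on Om (of_fun f) by apply: dist_of_cont => // x; exact: lip_cont.
rewrite -(distD df (test_tr_app L t1) (test_tr_app L t2)); congr (of_fun f _); apply/funext => x.
rewrite -[X in X + _]mul1r -tr_app_lin; [|exact: test_smooth t1|exact: test_smooth t2].
by congr (Lt _ _); apply/funext => y; rewrite mul1r.
Qed.

Lemma cutoff_of_compact : exists psi, cutoff K psi.
Proof.
have [psi [s [C [cC CT C0]] [V [oV KV V1]] _]] := cutoff_exists cK (@openT E) (fun _ _ => Logic.I).
by exists psi; split; [split; [case: s|exists C]|exists V].
Qed.

Lemma lip_norm_le1 (f : E -> R) : lip_bound G delta setT f 1 -> lip_norm G delta setT f <= 1.
Proof. by move=> h; apply: ge_inf => //; exists 0 => C [C0 _]; exact: ltW. Qed.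

Lemma removable_kappa0 : removable G L delta K -> kappa G L delta K = 0%E.
Proof.
move=> rem; rewrite /kappa (_ : [set z | _] = [set 0%E]) ?ereal_sup1//.
apply/seteqP; split=> [_ [f [psi [lf _ sf [tpsi _] ->]]]|_ ->] /=.
  rewrite (rem setT openT connected_rV _ f lf) ?normr0//; first by exists 0.
  apply: vanishes_local => [phi1 psi1 t1 t2|x [_ nK]]; first exact: (dist_Lt_add openT lf).
  have : ~ dsupport (diffop_dist L (of_fun f)) x by move=> /sf.
  by move=> /contrapT[V [oV UV] Vx]; exists V.
(* The zero function makes the set of competitors nonempty, so that the supremum is 0 and not
   $-\infty$. *)
have [psi cpsi] := cutoff_of_compact; exists (fun=> 0), psi.
have z phi : diffop_dist L (of_fun (fun _ : E => 0)) phi = 0.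
  rewrite /diffop_dist /of_fun; apply: etrans (@int0 R N); congr I.
  by apply/funext => x; rewrite mul0r.
have l0 : lip_bound G delta setT (fun _ : E => 0 : R) 1.
  by split=> // x y _ _; rewrite subrr normr0 mul1r powR_ge0.
split=> //; last by rewrite z normr0.
- by exists 1.
- exact: lip_norm_le1.
- move=> x nx; exfalso; apply: nx; exists setT => //; split; first exact: openT.
  by move=> phi _; exact: z.
Qed.

Lemma kappa0_removable : kappa G L delta K = 0%E -> removable G L delta K.
Proof.
move=> k0 Om oO _ _ f lf van phi tphi; apply: contrapT => /eqP nz.
have /andP[d0 d1] := delta_bounds; have [sphi' [C0 [C0c C0O phi0]]] := tphi.
have sphi : smooth setT phi by constructor.
have [eta [seta [Ce [cCe CeO eta0]] [V [oV C0V eta1]] _]] := cutoff_exists C0c oO C0O.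
have teta : test Om eta by split; [case: seta|exists Ce].
(* Multiplication by a cutoff extends [f] continuously to the whole group without changing it on
   [C0], outside of which [phi] vanishes. *)
pose F x := f x * eta x.
have CF : Cc F by apply: (Cc_test oO _ teta) => x; exact: lip_cont.
have FE x : C0 x -> F x = f x by move=> /C0V /eta1; rewrite /F => ->; rewrite mulr1.
have [Cf [Cf0 Hf]] := lf.
have FC0 x y : C0 x -> C0 y -> `|F x - F y| <= Cf * cc x y `^ delta.
  by move=> Cx Cy; rewrite !FE//; apply: Hf; exact: C0O.
have Q0 := hom_dim_gt0 lambda_bounds; have l1 := lambda_ge1 lambda_bounds.
(* In dimension 0 the homogeneous dimension would be 0, against $1\le\lambda<Q$. *)
have N0 : (0 < N)%N.
  rewrite lt0n; apply/eqP => N0; move: Q0; rewrite hom_dimE big1// => j _.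
  by move: (ltn_ord j); rewrite [X in (_ < X)%N]N0.
have [kap [omega [tkap tomega omega1 key]]] := dyadic_kernel l1 hom inv L_hypo Lt_hypo N0 Q0.
have [g [cg [Kg Kg0 gH] gE]] := localized_function lambda_bounds hom inv delta_bounds (ltW Cf0) CF.1 C0c FC0 sphi phi0 tkap tomega omega1 key.
have gf psi : test setT psi -> diffop_dist L (of_fun g) psi = diffop_dist L (of_fun f) (fun x => phi x * psi x).
  move=> tp; rewrite /diffop_dist /of_fun gE// /pairing; congr I; apply/funext => x.
  have [Cx|nC] := pselect (C0 x); first by rewrite FE.
  rewrite (tr_app_supp L (compact_closedR C0c)) ?mulr0// => y /phi0 ->.
  by rewrite mul0r.
have c0 : 0 < Kg + 1 by rewrite ltr_wpDl.
(* Normalized to be a competitor for [kappa]; adding 1 keeps the factor positive when [Kg] is 0. *)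
pose h x := (Kg + 1)^-1 * g x.
have hg psi : diffop_dist L (of_fun h) psi = (Kg + 1)^-1 * diffop_dist L (of_fun g) psi \/ ~ test setT psi.
  have [tp|] := pselect (test setT psi); last by right.
  left; rewrite /diffop_dist /of_fun -intZ; first by congr I; apply/funext => x; rewrite mulrA.
  by apply: Cc_mull => //; exact: test_Cc (test_tr_app L tp).
have hE psi : test setT psi -> diffop_dist L (of_fun h) psi = (Kg + 1)^-1 * diffop_dist L (of_fun f) (fun x => phi x * psi x).
  by move=> tp; rewrite -gf//; case: (hg psi).
have lh : lip_bound G delta setT h 1.
  split=> // x y _ _; rewrite -mulrBr normrM mul1r gtr0_norm ?invr_gt0// ler_pdivrMl//.
  apply: (le_trans (gH x y)); apply: ler_wpM2r; first exact: powR_ge0.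
  by rewrite lerDl.
(* The product is supported both in [Om] and off [K], where $\mathcal Lf$ vanishes by assumption;
   hence the support of $\mathcal Lh$ lies in [K]. *)
have van2 psi : test (~` K) psi -> diffop_dist L (of_fun f) (fun x => phi x * psi x) = 0.
  move=> [sp [C [cC CK C1]]]; apply: van.
  have [smx [D [cD DO D0]]] : test Om (fun x => phi x * psi x) by apply: test_mulr => //; constructor.
  split=> //; exists (C0 `&` C); split.
  - by apply: compact_closedI => //; exact: compact_closedR.
  - by move=> x [/C0O Ox /CK Kx].
  - move=> x nx; have [Cx|/phi0 ->] := pselect (C0 x); last by rewrite mul0r.
    by rewrite C1 ?mulr0// => Dx; apply: nx.
have [psi cpsi] := cutoff_of_compact; have [tpsi [W [oW KW W1]]] := cpsi.
(* The difference $\phi(1-\psi)$ vanishes near [K], so $\mathcal Lf$ does not see it: the competitor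
   [h] detects the nonzero number $\langle\mathcal Lf,\phi\rangle$. *)
have val : diffop_dist L (of_fun f) (fun x => phi x * psi x) = diffop_dist L (of_fun f) phi.
  have spsi := test_smooth tpsi; have tpp := test_mulr tphi spsi.
  have s1 : smooth setT (fun x => 1 - psi x).
    by apply: smooth_sub => //; [exact: openT|apply: smooth_cst; exact: openT].
  have tq := test_mulr tphi s1.
  have -> : diffop_dist L (of_fun f) phi = diffop_dist L (of_fun f) (fun x => phi x * psi x) + diffop_dist L (of_fun f) (fun x => phi x * (1 - psi x)).
    by rewrite -(dist_Lt_add oO lf tpp tq); congr diffop_dist; apply/funext => x; ring.
  rewrite [X in _ + X](_ : _ = 0) ?addr0//; apply: van.
  have [smq _] := tq; split=> //; exists (C0 `&` ~` W); split.
  - by apply: compact_closedI => //; exact: open_closedC.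
  - by move=> x [/C0O Ox nW]; split=> // /KW.
  - move=> x nx; have [Cx|/phi0 ->] := pselect (C0 x); last by rewrite mul0r.
    by rewrite W1 ?subrr ?mulr0//; apply: contrapT => nW; apply: nx.
have : (`|diffop_dist L (of_fun h) psi|%:E <= kappa G L delta K)%E.
  apply: ereal_sup_ubound; exists h, psi; split=> //.
  - by exists 1.
  - exact: lip_norm_le1.
  - move=> x nx; apply: contrapT => nK; apply: nx; exists (~` K) => //; split.
      by apply: closed_openC; exact: compact_closedR.
    by move=> th tth; rewrite hE ?van2 ?mulr0//; exact: test_subset tth.
rewrite k0 hE// val lee_fin normr_le0 mulf_eq0 (negbTE nz) orbF invr_eq0.
by rewrite gt_eqF.
Qed.

End removability.

Theorem theorem6p6 (R : realType) (N : nat) (G : carnot_group R N)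
    (lambda : R) (L : diffop R N) (delta : R) (T K : set 'rV[R]_N)
    (lambda_bounds : 1 <= lambda < (hom_dim G)%:R)
    (L_homogeneous : homogeneous G lambda (diffop_dist L))
    (L_left_invariant : left_invariant G (diffop_dist L))
    (L_hypoelliptic : hypoelliptic (diffop_dist L))
    (Lt_hypoelliptic : hypoelliptic (diffop_tr_dist L))
    (delta_bounds : 0 < delta < 1)
    (T_tile : fundamental_tile G T)
    (K_compact : compact K) (K_sub_T : K `<=` T) :
  removable G L delta K <-> kappa G L delta K = 0%E.
Proof.
split; first exact: removable_kappa0.
exact: kappa0_removable lambda_bounds L_homogeneous L_left_invariant L_hypoelliptic Lt_hypoelliptic delta_bounds K_compact.
Qed.
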